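(* Let $(\phi_t)_{t\ge0}$ be a non-elliptic semigroup of holomorphic self-maps of the unit disk $\mathbb{D}$ and let $K$ be a compact non-polar subset of $\mathbb{D}$. Then for every $z\in K$, as $u\to+\infty$, $$s_u(\phi_t,z)-\frac{\pi}{2}\,\lambda_{\mathbb{D}}(K,\phi_u(K))=o(u).$$
   Context: $\mathbb{D}$ is the open unit disk and $\mathbb{T}$ the unit circle. Semigroup: a family $(\phi_t)_{t\ge0}$ of holomorphic maps $\phi_t:\mathbb{D}\to\mathbb{D}$ with $\phi_0=\mathrm{id}$, $\phi_{t+s}=\phi_t\circ\phi_s$ for all $t,s\ge0$, and $\phi_t(z)\to z$ as $t\to0^+$ uniformly on compact subsets of $\mathbb{D}$. It is non-elliptic if its Denjoy–Wolff point lies on the unit circle, i.e. there is $\tau\in\mathbb{T}$ with $\lim_{t\to+\infty}\phi_t(z)=\tau$ for all $z\in\mathbb{D}$. A compact set is non-polar if its logarithmic capacity is strictly positive. Hyperbolic distance: $d_{\mathbb{D}}(z,w)=\operatorname{arctanh}\left|\frac{z-w}{1-\bar z w}\right|$. Hyperbolic step of order $u>0$ of the semigroup at $z\in\mathbb{D}$: $s_u(\phi_t,z):=\lim_{r\to+\infty}d_{\mathbb{D}}(\phi_r(z),\phi_{r+u}(z))$ (the $t$ in the notation is only the semigroup index). Extremal distance: for a family $\Gamma$ of rectifiable curves in a domain $\Omega$, the extremal length is $\lambda_\Omega(\Gamma)=\sup_\rho \frac{\left(\inf_{\gamma\in\Gamma}\int_\gamma\rho\,|dz|\right)^2}{\iint_\Omega\rho^2\,dx\,dy}$,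 the supremum being over non-negative Borel functions $\rho$ on $\Omega$ with $0<\iint_\Omega\rho^2\,dx\,dy<\infty$. For $E,F\subset\overline{\Omega}$, the extremal distance $\lambda_\Omega(E,F)$ is the extremal length of the family of curves in $\Omega$ joining $E$ and $F$. *)

(* Defs.v *)
From mathcomp Require Import all_boot all_order all_algebra.
From mathcomp Require Import complex.
From mathcomp Require Import all_classical all_reals all_analysis.

Set Implicit Arguments.
Unset Strict Implicit.
Unset Printing Implicit Defensive.

Import Order.TTheory GRing.Theory Num.Theory numFieldNormedType.Exports.

Local Open Scope classical_set_scope.
Local Open Scope ring_scope.

(* [R[i]^o] is the complex field as a normed module over itself, so that
   [derivable f z 1] is complex differentiability of [f] at [z]. The norm
   [`|z|] has values in [R[i]]; [normc z] is the same modulus as an element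
   of [R]. *)
Notation cplane R := ((complex R)^o) (only parsing).

(* Borel sets of the plane and the area measure are taken on [R * R]. *)
Definition toC (R : realType) (p : R * R) : cplane R := Complex p.1 p.2.

Definition modulus (R : realType) (z : cplane R) : R := Normc.normc z.

Definition unit_disk (R : realType) : set (cplane R) := [set z | `|z| < 1].

Definition holomorphic_on (R : realType) (A : set (cplane R))
    (f : cplane R -> cplane R) : Prop :=
  forall z, A z -> derivable f z 1.

(* The maps are total functions on the plane and the index ranges over [R];
   only their values on the disk for nonnegative indices are constrained. *)
Definition holomorphic_semigroup (R : realType)
    (phi : R -> cplane R -> cplane R) : Prop :=
  [/\ forall t, 0 <= t -> holomorphic_on (@unit_disk R) (phi t),
      forall t z, 0 <= t -> unit_disk z -> unit_disk (phi t z),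
      forall z, unit_disk z -> phi 0 z = z,
      forall t s z, 0 <= t -> 0 <= s -> unit_disk z ->
        phi (t + s) z = phi t (phi s z)
    & forall K : set (cplane R), compact K -> K `<=` @unit_disk R ->
        {uniform K, phi @ 0^'+ --> id}].

Definition non_elliptic (R : realType) (phi : R -> cplane R -> cplane R)
    : Prop :=
  exists tau : cplane R, `|tau| = 1 /\
    forall z, unit_disk z -> phi t z @[t --> +oo] --> tau.

Definition log_energy (R : realType) (mu : probability (R * R)%type R)
    : \bar R :=
  (\int[mu]_p \int[mu]_q lne (modulus (toC p - toC q))%:E)%E.

(* Here [lne 0 = -oo] and [expeR -oo = 0], so this is [exp (- V)], where [V] is
   the infimum over the Borel probability measures [mu] carried by [K] of the
   double integrals of [log (1 / |z - w|)]; the empty set has capacity 0. *)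
Definition log_capacity (R : realType) (K : set (cplane R)) : \bar R :=
  expeR (ereal_sup [set log_energy mu | mu in
    [set mu : probability (R * R)%type R | mu (@toC R @^-1` K) = 1%E]]).

Definition non_polar (R : realType) (K : set (cplane R)) : Prop :=
  (0 < log_capacity K)%E.

Definition artanh (R : realType) (x : R) : R := ln ((1 + x) / (1 - x)) / 2.

Definition hyp_dist (R : realType) (z w : cplane R) : R :=
  artanh (modulus ((z - w) / (1 - conjc z * w))).

Definition hyp_step (R : realType) (phi : R -> cplane R -> cplane R)
    (u : R) (z : cplane R) : R :=
  lim (hyp_dist (phi r z) (phi (r + u) z) @[r --> +oo]).

(* Complex-valued counterpart of [variation]. *)
Definition cvariation (R : realType) (a b : R) (g : R -> cplane R)
    (s : seq R) : R :=
  let F := g \o nth b (a :: s) in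
  \sum_(0 <= n < size s) modulus (F n.+1 - F n).

Definition curve_length (R : realType) (a b : R) (g : R -> cplane R)
    : \bar R :=
  ereal_sup [set (cvariation a b g s)%:E | s in itv_partition a b].

Definition rectifiable (R : realType) (g : R -> cplane R) : Prop :=
  {within `[0, 1], continuous g} /\ (curve_length 0 1 g < +oo)%E.

(* The arc-length parametrization of the curve [g] on [0, 1]: the point of [g]
   at the first parameter before which [g] has travelled the distance [s]. *)
Definition arc_param (R : realType) (g : R -> cplane R) (s : R) : cplane R :=
  g (inf [set t | 0 <= t <= 1 /\ (s%:E <= curve_length 0 t g)%E]).

Definition curve_integral (R : realType) (rho : cplane R -> R)
    (g : R -> cplane R) : \bar R :=
  (\int[@lebesgue_measure R]_(s in `[0%R, fine (curve_length 0 1 g)])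
     (rho (arc_param g s))%:E)%E.

Definition area_integral (R : realType) (Omega : set (cplane R))
    (h : cplane R -> R) : \bar R :=
  (\int[@lebesgue_measure R \x @lebesgue_measure R]_(p in @toC R @^-1` Omega)
     (h (toC p))%:E)%E.

Definition metric_on (R : realType) (Omega : set (cplane R))
    (rho : cplane R -> R) : Prop :=
  [/\ forall z, Omega z -> 0 <= rho z,
      measurable_fun (@toC R @^-1` Omega) (rho \o @toC R)
    & (0 < area_integral Omega (fun z => rho z ^+ 2)%R < +oo)%E].

Definition extremal_length (R : realType) (Omega : set (cplane R))
    (Gamma : set (R -> cplane R)) : \bar R :=
  ereal_sup
    [set ((ereal_inf [set curve_integral rho g | g in Gamma]) ^+ 2
          / area_integral Omega (fun z => rho z ^+ 2)%R)%E
    | rho in metric_on Omega].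

(* Only the end points may leave [Omega], since [E] and [F] are allowed to
   meet its boundary. *)
Definition joining_curves (R : realType) (Omega E F : set (cplane R))
    : set (R -> cplane R) :=
  [set g | [/\ rectifiable g, forall t, 0 < t < 1 -> Omega (g t),
               E (g 0) & F (g 1)]].

Definition extremal_distance (R : realType) (Omega E F : set (cplane R))
    : \bar R :=
  extremal_length Omega (joining_curves Omega E F).

(* Main.v *)
Require Import Defs.
From mathcomp Require Import all_boot all_order all_algebra.
From mathcomp Require Import complex ring lra.
From mathcomp Require Import all_classical all_reals all_analysis.
From mathcomp Require Import measurable_realfun.

(** Write [d] for the hyperbolic distance and [D u = d (z, phi u z)] for the
    displacement of the orbit of [z]. Both the hyperbolic step and [pi / 2] times
    the extremal distance agree with [D u] up to [o(u)].

    For the step, Schwarz-Pick makes [d (phi r z, phi (r + u) z)] nonincreasing in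
    [r], so that the step is an infimum, at most [D u]. The same contraction makes
    [D] subadditive, so that [D u / u] tends to its infimum [c] by the lemma of
    Fekete. Beyond any time [r] the orbit can be followed in steps of length [u],
    each covering at most [d (phi r z, phi (r + u) z)], whence the hyperbolic step
    is at least [c * u] ([hyp_step_displacement]).

    For the extremal distance, let [zeta] be the boundary point nearest to
    [phi u z] and [h = 1 - |phi u z|], so that [D u] is [ln (1 / h) / 2] up to a
    constant, and [phi u] maps [K] into a set of size [O(h)] at distance [O(h)] from
    [zeta].

    Lower bound ([extremal_distance_lower]). In the metric [1 / (|x - zeta| + h)]
    every curve from [K] to its image has length at least [ln (1 / h) - O(1)],
    while the area of the disk is at most [pi * ln (3 / h)]. The quotient is
    [(ln (1 / h) - O(1)) / pi].

    Upper bound ([extremal_distance_upper]). For an arbitrary metric of area [A] the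
    infimum of the lengths is at most the expected length of a random broken line,
    which is to be bounded by [sqrt A] times a quantity free of the metric. The line
    starts at a point [p] of [K] whose law is a probability of finite logarithmic
    energy, which exists since [K] is not polar; it goes to a random ray issuing
    from [zeta] inside a sector of opening [2 * atan T], follows the ray from a
    fixed scale down to a scale proportional to [h], and ends at [phi u p]. By the
    Cauchy-Schwarz inequality the three pieces contribute [sqrt (A * e1)],
    [sqrt (A * e2)] and [sqrt (A * e3)]. Here [e2 = ln (2 / h) / (2 * atan T)] is the
    extremal distance between two arcs of the sector up to a constant and, for [T]
    large, [pi / 2 * e2] is close to [D u]. The terms [e1] and [e3] are mutual
    energies of Riesz kernels, which are logarithmic ([riesz_convolution]): [e1] is
    a constant, and [e3] exceeds a constant by at most a multiple of [ln (1 / kappa)],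
    where [kappa] bounds from below the contraction of [K] by [phi u] relative to
    the scale [h].

    It remains to see that [kappa] does not decay exponentially
    ([subexponential_contraction]). Here non-ellipticity is
    essential. The pseudo-hyperbolic lengths of the steps of the orbit do not increase. If
    they have a positive limit, [phi 1] is nearly isometric on consecutive points
    far along the orbit; if they tend to 0, it is nearly isometric on pairs of
    points of the orbit at distance about [1 / 2], which exist because the orbit
    leaves every compact set. For fixed [p], the defect from isometry at the pair
    [p], [q] is [1 - |g q|] for a contraction [g] of the disk, obtained by dividing
    two Blaschke factors, and so obeys a Harnack inequality in [q]
    ([defect_harnack]). The smallness at one pair therefore spreads to all pairs of
    a hyperbolic ball of fixed radius, and a unit of time contracts [K] by no more
    than [expR (- eta)] once enough time has passed.

    The complex analysis behind Schwarz-Pick and Harnack is derived from complex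
    differentiability at each point: [flux_eq0], the mean value property on
    circles, and a maximum principle tolerating finitely many points of mere
    continuity, which is what repeated division by Blaschke factors needs. *)

Set Implicit Arguments.
Unset Strict Implicit.
Unset Printing Implicit Defensive.
Import Order.TTheory GRing.Theory Num.Theory numFieldNormedType.Exports.
Local Open Scope classical_set_scope.
Local Open Scope ring_scope.
Local Notation cRe := complex.Re.
Local Notation cIm := complex.Im.

(** * Modulus, limits and complex derivatives *)

Section modulus_theory.
Variable R : realType.
Implicit Types z w : cplane R.

Lemma modulusE z : modulus z = Num.sqrt (cRe z ^+ 2 + cIm z ^+ 2).
Proof. by rewrite /modulus; case: z. Qed.

Lemma modulus_ge0 z : 0 <= modulus z.
Proof. by rewrite modulusE sqrtr_ge0. Qed.

Lemma sqr_modulus z : modulus z ^+ 2 = cRe z ^+ 2 + cIm z ^+ 2.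
Proof. by rewrite modulusE sqr_sqrtr // addr_ge0 ?sqr_ge0. Qed.

Lemma modulusM z w : modulus (z * w) = modulus z * modulus w.
Proof. exact: Normc.normcM. Qed.

Lemma modulus0 : modulus (0 : cplane R) = 0.
Proof. exact: Normc.normc0. Qed.

Lemma modulus1 : modulus (1 : cplane R) = 1.
Proof. exact: Normc.normc1. Qed.

Lemma modulus_eq0 z : (modulus z == 0) = (z == 0).
Proof.
apply/eqP/eqP => [/Normc.eq0_normc //|->]; exact: modulus0.
Qed.

Lemma modulus_gt0 z : (0 < modulus z) = (z != 0).
Proof. by rewrite lt_neqAle modulus_ge0 andbT eq_sym modulus_eq0. Qed.

Lemma modulusV z : modulus z^-1 = (modulus z)^-1.
Proof. exact: Normc.normcV. Qed.

Lemma modulusf_div z w : modulus (z / w) = modulus z / modulus w.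
Proof. by rewrite modulusM modulusV. Qed.

Lemma modulusN z : modulus (- z) = modulus z.
Proof. exact: normcN. Qed.

Lemma modulusD z w : modulus (z + w) <= modulus z + modulus w.
Proof. exact: le_normcD. Qed.

Lemma modulusBC z w : modulus (z - w) = modulus (w - z).
Proof. by rewrite -modulusN opprB. Qed.

Lemma modulusB z w : modulus (z - w) <= modulus z + modulus w.
Proof. by rewrite (le_trans (modulusD _ _))// modulusN. Qed.

Lemma modulusB_ge z w : modulus z - modulus w <= modulus (z - w).
Proof. by rewrite lerBlDr (le_trans _ (modulusD _ _))// subrK. Qed.

Lemma modulus_triangle z w y : modulus (z - w) <= modulus (z - y) + modulus (y - w).
Proof. by rewrite (le_trans _ (modulusD _ _))// addrA subrK. Qed.

Lemma modulusJ z : modulus (conjc z) = modulus z.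
Proof. by rewrite !modulusE; case: z => a b /=; rewrite sqrrN. Qed.

Lemma modulus_real (x : R) : modulus (x%:C)%C = `|x|.
Proof. by rewrite modulusE /= expr0n addr0 sqrtr_sqr. Qed.

Lemma Re_le_modulus z : `|cRe z| <= modulus z.
Proof.
rewrite -(@ler_pXn2r _ 2) ?nnegrE ?modulus_ge0// sqr_modulus real_normK ?num_real//.
by rewrite lerDl sqr_ge0.
Qed.

Lemma Im_le_modulus z : `|cIm z| <= modulus z.
Proof.
rewrite -(@ler_pXn2r _ 2) ?nnegrE ?modulus_ge0// sqr_modulus real_normK ?num_real//.
by rewrite lerDr sqr_ge0.
Qed.

Lemma modulus_le_ReIm z : modulus z <= `|cRe z| + `|cIm z|.
Proof.
rewrite -(@ler_pXn2r _ 2) ?nnegrE ?modulus_ge0 ?addr_ge0// sqr_modulus.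
rewrite -(real_normK (num_real (cRe z))) -(real_normK (num_real (cIm z))).
have := mulr_ge0 (normr_ge0 (cRe z)) (normr_ge0 (cIm z)).
by nra.
Qed.

Lemma normC_modulus z : `|z| = (modulus z)%:C%C.
Proof. by rewrite normc_def modulusE. Qed.

Lemma unit_diskE z : unit_disk z = (modulus z < 1) :> Prop.
Proof. by rewrite /unit_disk /= normC_modulus -(ltcR (modulus z) 1). Qed.

Lemma nbhs_modulusP z (A : set (cplane R)) :
  nbhs z A <-> exists2 e : R, 0 < e & forall w, modulus (w - z) < e -> A w.
Proof.
split.
  move=> /nbhs_ballP[e /= e0 zA].
  have eE : e = (cRe e)%:C%C by rewrite RRe_real// gtr0_real.
  exists (cRe e); first by move: e0; rewrite eE ltcR.
  move=> w wz; apply: zA; rewrite -ball_normE /= eE.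
  by rewrite normC_modulus ltcR modulusBC.
move=> [e e0 zA]; apply/nbhs_ballP; exists (e%:C)%C; first by rewrite /= ltcR.
move=> w; rewrite -ball_normE /= normC_modulus ltcR modulusBC; exact: zA.
Qed.

Lemma cvg_modulusP (T : Type) (F : set_system T) (FF : Filter F) (f : T -> cplane R) z :
  f @ F --> z <-> forall e : R, 0 < e -> \forall t \near F, modulus (f t - z) < e.
Proof.
split=> [fz e e0|fz A /nbhs_modulusP[e e0 zA]].
  by apply: (fz [set w | modulus (w - z) < e]); apply/nbhs_modulusP; exists e.
by apply: filterS (fz _ e0) => t; exact: zA.
Qed.

Lemma modulus_continuous : continuous (@modulus R).
Proof.
move=> z; apply/(@cvgrPdist_lt R R^o _ _ (nbhs_filter z)) => e e0.
apply/nbhs_modulusP; exists e => // w wz.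
rewrite distrC; apply: le_lt_trans wz; rewrite ler_norml modulusB_ge andbT.
by rewrite lerNl opprB modulusBC modulusB_ge.
Qed.

Lemma derivable_modulusP (f : cplane R -> cplane R) z : derivable f z 1 ->
  exists l : cplane R, forall e : R, 0 < e -> exists2 d : R, 0 < d &
    forall h : cplane R, modulus h < d ->
      modulus (f (z + h) - f z - l * h) <= e * modulus h.
Proof.
move=> /derivable1P; rewrite /derivable => /cvg_ex[/= l fl].
exists l => e e0.
move/cvg_modulusP : fl => /(_ e e0); rewrite near_withinE.
move=> /nbhs_modulusP[d d0 H]; exists d => // h hd.
have [->|h0] := eqVneq h 0.
  by rewrite addr0 subrr mulr0 subrr modulus0 mulr0.
have := H h; rewrite subr0 => /(_ hd h0) /=.
rewrite /GRing.scale /= mulr1 => /ltW Hh.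
rewrite -ler_pdivrMr ?modulus_gt0// -modulusf_div.
apply: le_trans Hh; rewrite le_eqVlt; apply/orP; left; apply/eqP; congr modulus.
by rewrite mulr1 addr0 mul0r add0r [h + z]addrC; field.
Qed.

Lemma derivable_continuous (f : cplane R -> cplane R) z : derivable f z 1 -> {for z, continuous f}.
Proof. by move=> /derivable1_diffP/differentiable_continuous. Qed.

Section complex_calculus.
Implicit Types f g : cplane R -> cplane R.

Lemma ccontinuous_cst (k z : cplane R) : {for z, continuous (fun _ : cplane R => k)}.
Proof. exact: (@cst_continuous (cplane R) (cplane R) k z). Qed.
Lemma ccontinuous_id (z : cplane R) : {for z, continuous (fun x : cplane R => x)}.
Proof. exact: cvg_id. Qed.
Lemma ccontinuousD f g (z : cplane R) : {for z, continuous f} -> {for z, continuous g} ->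
  {for z, continuous (fun x => f x + g x)}.
Proof.
move=> cf cg; exact: (@cvgD _ (cplane R) _ (nbhs z) _ f g _ _ cf cg).
Qed.
Lemma ccontinuousB f g (z : cplane R) : {for z, continuous f} -> {for z, continuous g} ->
  {for z, continuous (fun x => f x - g x)}.
Proof.
move=> cf cg; exact: (@cvgB _ (cplane R) _ (nbhs z) _ f g _ _ cf cg).
Qed.
Lemma ccontinuousM f g (z : cplane R) : {for z, continuous f} -> {for z, continuous g} ->
  {for z, continuous (fun x => f x * g x)}.
Proof.
move=> cf cg; exact: (@cvgM R[i] _ (nbhs z) _ f g _ _ cf cg).
Qed.
Lemma ccontinuousV f (z : cplane R) : f z != 0 -> {for z, continuous f} ->
  {for z, continuous (fun x => (f x)^-1)}.
Proof.
move=> fz cf; exact: (@cvgV R[i] _ (nbhs z) _ f _ fz cf).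
Qed.
Lemma cderivable_cst (k z : cplane R) : derivable (fun _ : cplane R => k) z 1.
Proof. exact: derivable_cst. Qed.
Lemma cderivable_id (z : cplane R) : derivable (fun x : cplane R => x) z 1.
Proof. exact: derivable_id. Qed.
Lemma cderivableD f g (z : cplane R)  : derivable f z 1 -> derivable g z 1 ->
  derivable (fun x => f x + g x) z 1.
Proof. by move=> cf cg; exact: (@derivableD _ (cplane R) (cplane R) f g z 1 cf cg). Qed.
Lemma cderivableB f g (z : cplane R)  : derivable f z 1 -> derivable g z 1 ->
  derivable (fun x => f x - g x) z 1.
Proof. by move=> cf cg; exact: (@derivableB _ (cplane R) (cplane R) f g z 1 cf cg). Qed.
Lemma cderivableM f g (z : cplane R) : derivable f z 1 -> derivable g z 1 ->
  derivable (fun x => f x * g x) z 1.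
Proof. by move=> cf cg; exact: (@derivableM _ (cplane R) f g z 1 cf cg). Qed.
Lemma cderivableV f (z : cplane R) : f z != 0 -> derivable f z 1 ->
  derivable (fun x => (f x)^-1) z 1.
Proof. by move=> fz cf; exact: (@derivableV _ (cplane R) f z 1 fz cf). Qed.

End complex_calculus.
End modulus_theory.

Lemma dist_in_itv (R : realDomainType) (s t p q : R) :
  p <= s <= q -> p <= t <= q -> `|s - t| <= q - p.
Proof.
by move=> /andP[ps sq] /andP[pt tq]; rewrite ler_norml; apply/andP; split; lra.
Qed.

(** * Integrals of continuous functions on intervals *)

Section interval_integral.
Variable R : realType.
Implicit Types (f g : R -> R) (a b c : R).
Local Notation mu := (@lebesgue_measure R).

Definition itv_int f a b : R := (\int[mu]_(x in `[a, b]) f x)%R.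

Lemma continuous_itv f a b : (forall x, a <= x <= b -> {for x, continuous f}) ->
  {within `[a, b], continuous f}.
Proof.
move=> cf; apply: continuous_in_subspaceT => x; rewrite inE /= in_itv /=; exact: cf.
Qed.

Lemma itv_integrable f a b : {within `[a, b], continuous f} ->
  mu.-integrable `[a, b] (EFin \o f).
Proof. by move=> cf; apply: continuous_compact_integrable => //; exact: segment_compact. Qed.

Lemma itv_int_split f a b c : a <= b -> b <= c -> {within `[a, c], continuous f} ->
  itv_int f a c = itv_int f a b + itv_int f b c.
Proof.
move=> ab bc cf; rewrite /itv_int.
have If := itv_integrable cf.
have H := @Rintegral_itvB R f (BLeft a) (BRight c) b If.
rewrite -[RHS]addrC; apply/eqP; rewrite -subr_eq; apply/eqP; rewrite H ?bnd_simp//.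
apply: Rintegral_itv_obnd_cbnd.
apply: integrableS If => // x /=; rewrite !in_itv /= => /andP[bx ->].
by rewrite andbT (le_trans ab)// ltW.
Qed.

Lemma itv_int_cst k a b : a <= b -> itv_int (fun=> k) a b = k * (b - a).
Proof.
move=> ab; rewrite /itv_int Rintegral_cst; last exact: measurable_itv.
rewrite /= lebesgue_measure_itv /= lte_fin.
case: ltP => [//|ba]; rewrite (_ : b = a) ?subrr//.
by apply/eqP; rewrite eq_le ba.
Qed.

Lemma itv_int_le f g a b : {within `[a, b], continuous f} ->
  {within `[a, b], continuous g} -> (forall x, a <= x <= b -> f x <= g x) ->
  itv_int f a b <= itv_int g a b.
Proof.
move=> cf cg fg; apply: le_Rintegral => //; try exact: itv_integrable.
Qed.

Lemma itv_int_bound f M a b : a <= b -> {within `[a, b], continuous f} ->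
  (forall x, a <= x <= b -> `|f x| <= M) -> `|itv_int f a b| <= M * (b - a).
Proof.
move=> ab cf fM; rewrite ler_norml -mulNr -!itv_int_cst//.
have cc k : {within `[a, b], continuous (fun=> k : R)}.
  by apply: continuous_subspaceT => x; exact: cvg_cst.
by apply/andP; split; apply: itv_int_le => // x /fM; rewrite ler_norml => /andP[].
Qed.

Lemma itv_intB f g a b : {within `[a, b], continuous f} ->
  {within `[a, b], continuous g} ->
  itv_int (fun x => f x - g x) a b = itv_int f a b - itv_int g a b.
Proof. by move=> cf cg; rewrite /itv_int RintegralB//; exact: itv_integrable. Qed.

End interval_integral.

(** * Goursat theorem on rectangles *)

Section goursat.
Variable R : realType.
Implicit Types (u v : R -> R -> R) (a b c d x y : R).

Definition first_order u x0 y0 al be := forall e : R, 0 < e -> exists2 r : R, 0 < r &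
  forall x y, `|x - x0| < r -> `|y - y0| < r ->
    `|u x y - u x0 y0 - al * (x - x0) - be * (y - y0)| <= e * (`|x - x0| + `|y - y0|).

(** First-order form of the Cauchy-Riemann equation expressing that the form
    [u dy + v dx] is closed: the derivative of [u] in [x] is that of [v] in [y]. *)
Definition divergence_free_at u v x0 y0 := exists al be ga,
  first_order u x0 y0 al be /\ first_order v x0 y0 ga al.

Lemma first_order_continuous2 u x0 y0 al be : first_order u x0 y0 al be ->
  {for y0, continuous (u x0)}.
Proof.
move=> H; apply/(@cvgrPdist_le _ R^o) => e e0.
have [r r0 {}H] := H 1 ltr01.
have e1 : 0 < e / (1 + `|be|) by rewrite divr_gt0// ltr_wpDr.
near=> y.
have yr : `|y - y0| < r by near: y; exact: cvgr_distC_lt.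
have ye : `|y - y0| < e / (1 + `|be|) by near: y; exact: cvgr_distC_lt.
have := H x0 y; rewrite subrr normr0 add0r mulr0 subr0 mul1r => /(_ r0 yr) K.
rewrite distrC.
have -> : u x0 y - u x0 y0 = (u x0 y - u x0 y0 - be * (y - y0)) + be * (y - y0) by ring.
rewrite (le_trans (ler_normD _ _))// (le_trans (lerD K (lexx _)))//.
rewrite normrM.
have := ltW ye; rewrite ler_pdivlMr ?ltr_wpDr//; nra.
Unshelve. all: by end_near. Qed.

Lemma first_order_swap u x0 y0 al be : first_order u x0 y0 al be ->
  first_order (fun y x => u x y) y0 x0 be al.
Proof.
move=> H e e0; have [r r0 {}H] := H e e0; exists r => // y x yr xr.
by rewrite addrAC [`|y - y0| + _]addrC; exact: H.
Qed.

Lemma first_order_continuous1 u x0 y0 al be : first_order u x0 y0 al be ->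
  {for x0, continuous (u^~ y0)}.
Proof. by move=> /first_order_swap/first_order_continuous2. Qed.

(** Integral of [u dy + v dx] around the rectangle [a, b] x [c, d], that is, the
    imaginary part of the contour integral of [u + iv]. *)
Definition flux u v a b c d : R :=
  itv_int (fun y => u b y - u a y) c d - itv_int (fun x => v x d - v x c) a b.

Definition divergence_free u v a b c d :=
  forall x y, a <= x <= b -> c <= y <= d -> divergence_free_at u v x y.

Section rectangle.
Variables (u v : R -> R -> R) (A B C D : R).
Hypothesis uv : divergence_free u v A B C D.

Let cu x c d : A <= x <= B -> C <= c -> d <= D -> {within `[c, d], continuous (u x)}.
Proof.
move=> xAB Cc dD; apply: continuous_itv => y /andP[cy yd].
have [|al [be [ga [H _]]]] := uv xAB (y := y).
  by rewrite (le_trans Cc cy) (le_trans yd dD).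
exact: first_order_continuous2 H.
Qed.

Let cv y a b : C <= y <= D -> A <= a -> b <= B -> {within `[a, b], continuous (v^~ y)}.
Proof.
move=> yCD Aa bB; apply: continuous_itv => x /andP[ax xb].
have [|al [be [ga [_ H]]]] := uv _ yCD (x := x).
  by rewrite (le_trans Aa ax) (le_trans xb bB).
exact: first_order_continuous1 H.
Qed.

Let cB (f g : R -> R) a b : {within `[a, b], continuous f} ->
  {within `[a, b], continuous g} -> {within `[a, b], continuous (fun x => f x - g x)}.
Proof. by move=> cf cg x; apply: cvgB; [exact: cf|exact: cg]. Qed.

Let cc (k a b : R) : {within `[a, b], continuous (fun=> k)}.
Proof. by apply: continuous_subspaceT => x; exact: cvg_cst. Qed.

Lemma flux_split1 a m b c d : A <= a -> a <= m -> m <= b -> b <= B -> C <= c ->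
  c <= d -> d <= D -> flux u v a b c d = flux u v a m c d + flux u v m b c d.
Proof.
move=> Aa am mb bB Cc cd dD; rewrite /flux.
have Am := le_trans Aa am; have mB := le_trans mb bB.
have Ab := le_trans Am mb; have aB := le_trans am mB.
have Cd := le_trans Cc cd; have cD := le_trans cd dD.
rewrite (itv_int_split am mb); last by apply: cB; apply: cv => //; apply/andP.
rewrite !itv_intB; (try by apply: cu => //; apply/andP); (try by apply: cv => //; apply/andP).
by ring.
Qed.

Lemma flux_split2 a b c m d : A <= a -> a <= b -> b <= B -> C <= c ->
  c <= m -> m <= d -> d <= D -> flux u v a b c d = flux u v a b c m + flux u v a b m d.
Proof.
move=> Aa ab bB Cc cm md dD; rewrite /flux.
have Cm := le_trans Cc cm; have mD := le_trans md dD.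
have Cd := le_trans Cm md; have cD := le_trans cm mD.
have Ab := le_trans Aa ab; have aB := le_trans ab bB.
rewrite (itv_int_split cm md); last by apply: cB; apply: cu => //; apply/andP.
rewrite !itv_intB; (try by apply: cu => //; apply/andP); (try by apply: cv => //; apply/andP).
by ring.
Qed.

(** The affine parts of [u] and [v] have flux zero because they share the
    coefficient [al]; only the error terms remain. *)
Lemma flux_first_order a b c d x0 y0 al be ga (e r : R) : A <= a -> a <= b -> b <= B ->
  C <= c -> c <= d -> d <= D -> a <= x0 <= b -> c <= y0 <= d -> b - a < r -> d - c < r ->
  (forall x y, `|x - x0| < r -> `|y - y0| < r ->
    `|u x y - u x0 y0 - al * (x - x0) - be * (y - y0)| <= e * (`|x - x0| + `|y - y0|)) ->
  (forall x y, `|x - x0| < r -> `|y - y0| < r ->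
    `|v x y - v x0 y0 - ga * (x - x0) - al * (y - y0)| <= e * (`|x - x0| + `|y - y0|)) ->
  0 < e ->
  `|flux u v a b c d| <= 2 * e * ((b - a) + (d - c)) ^+ 2.
Proof.
move=> Aa ab bB Cc cd dD /andP[ax xb] /andP[cy yd] bar dcr Hu Hv e0; rewrite /flux.
have Cd := le_trans Cc cd; have cD := le_trans cd dD.
have Ab := le_trans Aa ab; have aB := le_trans ab bB.
have cuu : {within `[c, d], continuous (fun y => u b y - u a y)}.
  by apply: cB; apply: cu => //; apply/andP.
have cvv : {within `[a, b], continuous (fun x => v x d - v x c)}.
  by apply: cB; apply: cv => //; apply/andP.
have -> : itv_int (fun y => u b y - u a y) c d - itv_int (fun x => v x d - v x c) a b =
  itv_int (fun y => u b y - u a y - al * (b - a)) c d -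
  itv_int (fun x => v x d - v x c - al * (d - c)) a b.
  by rewrite (itv_intB cuu)// (itv_intB cvv)// !itv_int_cst//; ring.
rewrite (le_trans (ler_normB _ _))//.
have -> : 2 * e * ((b - a) + (d - c)) ^+ 2 =
  2 * e * ((b - a) + (d - c)) * (d - c) + 2 * e * ((b - a) + (d - c)) * (b - a) by ring.
apply: lerD; apply: itv_int_bound => //; try exact: cB.
- move=> y ycd.
  have y0y : `|y - y0| <= d - c by apply: dist_in_itv => //; apply/andP.
  have bx : `|b - x0| <= b - a by apply: dist_in_itv; apply/andP.
  have ax0 : `|a - x0| <= b - a by apply: dist_in_itv; apply/andP.
  have H1 := Hu b y (le_lt_trans bx bar) (le_lt_trans y0y dcr).
  have H2 := Hu a y (le_lt_trans ax0 bar) (le_lt_trans y0y dcr).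
  have -> : u b y - u a y - al * (b - a) =
    (u b y - u x0 y0 - al * (b - x0) - be * (y - y0)) -
    (u a y - u x0 y0 - al * (a - x0) - be * (y - y0)) by ring.
  rewrite (le_trans (ler_normB _ _))// (le_trans (lerD H1 H2))//.
  nra.
- move=> x xab.
  have x0x : `|x - x0| <= b - a by apply: dist_in_itv => //; apply/andP.
  have dy : `|d - y0| <= d - c by apply: dist_in_itv; apply/andP.
  have cy0 : `|c - y0| <= d - c by apply: dist_in_itv; apply/andP.
  have H1 := Hv x d (le_lt_trans x0x bar) (le_lt_trans dy dcr).
  have H2 := Hv x c (le_lt_trans x0x bar) (le_lt_trans cy0 dcr).
  have -> : v x d - v x c - al * (d - c) =
    (v x d - v x0 y0 - ga * (x - x0) - al * (d - y0)) -
    (v x c - v x0 y0 - ga * (x - x0) - al * (c - y0)) by ring.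
  rewrite (le_trans (ler_normB _ _))// (le_trans (lerD H1 H2))//.
  nra.
Qed.

Hypotheses (AB : A <= B) (CD : C <= D).

Let W n := (B - A) / 2 ^+ n.
Let H n := (D - C) / 2 ^+ n.
Let subflux n (p : R * R) := flux u v p.1 (p.1 + W n) p.2 (p.2 + H n).
Let corner n (p : R * R) (ij : bool * bool) :=
  (p.1 + (ij.1 : nat)%:R * W n.+1, p.2 + (ij.2 : nat)%:R * H n.+1).
(** A quarter with a large flux; [step_flux] shows that one exists, so that the
    default is never taken. *)
Let step n p := corner n p (odflt (false, false)
  [pick ij : bool * bool | `|subflux n p| <= 4 * `|subflux n.+1 (corner n p ij)|]).
Fixpoint shrink n : R * R := if n is m.+1 then step m (shrink m) else (A, C).

Let W2 n : W n = 2 * W n.+1.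
Proof. by rewrite /W exprS; field; rewrite expf_neq0. Qed.
Let H2 n : H n = 2 * H n.+1.
Proof. by rewrite /H exprS; field; rewrite expf_neq0. Qed.
Let W_ge0 n : 0 <= W n.
Proof. by rewrite divr_ge0 ?subr_ge0// exprn_ge0. Qed.
Let H_ge0 n : 0 <= H n.
Proof. by rewrite divr_ge0 ?subr_ge0// exprn_ge0. Qed.

Let inside n (p : R * R) := [/\ A <= p.1, p.1 + W n <= B, C <= p.2 & p.2 + H n <= D].

Let inside_corner n p ij : inside n p -> inside n.+1 (corner n p ij).
Proof.
move=> []; have := W_ge0 n.+1; have := H_ge0 n.+1.
rewrite /inside /corner (W2 n) (H2 n); move: (W n.+1) (H n.+1) => w h.
by case: ij => [[] []] /=; rewrite ?mul1r ?mul0r => *; split; lra.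
Qed.

Let inside_shrink n : inside n (shrink n).
Proof.
elim: n => [|n IH]; last exact: inside_corner.
by rewrite /inside /W /H /= expr0 !divr1 !subrKC.
Qed.

Let step_flux n p : inside n p -> `|subflux n p| <= 4 * `|subflux n.+1 (step n p)|.
Proof.
move=> pin; rewrite /step; case: pickP => [ij //|/= no].
have {no}lt ij : 4 * `|subflux n.+1 (corner n p ij)| < `|subflux n p|.
  by rewrite ltNge no.
have : subflux n p = subflux n.+1 (corner n p (false, false))
  + subflux n.+1 (corner n p (true, false))
  + (subflux n.+1 (corner n p (false, true)) + subflux n.+1 (corner n p (true, true))).
  rewrite /subflux /corner /= !mul0r !mul1r !addr0 (W2 n) (H2 n).
  case: pin; rewrite (W2 n) (H2 n) => h1 h2 h3 h4; have := W_ge0 n.+1; have := H_ge0 n.+1.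
  move: (W n.+1) (H n.+1) h2 h4 => w h h2 h4 h0 w0.
  rewrite (flux_split2 (m := p.2 + h)); try lra.
  rewrite (flux_split1 (m := p.1 + w)); try lra.
  rewrite (flux_split1 (m := p.1 + w) (c := p.2 + h)); try lra.
  by rewrite !addrA !(mulrDl 1 1) !mul1r !addrA.
move=> E; have := lt (false, false); have := lt (true, false).
have := lt (false, true); have := lt (true, true).
have : `|subflux n p| <= `|subflux n.+1 (corner n p (false, false))|
  + `|subflux n.+1 (corner n p (true, false))|
  + (`|subflux n.+1 (corner n p (false, true))| + `|subflux n.+1 (corner n p (true, true))|).
  by rewrite E (le_trans (ler_normD _ _))// lerD// ler_normD.
lra.
Qed.

Let shrink_flux n : `|flux u v A B C D| <= 4 ^+ n * `|subflux n (shrink n)|.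
Proof.
elim: n => [|n IH].
  by rewrite /subflux /shrink /W /H /= !expr0 !divr1 !subrKC mul1r.
rewrite (le_trans IH)// exprSr -mulrA ler_pM2l ?exprn_gt0// step_flux//.
Qed.

Let shrink1 n m : (n <= m)%N -> (shrink n).1 <= (shrink m).1 /\
  (shrink m).1 + W m <= (shrink n).1 + W n.
Proof.
elim: m => [|m IH]; first by rewrite leqn0 => /eqP ->.
rewrite leq_eqVlt => /predU1P[->//|]; rewrite ltnS => /IH[h1 h2].
have := W_ge0 m.+1; rewrite /= /step /corner; move: h2; rewrite (W2 m).
by case: (odflt _ _) => [[] j] /=; rewrite ?mul1r ?mul0r => *; split; lra.
Qed.

Let shrink2 n m : (n <= m)%N -> (shrink n).2 <= (shrink m).2 /\
  (shrink m).2 + H m <= (shrink n).2 + H n.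
Proof.
elim: m => [|m IH]; first by rewrite leqn0 => /eqP ->.
rewrite leq_eqVlt => /predU1P[->//|]; rewrite ltnS => /IH[h1 h2].
have := H_ge0 m.+1; rewrite /= /step /corner; move: h2; rewrite (H2 m).
by case: (odflt _ _) => [i []] /=; rewrite ?mul1r ?mul0r => *; split; lra.
Qed.

Let limit_point (s w : nat -> R) : (forall n, 0 <= w n) ->
  (forall n m, (n <= m)%N -> s n <= s m /\ s m + w m <= s n + w n) ->
  exists x, forall n, s n <= x <= s n + w n.
Proof.
move=> w0 sw; exists (sup (range s)) => n.
have ub k : ubound (range s) (s k + w k).
  move=> _ [m _ <-]; have [km|/ltnW mk] := leqP k m.
    by have [_] := sw _ _ km; have := w0 m; lra.
  by have [] := sw _ _ mk; have := w0 k; lra.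
apply/andP; split; first by apply: ub_le_sup; [exists (s 0%N + w 0%N)|exists n].
by apply: ge_sup; [exists (s 0%N), 0%N|].
Qed.

(** Bisection: the flux through one of the four quarters of a rectangle is at
    least a quarter of the whole. Repeating this produces rectangles shrinking to
    a point, and after [n] steps the first-order expansion at that point bounds
    the flux by an arbitrarily small multiple of [4 ^- n]. *)
Lemma flux_eq0 : flux u v A B C D = 0.
Proof.
have [x0 xW] := limit_point W_ge0 shrink1.
have [y0 yH] := limit_point H_ge0 shrink2.
have xAB : A <= x0 <= B by have := xW 0%N; rewrite /= /W expr0 divr1 subrKC.
have yCD : C <= y0 <= D by have := yH 0%N; rewrite /= /H expr0 divr1 subrKC.
have [al [be [ga [fu fv]]]] := uv xAB yCD.
apply/eqP; rewrite -normr_le0; apply/ler_addgt0Pr => e' e'0; rewrite add0r.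
have S0 : 0 < 2 * ((B - A) + (D - C)) ^+ 2 + 1 by rewrite ltr_wpDl// mulr_ge0// sqr_ge0.
pose e := e' / (2 * ((B - A) + (D - C)) ^+ 2 + 1).
have e0 : 0 < e by rewrite divr_gt0.
have [r1 r10 {}fu] := fu e e0; have [r2 r20 {}fv] := fv e e0.
pose r := Num.min r1 r2; have r0 : 0 < r by rewrite lt_min r10.
have [n nr] : exists n, ((B - A) + (D - C)) / 2 ^+ n < r.
  exists (Num.truncn (((B - A) + (D - C)) / r)).+1.
  rewrite ltr_pdivrMr ?exprn_gt0// mulrC -ltr_pdivrMr//.
  rewrite (lt_le_trans (truncnS_gt _))// -natrX ler_nat ltnW// ltn_expl//.
rewrite mulrDl in nr; have := shrink_flux n; have [i1 i2 i3 i4] := inside_shrink n.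
have w0 := W_ge0 n; have h0 := H_ge0 n.
have := @flux_first_order _ _ _ _ x0 y0 al be ga e r i1 _ i2 i3 _ i4 (xW n) (yH n).
rewrite !lerDl => /(_ w0 h0); rewrite ![_ + _ - _]addrAC !subrr !add0r.
move=> /(_ _ _ _ _ e0) K /le_trans; apply.
have {K} : `|subflux n (shrink n)| <= 2 * e * (W n + H n) ^+ 2.
  apply: K.
  - by apply: le_lt_trans nr; rewrite lerDl; exact: h0.
  - by apply: le_lt_trans nr; rewrite lerDr; exact: w0.
  - by move=> x y; rewrite !lt_min => /andP[x1 _] /andP[y1 _]; exact: fu.
  - by move=> x y; rewrite !lt_min => /andP[_ x1] /andP[_ y1]; exact: fv.
rewrite -(ler_pM2l (_ : 0 < 4 ^+ n)) ?exprn_gt0// => /le_trans; apply.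
have -> : 4 ^+ n * (2 * e * (W n + H n) ^+ 2) = 2 * e * ((B - A) + (D - C)) ^+ 2.
  rewrite /W /H (_ : 4 = 2 ^+ 2 :> R); last by rewrite expr2 -natrM.
  by rewrite -exprM mulnC exprM; field; rewrite expf_neq0.
rewrite /e [X in _ <= X](_ : e' = e * (2 * ((B - A) + (D - C)) ^+ 2 + 1)); last first.
  by rewrite /e; field; rewrite gt_eqF.
by rewrite -/e; nra.
Qed.

End rectangle.
End goursat.

(** * Mean value property in polar coordinates *)

Section mean_value.
Variable R : realType.

Lemma is_derive_approx (f : R -> R) (x l : R) : is_derive x 1 f l ->
  forall e : R, 0 < e -> exists2 d : R, 0 < d & forall h, `|h| < d ->
    `|f (x + h) - f x - l * h| <= e * `|h|.
Proof.
move=> [Df Dl] e e0.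
have : (fun h => h^-1 *: (f (h *: 1 + x) - f x)) @ 0^' --> l.
  by rewrite -Dl; exact: Df.
move=> /cvgrPdist_lt/(_ e e0); rewrite near_withinE => /nbhs_ballP[d /= d0 H].
exists d => // h hd; have [->|h0] := eqVneq h 0.
  by rewrite addr0 subrr mulr0 subrr normr0 mulr0.
have := H h; rewrite /ball /= sub0r normrN => /(_ hd h0) /ltW K.
have -> : f (x + h) - f x - l * h = - h * (l - h^-1 * (f (h * 1 + x) - f x)).
  by rewrite mulr1 [h + x]addrC; field.
by rewrite normrM normrN mulrC ler_wpM2r.
Qed.

(** Exponential of [x + iy]; [z0 + cexp x y] are logarithmic polar coordinates
    at [z0]. *)
Definition cexp (x y : R) : cplane R := Complex (expR x * cos y) (expR x * sin y).

Lemma modulus_cexp x y : modulus (cexp x y) = expR x.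
Proof.
rewrite modulusE /= !exprMn -mulrDr cos2Dsin2 mulr1 sqrtr_sqr ger0_norm// expR_ge0.
Qed.

Lemma cexpD x y h k : cexp (x + h) (y + k) = cexp x y * cexp h k.
Proof.
apply/eqP; rewrite eq_complex /= expRD cosD sinD; apply/andP; split; apply/eqP; ring.
Qed.

Lemma cexp_approx (e : R) : 0 < e -> exists2 d : R, 0 < d & forall h k : R, `|h| < d -> `|k| < d ->
  modulus (cexp h k - 1 - Complex h k) <= e * (`|h| + `|k|).
Proof.
move=> e0; have [e1 [e10 e11 e18]] : exists e1 : R, [/\ 0 < e1, e1 <= 1 & e1 <= e / 8].
  by exists (Num.min (e / 8) 1); rewrite lt_min divr_gt0//= !ge_min !lexx orbT.
have [d1 d10 H1] := is_derive_approx (is_derive_expR 0) e10.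
have [d2 d20 H2] := is_derive_approx (is_derive_cos 0) e10.
have [d3 d30 H3] := is_derive_approx (is_derive_sin 0) e10.
exists (Num.min (Num.min d1 d2) (Num.min d3 e1)).
  by rewrite !lt_min d10 d20 d30 e10.
move=> h k; rewrite !lt_min => /andP[/andP[hd1 hd2] /andP[hd3 he1]].
move=> /andP[/andP[kd1 kd2] /andP[kd3 ke1]].
have := H1 h hd1; have := H2 k kd2; have := H3 k kd3.
rewrite !add0r sin0 cos0 expR0 oppr0 mul0r !subr0 !mul1r ?addr0 => K3 K2 K1.
have E3 : expR h <= 3.
  by have := K1; rewrite ler_norml => /andP[_]; have := ler_norm h; nra.
have Ege0 := expR_ge0 h.
rewrite (le_trans (modulus_le_ReIm _))//=.
have -> : expR h * cos k - 1 - h = (expR h - 1 - h) + expR h * (cos k - 1) by ring.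
rewrite ?oppr0 ?addr0 ?subr0.
have -> : expR h * sin k - k = expR h * (sin k - k) + (expR h - 1 - h) * k + h * k by ring.
apply: le_trans (_ : (`|expR h - 1 - h| + expR h * `|cos k - 1|) +
  (expR h * `|sin k - k| + `|expR h - 1 - h| * `|k| + `|h| * `|k|) <= _).
  apply: lerD; first by rewrite (le_trans (ler_normD _ _))// normrM (ger0_norm Ege0).
  rewrite (le_trans (ler_normD _ _))// normrM lerD2r.
  by rewrite (le_trans (ler_normD _ _))// !normrM (ger0_norm Ege0).
have h0 := normr_ge0 h; have k0 := normr_ge0 k.
have c0 := normr_ge0 (cos k - 1); have s0 := normr_ge0 (sin k - k).
have T1 : expR h * `|cos k - 1| <= 3 * (e1 * `|k|) by rewrite ler_pM.
have T2 : expR h * `|sin k - k| <= 3 * (e1 * `|k|) by rewrite ler_pM.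
have T3 : `|expR h - 1 - h| * `|k| <= (e1 * `|h|) * 1.
  by rewrite ler_pM// (le_trans (ltW ke1)).
have T4 : `|h| * `|k| <= e1 * `|k| by rewrite ler_wpM2r// ltW.
have T5 : e1 * `|h| <= e / 8 * `|h| by rewrite ler_wpM2r.
have T6 : e1 * `|k| <= e / 8 * `|k| by rewrite ler_wpM2r.
have T7 : 0 <= e * `|h| by rewrite mulr_ge0// ltW.
have T8 : 0 <= e * `|k| by rewrite mulr_ge0// ltW.
lra.
Qed.

(** Chain rule, in the form of a first-order expansion in the two real
    variables with a complex-linear differential. *)
Lemma comp_cexp_approx (f : cplane R -> cplane R) (z0 : cplane R) (x0 y0 : R) :
  derivable f (z0 + cexp x0 y0) 1 -> exists m : cplane R,
  forall e : R, 0 < e -> exists2 d : R, 0 < d & forall x y, `|x - x0| < d -> `|y - y0| < d ->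
    modulus (f (z0 + cexp x y) - f (z0 + cexp x0 y0) - m * Complex (x - x0) (y - y0))
    <= e * (`|x - x0| + `|y - y0|).
Proof.
move=> /derivable_modulusP[l Hl]; pose E := cexp x0 y0; exists (l * E) => e e0.
have E0 : 0 <= modulus E by exact: modulus_ge0.
have l0 : 0 <= modulus l by exact: modulus_ge0.
pose e1 := e / (2 * (2 * modulus E + 1)).
have e10 : 0 < e1 by rewrite divr_gt0// mulr_gt0// ltr_wpDl// mulr_ge0.
have [d1 d10 H1] := Hl _ e10.
have [e2 [e20 e21 e22]] : exists e2 : R, [/\ 0 < e2, e2 <= 1 &
    e2 <= e / (2 * (modulus l * modulus E + 1))].
  exists (Num.min 1 (e / (2 * (modulus l * modulus E + 1)))); rewrite !ge_min !lexx orbT.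
  by rewrite lt_min ltr01 divr_gt0// mulr_gt0// ltr_wpDl// mulr_ge0.
have [d2 d20 H2] := cexp_approx e20.
pose d := Num.min d2 (d1 / (4 * (modulus E + 1))).
have d0 : 0 < d by rewrite lt_min d20 divr_gt0// mulr_gt0// ltr_wpDl.
exists d => // x y; set h := x - x0; set k := y - y0; rewrite !lt_min.
move=> /andP[hd2 hd1] /andP[kd2 kd1].
have := H2 h k hd2 kd2; set err := cexp h k - 1 - Complex h k => Herr.
have h0 := normr_ge0 h; have k0 := normr_ge0 k.
have EE : cexp x y = E + E * (Complex h k + err).
  have -> : cexp x y = E * cexp h k by rewrite -cexpD /h /k !subrKC.
  by rewrite /err; ring.
pose w := E * (Complex h k + err).
have hk : modulus (Complex h k : cplane R) <= `|h| + `|k| by exact: modulus_le_ReIm.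
have wle : modulus w <= 2 * modulus E * (`|h| + `|k|).
  rewrite modulusM [2 * _]mulrC -mulrA ler_wpM2l// (le_trans (modulusD _ _))//.
  have : e2 * (`|h| + `|k|) <= 1 * (`|h| + `|k|) by rewrite ler_wpM2r// addr_ge0.
  by lra.
have wd1 : modulus w < d1.
  apply: (le_lt_trans wle).
  move: hd1 kd1; rewrite !ltr_pdivlMr ?mulr_gt0 ?ltr_wpDl// => hd1 kd1.
  nra.
have -> : f (z0 + cexp x y) - f (z0 + E) - l * E * Complex h k =
   (f ((z0 + E) + w) - f (z0 + E) - l * w) + l * E * err.
  by rewrite EE -/w addrA /w; ring.
rewrite (le_trans (modulusD _ _))//.
have K1 := H1 w wd1.
rewrite !modulusM.
have K2 : e1 * modulus w <= e / 2 * (`|h| + `|k|).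
  rewrite (le_trans (ler_wpM2l (ltW e10) wle))// mulrA ler_wpM2r ?addr_ge0//.
  rewrite /e1 mulrAC ler_pdivrMr ?mulr_gt0// ?ltr_wpDl ?mulr_ge0//.
  by nra.
have K3 : modulus l * modulus E * modulus err <= e / 2 * (`|h| + `|k|).
  rewrite (le_trans (ler_wpM2l (mulr_ge0 l0 E0) Herr))// mulrA ler_wpM2r ?addr_ge0//.
  apply: (le_trans (ler_wpM2l (mulr_ge0 l0 E0) e22)).
  have P0 := mulr_ge0 l0 E0.
  rewrite mulrA ler_pdivrMr ?mulr_gt0// ?ltr_wpDl//.
  by nra.
lra.
Qed.

Lemma comp_cexp_divergence_free (f : cplane R -> cplane R) (z0 : cplane R) (x0 y0 : R) :
  derivable f (z0 + cexp x0 y0) 1 ->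
  divergence_free_at (fun x y => cRe (f (z0 + cexp x y)))
    (fun x y => cIm (f (z0 + cexp x y))) x0 y0.
Proof.
move=> /comp_cexp_approx[m Hm]; exists (cRe m), (- cIm m), (cIm m); split=> e e0.
  have [d d0 H] := Hm e e0; exists d => // x y xd yd.
  apply: le_trans (H x y xd yd); apply: le_trans (Re_le_modulus _).
  rewrite le_eqVlt; apply/orP; left; apply/eqP; congr `| _ |.
  by case: (f _) (f _) m {Hm H} => [? ?] [? ?] [? ?] /=; ring.
have [d d0 H] := Hm e e0; exists d => // x y xd yd.
apply: le_trans (H x y xd yd); apply: le_trans (Im_le_modulus _).
rewrite le_eqVlt; apply/orP; left; apply/eqP; congr `| _ |.
by case: (f _) (f _) m {Hm H} => [? ?] [? ?] [? ?] /=; ring.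
Qed.

(** In logarithmic polar coordinates an annulus is a rectangle whose horizontal
    sides coincide by periodicity. The vanishing of the flux thus says that the
    mean of the real part over a circle is independent of the radius, and the
    mean over a small circle is close to the value at the centre by continuity.
    Continuity is what is asked at the centre, so that isolated exceptional
    points are harmless. *)
Lemma mean_value (f : cplane R -> cplane R) (z0 : cplane R) (r r' : R) : 0 < r -> r < r' ->
  {for z0, continuous f} ->
  (forall z, 0 < modulus (z - z0) < r' -> derivable f z 1) ->
  let u y := cRe (f (z0 + cexp (ln r) y)) in
  {within `[0, 2 * pi], continuous u} /\
  itv_int u 0 (2 * pi) = cRe (f z0) * (2 * pi).
Proof.
move=> r0 rr' cf df u.
have T1 : 0 < 2 * pi :> R by rewrite mulr_gt0// pi_gt0.
have cT : cos (2 * pi) = 1 :> R by rewrite mulr_natl cos2pi.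
have sT : sin (2 * pi) = 0 :> R by rewrite mulr_natl sin2pi.
move: (2 * pi) T1 cT sT => T T1 cT sT; have T0 := ltW T1.
have DF x y : expR x < r' -> divergence_free_at (fun x y => cRe (f (z0 + cexp x y)))
    (fun x y => cIm (f (z0 + cexp x y))) x y.
  move=> xr; apply: comp_cexp_divergence_free; apply: df.
  by rewrite addrAC subrr add0r modulus_cexp expR_gt0.
have cu x : expR x < r' -> {within `[0, T], continuous (fun y => cRe (f (z0 + cexp x y)))}.
  move=> xr; apply: continuous_itv => y _.
  have [al [be [ga [H _]]]] := DF x y xr.
  exact: (first_order_continuous2 H).
have lr : expR (ln r) < r' by rewrite lnK ?posrE.
split; first exact: cu.
apply/eqP; rewrite -subr_eq0 -normr_le0; apply/ler_addgt0Pr => e e0; rewrite add0r.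
pose e1 := e / T.
have e10 : 0 < e1 by rewrite divr_gt0.
have [d d0 Hd] : exists2 d : R, 0 < d & forall z, modulus (z - z0) < d ->
    modulus (f z - f z0) < e1.
  by apply/nbhs_modulusP; move: (cf) => /(cvg_modulusP (nbhs_filter z0) f) /(_ e1 e10).
(* [expR a] is a radius at which [f] is within [e1] of its value at the centre *)
pose a := Num.min (ln r) (ln (d / 2)).
have ar : a <= ln r by rewrite /a ge_min lexx.
have ad : expR a < d.
  have : expR a <= d / 2.
    by rewrite -ler_ln ?posrE ?expR_gt0 ?divr_gt0// expRK /a ge_min lexx orbT.
  lra.
have ar' : expR a < r' by rewrite (le_lt_trans _ lr)// ler_expR.
have := @flux_eq0 R _ _ a (ln r) 0 T _ ar T0.
move=> /(_ (fun x y => cRe (f (z0 + cexp x y))) (fun x y => cIm (f (z0 + cexp x y)))).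
have DF2 : divergence_free (fun x y => cRe (f (z0 + cexp x y)))
  (fun x y => cIm (f (z0 + cexp x y))) a (ln r) 0 T.
  move=> x y /andP[_ xr] _; apply: DF; rewrite (le_lt_trans _ lr)// ler_expR//.
move=> /(_ DF2); rewrite /flux.
have -> : itv_int (fun x => cIm (f (z0 + cexp x T)) - cIm (f (z0 + cexp x 0))) a (ln r) = 0.
  transitivity (itv_int (fun=> 0 : R) a (ln r)); last by rewrite itv_int_cst// mul0r.
  congr itv_int; apply/funext => x.
  by rewrite /cexp cT sT cos0 sin0 subrr.
rewrite subr0 itv_intB; [|exact: cu|exact: cu].
move/eqP; rewrite subr_eq0 => /eqP E.
have -> : itv_int u 0 T = itv_int (fun y => cRe (f (z0 + cexp a y))) 0 T by exact: E.
have -> : cRe (f z0) * T = itv_int (fun=> cRe (f z0)) 0 T.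
  rewrite (itv_int_cst _ T0) subr0; reflexivity.
have cc : {within `[0, T], continuous (fun _ : R => cRe (f z0) : R)}.
  by apply: continuous_subspaceT => x; exact: cvg_cst.
rewrite -(itv_intB (cu _ ar') cc).
have -> : e = e1 * (T - 0) by rewrite subr0 /e1 (divfK (lt0r_neq0 T1)).
apply: (itv_int_bound T0); first by move=> x; apply: cvgB; [exact: cu|exact: cc].
move=> y _; have K : modulus (f (z0 + cexp a y) - f z0) < e1.
  by apply: Hd; rewrite addrAC subrr add0r modulus_cexp.
apply: le_trans (ltW K); apply: le_trans (Re_le_modulus _).
by case: (f _) (f _) => [? ?] [? ?].
Qed.

End mean_value.

(** * Maximum principle with finitely many exceptional points *)

Section maximum_principle.
Variable R : realType.

Lemma toC_continuous : continuous (@toC R).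
Proof.
move=> [x y]; apply/(cvg_modulusP (nbhs_filter (x, y))) => e e0.
have e20 : 0 < e / 2 by rewrite divr_gt0.
exists ([set x' | `|x' - x| < e / 2], [set y' | `|y' - y| < e / 2]).
  by split; apply/nbhs_ballP; exists (e / 2) => // w; rewrite /ball/= distrC.
move=> [x' y'] [/= xx yy]; apply: (le_lt_trans (modulus_le_ReIm (toC (x', y') - toC (x, y)))).
by rewrite [ltRHS](splitr e) ltrD.
Qed.

Lemma compact_closed_disk (r : R) : compact [set z : cplane R | modulus z <= r].
Proof.
have K : compact (@toC R @` (`[- r, r] `*` `[- r, r])).
  apply: continuous_compact; first by apply: continuous_subspaceT; exact: toC_continuous.
  by apply: compact_setX; exact: segment_compact.
apply: subclosed_compact K _.
  have -> : [set z : cplane R | modulus z <= r] = (@modulus R) @^-1` [set x | x <= r] by [].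
  apply: preimage_closed; [by move=> x _; exact: modulus_continuous|exact: closed_le].
move=> [x y] /= zr; exists (x, y) => //=; rewrite !in_itv /= -!ler_norml.
by split; apply: le_trans zr; [exact: (Re_le_modulus (Complex x y))|exact: (Im_le_modulus (Complex x y))].
Qed.

Lemma seq_isolated (S : seq (cplane R)) z : exists2 r : R, 0 < r &
  forall s, s \in S -> s != z -> r <= modulus (s - z).
Proof.
elim: S => [|s S [r r0 H]]; first by exists 1.
have [->|sz] := eqVneq s z.
  by exists r => // t; rewrite in_cons => /predU1P[->|/H //]; rewrite eqxx.
exists (Num.min r (modulus (s - z))); first by rewrite lt_min r0 modulus_gt0 subr_eq0.
move=> t; rewrite in_cons => /predU1P[->|tS tz]; first by rewrite ge_min lexx orbT.
by rewrite ge_min H.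
Qed.

Lemma Re_polarization (eta : R) (a z : cplane R) :
  cRe (conjc a * a + (Complex eta 0 * conjc z) * z) = modulus a ^+ 2 + eta * modulus z ^+ 2.
Proof. by rewrite !sqr_modulus; case: a z => [a b] [x y] /=; ring. Qed.

(** Polarisation of [|b|^2 + eta |z|^2]: its value is dominated by the real part
    of an expression that is linear in [b] and [z], with the gain
    [eta |w|^2]. *)
Lemma Re_polarization_le (eta : R) (a b z w : cplane R) :
  2 * cRe (conjc a * b + (Complex eta 0 * conjc z) * (z + w)) <=
  (modulus b ^+ 2 + eta * modulus (z + w) ^+ 2) + (modulus a ^+ 2 + eta * modulus z ^+ 2)
  - eta * modulus w ^+ 2.
Proof.
rewrite !sqr_modulus; case: a b z w => [a a'] [b b'] [x x'] [y y'] /=.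
by have := sqr_ge0 (a - b); have := sqr_ge0 (a' - b'); nra.
Qed.

(** At an interior maximum [z1] of [F = |g|^2 + eta |z|^2], the polarised function
    [h z = conj (g z1) * g z + eta * conj z1 * z] satisfies [Re (h z1) = F z1] and
    [2 Re (h z) <= F z + F z1 - eta |z - z1|^2]. On a small circle around [z1] its
    real part is then strictly below its value at the centre, against the mean
    value property. The points of [S] are isolated, and the mean value property
    only asks for continuity at the centre, so [z1] itself may belong to [S]. *)
Lemma maximum_principle (g : cplane R -> cplane R) (S : seq (cplane R)) (r M : R) :
  0 < r -> r < 1 -> 0 <= M ->
  (forall z, modulus z < 1 -> {for z, continuous g}) ->
  (forall z, modulus z < 1 -> z \notin S -> derivable g z 1) ->
  (forall z, modulus z = r -> modulus (g z) <= M) ->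
  forall z, modulus z <= r -> modulus (g z) <= M.
Proof.
move=> r0 r1 M0 cg dg gM z0 z0r; rewrite leNgt; apply/negP => Mz0.
have [eta eta0 etaE] : exists2 eta : R, 0 < eta & modulus (g z0) ^+ 2 = M ^+ 2 + 2 * eta.
  exists ((modulus (g z0) ^+ 2 - M ^+ 2) / 2); last by field.
  by rewrite divr_gt0// subr_gt0 ltr_pXn2r// nnegrE modulus_ge0.
pose F (z : cplane R) : R := modulus (g z) ^+ 2 + eta * modulus z ^+ 2.
have cF : {within [set z | modulus z <= r], continuous F}.
  apply: continuous_in_subspaceT => z; rewrite inE /= => zr.
  have cm : {for z, continuous (fun z => modulus (g z))}.
    by apply: continuous_comp; [apply: cg; exact: le_lt_trans r1|exact: modulus_continuous].
  have cz : {for z, continuous (@modulus R)} by exact: modulus_continuous.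
  exact: (cvgD (cvgM cm cm) (cvgM (cvg_cst eta) (cvgM cz cz))).
have [z1 z1r z1max] := @compact_EVT_max _ R F [set z | modulus z <= r] (ex_intro _ z0 z0r) (@compact_closed_disk r) cF.
move: z1r; rewrite inE /= => z1r.
have {}z1max z : modulus z <= r -> F z <= F z1.
  by move=> zr; apply: z1max; rewrite inE.
have z1lt : modulus z1 < r.
  rewrite lt_neqAle z1r andbT; apply/eqP => E.
  have := z1max z0 z0r; rewrite /F E; have := gM _ E => gz1.
  have : modulus (g z1) ^+ 2 <= M ^+ 2 by rewrite ler_pXn2r ?nnegrE ?modulus_ge0.
  have : 0 <= eta * modulus z0 ^+ 2 by rewrite mulr_ge0 ?sqr_ge0 ?ltW.
  have : eta * r ^+ 2 <= eta * 1 by rewrite ler_pM2l// exprn_ile1 ?ltW.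
  by move: eta0 etaE; lra.
have [d d0 Sd] := seq_isolated S z1.
have [rho [rho0 rhod rhor]] : exists rho : R, [/\ 0 < rho, rho < d & rho < r - modulus z1].
  exists (Num.min d (r - modulus z1) / 2).
  have : 0 < Num.min d (r - modulus z1) by rewrite lt_min d0 subr_gt0.
  have : Num.min d (r - modulus z1) <= d by rewrite ge_min lexx.
  have : Num.min d (r - modulus z1) <= r - modulus z1 by rewrite ge_min lexx orbT.
  by move=> *; split; lra.
pose h (z : cplane R) : cplane R := conjc (g z1) * g z + (Complex eta 0 * conjc z1) * z.
have z11 : modulus z1 < 1 by exact: lt_trans z1lt r1.
have ch : {for z1, continuous h}.
  have cg1 : {for z1, continuous g} by exact: cg.
  apply: ccontinuousD; apply: ccontinuousM; [exact: ccontinuous_cst|exact: cg1| |].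
    exact: ccontinuous_cst.
  exact: ccontinuous_id.
pose r' := Num.min d (r - modulus z1).
have rr' : rho < r' by rewrite lt_min rhod.
have dh (z : cplane R) : 0 < modulus (z - z1) < r' -> derivable h z 1.
  rewrite lt_min => /andP[zz1 /andP[zd zr]].
  have z_1 : modulus z < 1.
    by have := modulusB_ge z z1; lra.
  apply: cderivableD; last first.
    by apply: cderivableM; [exact: cderivable_cst|exact: cderivable_id].
  apply: cderivableM; first exact: cderivable_cst.
  apply: dg => //; apply/negP => zS.
  have := Sd _ zS; rewrite -subr_eq0 -modulus_gt0 => /(_ zz1).
  by rewrite leNgt zd.
have [cu Iu] := mean_value rho0 rr' ch dh.
have hz1 : cRe (h z1) = F z1.
  exact: Re_polarization.
have key y : cRe (h (z1 + cexp (ln rho) y)) <= F z1 - eta * rho ^+ 2 / 2.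
  set w := cexp _ _.
  have mw : modulus w ^+ 2 = rho ^+ 2 by rewrite modulus_cexp lnK.
  have zr : modulus (z1 + w) <= r.
    by rewrite (le_trans (modulusD _ _))// /w modulus_cexp lnK ?posrE//; lra.
  have := z1max _ zr.
  have E : 2 * cRe (h (z1 + w)) <= F (z1 + w) + F z1 - eta * modulus w ^+ 2.
    exact: Re_polarization_le.
  by move: E; rewrite mw; lra.
have pi1 : 0 < 2 * pi :> R by rewrite mulr_gt0// pi_gt0.
have : cRe (h z1) * (2 * pi) <= (F z1 - eta * rho ^+ 2 / 2) * (2 * pi).
  rewrite -Iu; apply: le_trans (_ : itv_int (fun=> F z1 - eta * rho ^+ 2 / 2) 0 (2 * pi) <= _).
    apply: itv_int_le => //.
    by apply: continuous_subspaceT => x; exact: cvg_cst.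
  by rewrite (itv_int_cst _ (ltW pi1)) subr0.
rewrite (ler_pM2r pi1) hz1.
have : 0 < eta * rho ^+ 2 / 2 by rewrite divr_gt0// mulr_gt0// exprn_gt0.
lra.
Qed.

End maximum_principle.

(** * Pseudo-hyperbolic distance and division by a Blaschke factor *)

Section schwarz_pick.
Variable R : realType.
Implicit Types (z w p q a : cplane R).

Definition blaschke p z : cplane R := (z - p) / (1 - conjc p * z).

(** Pseudo-hyperbolic distance, the hyperbolic tangent of the hyperbolic one. *)
Definition phd z w : R := modulus (blaschke z w).

Lemma sqr_modulus_sub1 z w : modulus (1 - conjc z * w) ^+ 2 =
  modulus (z - w) ^+ 2 + (1 - modulus z ^+ 2) * (1 - modulus w ^+ 2).
Proof. by rewrite !sqr_modulus; case: z w => [a b] [c d] /=; ring. Qed.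

Lemma modulus_sub1_ge z w : 1 - modulus z * modulus w <= modulus (1 - conjc z * w).
Proof.
have := modulusB_ge 1 (conjc z * w); by rewrite modulus1 modulusM modulusJ.
Qed.

Lemma modulus_sub1_gt0 z w : modulus z < 1 -> modulus w <= 1 -> 0 < modulus (1 - conjc z * w).
Proof.
move=> z1 w1; apply: lt_le_trans (modulus_sub1_ge z w); rewrite subr_gt0.
apply: le_lt_trans z1; exact: (ler_piMr (modulus_ge0 z) w1).
Qed.

Lemma sub1_neq0 z w : modulus z < 1 -> modulus w <= 1 -> 1 - conjc z * w != 0.
Proof. by move=> z1 w1; rewrite -modulus_gt0 modulus_sub1_gt0. Qed.

Lemma phdE z w : phd z w = modulus (z - w) / modulus (1 - conjc z * w).
Proof. by rewrite /phd /blaschke modulusf_div modulusBC. Qed.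

Lemma phd_ge0 z w : 0 <= phd z w.
Proof. exact: modulus_ge0. Qed.

Lemma phdC z w : phd z w = phd w z.
Proof.
rewrite !phdE modulusBC; congr (_ / _).
by rewrite -modulusJ rmorphB rmorph1 rmorphM /= conjcK mulrC.
Qed.

Lemma phdxx z : phd z z = 0.
Proof. by rewrite phdE subrr modulus0 mul0r. Qed.

(** The identity behind all comparisons of [phd] with the distance to the unit
    circle. *)
Lemma one_sub_phd2 z w : modulus z < 1 -> modulus w <= 1 ->
  1 - phd z w ^+ 2 = (1 - modulus z ^+ 2) * (1 - modulus w ^+ 2) / modulus (1 - conjc z * w) ^+ 2.
Proof.
move=> z1 w1; have := modulus_sub1_gt0 z1 w1; have := sqr_modulus_sub1 z w.
rewrite phdE; move: (modulus (1 - _)) (modulus (z - w)) => s t E s0.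
have s20 : s ^+ 2 != 0 by rewrite expf_neq0// gt_eqF.
by apply: (mulIf s20); rewrite mulfVK// exprMn exprVn mulrBl mulfVK// mul1r E; ring.
Qed.

Lemma phd_le1 z w : modulus z < 1 -> modulus w <= 1 -> phd z w <= 1.
Proof.
move=> z1 w1; have := one_sub_phd2 z1 w1.
have : 0 <= (1 - modulus z ^+ 2) * (1 - modulus w ^+ 2) / modulus (1 - conjc z * w) ^+ 2.
  apply: divr_ge0; last by rewrite sqr_ge0.
  by rewrite mulr_ge0// subr_ge0 exprn_ile1 ?modulus_ge0// ltW.
have := phd_ge0 z w; nra.
Qed.

Lemma phd_lt1 z w : modulus z < 1 -> modulus w < 1 -> phd z w < 1.
Proof.
move=> z1 w1; have := one_sub_phd2 z1 (ltW w1).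
have : 0 < (1 - modulus z ^+ 2) * (1 - modulus w ^+ 2) / modulus (1 - conjc z * w) ^+ 2.
  apply: divr_gt0; last by rewrite exprn_gt0// modulus_sub1_gt0// ltW.
  by rewrite mulr_gt0// subr_gt0 exprn_ilt1 ?modulus_ge0.
have := phd_ge0 z w; nra.
Qed.

Lemma phd_gt0 z w : modulus z < 1 -> modulus w < 1 -> z != w -> 0 < phd z w.
Proof.
move=> z1 w1 zw; rewrite phdE divr_gt0//; first by rewrite modulus_gt0 subr_eq0.
exact: modulus_sub1_gt0 (ltW w1).
Qed.

Lemma blaschke_neq0 p z : modulus p < 1 -> modulus z < 1 -> z != p -> blaschke p z != 0.
Proof. by move=> p1 z1 zp; rewrite -modulus_gt0; apply: phd_gt0 => //; rewrite eq_sym. Qed.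

(** The modulus of a Blaschke factor tends to 1 at the unit circle, at a rate
    linear in the distance to the circle. *)
Lemma phd_circle_ge p z (r : R) : modulus p < 1 -> 0 <= r -> r < 1 -> modulus z = r ->
  1 - 4 / (1 - modulus p) * (1 - r) <= phd p z ^+ 2.
Proof.
move=> p1 r0 r1 zr; have z1 : modulus z <= 1 by rewrite zr ltW.
have := one_sub_phd2 p1 z1; rewrite zr.
have s0 := modulus_sub1_gt0 p1 z1.
have s1 : 1 - modulus p <= modulus (1 - conjc p * z).
  apply: le_trans (modulus_sub1_ge p z).
  by rewrite lerD2l lerN2 ler_piMr// modulus_ge0.
have p0 := modulus_ge0 p.
have K : (1 - modulus p ^+ 2) * (1 - r ^+ 2) / modulus (1 - conjc p * z) ^+ 2 <=
  4 / (1 - modulus p) * (1 - r).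
  rewrite ler_pdivrMr ?exprn_gt0//.
  have t0 : 0 < 1 - modulus p by rewrite subr_gt0.
  apply: (@le_trans _ _ (4 / (1 - modulus p) * (1 - r) * (1 - modulus p) ^+ 2)).
    have -> : 4 / (1 - modulus p) * (1 - r) * (1 - modulus p) ^+ 2 =
      4 * (1 - r) * (1 - modulus p) by field; rewrite gt_eqF.
    have -> : (1 - modulus p ^+ 2) * (1 - r ^+ 2) =
       (1 + modulus p) * (1 + r) * ((1 - r) * (1 - modulus p)) by ring.
    rewrite -[leRHS]mulrA ler_wpM2r//; first by rewrite mulr_ge0// subr_ge0 ltW.
    have -> : 4 = 2 * 2 :> R by ring.
    by apply: ler_pM; lra.
  apply: ler_wpM2l; first by rewrite mulr_ge0 ?subr_ge0 ?(ltW r1)// divr_ge0// ltW.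
  by rewrite ler_pXn2r// nnegrE ltW.
lra.
Qed.

Lemma near_neq p z : z != p -> \near z, z != p.
Proof.
move=> zp; apply/nbhs_modulusP; exists (modulus (z - p)).
  by rewrite modulus_gt0 subr_eq0.
by move=> w; apply: contraTneq => ->; rewrite -leNgt modulusBC.
Qed.

(** Division by a Blaschke factor. The quotient extends continuously to [p] by
    the derivative of [f], and on circles close to the unit circle it is bounded
    by nearly 1 because the divisor is; the maximum principle carries the bound
    inside. Differentiability of the quotient is lost at [p] only, so that [p]
    joins the exceptional set, and the division can be repeated: one division
    gives Schwarz-Pick, two give the Harnack inequality for the defect. *)
Lemma blaschke_quotient (f : cplane R -> cplane R) (S : seq (cplane R)) p :
  (forall z, modulus z < 1 -> {for z, continuous f}) ->
  (forall z, modulus z < 1 -> z \notin S -> derivable f z 1) ->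
  (forall z, modulus z < 1 -> modulus (f z) <= 1) ->
  modulus p < 1 -> p \notin S -> modulus (f p) < 1 ->
  exists g : cplane R -> cplane R,
  [/\ forall z, modulus z < 1 -> {for z, continuous g},
      forall z, modulus z < 1 -> z \notin p :: S -> derivable g z 1,
      forall z, modulus z < 1 -> modulus (g z) <= 1 &
      forall z, modulus z < 1 -> blaschke (f p) (f z) = g z * blaschke p z].
Proof.
move=> cf df f1 p1 pS fp1.
have [l Hl] := derivable_modulusP (df p p1 pS).
pose L : cplane R := l * ((1 - conjc p * p) / (1 - conjc (f p) * f p)).
pose g0 z : cplane R := blaschke (f p) (f z) / blaschke p z.
pose g z : cplane R := if z == p then L else g0 z.
have g0E z : z != p -> \near z, g0 z = g z.
  move=> zp; have := near_neq zp; apply: filterS => w wp.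
  by rewrite /g (negbTE wp).
have gE z : z != p -> g z = g0 z by move=> zp; rewrite /g (negbTE zp).
have fz_neq z : modulus z < 1 -> 1 - conjc (f p) * f z != 0.
  by move=> z1; apply: sub1_neq0 => //; exact: f1.
have pz_neq z : modulus z < 1 -> 1 - conjc p * z != 0.
  by move=> z1; apply: sub1_neq0 => //; exact: ltW.
have cblaschke (h : cplane R -> cplane R) a z : 1 - conjc a * h z != 0 -> {for z, continuous h} ->
    {for z, continuous (fun x => blaschke a (h x))}.
  move=> nz ch; apply: ccontinuousM; first exact: ccontinuousB ch (@ccontinuous_cst _ _ _).
  apply: ccontinuousV; first exact: nz.
  apply: ccontinuousB; first exact: ccontinuous_cst.
  exact: ccontinuousM (@ccontinuous_cst _ _ _) ch.
have dblaschke (h : cplane R -> cplane R) a z : 1 - conjc a * h z != 0 -> derivable h z 1 ->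
    derivable (fun x => blaschke a (h x)) z 1.
  move=> nz ch; apply: cderivableM; first exact: cderivableB ch (@cderivable_cst _ _ _).
  apply: cderivableV; first exact: nz.
  apply: cderivableB; first exact: cderivable_cst.
  exact: cderivableM (@cderivable_cst _ _ _) ch.
have cg z : modulus z < 1 -> {for z, continuous g}.
  move=> z1; have [zp|zp] := eqVneq z p; last first.
    rewrite /prop_for /continuous_at (gE z zp).
    have cg0 : {for z, continuous g0}.
      apply: ccontinuousM; first by apply: cblaschke; [exact: fz_neq|exact: cf].
      apply: ccontinuousV; first exact: blaschke_neq0.
      by apply: (cblaschke id); [exact: pz_neq|exact: ccontinuous_id].
    exact: cvg_trans (near_eq_cvg (g0E z zp)) cg0.
  rewrite zp; pose k z : cplane R := (1 - conjc p * z) / (1 - conjc (f p) * f z).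
  have ck : {for p, continuous k}.
    apply: ccontinuousM; last apply: ccontinuousV; first last.
    - by apply: ccontinuousB; [exact: ccontinuous_cst|apply: ccontinuousM; [exact: ccontinuous_cst|exact: cf]].
    - exact: fz_neq.
    - by apply: ccontinuousB; [exact: ccontinuous_cst|apply: ccontinuousM; [exact: ccontinuous_cst|exact: ccontinuous_id]].
  pose s z : cplane R := if z == p then l else (f z - f p) / (z - p).
  have cs : {for p, continuous s}.
    apply/(cvg_modulusP (nbhs_filter p)) => e e0.
    have e20 : 0 < e / 2 by rewrite divr_gt0.
    have [d d0 Hd] := Hl _ e20.
    apply/nbhs_modulusP; exists d => // w wp; rewrite /s eqxx.
    case: eqVneq => [_|wneq]; first by rewrite subrr modulus0.
    have := Hd _ wp; rewrite [p + _]addrC subrK => Hw.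
    have -> : (f w - f p) / (w - p) - l = (f w - f p - l * (w - p)) / (w - p).
      by field; rewrite subr_eq0.
    rewrite modulusf_div ltr_pdivrMr ?modulus_gt0 ?subr_eq0//.
    by apply: (le_lt_trans Hw); rewrite ltr_pM2r ?modulus_gt0 ?subr_eq0//; lra.
  have : {for p, continuous (fun z => s z * k z)} by exact: ccontinuousM.
  rewrite /prop_for /continuous_at /g eqxx [s p]/s eqxx -/L => csk.
  refine (cvg_trans (near_eq_cvg _) csk).
  near=> w; rewrite /s /g; case: eqVneq => [->//|wp].
  rewrite /k /g0 /blaschke; field.
  have w1 : modulus w < 1.
    near: w; apply/nbhs_modulusP; exists (1 - modulus p); first by rewrite subr_gt0.
    by move=> w; have := modulusB_ge w p; lra.
  by apply/and3P; split; [exact: pz_neq|by rewrite subr_eq0|exact: fz_neq].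
have dg z : modulus z < 1 -> z \notin p :: S -> derivable g z 1.
  rewrite in_cons negb_or => z1 /andP[zp zS].
  have dg0 : derivable g0 z 1.
    apply: cderivableM; first by apply: dblaschke; [exact: fz_neq|exact: df].
    apply: cderivableV; first exact: blaschke_neq0.
    by apply: (dblaschke id); [exact: pz_neq|exact: cderivable_id].
  exact: (near_eq_derivable (g0E z zp) dg0).
have gB z : modulus z < 1 -> blaschke (f p) (f z) = g z * blaschke p z.
  move=> z1; have [->|zp] := eqVneq z p; first by rewrite /blaschke !subrr !mul0r mulr0.
  by rewrite gE// /g0 divfK// blaschke_neq0.
exists g; split=> // z z1.
have key (r : R) : 0 < r -> modulus z <= r -> modulus p < r -> r < 1 ->
    0 < 1 - 4 / (1 - modulus p) * (1 - r) ->
    modulus (g z) ^+ 2 <= (1 - 4 / (1 - modulus p) * (1 - r))^-1.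
  move=> r0 zr pr r1; set t := 1 - _ => t0.
  have M0 : 0 <= (Num.sqrt t)^-1 by rewrite invr_ge0 sqrtr_ge0.
  have := maximum_principle r0 r1 M0 cg dg.
  have -> : t^-1 = ((Num.sqrt t)^-1) ^+ 2 by rewrite exprVn sqr_sqrtr// ltW.
  move=> H; rewrite ler_pXn2r ?nnegrE ?modulus_ge0//; apply: H zr => w wr.
  have w1 : modulus w < 1 by rewrite wr.
  have wp : w != p by apply: contraTneq pr => <-; rewrite wr ltxx.
  rewrite gE// /g0 modulusf_div -[leRHS]mul1r; apply: ler_pM; rewrite ?invr_ge0 ?modulus_ge0//.
    by apply: phd_le1 => //; exact: f1.
  rewrite lef_pV2 ?posrE ?sqrtr_gt0// ?modulus_gt0 ?blaschke_neq0//.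
  rewrite -(@ler_pXn2r _ 2) ?nnegrE ?sqrtr_ge0 ?modulus_ge0// (sqr_sqrtr (ltW t0)).
  exact: phd_circle_ge (ltW r0) r1 wr.
rewrite leNgt; apply/negP => gz1.
have c0 : 0 < 4 / (1 - modulus p) by rewrite divr_gt0// subr_gt0.
have gz2 : 1 < modulus (g z) ^+ 2 by rewrite exprn_egt1.
set G := modulus (g z) ^+ 2 in key gz2; set c := 4 / _ in key c0.
pose m := Num.max (modulus z) (modulus p).
have m1 : m < 1 by rewrite gt_max z1.
have zm : modulus z <= m by rewrite le_max lexx.
have pm : modulus p <= m by rewrite le_max lexx orbT.
have m0 : 0 <= m by exact: le_trans (modulus_ge0 z) zm.
(* the distance [e] to the unit circle leaves [z] and [p] inside the circle of radius
   [1 - e] and makes the bound on that circle less than [G] *)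
pose e := Num.min ((1 - m) / 2) ((1 - G^-1) / (2 * c)).
have Gi : G^-1 < 1 by rewrite invf_lt1// (lt_trans _ gz2).
have e0 : 0 < e by rewrite lt_min !divr_gt0 ?subr_gt0// mulr_gt0.
have em : e <= (1 - m) / 2 by rewrite /e ge_min lexx.
have ec : c * e <= (1 - G^-1) / 2.
  apply: (@le_trans _ _ (c * ((1 - G^-1) / (2 * c)))).
    by rewrite (ler_pM2l c0) /e ge_min lexx orbT.
  have fieldE (x y : R) : 0 < x -> x * (y / (2 * x)) = y / 2.
      by move=> x0; field; rewrite gt_eqF.
    by rewrite (fieldE _ _ c0).
have := key (1 - e); rewrite subKr.
have t0 : G^-1 < 1 - c * e by lra.
have Gi0 : 0 < G^-1 by rewrite invr_gt0 (lt_trans _ gz2).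
have -> : 0 < 1 - e by lra.
have -> : modulus z <= 1 - e by lra.
have -> : modulus p < 1 - e by lra.
have -> : 1 - e < 1 by lra.
have t1 : 0 < 1 - c * e by lra.
rewrite t1 => /(_ isT isT isT isT isT); apply/negP; rewrite -ltNge.
by rewrite invf_plt ?posrE// (lt_trans ltr01 gz2).
Unshelve. all: by end_near. Qed.

End schwarz_pick.

(** * Schwarz-Pick, Harnack and the hyperbolic distance *)

Section hyperbolic.
Variable R : realType.
Implicit Types (z w p q a b c : cplane R).

Definition self_map (f : cplane R -> cplane R) : Prop :=
  (forall z, modulus z < 1 -> derivable f z 1) /\
  (forall z, modulus z < 1 -> modulus (f z) < 1).

Lemma phd_contract_off (f : cplane R -> cplane R) (S : seq (cplane R)) p z :
  (forall z, modulus z < 1 -> {for z, continuous f}) ->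
  (forall z, modulus z < 1 -> z \notin S -> derivable f z 1) ->
  (forall z, modulus z < 1 -> modulus (f z) <= 1) ->
  modulus p < 1 -> p \notin S -> modulus (f p) < 1 -> modulus z < 1 ->
  phd (f p) (f z) <= phd p z.
Proof.
move=> cf df f1 p1 pS fp1 z1.
have [g [_ _ g1 gB]] := blaschke_quotient cf df f1 p1 pS fp1.
by rewrite /phd gB// modulusM ler_piMl ?modulus_ge0// g1.
Qed.

Lemma self_map_continuous f z : self_map f -> modulus z < 1 -> {for z, continuous f}.
Proof. by move=> [df _] z1; apply: derivable_continuous; exact: df. Qed.

Lemma schwarz_pick f p z : self_map f -> modulus p < 1 -> modulus z < 1 ->
  phd (f p) (f z) <= phd p z.
Proof.
move=> sf p1 z1.
apply: (@phd_contract_off f [::]); [| | |exact: p1|by []|exact: sf.2|exact: z1].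
- by move=> w w1; exact: self_map_continuous.
- by move=> w w1 _; exact: sf.1.
- by move=> w w1; apply: ltW; exact: sf.2.
Qed.

(** The constant is uniform in [a] and [b]: a hyperbolic ball of fixed radius
    stays at comparable distances from the unit circle. *)
Lemma phd_modulus_le a b (k : R) : modulus a < 1 -> modulus b < 1 -> phd a b <= k -> k < 1 ->
  1 - modulus a <= 4 / (1 - k ^+ 2) * (1 - modulus b).
Proof.
move=> a1 b1 abk k1; have := one_sub_phd2 a1 (ltW b1).
have k0 := le_trans (phd_ge0 a b) abk.
have kk : 0 < 1 - k ^+ 2 by rewrite subr_gt0 exprn_ilt1.
have : phd a b ^+ 2 <= k ^+ 2 by rewrite ler_pXn2r ?nnegrE ?phd_ge0.
have := modulus_sub1_ge a b; have := modulus_sub1_gt0 a1 (ltW b1).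
move: (modulus_ge0 a) (modulus_ge0 b).
set x := modulus a in a1 *; set y := modulus b in b1 *; set t := modulus (1 - _).
move=> x0 y0 t0 tge dk E.
rewrite mulrAC ler_pdivlMr//.
have s0 : 0 < 1 - x by rewrite subr_gt0.
rewrite -(ler_pM2r s0).
have K : (1 - k ^+ 2) * t ^+ 2 <= (1 - x ^+ 2) * (1 - y ^+ 2).
  by rewrite -ler_pdivlMr ?exprn_gt0//; lra.
have T : (1 - x) ^+ 2 <= t ^+ 2.
  rewrite ler_pXn2r ?nnegrE ?(ltW s0) ?(ltW t0)//; apply: le_trans tge.
  by rewrite lerD2l lerN2 ler_piMr// ltW.
have K1 : (1 - k ^+ 2) * (1 - x) ^+ 2 <= (1 - k ^+ 2) * t ^+ 2 by rewrite ler_pM2l.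
have K2 : (1 - x ^+ 2) * (1 - y ^+ 2) <= 4 * (1 - y) * (1 - x).
  have -> : (1 - x ^+ 2) * (1 - y ^+ 2) = (1 + x) * (1 + y) * ((1 - y) * (1 - x)) by ring.
  rewrite -[leRHS]mulrA ler_wpM2r//.
    by rewrite mulr_ge0 ?subr_ge0 ?(ltW a1) ?(ltW b1).
  have -> : 4 = 2 * 2 :> R by ring.
  by apply: ler_pM; lra.
have -> : (1 - x) * (1 - k ^+ 2) * (1 - x) = (1 - k ^+ 2) * (1 - x) ^+ 2 by ring.
lra.
Qed.

(** The relative loss of pseudo-hyperbolic distance under [f]; it is zero for
    automorphisms of the disk. *)
Definition defect (f : cplane R -> cplane R) p q : R := 1 - phd (f p) (f q) / phd p q.

Lemma defectC f p q : defect f p q = defect f q p.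
Proof. by rewrite /defect phdC [phd p q]phdC. Qed.

Lemma defect_ge0 f p q : self_map f -> modulus p < 1 -> modulus q < 1 -> p != q -> 0 <= defect f p q.
Proof.
move=> sf p1 q1 pq; rewrite subr_ge0 ler_pdivrMr ?phd_gt0// mul1r; exact: schwarz_pick.
Qed.

(** As a function of [q], the defect is [1 - |g q|] for the quotient [g] of
    Blaschke factors, which is again a contraction of the disk. Points [q] and
    [q'] at bounded distance have images under [g] at bounded distance, hence at
    comparable distances from the unit circle. Since [g] might take values on the
    circle, the argument is applied to [(1 - t) * g] with [t] tending to 0. *)
Lemma defect_harnack f p q q' (k : R) : self_map f -> modulus p < 1 -> modulus q < 1 ->
  modulus q' < 1 -> q != p -> q' != p -> phd q q' <= k -> k < 1 ->
  defect f p q <= 4 / (1 - k ^+ 2) * defect f p q'.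
Proof.
move=> sf p1 q1 q'1 qp q'p qk k1.
have [|||g [cg dg g1 gB]] := @blaschke_quotient R f [::] p _ _ _ p1 isT (sf.2 p p1).
- by move=> w w1; exact: self_map_continuous.
- by move=> w w1 _; exact: sf.1.
- by move=> w w1; apply: ltW; exact: sf.2.
have dE r : modulus r < 1 -> r != p -> defect f p r = 1 - modulus (g r).
  move=> r1 rp; rewrite /defect /phd gB// modulusM mulfK// modulus_eq0.
  exact: blaschke_neq0.
rewrite !dE//.
have kk : 0 < 1 - k ^+ 2.
  by rewrite subr_gt0 exprn_ilt1// (le_trans (phd_ge0 q q')).
set C := 4 / _; have C0 : 0 < C by rewrite divr_gt0.
apply/ler_addgt0Pr => e e0.
pose t := Num.min (e / C) (1 / 2).
have t0 : 0 < t by rewrite lt_min !divr_gt0.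
have t1 : t <= 1 / 2 by rewrite /t ge_min lexx orbT.
have tC : C * t <= e.
  by rewrite mulrC -ler_pdivlMr// /t ge_min lexx.
pose h z : cplane R := Complex (1 - t) 0 * g z.
have hE z : modulus (h z) = (1 - t) * modulus (g z).
  by rewrite modulusM (modulus_real (1 - t)) ger0_norm//; lra.
have h1 z : modulus z < 1 -> modulus (h z) < 1.
  move=> z1; rewrite hE; have := g1 _ z1; have := modulus_ge0 (g z); nra.
(* the second division: [h] is differentiable off [p] only *)
have : phd (h q') (h q) <= phd q' q.
  have ch z : modulus z < 1 -> {for z, continuous h}.
    by move=> z1; apply: ccontinuousM; [exact: ccontinuous_cst|exact: cg].
  have dh z : modulus z < 1 -> z \notin [:: p] -> derivable h z 1.
    by move=> z1 zp; apply: cderivableM; [exact: cderivable_cst|exact: dg].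
  have q'S : q' \notin [:: p] by rewrite inE.
  have h1' z : modulus z < 1 -> modulus (h z) <= 1 by move=> z1; exact: ltW (h1 z z1).
  exact: (@phd_contract_off h [:: p] q' q ch dh h1' q'1 q'S (h1 _ q'1) q1).
rewrite phdC [phd q' q]phdC => /le_trans /(_ qk) K.
have := phd_modulus_le (h1 _ q1) (h1 _ q'1) K k1; rewrite -/C !hE.
have := g1 _ q1; have := g1 _ q'1; have := modulus_ge0 (g q); have := modulus_ge0 (g q').
move: (modulus (g q)) (modulus (g q')) => x y y0 x0 y1 x1 H.
have : t * x >= 0 by rewrite mulr_ge0// ltW.
have : C * t * y <= C * t * 1 by rewrite ler_wpM2l// mulr_ge0 ?ltW.
lra.
Qed.

(** Moving [b] to the origin reduces the triangle inequality to that of three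
    points with 0 in the middle. *)
Lemma phd_blaschke a b c : modulus a < 1 -> modulus b < 1 -> modulus c < 1 ->
  phd (blaschke b a) (blaschke b c) = phd a c.
Proof.
move=> a1 b1 c1; rewrite !phdE.
have ba := sub1_neq0 b1 (ltW a1); have bc := sub1_neq0 b1 (ltW c1).
have ab := sub1_neq0 a1 (ltW b1).
have bb := sub1_neq0 b1 (ltW b1).
have E1 : blaschke b a - blaschke b c = (a - c) * (1 - conjc b * b) / ((1 - conjc b * a) * (1 - conjc b * c)).
  by rewrite /blaschke; field; rewrite ba bc.
have cba : conjc (1 - conjc b * a) = 1 - conjc a * b.
  by rewrite rmorphB rmorph1 rmorphM /= conjcK mulrC.
have E2 : 1 - conjc (blaschke b a) * blaschke b c =
   (1 - conjc a * c) * (1 - conjc b * b) / ((1 - conjc a * b) * (1 - conjc b * c)).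
  rewrite /blaschke rmorphM /= (fmorphV (@conjc R)) /= cba rmorphB /=.
  by field; rewrite ab bc.
rewrite E1 E2 !modulusf_div !modulusM.
rewrite -[modulus (1 - conjc a * b)]modulusJ.
have -> : conjc (1 - conjc a * b) = 1 - conjc b * a.
  by rewrite rmorphB rmorph1 rmorphM /= conjcK mulrC.
have := sub1_neq0 a1 (ltW c1); move: ba bc bb; rewrite -!modulus_eq0.
move: (modulus (1 - _ * a)) (modulus (1 - _ * b)) (modulus (1 - conjc b * c)) (modulus (1 - conjc a * c)).
by move=> x y t s x0 y0 t0 s0; field; rewrite x0 y0 t0 s0.
Qed.

Lemma phd_triangle a b c : modulus a < 1 -> modulus b < 1 -> modulus c < 1 ->
  phd a c <= (phd a b + phd b c) / (1 + phd a b * phd b c).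
Proof.
move=> a1 b1 c1; rewrite -(phd_blaschke a1 b1 c1) [phd a b]phdC.
have x1 : phd b a < 1 by exact: phd_lt1.
have y1 : phd b c < 1 by exact: phd_lt1.
have := one_sub_phd2 x1 (ltW y1).
have := modulus_sub1_gt0 x1 (ltW y1).
have : modulus (1 - conjc (blaschke b a) * blaschke b c) <= 1 + phd b a * phd b c.
  by rewrite (le_trans (modulusB _ _))// modulus1 modulusM modulusJ.
have := phd_ge0 (blaschke b a) (blaschke b c).
have x0 : 0 <= phd b a by exact: phd_ge0.
have y0 : 0 <= phd b c by exact: phd_ge0.
rewrite -/(phd b a) -/(phd b c).
move: (phd (blaschke _ _) _) (modulus _) (phd b a) (phd b c) x0 y0 x1 y1 => d t x y x0 y0 x1 y1 d0 tle t0 E.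
have xy : 0 < 1 + x * y by rewrite ltr_wpDr// mulr_ge0.
rewrite -(@ler_pXn2r _ 2) ?nnegrE// ?divr_ge0 ?addr_ge0 ?mulr_ge0//.
rewrite exprMn exprVn ler_pdivlMr ?exprn_gt0//.
have t2 : t ^+ 2 <= (1 + x * y) ^+ 2 by rewrite ler_pXn2r ?nnegrE ?(ltW t0) ?(ltW xy).
have dd : 0 <= 1 - d ^+ 2.
  by rewrite E divr_ge0 ?sqr_ge0// mulr_ge0// subr_ge0 exprn_ile1// ltW.
have E' : (1 - d ^+ 2) * t ^+ 2 = (1 - x ^+ 2) * (1 - y ^+ 2).
  by rewrite E divfK// expf_neq0// gt_eqF.
have : (1 - d ^+ 2) * t ^+ 2 <= (1 - d ^+ 2) * (1 + x * y) ^+ 2 by rewrite ler_wpM2l.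
rewrite E'; nra.
Qed.

Lemma phd_triangle_le a b c : modulus a < 1 -> modulus b < 1 -> modulus c < 1 ->
  phd a c <= phd a b + phd b c.
Proof.
move=> a1 b1 c1; apply: (le_trans (phd_triangle a1 b1 c1)).
have x0 := phd_ge0 a b; have y0 := phd_ge0 b c.
have xy : 0 <= phd a b * phd b c by rewrite mulr_ge0.
by rewrite ler_pdivrMr ?ltr_wpDr// ler_peMr ?addr_ge0// lerDl.
Qed.

(** The addition formula of the hyperbolic tangent: radii compose as
    [(k + l) / (1 + k * l)], which stays below 1. *)
Lemma phd_triangle_radius a b c (k l : R) : modulus a < 1 -> modulus b < 1 -> modulus c < 1 ->
  phd a b <= k -> phd b c <= l -> k < 1 -> l < 1 -> phd a c <= (k + l) / (1 + k * l).
Proof.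
move=> a1 b1 c1 abk bcl k1 l1; apply: (le_trans (phd_triangle a1 b1 c1)).
have x0 := phd_ge0 a b; have y0 := phd_ge0 b c.
move: (phd a b) (phd b c) x0 y0 abk bcl => x y x0 y0 xk yl.
have k0 := le_trans x0 xk; have l0 := le_trans y0 yl.
have xy : 0 <= x * y by rewrite mulr_ge0.
have kl : 0 <= k * l by rewrite mulr_ge0.
rewrite ler_pdivrMr ?ltr_wpDr// mulrAC ler_pdivlMr ?ltr_wpDr//.
have -> : (k + l) * (1 + x * y) = (x + y) * (1 + k * l) + ((k - x) * (1 - l * y) + (l - y) * (1 - k * x)) by ring.
rewrite lerDl addr_ge0// mulr_ge0 ?subr_ge0//; first by nra.
by nra.
Qed.

Lemma radius_lt1 (k l : R) : 0 <= k -> 0 <= l -> k < 1 -> l < 1 -> (k + l) / (1 + k * l) < 1.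
Proof.
move=> k0 l0 k1 l1; have kl : 0 <= k * l by rewrite mulr_ge0.
rewrite ltr_pdivrMr ?ltr_wpDr// mul1r; nra.
Qed.

(** A hyperbolic ball of fixed radius has Euclidean size comparable to the
    distance of its centre from the unit circle. *)
Lemma phd_dist_le w w' (k : R) : modulus w < 1 -> modulus w' < 1 -> phd w w' <= k -> k < 1 ->
  modulus (w - w') <= 2 * k / (1 - k) * (1 - modulus w).
Proof.
move=> w1 w'1; rewrite phdE.
have s0 := modulus_sub1_gt0 w1 (ltW w'1); rewrite ler_pdivrMr// => H k1.
have k0 : 0 <= k.
  by have := le_trans (modulus_ge0 _) H; rewrite pmulr_lge0.
have : modulus (1 - conjc w * w') <= (1 - modulus w ^+ 2) + modulus w * modulus (w - w').
  have -> : 1 - conjc w * w' = (1 - conjc w * w) + conjc w * (w - w') by ring.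
  rewrite (le_trans (modulusD _ _))// modulusM modulusJ lerD2r.
  have -> : 1 - conjc w * w = Complex (1 - modulus w ^+ 2) 0 :> cplane R.
    rewrite sqr_modulus; case: w {w1 s0 H} => a b; apply/eqP; rewrite eq_complex /=.
    by apply/andP; split; apply/eqP; ring.
  rewrite (modulus_real (1 - modulus w ^+ 2)) ger0_norm// subr_ge0 exprn_ile1 ?modulus_ge0//.
  exact: ltW.
move=> H2; rewrite mulrAC ler_pdivlMr ?subr_gt0//.
have m0 := modulus_ge0 (w - w'); have w0 := modulus_ge0 w.
move: (modulus (w - w')) (modulus w) (modulus (1 - _)) w1 w0 m0 s0 H H2 => m x s x1 x0 m0 s0 H H2.
have A1 : k * s <= k * ((1 - x ^+ 2) + x * m) by rewrite ler_wpM2l.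
have A2 : k * (x * m) <= k * m by rewrite ler_wpM2l// ler_piMl// ltW.
have A3 : k * (1 - x ^+ 2) <= k * (2 * (1 - x)) by rewrite ler_wpM2l//; nra.
lra.
Qed.

Lemma phd_ge_dist p q : modulus p < 1 -> modulus q < 1 -> modulus (p - q) / 2 <= phd p q.
Proof.
move=> p1 q1; rewrite phdE ler_wpM2l ?modulus_ge0// lef_pV2 ?posrE ?modulus_sub1_gt0//.
  rewrite (le_trans (modulusB _ _))// modulus1 modulusM modulusJ.
  have := modulus_ge0 p; have := modulus_ge0 q; nra.
exact: ltW.
Qed.

Lemma phd_le_dist p q : modulus p < 1 -> modulus q < 1 -> phd p q * (1 - modulus p) <= modulus (p - q).
Proof.
move=> p1 q1; rewrite phdE mulrAC ler_pdivrMr ?modulus_sub1_gt0 ?(ltW q1)//.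
rewrite ler_wpM2l ?modulus_ge0//; apply: le_trans (modulus_sub1_ge p q).
by rewrite lerD2l lerN2 ler_piMr ?modulus_ge0// ltW.
Qed.

Lemma hyp_distE z w : hyp_dist z w = artanh (phd z w).
Proof. by rewrite /hyp_dist phdE modulusf_div. Qed.

Lemma artanh_le (x y : R) : 0 <= x -> x <= y -> y < 1 -> artanh x <= artanh y.
Proof.
move=> x0 xy y1; have x1 := le_lt_trans xy y1; have y0 := le_trans x0 xy.
rewrite /artanh ler_pM2r ?invr_gt0// ler_ln ?posrE ?divr_gt0 ?subr_gt0//; try lra.
by rewrite ler_pdivrMr ?subr_gt0// mulrAC ler_pdivlMr ?subr_gt0//; nra.
Qed.

Lemma artanh_ge0 (x : R) : 0 <= x -> x < 1 -> 0 <= artanh x.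
Proof.
move=> x0 x1; rewrite (le_trans _ (artanh_le (lexx 0) x0 x1))//.
by rewrite /artanh subr0 addr0 divr1 ln1 mul0r.
Qed.

Lemma artanh_add (x y : R) : 0 <= x -> x < 1 -> 0 <= y -> y < 1 ->
  artanh ((x + y) / (1 + x * y)) = artanh x + artanh y.
Proof.
move=> x0 x1 y0 y1; rewrite /artanh -mulrDl -lnM ?posrE ?divr_gt0 ?subr_gt0//; try lra.
congr (ln _ / 2); have xy : 0 <= x * y by rewrite mulr_ge0.
by field; apply/and4P; split; apply: lt0r_neq0; nra.
Qed.

Lemma hyp_dist_ge0 z w : modulus z < 1 -> modulus w < 1 -> 0 <= hyp_dist z w.
Proof. by move=> z1 w1; rewrite hyp_distE artanh_ge0 ?phd_ge0 ?phd_lt1. Qed.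

Lemma hyp_dist_triangle a b c : modulus a < 1 -> modulus b < 1 -> modulus c < 1 ->
  hyp_dist a c <= hyp_dist a b + hyp_dist b c.
Proof.
move=> a1 b1 c1; rewrite !hyp_distE -artanh_add ?phd_ge0 ?phd_lt1//.
apply: artanh_le; rewrite ?phd_ge0// ?phd_triangle// radius_lt1 ?phd_ge0 ?phd_lt1//.
Qed.

Lemma hyp_dist_contract f z w : self_map f -> modulus z < 1 -> modulus w < 1 ->
  hyp_dist (f z) (f w) <= hyp_dist z w.
Proof.
by move=> sf z1 w1; rewrite !hyp_distE artanh_le ?phd_ge0 ?schwarz_pick ?phd_lt1.
Qed.

Lemma hyp_dist0 w : hyp_dist 0 w = artanh (modulus w).
Proof.
by rewrite hyp_distE phdE sub0r modulusN -[0]/(0 : cplane R) conjc0 mul0r subr0 modulus1 divr1.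
Qed.

Lemma ln_bdist_le w : modulus w < 1 ->
  - ln (1 - modulus w) <= 2 * hyp_dist 0 w <= ln 2 - ln (1 - modulus w).
Proof.
move=> w1; have w0 := modulus_ge0 w; rewrite hyp_dist0 /artanh mulrC divfK//.
have h0 : 0 < 1 - modulus w by rewrite subr_gt0.
rewrite ln_div ?posrE//; last lra.
rewrite lerDr lerD2r; apply/andP; split; first by rewrite ln_ge0; lra.
by rewrite ler_ln ?posrE; lra.
Qed.

End hyperbolic.

Lemma radius_ge (R : realType) (k l : R) : 0 <= k -> k <= 1 -> 0 <= l ->
  k <= (k + l) / (1 + k * l).
Proof.
move=> k0 k1 l0; have kl : 0 <= k * l by rewrite mulr_ge0.
rewrite ler_pdivlMr ?ltr_wpDr// mulrDr mulr1 lerD2l mulrA ler_piMl//.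
by rewrite mulr_ile1.
Qed.

(** * Uniform control of the semigroup for bounded times *)

Section semigroup.
Variables (R : realType) (phi : R -> cplane R -> cplane R).
Hypothesis sgphi : holomorphic_semigroup phi.
Implicit Types (z w p q : cplane R) (t s u k : R).

Lemma semigroup_self_map t : 0 <= t -> self_map (phi t).
Proof.
case: sgphi => hol dis _ _ _ t0; split => z z1.
  by apply: hol => //; rewrite unit_diskE.
by have := dis t z t0; rewrite !unit_diskE; exact.
Qed.

Lemma semigroup_lt1 t z : 0 <= t -> modulus z < 1 -> modulus (phi t z) < 1.
Proof. by move=> /semigroup_self_map[_]; exact. Qed.

Lemma semigroup0 z : modulus z < 1 -> phi 0 z = z.
Proof. by case: sgphi => _ _ id0 _ _ z1; apply: id0; rewrite unit_diskE. Qed.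

Lemma semigroupD t s z : 0 <= t -> 0 <= s -> modulus z < 1 -> phi (t + s) z = phi t (phi s z).
Proof. by case: sgphi => _ _ _ D _ t0 s0 z1; apply: D => //; rewrite unit_diskE. Qed.

Lemma semigroup_unif (r e : R) : r < 1 -> 0 < e -> exists2 t1 : R, 0 < t1 &
  forall t z, 0 <= t <= t1 -> modulus z <= r -> modulus (phi t z - z) < e.
Proof.
case: (sgphi) => _ _ _ _ U r1 e0.
have := U _ (@compact_closed_disk R r).
have sub : [set z | modulus z <= r] `<=` @unit_disk R.
  by move=> z /= zr; rewrite unit_diskE (le_lt_trans zr).
have ec0 : 0 < (e%:C)%C by rewrite ltcR.
move=> /(_ sub) /(_ [set h | forall z, modulus z <= r -> modulus (h z - z) < e]) [].
  apply/uniform_nbhs; exists [set xy | ball xy.1 (e%:C)%C xy.2].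
  split; first exact: (@entourage_ball _ _ (PosNum ec0)).
  move=> h H z zr; have := H z zr.
  by rewrite -ball_normE /= normC_modulus ltcR modulusBC.
move=> t1 /= t10 H; exists (t1 / 2); first by rewrite divr_gt0.
move=> t z /andP[t0 tt1] zr; move: t0; rewrite le_eqVlt => /predU1P[<-|t0].
  by rewrite semigroup0 ?(le_lt_trans zr)// subrr modulus0.
apply: (H t) => //; rewrite /= sub0r normrN gtr0_norm//; lra.
Qed.

Section base_point.
Variable z0 : cplane R.
Hypothesis z01 : modulus z0 < 1.

Lemma phd_ball_modulus k : k < 1 -> exists2 r : R, 0 <= r < 1 &
  forall p, modulus p < 1 -> phd z0 p <= k -> modulus p <= r.
Proof.
move=> k1; have [k0|k0] := ltP k 0.
  by exists 0 => [|p p1 /(le_trans (phd_ge0 _ _))]; rewrite ?lexx ?ltr01// leNgt k0.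
pose C := 4 / (1 - k ^+ 2).
have kk : 0 < 1 - k ^+ 2 by rewrite subr_gt0 exprn_ilt1.
have C1 : 1 <= C by rewrite ler_pdivlMr// mul1r; have := sqr_ge0 k; lra.
have C0 : 0 < C by apply: lt_le_trans C1.
have zz : 0 < 1 - modulus z0 by rewrite subr_gt0.
exists (1 - (1 - modulus z0) / C).
  rewrite subr_ge0 ler_pdivrMr// mul1r gtrBl divr_gt0//.
  by have := modulus_ge0 z0; lra.
move=> p p1 pk; rewrite lerBrDr -lerBrDl ler_pdivrMr// mulrC.
exact: phd_modulus_le.
Qed.

Lemma phd_small w w' : modulus w < 1 -> modulus w' < 1 ->
  phd w w' <= modulus (w' - w) / (1 - modulus w).
Proof.
by move=> w1 w'1; rewrite ler_pdivlMr ?subr_gt0// modulusBC phd_le_dist.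
Qed.

(** Hyperbolic balls around [z0] are relatively compact in the disk, so the
    uniform convergence to the identity applies to them. *)
Lemma semigroup_phd_unif k (e : R) : k < 1 -> 0 < e -> exists2 t1 : R, 0 < t1 &
  forall t p, 0 <= t <= t1 -> modulus p < 1 -> phd z0 p <= k -> phd p (phi t p) <= e.
Proof.
move=> k1 e0; have [r /andP[r0 r1] H] := phd_ball_modulus k1.
have r10 : 0 < 1 - r by rewrite subr_gt0.
have [t1 t10 {}Ht] := @semigroup_unif r (e * (1 - r)) r1 (mulr_gt0 e0 r10).
exists t1 => // t p t01 p1 pk; have pr := H p p1 pk.
have t0 : 0 <= t by case/andP: t01.
apply: (le_trans (phd_small p1 (semigroup_lt1 t0 p1))).
rewrite ler_pdivrMr ?subr_gt0//; apply: (le_trans (ltW (Ht _ _ t01 pr))).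
by rewrite ler_pM2l// lerD2l lerN2.
Qed.

(** A bounded time is a bounded number of short steps, each of bounded length by
    Schwarz-Pick. *)
Lemma semigroup_radius T : 0 <= T -> exists2 k : R, 0 <= k < 1 &
  forall t, 0 <= t <= T -> phd z0 (phi t z0) <= k.
Proof.
move=> T0; have h2 : 0 < 1 / 2 :> R by rewrite divr_gt0.
have [|t1 t10 Ht] := @semigroup_phd_unif 0 (1 / 2) _ h2; first exact: ltr01.
have {}Ht t : 0 <= t <= t1 -> phd z0 (phi t z0) <= 1 / 2.
  by move=> tt; apply: Ht => //; rewrite phdxx.
have step n : exists2 k : R, 0 <= k < 1 & forall t, 0 <= t <= n%:R * t1 -> phd z0 (phi t z0) <= k.
  elim: n => [|n [k /andP[k0 k1] IH]].
    exists 0; first by rewrite lexx ltr01.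
    by move=> t; rewrite mul0r -eq_le => /eqP <-; rewrite semigroup0// phdxx.
  exists ((k + 1 / 2) / (1 + k * (1 / 2))).
    rewrite radius_lt1//; last lra.
    by rewrite andbT divr_ge0//; lra.
  move=> t; rewrite -natr1 mulrDl mul1r => /andP[t0 tn].
  have [tt|tt] := leP t (n%:R * t1).
    have := IH t; rewrite t0 tt => /(_ isT) /le_trans; apply.
    rewrite ler_pdivlMr; nra.
  pose s := t - n%:R * t1.
  have s0 : 0 <= s by rewrite subr_ge0 ltW.
  have ss : s <= t1 by rewrite lerBlDr addrC.
  have n0 : 0 <= n%:R * t1 by rewrite mulr_ge0// ltW.
  have -> : t = n%:R * t1 + s by rewrite /s addrC subrK.
  rewrite semigroupD//; apply: (@phd_triangle_radius _ _ (phi (n%:R * t1) z0)) => //.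
  - exact: semigroup_lt1.
  - by do 2 apply: semigroup_lt1 => //.
  - by apply: IH; rewrite lexx andbT.
  - apply: le_trans (Ht s _); last by rewrite s0.
    by apply: schwarz_pick => //; [exact: semigroup_self_map|exact: semigroup_lt1].
  - lra.
have [k kk H] := step (Num.truncn (T / t1)).+1; exists k => // t /andP[t0 tT].
apply: H; rewrite t0 (le_trans tT)// -ler_pdivrMr// ltW// truncnS_gt//.
Qed.

Lemma semigroup_ball_radius T k : 0 <= T -> k < 1 -> exists2 l : R, l < 1 &
  forall t p, 0 <= t <= T -> modulus p < 1 -> phd z0 p <= k -> phd z0 (phi t p) <= l.
Proof.
move=> T0 k1; have [k' /andP[k'0 k'1] H] := semigroup_radius T0.
have [k0|k0] := ltP k 0.
  by exists 0 => // t p _ p1 /(le_trans (phd_ge0 _ _)); rewrite leNgt k0.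
exists ((k' + k) / (1 + k' * k)); first exact: radius_lt1.
move=> t p tT p1 pk; have t0 : 0 <= t by case/andP: tT.
apply: (@phd_triangle_radius _ _ (phi t z0)) => //; try exact: semigroup_lt1.
  exact: H.
by apply: le_trans pk; apply: schwarz_pick => //; exact: semigroup_self_map.
Qed.

(** A second reference point, for use where [z0] itself is too close. *)
Lemma far_point : exists z1 : cplane R, modulus z1 < 1 /\ 0 < phd z0 z1.
Proof.
have [->|z00] := eqVneq z0 0.
  have h : modulus (Complex (1/2 : R) 0) = 1 / 2 by rewrite (modulus_real (1/2 : R)) ger0_norm//; lra.
  exists (Complex (1 / 2) 0); rewrite h; split; first lra.
  apply: phd_gt0; rewrite ?modulus0// ?h; first lra.
  by rewrite eq_sym -modulus_gt0 h divr_gt0.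
by exists 0; rewrite modulus0; split => //; apply: phd_gt0 => //; rewrite modulus0.
Qed.

(** For [p] in the ball, one of two fixed points [z0], [z1] is far from [p]; at
    that point the defect is small since [phi t] moves both points little. The
    Harnack inequality for the defect passes to all [q] of the ball, however close
    to [p]. *)
Lemma semigroup_half_isometry k : k < 1 -> exists2 t1 : R, 0 < t1 &
  forall t p q, 0 <= t <= t1 -> modulus p < 1 -> modulus q < 1 -> phd z0 p <= k -> phd z0 q <= k ->
  1 / 2 * phd p q <= phd (phi t p) (phi t q).
Proof.
move=> k1; have [k0|k0] := ltP k 0.
  by exists 1 => // t p q _ p1 _ /(le_trans (phd_ge0 _ _)); rewrite leNgt k0.
have [z1 [z11 d0]] := far_point; set d := phd z0 z1 in d0.
have d1 : d < 1 by exact: phd_lt1.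
pose l := (k + d) / (1 + k * d); have l1 : l < 1 by rewrite radius_lt1// ltW.
have kl : k <= l by rewrite radius_ge// ltW.
pose C := 4 / (1 - l ^+ 2).
have l0 : 0 <= l by exact: le_trans kl.
have C0 : 0 < C by rewrite divr_gt0// subr_gt0 exprn_ilt1.
(* the points [p] and [i] are moved by at most [e] and are [d / 2] apart, so the defect
   is at most [4 * e / d], and [C * (4 * e / d)] is [1 / 2] *)
pose e := d / (8 * C).
have e0 : 0 < e by rewrite divr_gt0// mulr_gt0.
have K1 : Num.max k d < 1 by rewrite gt_max k1.
have [t1 t10 Ht] := semigroup_phd_unif K1 e0.
exists t1 => // t p q tt p1 q1 pk qk.
have t0 : 0 <= t by case/andP: tt.
have sf := semigroup_self_map t0.
have [->|pq] := eqVneq p q; first by rewrite !phdxx mulr0.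
have Hp := Ht t p tt p1; rewrite le_max pk in Hp; have {}Hp := Hp isT.
have far i : (i = z0 \/ i = z1) -> d / 2 <= phd p i -> 1 / 2 * phd p q <= phd (phi t p) (phi t q).
  move=> iz di.
  have i1 : modulus i < 1 by case: iz => ->.
  have ip : i != p by apply: contraTneq di => ->; rewrite phdxx -ltNge divr_gt0.
  have Hi : phd i (phi t i) <= e.
    by apply: Ht => //; rewrite le_max; case: iz => ->; rewrite ?phdxx ?k0 ?lexx ?orbT.
  have qi : phd q i <= l.
    case: iz => ->; first by rewrite phdC (le_trans qk).
    by apply: (@phd_triangle_radius _ _ z0) => //; rewrite phdC.
  have := defect_harnack sf p1 q1 i1 _ ip qi l1; rewrite eq_sym pq -/C => /(_ isT).
  have pi0 : 0 < phd p i by apply: lt_le_trans di; rewrite divr_gt0.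
  have E : defect (phi t) p i <= 4 * e / d.
    rewrite /defect -[X in X - _](mulfV (lt0r_neq0 pi0)) -mulrBl ler_pdivrMr//.
    have T1 : phd p i <= phd p (phi t p) + (phd (phi t p) (phi t i) + phd (phi t i) i).
      apply: le_trans (phd_triangle_le p1 (sf.2 _ p1) i1) _.
      by rewrite lerD2l phd_triangle_le//; exact: sf.2.
    rewrite [phd (phi t i) i]phdC in T1.
    apply: (@le_trans _ _ (2 * e)); first lra.
    have -> : 2 * e = 4 * e / d * (d / 2) by field; rewrite gt_eqF.
    by rewrite ler_pM2l// divr_gt0// mulr_gt0.
  have CE : C * (4 * e / d) = 1 / 2.
    by rewrite /e; field; rewrite !gt_eqF// subr_gt0 exprn_ilt1.
  move=> H; have : defect (phi t) p q <= 1 / 2.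
    by apply: (le_trans H); rewrite -CE ler_pM2l.
  have pq0 : 0 < phd p q by exact: phd_gt0.
  rewrite /defect lerBlDr -lerBlDl => H2.
  rewrite -ler_pdivlMr//; lra.
have [dp|dp] := leP (d / 2) (phd p z0); first by apply: (far z0) => //; left.
apply: (far z1); first by right.
have := phd_triangle_le z01 p1 z11; rewrite [phd z0 p]phdC -/d; lra.
Qed.

(** The time [T] is cut into steps short enough that each of them at most halves
    the pseudo-hyperbolic distance. *)
Lemma semigroup_coarse_isometry T k : 0 <= T -> k < 1 -> exists2 c : R, 0 < c &
  forall t p q, 0 <= t <= T -> modulus p < 1 -> modulus q < 1 -> phd z0 p <= k -> phd z0 q <= k ->
  c * phd p q <= phd (phi t p) (phi t q).
Proof.
move=> T0 k1; have [l l1 Hl] := semigroup_ball_radius T0 k1.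
have [t1 t10 Ht] := semigroup_half_isometry l1.
pose n := (Num.truncn (T / t1)).+1.
exists ((1 / 2) ^+ n); first by rewrite exprn_gt0// divr_gt0.
move=> t p q /andP[t0 tT] p1 q1 pk qk.
pose s := t / n%:R.
have s0 : 0 <= s by rewrite divr_ge0.
have st1 : s <= t1.
  rewrite /s ler_pdivrMr// mulrC -ler_pdivrMr// (le_trans _ (ltW (truncnS_gt _)))//.
  by rewrite ler_pM2r ?invr_gt0.
have key m : (m <= n)%N -> (1 / 2) ^+ m * phd p q <= phd (phi (m%:R * s) p) (phi (m%:R * s) q).
  elim: m => [|m IH] mn; first by rewrite expr0 !mul0r mul1r !semigroup0.
  have m0 : 0 <= m%:R * s by rewrite mulr_ge0.
  have ms : 0 <= m%:R * s <= T.
    rewrite m0 (le_trans _ tT)// /s mulrCA ler_piMr//.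
    by rewrite ler_pdivrMr// mul1r ler_nat ltnW.
  have -> : m.+1%:R * s = s + m%:R * s by rewrite -natr1 mulrDl mul1r addrC.
  rewrite !semigroupD// exprS -mulrA.
  apply: le_trans (_ : 1 / 2 * phd (phi (m%:R * s) p) (phi (m%:R * s) q) <= _).
    by rewrite ler_pM2l ?divr_gt0// IH// ltnW.
  by apply: Ht; rewrite ?s0 ?st1 ?semigroup_lt1// Hl.
have := key n (leqnn n).
by have -> : n%:R * s = t by rewrite /s mulrC divfK// pnatr_eq0.
Qed.

End base_point.
End semigroup.

(** * Contraction along a non-elliptic semigroup is subexponential *)

Section rigidity.
Variables (R : realType) (phi : R -> cplane R -> cplane R).
Hypothesis sgphi : holomorphic_semigroup phi.
Hypothesis nephi : non_elliptic phi.
Variable z0 : cplane R.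
Hypothesis z01 : modulus z0 < 1.
Implicit Types (z w p q : cplane R) (t s u k : R).

Local Notation sg_lt1 := (semigroup_lt1 sgphi).
Local Notation sg_map := (semigroup_self_map sgphi).

(** Non-ellipticity enters through this lemma alone: orbits leave every compact
    subset of the disk. *)
Lemma orbit_modulus z (r : R) : modulus z < 1 -> r < 1 -> exists2 T : R, 0 <= T &
  forall t, T <= t -> r <= modulus (phi t z).
Proof.
move=> z1 r1; case: nephi => tau [tau1 H].
have {}tau1 : modulus tau = 1.
  by apply/eqP; rewrite -(inj_eq (@complexI R)) -normC_modulus tau1.
have r0 : 0 < 1 - r by rewrite subr_gt0.
have /(cvg_modulusP (@proper_pinfty_nbhs R) (phi ^~ z)) /(_ _ r0) : phi t z @[t --> +oo] --> tau.
  by apply: H; rewrite unit_diskE.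
case=> M [_ HM]; exists (Num.max 0 (M + 1)); first by rewrite le_max lexx.
move=> t; rewrite ge_max => /andP[_ Mt].
have := HM t; rewrite /= => /(_ (lt_le_trans _ Mt)); rewrite ltrDl => /(_ ltr01).
by have := modulusB_ge tau (phi t z); rewrite modulusBC tau1; lra.
Qed.

Let a t := phd (phi t z0) (phi (t + 1) z0).

Let a_ge0 t : 0 <= a t. Proof. exact: phd_ge0. Qed.

Lemma phd_orbit_le t s u : 0 <= t -> 0 <= s -> 0 <= u ->
  phd (phi (t + s) z0) (phi (t + s + u) z0) <= phd (phi t z0) (phi (t + u) z0).
Proof.
move=> t0 s0 u0; have -> : t + s + u = s + (t + u) by ring.
rewrite [t + s]addrC (semigroupD sgphi s0 t0 z01) (semigroupD sgphi s0 (addr_ge0 t0 u0) z01).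
by apply: schwarz_pick; [exact: sg_map|exact: sg_lt1|exact: sg_lt1 (addr_ge0 t0 u0) z01].
Qed.

Let a_nincr t s : 0 <= t -> t <= s -> a s <= a t.
Proof.
move=> t0 ts; have -> : s = t + (s - t) by rewrite subrKC.
by apply: phd_orbit_le => //; rewrite subr_ge0.
Qed.

Lemma phd_orbit_far t : 0 <= t -> exists m : nat, 1 / 2 <= phd (phi t z0) (phi (t + m%:R) z0).
Proof.
move=> t0; set p := phi t z0; have p1 : modulus p < 1 by exact: sg_lt1.
have p0 : 0 < 1 - modulus p by rewrite subr_gt0.
pose r := 1 - (1 - modulus p) / 8.
have r1 : r < 1 by rewrite /r gtrBl divr_gt0.
have [T T0 HT] := orbit_modulus z01 r1.
exists (Num.truncn T).+1; set q := phi _ _.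
have q1 : modulus q < 1 by rewrite sg_lt1// addr_ge0.
have rq : r <= modulus q.
  by apply: HT; rewrite (le_trans (ltW (truncnS_gt T)))// lerDr.
have := phd_circle_ge p1 (modulus_ge0 q) q1 erefl.
have : 4 / (1 - modulus p) * (1 - modulus q) <= 1 / 2.
  rewrite mulrAC ler_pdivrMr//; move: rq; rewrite /r; lra.
have := phd_ge0 p q; nra.
Qed.

(** The steps [a t = phd (phi t z0) (phi (t + 1) z0)] do not increase with [t]. If
    they stay away from 0, they converge to a positive limit, and the ratio of
    consecutive steps tends to 1: the next point of the orbit is the wanted [q].
    If they tend to 0, the orbit is followed until it is first at distance at
    least [1 / 2] from its starting point, which happens since it leaves every
    hyperbolic ball; [phi 1] moves both end points of that stretch very little
    compared with their distance. *)
Lemma small_defect : exists2 k : R, k < 1 & forall e : R, 0 < e -> exists2 N : R, 0 <= N &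
  forall t, N <= t -> exists q, [/\ modulus q < 1, q != phi t z0, phd (phi t z0) q <= k &
    defect (phi 1) (phi t z0) q <= e].
Proof.
have w1 t : 0 <= t -> modulus (phi t z0) < 1 by move=> t0; exact: sg_lt1.
have phi1 t : 0 <= t -> phi 1 (phi t z0) = phi (t + 1) z0.
  by move=> t0; rewrite addrC semigroupD.
have [[al al0 Hal]|noal] := pselect (exists2 al : R, 0 < al & forall t, 0 <= t -> al <= a t).
  exists (a 0); first by apply: phd_lt1; apply: w1; rewrite ?add0r.
  move=> e e0; pose A := [set a t | t in [set t | 0 <= t]].
  have infA : has_inf A.
    split; first by exists (a 0), 0 => //=.
    by exists 0 => _ [t t0 <-].
  have ea : 0 < e * al by rewrite mulr_gt0.
  have [_ [N /= N0 <-] HN] := inf_adherent ea infA.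
  exists N => // t Nt; have t0 := le_trans N0 Nt.
  have at0 : 0 < a t by apply: lt_le_trans (Hal _ t0).
  exists (phi (t + 1) z0); split.
  - by apply: w1; rewrite addr_ge0.
  - by apply: contraTneq at0 => E; rewrite /a E phdxx ltxx.
  - exact: (a_nincr (lexx 0) t0).
  rewrite /defect !phi1 ?addr_ge0// -/(a t) -/(a (t + 1)).
  have := a_nincr N0 Nt.
  have : inf A <= a (t + 1).
    by apply: ge_inf; [exact: infA.2|exists (t + 1) => //=; rewrite addr_ge0].
  rewrite -[X in X - _](mulfV (lt0r_neq0 at0)) -mulrBl ler_pdivrMr//.
  have : e * al <= e * a t by rewrite ler_pM2l// Hal.
  lra.
exists (3 / 4); first lra.
move=> e e0; pose d := Num.min (1 / 4) (e / 4).
have d0 : 0 < d by rewrite lt_min !divr_gt0.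
have d4 : d <= 1 / 4 by rewrite /d ge_min lexx.
have de : d <= e / 4 by rewrite /d ge_min lexx orbT.
have [N N0 HN] : exists2 N : R, 0 <= N & a N < d.
  apply: contrapT => noN; apply: noal; exists d => // t t0.
  by rewrite leNgt; apply/negP => atd; apply: noN; exists t.
exists N => // t Nt; have t0 := le_trans N0 Nt.
have atd s : t <= s -> a s < d.
  by move=> ts; apply: le_lt_trans HN; apply: a_nincr => //; exact: le_trans ts.
have ex := phd_orbit_far t0.
(* the first time at which the orbit is far: just before, it was within [1 / 2], and
   the last step is short, so that the distance is at most [3 / 4] *)
pose m := ex_minn ex; have : m = ex_minn ex by [].
case: ex_minnP => m' Hm' minm' _.
have m'0 : (0 < m')%N.
  by case: m' Hm' {minm'} => //; rewrite addr0 phdxx; lra.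
set q := phi (t + m'%:R) z0 in Hm'.
have tm : 0 <= t + m'%:R by rewrite addr_ge0.
have q1 : modulus q < 1 by exact: w1.
exists q; split => //.
- by apply: contraTneq Hm' => ->; rewrite phdxx -ltNge; lra.
- pose q' := phi (t + m'.-1%:R) z0.
  have tm1 : 0 <= t + m'.-1%:R by rewrite addr_ge0.
  have Hq' : phd (phi t z0) q' < 1 / 2.
    by rewrite ltNge; apply/negP => /minm'; rewrite leqNgt ltn_predL m'0.
  have E : q = phi (t + m'.-1%:R + 1) z0 by rewrite /q -addrA natr1 prednK.
  have := phd_triangle_le (w1 _ t0) (w1 _ tm1) q1.
  have : phd q' q < d by rewrite E; apply: atd; rewrite lerDl.
  by rewrite -/q'; lra.
have pos : 0 < phd (phi t z0) q by apply: lt_le_trans Hm'; rewrite divr_gt0.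
rewrite /defect -[X in X - _](mulfV (lt0r_neq0 pos)) -mulrBl ler_pdivrMr//.
have f1 : modulus (phi 1 (phi t z0)) < 1 by apply: sg_lt1 => //; exact: w1.
have f2 : modulus (phi 1 q) < 1 by exact: sg_lt1.
have := phd_triangle_le (w1 _ t0) f1 q1; have := phd_triangle_le f1 f2 q1.
have : phd (phi t z0) (phi 1 (phi t z0)) < d by rewrite phi1//; exact: atd.
have : phd (phi 1 q) q < d by rewrite phdC /q phi1//; apply: atd; rewrite lerDl.
have : e * (1 / 2) <= e * phd (phi t z0) q by rewrite ler_pM2l.
lra.
Qed.

(** Two applications of the Harnack inequality replace the special pair
    [phi t z0], [q] by [phi t p], [q] and then by [phi t p], [phi t q]; the distances
    between the points exchanged are bounded by Schwarz-Pick. *)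
Lemma uniform_small_defect k (e : R) : k < 1 -> 0 < e -> exists2 N : R, 0 <= N &
  forall t p q, N <= t -> modulus p < 1 -> modulus q < 1 -> phd z0 p <= k -> phd z0 q <= k ->
  phi t p != phi t q -> defect (phi 1) (phi t p) (phi t q) <= e.
Proof.
move=> k1 e0; have [k0|k0] := ltP k 0.
  by exists 0 => // t p q _ p1 _ /(le_trans (phd_ge0 _ _)); rewrite leNgt k0.
have [l l1 Hl] := small_defect.
have [l0|l0] := ltP l 0.
  have [N N0 HN] := Hl e e0; have [q [_ _ +  _]] := HN N (lexx N).
  by move=> /(le_trans (phd_ge0 _ _)); rewrite leNgt l0.
pose m := (k + l) / (1 + k * l); have m1 : m < 1 by exact: radius_lt1.
have m0 : 0 <= m by apply: le_trans (radius_ge k0 (ltW k1) l0).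
pose C1 := 4 / (1 - m ^+ 2); pose C2 := 4 / (1 - k ^+ 2).
have C10 : 0 < C1 by rewrite divr_gt0// subr_gt0 exprn_ilt1.
have C20 : 0 < C2 by rewrite divr_gt0// subr_gt0 exprn_ilt1.
have C11 : 1 <= C1.
  by rewrite ler_pdivlMr ?subr_gt0 ?exprn_ilt1// mul1r; have := sqr_ge0 m; lra.
have CC : 0 < C1 * C2 by rewrite mulr_gt0.
have [N N0 HN] := Hl _ (divr_gt0 e0 CC).
exists N => // t p q Nt p1 q1 pk qk pq; have t0 := le_trans N0 Nt.
have [q' [q'1 q'w wq' Hd]] := HN t Nt.
set P := phi t p in pq *; set Q := phi t q in pq *; set w := phi t z0 in q'w wq' Hd.
have P1 : modulus P < 1 by exact: sg_lt1.
have Q1 : modulus Q < 1 by exact: sg_lt1.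
have w1 : modulus w < 1 by exact: sg_lt1.
have Pw : phd P w <= k.
  by rewrite phdC (le_trans _ pk)//; apply: schwarz_pick => //; exact: sg_map.
have Qw : phd Q w <= k.
  by rewrite phdC (le_trans _ qk)//; apply: schwarz_pick => //; exact: sg_map.
have sf := sg_map (ler01 : 0 <= 1 :> R).
have fin : C1 * (C2 * defect (phi 1) q' w) <= e.
  by rewrite mulrA mulrC -ler_pdivlMr// defectC.
have d0 : 0 <= defect (phi 1) q' w by exact: defect_ge0.
have [Pq'|Pq'] := eqVneq P q'.
  apply: le_trans fin; apply: (@le_trans _ _ (C2 * defect (phi 1) q' w)).
    rewrite Pq'; apply: defect_harnack => //.
      by rewrite -Pq' eq_sym.
    by rewrite eq_sym.
  by rewrite ler_peMl// mulr_ge0// ltW.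
apply: le_trans fin; apply: (@le_trans _ _ (C1 * defect (phi 1) P q')).
  apply: defect_harnack => //; rewrite 1?eq_sym//.
  exact: (phd_triangle_radius Q1 w1 q'1).
rewrite ler_pM2l// defectC; apply: defect_harnack => //.
by rewrite eq_sym.
Qed.

(** After the time [N] of the previous lemma every unit of time costs at most a
    factor [expR (- eta)]; the initial stretch of time costs a constant. *)
Lemma subexponential_contraction k (eta : R) : k < 1 -> 0 < eta -> exists2 c : R, 0 < c &
  forall u p q, 0 <= u -> modulus p < 1 -> modulus q < 1 -> phd z0 p <= k -> phd z0 q <= k ->
  c * expR (- eta * u) * phd p q <= phd (phi u p) (phi u q).
Proof.
move=> k1 eta0; have e0 : 0 < 1 - expR (- eta) by rewrite subr_gt0 expR_lt1// oppr_lt0.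
have [N N0 HN] := uniform_small_defect k1 e0.
have [c c0 Hc] := semigroup_coarse_isometry sgphi z01 (addr_ge0 N0 ler01) k1.
exists c => // u p q u0 p1 q1 pk qk.
have step (j : nat) s : N <= s -> s <= N + 1 ->
    c * expR (- eta * j%:R) * phd p q <= phd (phi (s + j%:R) p) (phi (s + j%:R) q).
  move=> Ns sN; have s0 := le_trans N0 Ns; elim: j => [|j IH].
    by rewrite mulr0 expR0 mulr1 addr0; apply: Hc; rewrite ?s0.
  have sj : 0 <= s + j%:R by rewrite addr_ge0.
  have -> : s + j.+1%:R = 1 + (s + j%:R) by rewrite -natr1 addrA addrC.
  have o1 : 0 <= 1 :> R by exact: ler01.
  rewrite (semigroupD sgphi o1 sj p1) (semigroupD sgphi o1 sj q1).
  set P := phi (s + j%:R) p in IH *; set Q := phi (s + j%:R) q in IH *.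
  apply: (@le_trans _ _ (expR (- eta) * phd P Q)).
    rewrite -natr1 mulrDr mulr1 expRD.
    have H : expR (- eta) * (c * expR (- eta * j%:R) * phd p q) <= expR (- eta) * phd P Q.
      by rewrite ler_pM2l ?expR_gt0.
    by apply: le_trans H; rewrite le_eqVlt; apply/orP; left; apply/eqP; ring.
  have [->|PQ] := eqVneq P Q; first by rewrite !phdxx mulr0.
  have := HN (s + j%:R) p q; rewrite -/P -/Q => /(_ _ p1 q1 pk qk PQ).
  rewrite (le_trans Ns) ?lerDl// => /(_ isT).
  have PQ0 : 0 < phd P Q by rewrite phd_gt0 ?sg_lt1.
  by rewrite /defect lerD2l lerN2 ler_pdivlMr.
have [uN|uN] := leP u N.
  apply: le_trans (Hc u p q _ p1 q1 pk qk); last by rewrite u0 (le_trans uN)// lerDl.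
  rewrite -mulrA ler_pM2l// ler_piMl ?phd_ge0// -expR0 ler_expR.
  by rewrite mulNr oppr_le0 mulr_ge0// ltW.
pose j := Num.truncn (u - N).
have uN0 : 0 <= u - N by rewrite subr_ge0 ltW.
have := truncn_itv uN0; rewrite -/j => /andP[j1 j2].
have := step j (u - j%:R); rewrite subrK => /(_ _ _)/(le_trans _); apply.
- rewrite -!mulrA ler_pM2l// ler_wpM2r ?phd_ge0// ler_expR !mulNr lerN2 ler_pM2l//.
  lra.
- lra.
- by move: j2; rewrite -natr1; lra.
Qed.

End rigidity.

(** * Hyperbolic step and displacement of an orbit *)

Section divergence_rate.
Variables (R : realType) (phi : R -> cplane R -> cplane R).
Hypothesis sgphi : holomorphic_semigroup phi.
Variable z0 : cplane R.
Hypothesis z01 : modulus z0 < 1.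
Implicit Types (t s u v r : R).

Definition displacement u : R := hyp_dist z0 (phi u z0).

Let orbit_lt1 t : 0 <= t -> modulus (phi t z0) < 1.
Proof. by move=> t0; exact: semigroup_lt1. Qed.

Lemma displacement_ge0 u : 0 <= u -> 0 <= displacement u.
Proof. by move=> u0; apply: hyp_dist_ge0 => //; exact: orbit_lt1. Qed.

Lemma orbit_dist_le t s u : 0 <= t -> 0 <= s -> 0 <= u ->
  hyp_dist (phi (t + s) z0) (phi (t + s + u) z0) <= hyp_dist (phi t z0) (phi (t + u) z0).
Proof.
move=> t0 s0 u0; have -> : t + s + u = s + (t + u) by ring.
have tu0 := addr_ge0 t0 u0.
rewrite [t + s]addrC (semigroupD sgphi s0 t0 z01) (semigroupD sgphi s0 tu0 z01).
apply: hyp_dist_contract; [exact: semigroup_self_map|exact: orbit_lt1|exact: orbit_lt1].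
Qed.

Lemma orbit_dist_le_displacement t u : 0 <= t -> 0 <= u ->
  hyp_dist (phi t z0) (phi (t + u) z0) <= displacement u.
Proof.
move=> t0 u0; have := orbit_dist_le (lexx 0) t0 u0.
by rewrite !add0r semigroup0.
Qed.

(** Schwarz-Pick: the orbit of [phi u z0] follows that of [z0]. *)
Lemma displacement_subadditive u v : 0 <= u -> 0 <= v ->
  displacement (u + v) <= displacement u + displacement v.
Proof.
move=> u0 v0; apply: le_trans (_ : displacement u + hyp_dist (phi u z0) (phi (u + v) z0) <= _).
  by apply: hyp_dist_triangle => //; apply: orbit_lt1; rewrite ?addr_ge0.
by rewrite lerD2l orbit_dist_le_displacement.
Qed.

Lemma displacement_bounded T : 0 <= T -> exists2 M : R, 0 <= M &
  forall t, 0 <= t <= T -> displacement t <= M.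
Proof.
move=> T0; have [k /andP[k0 k1] H] := semigroup_radius sgphi z01 T0.
exists (artanh k); first exact: artanh_ge0.
by move=> t tT; rewrite /displacement hyp_distE artanh_le ?phd_ge0 ?H.
Qed.

Lemma displacementMn n v r : 0 <= v -> 0 <= r ->
  displacement (n%:R * v + r) <= n%:R * displacement v + displacement r.
Proof.
move=> v0 r0; elim: n => [|n IH]; first by rewrite !mul0r !add0r.
have -> : n.+1%:R * v + r = v + (n%:R * v + r) by rewrite -natr1; ring.
have nv : 0 <= n%:R * v + r by rewrite addr_ge0// mulr_ge0.
apply: (le_trans (displacement_subadditive v0 nv)).
have -> : n.+1%:R * displacement v + displacement r =
  displacement v + (n%:R * displacement v + displacement r) by rewrite -natr1; ring.
by rewrite lerD2l.
Qed.

(** Subadditive limit lemma of Fekete: [displacement u / u] tends to its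
    infimum. *)
Lemma displacement_rate : exists c : R, (forall u, 1 <= u -> c * u <= displacement u) /\
  forall e : R, 0 < e -> exists2 U : R, 1 <= U & forall u, U <= u -> displacement u <= (c + e) * u.
Proof.
pose A := [set displacement u / u | u in [set u : R | 1 <= u]].
have infA : has_inf A.
  split; first by exists (displacement 1 / 1), 1 => /=.
  exists 0 => _ [u /= u1 <-]; have u0 : 0 <= u by apply: le_trans u1.
  by rewrite divr_ge0// displacement_ge0.
exists (inf A); split=> [u u1|e e0].
  have u0 : 0 < u by apply: lt_le_trans u1.
  by rewrite -ler_pdivlMr//; apply: ge_inf; [exact: infA.2|exists u].
have e2 : 0 < e / 2 by rewrite divr_gt0.
have [_ [v /= v1 <-] Hv] := inf_adherent e2 infA.
have v0 : 0 < v by apply: lt_le_trans v1.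
have [M M0 HM] := displacement_bounded (ltW v0).
have MU : 0 <= M / (e / 2) by rewrite divr_ge0// ltW.
exists (1 + M / (e / 2)); first by rewrite lerDl.
move=> u Uu; have u1 : 1 <= u by rewrite (le_trans _ Uu)// lerDl.
have u0 : 0 < u by apply: lt_le_trans u1.
pose n := Num.truncn (u / v).
have uv0 : 0 <= u / v by rewrite divr_ge0// ltW.
have := truncn_itv uv0; rewrite -/n => /andP[n1 n2].
move: n1 n2; rewrite ler_pdivlMr// ltr_pdivrMr// -natr1 => n1 n2.
pose r := u - n%:R * v.
have r0 : 0 <= r by rewrite subr_ge0.
have rv : r <= v by rewrite /r; lra.
have -> : displacement u = displacement (n%:R * v + r) by rewrite /r subrKC.
apply: (le_trans (displacementMn n (ltW v0) r0)).
have Mr : displacement r <= M by apply: HM; rewrite r0.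
have Me : M <= e / 2 * u.
  by rewrite mulrC -ler_pdivrMr// (le_trans _ Uu)// lerDr.
have Dv : displacement v <= (inf A + e / 2) * v by rewrite -ler_pdivrMr// ltW.
have : n%:R * displacement v <= (inf A + e / 2) * u.
  apply: (@le_trans _ _ (displacement v / v * (n%:R * v))).
    by rewrite mulrA mulrAC divfK ?gt_eqF// mulrC.
  apply: ler_pM => //; [|by rewrite mulr_ge0// ltW|exact: ltW].
  by rewrite divr_ge0 ?(ltW v0)// displacement_ge0// ltW.
have -> : (inf A + e) * u = (inf A + e / 2) * u + e / 2 * u by field.
lra.
Qed.

Lemma displacement_linear : exists2 M : R, 0 < M & forall u, 1 <= u -> displacement u <= M * u.
Proof.
have [M M0 HM] := displacement_bounded (ler01 : 0 <= 1 :> R).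
exists (2 * M + 1); first by rewrite ltr_wpDl// mulr_ge0.
move=> u u1; have u0 : 0 <= u by apply: le_trans u1.
have := truncn_itv u0; set n := Num.truncn u => /andP[n1]; rewrite -natr1 => n2.
have -> : u = n%:R * 1 + (u - n%:R) by rewrite mulr1 subrKC.
have r0 : 0 <= u - n%:R by rewrite subr_ge0.
apply: (le_trans (displacementMn n ler01 r0)).
rewrite mulr1 subrKC.
have D1 : displacement 1 <= M by apply: HM; rewrite ler01 lexx.
have Dr : displacement (u - n%:R) <= M by apply: HM; rewrite r0/=; lra.
have : n%:R * displacement 1 <= u * M by apply: ler_pM => //; rewrite displacement_ge0.
have : M <= u * M by rewrite ler_peMl.
lra.
Qed.

(** By Schwarz-Pick the distance between two points of the orbit at fixed time
    lag does not increase, so its limit is its infimum. *)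
Lemma hyp_step_inf u : 0 <= u ->
  let A := [set hyp_dist (phi r z0) (phi (r + u) z0) | r in [set r | 0 <= r]] in
  has_inf A /\ hyp_step phi u z0 = inf A.
Proof.
move=> u0 A.
have infA : has_inf A.
  split; first by exists (hyp_dist (phi 0 z0) (phi (0 + u) z0)), 0 => /=.
  exists 0 => _ [r /= r0 <-]; apply: hyp_dist_ge0; apply: orbit_lt1 => //.
  by rewrite addr_ge0.
split => //; apply: cvg_lim => //; apply/cvgrPdist_lt => e e0.
have [_ [r /= r0 <-] Hr] := inf_adherent e0 infA.
exists r; split; first exact: num_real.
move=> s rs; have s0 : 0 <= s by rewrite ltW// (le_lt_trans r0).
have : inf A <= hyp_dist (phi s z0) (phi (s + u) z0).
  by apply: ge_inf; [exact: infA.2|exists s].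
have : hyp_dist (phi s z0) (phi (s + u) z0) <= hyp_dist (phi r z0) (phi (r + u) z0).
  have := @orbit_dist_le r (s - r) u r0 _ u0; rewrite subrKC; apply.
  by rewrite subr_ge0 ltW.
by move=> h1 h2; rewrite distrC ger0_norm ?subr_ge0//; lra.
Qed.

Lemma hyp_step_le_displacement u : 0 <= u -> hyp_step phi u z0 <= displacement u.
Proof.
move=> u0; have [infA ->] := hyp_step_inf u0.
apply: ge_inf; first exact: infA.2.
by exists 0 => //=; rewrite add0r semigroup0.
Qed.

(** After the time [r] the orbit advances by at most the same distance in each
    of the [n] intervals of length [u]. *)
Lemma displacement_chain r u n : 0 <= r -> 0 <= u ->
  displacement (r + n%:R * u) <= displacement r + n%:R * hyp_dist (phi r z0) (phi (r + u) z0).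
Proof.
move=> r0 u0; elim: n => [|n IH]; first by rewrite !mul0r !addr0.
have nu : 0 <= n%:R * u by rewrite mulr_ge0.
have -> : r + n.+1%:R * u = r + n%:R * u + u by rewrite -natr1; ring.
set h := hyp_dist (phi r z0) (phi (r + u) z0) in IH *.
have -> : displacement r + n.+1%:R * h = (displacement r + n%:R * h) + h by rewrite -natr1; ring.
apply: le_trans (_ : displacement (r + n%:R * u) +
  hyp_dist (phi (r + n%:R * u) z0) (phi (r + n%:R * u + u) z0) <= _).
  by apply: hyp_dist_triangle => //; apply: orbit_lt1; rewrite ?addr_ge0.
by rewrite lerD// orbit_dist_le.
Qed.

(** The bound is obtained by dividing the inequality of the chain of [n] steps by
    [n] and letting [n] grow: the initial displacement disappears. *)
Lemma rate_le_hyp_step (c : R) u : (forall v, 1 <= v -> c * v <= displacement v) -> 1 <= u ->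
  c * u <= hyp_step phi u z0.
Proof.
move=> Hc u1; have u0 : 0 <= u by apply: le_trans u1.
have [infA ->] := hyp_step_inf u0.
apply: lb_le_inf; first exact: infA.1.
move=> _ [r /= r0 <-]; set h := hyp_dist _ _.
have D0 := displacement_ge0 r0.
apply/ler_addgt0Pr => e e0.
pose K := displacement r + `|c| * r.
have K0 : 0 <= K by rewrite addr_ge0// mulr_ge0.
pose n := (Num.truncn (K / e)).+1.
have nK : K <= e * n%:R by rewrite mulrC -ler_pdivrMr// ltW// truncnS_gt.
have n0 : 0 < n%:R :> R by [].
have n1 : 1 <= n%:R :> R by rewrite ler1n.
have := displacement_chain n r0 u0; rewrite -/h => H.
have := Hc (r + n%:R * u); rewrite (le_trans u1); last first.
  by rewrite (le_trans (ler_peMl u0 n1))// lerDr.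
move=> /(_ isT) /le_trans /(_ H) H2.
have cr : - (`|c| * r) <= c * r.
  by rewrite -mulNr ler_wpM2r// lerNl; rewrite -normrN ler_norm.
rewrite -(ler_pM2l n0) mulrDr; move: H2; rewrite mulrDr mulrCA; move: nK; rewrite /K [e * _]mulrC.
lra.
Qed.

Lemma hyp_step_displacement (e : R) : 0 < e -> exists2 U : R, 1 <= U & forall u, U <= u ->
  `|hyp_step phi u z0 - displacement u| <= e * u.
Proof.
move=> e0; have [c [c1 c2]] := displacement_rate; have [U U1 HU] := c2 e e0.
exists U => // u Uu; have u1 := le_trans U1 Uu.
have u0 : 0 <= u by apply: le_trans u1.
have := hyp_step_le_displacement u0; have := rate_le_hyp_step c1 u1; have := HU u Uu.
by move=> h1 h2 h3; rewrite distrC ger0_norm ?subr_ge0//; lra.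
Qed.

End divergence_rate.

(** * Plane integrals under affine maps *)

Section plane_integral.
Variable R : realType.
Local Notation mu := (@lebesgue_measure R).
Implicit Types (F : R * R -> \bar R) (f : R -> \bar R).
Local Open Scope ereal_scope.

Lemma measurable_affine (k m : R) : measurable_fun [set: R] (fun x : R => k * x + m)%R.
Proof. by apply: measurable_funD => //; exact: measurable_funM. Qed.

Lemma affine_preimage_oc (k m a b : R) : (a < b)%R -> k != 0%R ->
  mu ((fun x : R => k * x + m)%R @^-1` `]a, b]) = ((b - a) / `|k|)%:E.
Proof.
move=> ab k0; have [kn|kp] := ltP k 0%R.
  have -> : (fun x : R => k * x + m)%R @^-1` `]a, b] = `[((b - m) / k)%R, ((a - m) / k)%R[%classic.
    apply/seteqP; split=> x /=; rewrite !in_itv /= ler_ndivrMr// ltr_ndivlMr// [(x * k)%R]mulrC.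
      by move=> /andP[h1 h2]; apply/andP; split; lra.
    by move=> /andP[h1 h2]; apply/andP; split; lra.
  rewrite lebesgue_measure_itv /= lte_fin ltr_ndivrMr// divfK// ltrD2r ab.
  by rewrite -EFinB ltr0_norm//; congr EFin; field.
have {kp}k0' : (0 < k)%R by rewrite lt_neqAle eq_sym k0.
have -> : (fun x : R => k * x + m)%R @^-1` `]a, b] = `]((a - m) / k)%R, ((b - m) / k)%R]%classic.
  apply/seteqP; split=> x /=; rewrite !in_itv /= ler_pdivlMr// ltr_pdivrMr// [(x * k)%R]mulrC.
    by move=> /andP[h1 h2]; apply/andP; split; lra.
  by move=> /andP[h1 h2]; apply/andP; split; lra.
rewrite lebesgue_measure_itv /= lte_fin ltr_pdivrMr// divfK// ltrD2r ab.
by rewrite -EFinB gtr0_norm//; congr EFin; field.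
Qed.

(** Change of variables on the line, from the uniqueness of the Lebesgue
    measure on intervals. *)
Lemma integral_affine (k m : R) f : k != 0%R -> measurable_fun setT f -> (forall x, 0 <= f x) ->
  \int[mu]_x f (k * x + m)%R = (`|k|^-1)%:E * \int[mu]_x f x.
Proof.
move=> k0 mf f0; have maff := measurable_affine k m.
have kn0 : (0 < `|k|)%R by rewrite normr_gt0.
pose aff : R -> measurableTypeR R := fun x => (k * x + m)%R.
have E : \int[mu]_x f x = \int[mscale (NngNum (ltW kn0)) (pushforward mu aff)]_x f x.
  move=> maff'; apply: eq_measure_integral => A mA _.
  apply: lebesgue_measure_unique => //= _ [[a b] /= ab] <-.
  rewrite /mscale /= /pushforward; have [lt_ab|ba] := ltP a b; last first.
    by rewrite set_itv_ge ?bnd_simp -?leNgt// preimage_set0 !measure0 mule0.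
  rewrite affine_preimage_oc// -EFinM mulrC divfK ?gt_eqF//.
  by rewrite lebesgue_measure_itv /= lte_fin lt_ab -EFinB.
rewrite (E maff) ge0_integral_mscale//= ge0_integral_pushforward//= muleA -EFinM.
by rewrite mulVf ?gt_eqF// mul1e.
Qed.

(** The plane integral in iterated form, in which changes of one variable at a
    time can be carried out. *)
Definition I2 F : \bar R := \int[mu]_x \int[mu]_y F (x, y).

Definition nneg_meas F := measurable_fun setT F /\ forall p, 0 <= F p.

Lemma I2_swap F : nneg_meas F -> I2 F = \int[mu]_y \int[mu]_x F (x, y).
Proof. by move=> [mF F0]; exact: fubini_tonelli. Qed.

Lemma I2_prod F : nneg_meas F -> \int[mu \x mu]_p F p = I2 F.
Proof. by move=> [mF F0]; exact: fubini_tonelli1. Qed.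

Lemma nneg_meas_comp F (h : R * R -> R * R) : nneg_meas F -> measurable_fun setT h ->
  nneg_meas (F \o h).
Proof. by move=> [mF F0] mh; split => [|p]; [exact: measurableT_comp|exact: F0]. Qed.

Lemma nneg_meas_inner F : nneg_meas F -> measurable_fun setT (fun x => \int[mu]_y F (x, y)).
Proof. by move=> [mF F0]; exact: (@measurable_fun_fubini_tonelli_F _ _ _ _ R mu F mF F0). Qed.

Lemma I2_affine F (k m k' m' : R) : k != 0%R -> k' != 0%R -> nneg_meas F ->
  I2 (fun p => F (k * p.1 + m, k' * p.2 + m')%R) = (`|k * k'|^-1)%:E * I2 F.
Proof.
move=> k0 k'0 nF; rewrite /I2 /=; have [mF F0] := nF.
have mi := nneg_meas_inner nF.
have i0 x : 0 <= \int[mu]_y F (x, y) by apply: integral_ge0.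
under eq_integral => x _.
  rewrite (integral_affine m' k'0 (f := fun y => F ((k * x + m)%R, y))); last 2 first.
  - exact: measurable_fun_pair2.
  - by [].
  over.
have mc : measurable_fun setT (fun x : R => \int[mu]_y F ((k * x + m)%R, y)).
  exact: (measurableT_comp mi (measurable_affine k m)).
have k'i : 0 <= (`|k'|^-1)%:E by rewrite lee_fin invr_ge0.
rewrite (ge0_integralZl mu measurableT mc (fun x _ => i0 _) k'i).
rewrite (integral_affine m k0 mi i0) muleA -EFinM normrM invfM mulrC.
by rewrite [(`|k|^-1 * _)%R]mulrC.
Qed.

Lemma I2_shear2 F (k : R) : nneg_meas F -> I2 (fun p => F (p.1, p.2 + k * p.1)%R) = I2 F.
Proof.
move=> [mF F0]; apply: eq_integral => x _ /=.
have := @integral_affine 1 (k * x) (fun y => F (x, y)) (oner_neq0 _).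
rewrite normr1 invr1 mul1e => <- //; last exact: measurable_fun_pair2.
by apply: eq_integral => y _; rewrite mul1r.
Qed.

Lemma measurable_swap_pair : measurable_fun [set: R * R] (fun p : R * R => (p.2, p.1)).
Proof. by apply: measurable_fun_pair; [exact: measurable_snd|exact: measurable_fst]. Qed.

Lemma I2_shear1 F (k : R) : nneg_meas F -> I2 (fun p => F (p.1 + k * p.2, p.2)%R) = I2 F.
Proof.
move=> nF; have [mF F0] := nF.
have nG : nneg_meas (fun p => F (p.2, p.1)) := nneg_meas_comp nF measurable_swap_pair.
rewrite (I2_swap nF) -/(I2 (fun p => F (p.2, p.1))) -(I2_shear2 k nG) /=.
rewrite I2_swap//; split=> [|//].
apply: (measurableT_comp mF); apply: measurable_fun_pair; last exact: measurable_snd.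
apply: measurable_funD; [exact: measurable_fst|apply: measurable_funM => //; exact: measurable_snd].
Qed.

Lemma measurable_shear1 (k : R) : measurable_fun [set: R * R] (fun p : R * R => (p.1 + k * p.2, p.2)%R).
Proof.
apply: measurable_fun_pair; last exact: measurable_snd.
by apply: measurable_funD; [exact: measurable_fst|apply: measurable_funM => //; exact: measurable_snd].
Qed.

Lemma measurable_shear2 (k : R) : measurable_fun [set: R * R] (fun p : R * R => (p.1, p.2 + k * p.1)%R).
Proof.
apply: measurable_fun_pair; first exact: measurable_fst.
by apply: measurable_funD; [exact: measurable_snd|apply: measurable_funM => //; exact: measurable_fst].
Qed.

(** A rotation other than the half turn is a product of three shears, each of
    which changes one variable at a time. *)
Lemma I2_rotation F (c s : R) : (c ^+ 2 + s ^+ 2 = 1)%R -> nneg_meas F ->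
  I2 (fun p => F (c * p.1 - s * p.2, s * p.1 + c * p.2)%R) = I2 F.
Proof.
move=> cs nF; have [c1|c1] := eqVneq c (-1)%R.
  have s0 : s = 0%R by apply/eqP; rewrite -sqrf_eq0; apply/eqP; move: cs; rewrite c1; lra.
  have n1 : (-1 : R)%R != 0%R by rewrite oppr_eq0 oner_neq0.
  have := I2_affine 0 0 n1 n1 nF; rewrite mulrNN mulr1 normr1 invr1 mul1e => <-.
  by congr I2; apply/funext => p; rewrite c1 s0; congr (F (_, _)); ring.
have c1' : (1 + c)%R != 0%R by rewrite addrC addr_eq0.
pose al := (- s / (1 + c))%R.
have n1 := nneg_meas_comp nF (measurable_shear1 al).
have n2 := nneg_meas_comp n1 (measurable_shear2 s).
rewrite -(I2_shear1 al nF) -(I2_shear2 s n1) -(I2_shear1 al n2) /=.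
have as1 : (1 + al * s)%R = c.
  have H : (al * s * (1 + c))%R = (- s ^+ 2)%R by rewrite mulrAC /al divfK// mulNr expr2.
  by apply: (mulIf c1'); rewrite mulrDl H; lra.
have al1 : (al * (1 + c))%R = (- s)%R by rewrite /al divfK.
congr I2; apply/funext => -[x y] /=; congr (F (_, _)).
  transitivity ((1 + al * s) * x + al * (1 + (1 + al * s)) * y)%R; last by ring.
  by rewrite as1 al1; ring.
transitivity (s * x + (1 + al * s) * y)%R; last by ring.
by rewrite as1.
Qed.

(** Affine chart of the plane centred at the boundary point [zeta], at scale [r],
    whose first axis is the inner normal of the disk. *)
Definition boundary_chart (zeta : cplane R) (r : R) (p : R * R) : cplane R :=
  (zeta * (1 - Complex (r * p.1) (r * p.2)))%R.

Definition ofC (z : cplane R) : R * R := (complex.Re z, complex.Im z).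

Lemma toCK : cancel (@ofC) (@toC R). Proof. by case. Qed.
Lemma ofCK : cancel (@toC R) ofC. Proof. by case. Qed.

Lemma ofC_boundary_chart zeta r p : ofC (boundary_chart zeta r p) =
  (let c := cRe zeta in let s := cIm zeta in
   (c * (- r * p.1 + 1) - s * (- r * p.2 + 0), s * (- r * p.1 + 1) + c * (- r * p.2 + 0)))%R.
Proof. by case: zeta p => [c s] [x y]; rewrite /ofC /=; congr pair; ring. Qed.

Lemma measurable_ofC_boundary_chart zeta r :
  measurable_fun [set: R * R] (fun p => ofC (boundary_chart zeta r p)).
Proof.
under eq_fun do rewrite ofC_boundary_chart /=.
have mf (k m : R) : measurable_fun [set: R * R] (fun p : R * R => k * p.1 + m)%R.
  by apply: (measurableT_comp (measurable_affine k m)); exact: measurable_fst.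
have ms (k m : R) : measurable_fun [set: R * R] (fun p : R * R => k * p.2 + m)%R.
  by apply: (measurableT_comp (measurable_affine k m)); exact: measurable_snd.
apply: measurable_fun_pair; [apply: measurable_funB|apply: measurable_funD]; exact: measurable_funM.
Qed.

Lemma I2_boundary_chart F (zeta : cplane R) (r : R) : modulus zeta = 1%R -> r != 0%R -> nneg_meas F ->
  I2 (fun p => F (ofC (boundary_chart zeta r p))) = (r ^- 2)%:E * I2 F.
Proof.
move=> z1 r0 nF; have cs : (cRe zeta ^+ 2 + cIm zeta ^+ 2 = 1)%R.
  by rewrite -(expr1n _ 2) -z1 /modulus; case: zeta {z1} => c s /=; rewrite sqr_sqrtr// addr_ge0 ?sqr_ge0.
under [X in I2 X]eq_fun do rewrite ofC_boundary_chart /=.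
set c := cRe zeta; set s := cIm zeta.
have nG : nneg_meas (fun p : R * R => F (c * p.1 - s * p.2, s * p.1 + c * p.2)%R).
  apply: (nneg_meas_comp nF (h := fun p : R * R => (c * p.1 - s * p.2, s * p.1 + c * p.2)%R)).
  by apply: measurable_fun_pair; [apply: measurable_funB|apply: measurable_funD];
    apply: measurable_funM => //; (exact: measurable_fst || exact: measurable_snd).
have nr0 : (- r)%R != 0%R by rewrite oppr_eq0.
have := I2_affine 1 0 nr0 nr0 nG; rewrite /= => ->.
by rewrite (I2_rotation cs nF) mulrNN -expr2 ger0_norm// sqr_ge0.
Qed.

End plane_integral.

(** * Elementary integrals *)

Section line_integrals.
Variable R : realType.
Local Notation mu := (@lebesgue_measure R).
Implicit Types (f F : R -> R).

Lemma integral_antiderivative f F (a b : R) : a < b ->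
  (forall x, a <= x <= b -> {for x, continuous f}) ->
  (forall x, a <= x <= b -> is_derive x 1 F (f x)) ->
  (\int[mu]_(x in `[a, b]) (f x)%:E = (F b - F a)%:E)%E.
Proof.
move=> ab cf dF; rewrite EFinB; apply: continuous_FTC2 => //.
- apply: continuous_in_subspaceT => x; rewrite inE /= in_itv /=; exact: cf.
- have cF x : a <= x <= b -> {for x, continuous F}.
    move=> xab; have [dx _] := dF x xab.
    by apply/differentiable_continuous; rewrite -derivable1_diffP.
  split.
  - move=> x; rewrite in_itv /= => /andP[/ltW ax /ltW xb].
    by have [] := dF x _; rewrite ?ax ?xb.
  - by apply: cvg_at_right_filter; apply: cF; rewrite lexx ltW.
  - by apply: cvg_at_left_filter; apply: cF; rewrite lexx ltW.
- move=> x; rewrite in_itv /= => /andP[/ltW ax /ltW xb].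
  by rewrite derive1E; apply: derive_val; apply: dF; rewrite ax.
Qed.

Lemma continuous_pow_inv n (x : R) : x != 0 -> {for x, continuous (fun x : R => (x ^+ n)^-1)}.
Proof.
move=> x0; apply: continuousV; first by rewrite expf_neq0.
exact: exprn_continuous.
Qed.

Lemma integral_inv (a b : R) : 0 < a -> a <= b ->
  (\int[mu]_(x in `[a, b]) (x^-1)%:E = (ln b - ln a)%:E)%E.
Proof.
move=> a0; rewrite le_eqVlt => /predU1P[<-|ab]; first by rewrite set_itv1 integral_set1 subrr.
apply: integral_antiderivative => // x /andP[ax _]; have x0 : 0 < x by apply: lt_le_trans ax.
  by apply: continuousV; [rewrite gt_eqF|exact: cvg_id].
exact: is_derive1_ln.
Qed.

Lemma integral_inv3 (a : R) : 0 < a -> a <= 1 ->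
  (\int[mu]_(x in `[a, 1%R]) ((x ^+ 3)^-1)%:E = ((a ^- 2 - 1) / 2)%:E)%E.
Proof.
move=> a0; rewrite le_eqVlt => /predU1P[->|a1].
  by rewrite set_itv1 integral_set1 expr1n invr1 subrr mul0r.
have dF x : a <= x <= 1 -> is_derive x 1 (fun x : R => - (1 / 2) *: (x ^+ 2)^-1) (x ^+ 3)^-1.
  move=> /andP[ax _]; have x0 : 0 < x by apply: lt_le_trans ax.
  have x2 : x ^+ 2 != 0 by rewrite expf_neq0// gt_eqF.
  have D1 : is_derive x 1 (fun x : R => x ^+ 2) ((2%:R * x ^+ 1) *: 1).
    exact: (is_deriveX 2 (is_derive_id x 1)).
  have D2 := is_deriveZ (- (1 / 2)) (@is_deriveV R (fun x : R => x ^+ 2) x _ 1 x2 D1).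
  apply: (is_derive_eq D2); rewrite /GRing.scale /= expr1; field.
  by rewrite gt_eqF.
have cf x : a <= x <= 1 -> {for x, continuous (fun x : R => (x ^+ 3)^-1)}.
  by move=> /andP[ax _]; apply: continuous_pow_inv; rewrite gt_eqF// (lt_le_trans a0).
rewrite (integral_antiderivative a1 cf dF).
by congr EFin; rewrite /GRing.scale /= expr1n; field; rewrite gt_eqF.
Qed.

Lemma integral_atan (T : R) : 0 < T ->
  (\int[mu]_(t in `[(- T)%R, T]) ((1 + t ^+ 2)^-1)%:E = (2 * atan T)%:E)%E.
Proof.
move=> T0; have dF (x : R) : - T <= x <= T -> is_derive x 1 (@atan R) (1 + x ^+ 2)^-1.
  by move=> _; exact: is_derive1_atan.
have cf x : - T <= x <= T -> {for x, continuous (fun t : R => (1 + t ^+ 2)^-1)}.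
  move=> _; apply: continuousV; first by rewrite gt_eqF// ltr_pwDl// sqr_ge0.
  by apply: continuousD; [exact: cvg_cst|exact: exprn_continuous].
have TT : - T < T by lra.
by rewrite (integral_antiderivative TT cf dF) atanN opprK mulr_natl.
Qed.

End line_integrals.

(** * Measurability of inverses and norms *)

Section measurability.
Context d (T : measurableType d) (R : realType).
Implicit Types (f g : T -> R).

Lemma measurable_invr : measurable_fun [set: R] (fun x : R => x^-1).
Proof.
rewrite -(setvU [set 0 : R]); apply/measurable_funU => //; first exact: measurableC.
split; last exact: measurable_fun_set1.
apply: open_continuous_measurable_fun; first by apply: closed_openC; exact: closed_eq.
by move=> x; rewrite inE /= => /eqP x0; apply: continuousV => //; exact: cvg_id.
Qed.

Lemma measurable_funV f : measurable_fun setT f -> measurable_fun setT (fun x => (f x)^-1).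
Proof. by move=> mf; exact: (measurableT_comp measurable_invr mf). Qed.

Lemma measurable_fun_div f g : measurable_fun setT f -> measurable_fun setT g ->
  measurable_fun setT (fun x => f x / g x).
Proof. by move=> mf mg; apply: measurable_funM => //; exact: measurable_funV. Qed.

Lemma measurable_fun_sqrt f : measurable_fun setT f -> measurable_fun setT (fun x => Num.sqrt (f x)).
Proof.
move=> mf; apply: (measurableT_comp (continuous_measurable_fun _) mf).
exact: sqrt_continuous.
Qed.

End measurability.

Section plane_points.
Variable R : realType.
Implicit Types (p q : R * R).

Definition pnorm p : R := modulus (toC p).

Lemma pnormE p : pnorm p = Num.sqrt (p.1 ^+ 2 + p.2 ^+ 2).
Proof. by rewrite /pnorm modulusE. Qed.

Lemma pnorm_ge0 p : 0 <= pnorm p. Proof. exact: modulus_ge0. Qed.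

Lemma toCB p q : toC (p - q) = toC p - toC q.
Proof. by case: p q => [a b] [c d]. Qed.

Lemma pnormN p : pnorm (- p) = pnorm p.
Proof. by rewrite !pnormE /= !sqrrN. Qed.

Lemma pnormB p q : pnorm (p - q) = modulus (toC p - toC q).
Proof. by rewrite /pnorm toCB. Qed.

Lemma pnormBC p q : pnorm (p - q) = pnorm (q - p).
Proof. by rewrite -pnormN opprB. Qed.

Lemma pnorm_triangle p q r : pnorm (p - q) <= pnorm (p - r) + pnorm (r - q).
Proof. by rewrite !pnormB modulus_triangle. Qed.

Lemma pnormD p q : pnorm (p + q) <= pnorm p + pnorm q.
Proof. by rewrite -[q]opprK pnormN pnormB modulusB. Qed.

Lemma pnormZ (k : R) p : pnorm (k * p.1, k * p.2) = `|k| * pnorm p.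
Proof. by rewrite !pnormE /= !exprMn -mulrDr sqrtrM ?sqr_ge0// sqrtr_sqr. Qed.

Lemma coord1_le_pnorm p : `|p.1| <= pnorm p.
Proof. exact: (Re_le_modulus (toC p)). Qed.

Lemma coord2_le_pnorm p : `|p.2| <= pnorm p.
Proof. exact: (Im_le_modulus (toC p)). Qed.

Lemma pnorm_le_coord p : pnorm p <= `|p.1| + `|p.2|.
Proof. exact: (modulus_le_ReIm (toC p)). Qed.

Lemma measurable_fun_coord1 d (T : measurableType d) (f : T -> R * R) :
  measurable_fun setT f -> measurable_fun setT (fun x => (f x).1).
Proof. by move=> mf; exact: (measurableT_comp measurable_fst mf). Qed.

Lemma measurable_fun_coord2 d (T : measurableType d) (f : T -> R * R) :
  measurable_fun setT f -> measurable_fun setT (fun x => (f x).2).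
Proof. by move=> mf; exact: (measurableT_comp measurable_snd mf). Qed.

Lemma measurable_fun_pnorm d (T : measurableType d) (f : T -> R * R) :
  measurable_fun setT f -> measurable_fun setT (fun x => pnorm (f x)).
Proof.
move=> mf; under eq_fun do rewrite pnormE; apply: measurable_fun_sqrt.
by apply: measurable_funD; apply: measurable_funX;
  [exact: measurable_fun_coord1|exact: measurable_fun_coord2].
Qed.

Lemma measurable_pnorm : measurable_fun [set: R * R] pnorm.
Proof. by apply: (@measurable_fun_pnorm _ (R * R)%type id); exact: measurable_id. Qed.

Lemma measurable_fun_pB d (T : measurableType d) (f g : T -> R * R) :
  measurable_fun setT f -> measurable_fun setT g -> measurable_fun setT (fun x => f x - g x).
Proof.
move=> mf mg; apply: measurable_fun_pair; apply: measurable_funB;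
  (exact: measurable_fun_coord1 || exact: measurable_fun_coord2).
Qed.

Lemma measurable_fun_pD d (T : measurableType d) (f g : T -> R * R) :
  measurable_fun setT f -> measurable_fun setT g -> measurable_fun setT (fun x => f x + g x).
Proof.
move=> mf mg; apply: measurable_fun_pair; apply: measurable_funD;
  (exact: measurable_fun_coord1 || exact: measurable_fun_coord2).
Qed.

Lemma I2_translate (F : R * R -> \bar R) p : nneg_meas F -> I2 (fun y => F (y - p)) = I2 F.
Proof.
move=> nF; have := I2_affine (- p.1) (- p.2) (oner_neq0 R) (oner_neq0 R) nF.
rewrite mulr1 normr1 invr1 mul1e => <-; congr I2; apply/funext => y.
by rewrite !mul1r.
Qed.

Lemma I2_le (F G : R * R -> \bar R) : nneg_meas F -> nneg_meas G ->
  (forall p, (F p <= G p)%E) -> (I2 F <= I2 G)%E.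
Proof.
move=> nF nG FG; rewrite -!I2_prod//; apply: ge0_le_integral => //.
- by move=> p _; exact: nF.2.
- exact: nF.1.
- exact: nG.1.
Qed.

Lemma I2D (F G : R * R -> \bar R) : nneg_meas F -> nneg_meas G ->
  (I2 (fun p => F p + G p) = I2 F + I2 G)%E.
Proof.
move=> nF nG; rewrite -!I2_prod//; last first.
  split; first by apply: emeasurable_funD; [exact: nF.1|exact: nG.1].
  by move=> p; rewrite adde_ge0 ?nF.2 ?nG.2.
rewrite ge0_integralD//; by [move=> p _; exact: nF.2|exact: nF.1|move=> p _; exact: nG.2|exact: nG.1].
Qed.

Lemma I2Zl (F : R * R -> \bar R) (k : R) : 0 <= k -> nneg_meas F ->
  (I2 (fun p => k%:E * F p) = k%:E * I2 F)%E.
Proof.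
move=> k0 nF; rewrite -!I2_prod//; last first.
  split; first by apply: measurable_funeM; exact: nF.1.
  by move=> p; rewrite mule_ge0 ?nF.2.
by rewrite ge0_integralZl//; [exact: nF.1|move=> p _; exact: nF.2].
Qed.

Lemma nneg_meas_EFin (f : R * R -> R) : measurable_fun setT f -> (forall p, 0 <= f p) ->
  nneg_meas (fun p => (f p)%:E).
Proof. by move=> mf f0; split=> [|p]; [exact/measurable_EFinP|rewrite lee_fin]. Qed.

End plane_points.

(** * Convolution of two Riesz kernels *)

Section kernel_convolution.
Variable R : realType.
Local Notation mu := (@lebesgue_measure R).
Implicit Types (p q : R * R) (r dl : R).

(** The Riesz kernel of order one, cut off at distance [r]. *)
Definition riesz r p : R := if pnorm p <= r then (pnorm p)^-1 else 0.

(** Bound for the product of the two kernels near one of the poles, the other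
    being at distance [2 * dl]; [psi] is its comparison function on a cone. *)
Let phi r dl p : R := if pnorm p <= r then (pnorm p * Num.max (pnorm p) dl)^-1 else 0.
Let psi r dl p : R :=
  if `|p.2| <= `|p.1| then (if `|p.1| <= r then (`|p.1| * Num.max `|p.1| dl)^-1 else 0) else 0.

Lemma measurable_riesz r : measurable_fun setT (riesz r).
Proof.
have mn := @measurable_pnorm R.
apply: measurable_fun_ifT => //; first exact: measurable_fun_ler.
exact: measurable_funV.
Qed.

Lemma riesz_ge0 r p : 0 <= riesz r p.
Proof. by rewrite /riesz; case: ifP => // _; rewrite invr_ge0 pnorm_ge0. Qed.

Let measurable_phi r dl : measurable_fun setT (phi r dl).
Proof.
have mn := @measurable_pnorm R.
apply: measurable_fun_ifT => //; first exact: measurable_fun_ler.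
by apply: measurable_funV; apply: measurable_funM => //; exact: measurable_maxr.
Qed.

Let measurable_psi r dl : measurable_fun setT (psi r dl).
Proof.
have m1 : measurable_fun [set: R * R] (fun p : R * R => `|p.1|).
  by apply: (measurableT_comp (@normr_measurable R setT)); exact: measurable_fst.
have m2 : measurable_fun [set: R * R] (fun p : R * R => `|p.2|).
  by apply: (measurableT_comp (@normr_measurable R setT)); exact: measurable_snd.
apply: measurable_fun_ifT => //; first exact: measurable_fun_ler.
apply: measurable_fun_ifT => //; first exact: measurable_fun_ler.
by apply: measurable_funV; apply: measurable_funM => //; exact: measurable_maxr.
Qed.

Let phi_ge0 r dl p : 0 <= phi r dl p.
Proof.
by rewrite /phi; case: ifP => // _; rewrite invr_ge0 mulr_ge0 ?pnorm_ge0// le_max pnorm_ge0.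
Qed.

Let psi_ge0 r dl p : 0 <= psi r dl p.
Proof.
rewrite /psi; case: ifP => // _; case: ifP => // _.
by rewrite invr_ge0 mulr_ge0// le_max normr_ge0.
Qed.

Let phi_le_psi r dl p : 0 < dl -> phi r dl p <= psi r dl p + psi r dl (p.2, p.1).
Proof.
move=> dl0; rewrite /phi; case: ifPn => [pr|_]; last by rewrite addr_ge0.
have key a : 0 <= a -> a <= pnorm p -> (0 < a \/ pnorm p = 0) ->
    (pnorm p * Num.max (pnorm p) dl)^-1 <= (a * Num.max a dl)^-1.
  move=> a0 ap [ap0|->]; last by rewrite mul0r invr0 invr_ge0 mulr_ge0// le_max a0.
  have mx : 0 < Num.max a dl by rewrite lt_max ap0.
  have mx' : 0 < Num.max (pnorm p) dl by rewrite lt_max dl0 orbT.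
  have p0 : 0 < pnorm p by apply: lt_le_trans ap.
  rewrite lef_pV2 ?posrE ?mulr_gt0//; apply: ler_pM => //; first exact: ltW.
  by rewrite ge_max !le_max ap lexx orbT.
have p1 := coord1_le_pnorm p; have p2 := coord2_le_pnorm p; have p12 := pnorm_le_coord p.
have [h|h] := leP `|p.2| `|p.1|.
  apply: le_trans (_ : psi r dl p <= _); last by rewrite lerDl.
  rewrite /psi h (le_trans p1 pr) key//.
  have [/eqP a0|a0] := eqVneq `|p.1| 0; last by left; rewrite lt_neqAle eq_sym a0 normr_ge0.
  by right; apply/eqP; rewrite eq_le pnorm_ge0 andbT (le_trans p12)//; move/eqP: a0 => a0; lra.
apply: le_trans (_ : psi r dl (p.2, p.1) <= _); last by rewrite lerDr.
by rewrite /psi /= (ltW h) (le_trans p2 pr) key//; left; apply: le_lt_trans h.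
Qed.

Lemma integral_indicM (A : set R) (f : R -> R) :
  (\int[mu]_x (\1_A x * f x)%:E = \int[mu]_(x in A) (f x)%:E)%E.
Proof.
rewrite [RHS]integral_mkcond; apply: eq_integral => x _; rewrite patchE indicE.
by case: ifP => _; rewrite ?mul1r ?mul0r.
Qed.

Lemma integral_indic_itv (a b k : R) : 0 <= k -> a <= b ->
  (\int[mu]_x (k * \1_(`[a, b]) x)%:E = (k * (b - a))%:E)%E.
Proof.
move=> k0 ab; under eq_integral do rewrite EFinM.
rewrite ge0_integralZl//; last by apply/measurable_EFinP; exact: measurable_indic.
rewrite integral_indic// setIT /= lebesgue_measure_itv /= lte_fin.
case: ltP => [_|ba]; first by rewrite -EFinB -EFinM.
by rewrite (_ : b = a) ?subrr ?mulr0 ?mule0//; apply/eqP; rewrite eq_le ba.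
Qed.

(** A majorant of [1 / max (x, dl)] on [0, r] with an elementary integral. *)
Let half r dl x : R := \1_(`[0, dl]) x * dl^-1 + \1_(`[dl, r]) x * x^-1.

Let measurable_half r dl : measurable_fun setT (half r dl).
Proof.
by apply: measurable_funD; apply: measurable_funM => //;
  (exact: measurable_indic || exact: measurable_invr).
Qed.

Let half_ge0 r dl x : 0 < dl -> 0 <= half r dl x.
Proof.
move=> dl0; rewrite /half !indicE; apply: addr_ge0.
  by rewrite mulr_ge0// invr_ge0 ltW.
case: (boolP (x \in _)) => [|_]; last by rewrite mul0r.
by rewrite inE /= in_itv /= => /andP[dx _]; rewrite mul1r invr_ge0 (le_trans (ltW dl0)).
Qed.

Let integral_half r dl : 0 < dl -> dl <= r ->
  (\int[mu]_x (half r dl x)%:E = (1 + ln (r / dl))%:E)%E.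
Proof.
move=> dl0 dr; have r0 := lt_le_trans dl0 dr.
under eq_integral do rewrite EFinD.
rewrite ge0_integralD//.
- under [X in (X + _)%E]eq_integral do rewrite mulrC.
  rewrite integral_indic_itv ?invr_ge0 ?(ltW dl0)// subr0 mulVf ?gt_eqF//.
  by rewrite integral_indicM integral_inv// -EFinD ln_div.
- by move=> x _; rewrite lee_fin mulr_ge0// ?invr_ge0 ?(ltW dl0)// indicE.
- by apply/measurable_EFinP; apply: measurable_funM => //; exact: measurable_indic.
- move=> x _; rewrite lee_fin indicE; case: (boolP (x \in _)) => [|_]; last by rewrite mul0r.
  by rewrite inE /= in_itv /= => /andP[dx _]; rewrite mul1r invr_ge0 (le_trans (ltW dl0)).
- apply/measurable_EFinP; apply: measurable_funM; first exact: measurable_indic.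
  exact: measurable_invr.
Qed.

Let I2_psi r dl : 0 < dl -> dl <= r ->
  (I2 (fun p => (psi r dl p)%:E) <= (4 * (1 + ln (r / dl)))%:E)%E.
Proof.
move=> dl0 dr.
have mh := measurable_half r dl.
have mhN : measurable_fun setT (fun x : R => (half r dl (- x))%:E).
  by apply/measurable_EFinP; by apply: (measurableT_comp mh); exact: oppr_measurable.
have E : (\int[mu]_x (half r dl (- x))%:E = (1 + ln (r / dl))%:E)%E.
  have := @integral_affine R (-1) 0 (fun x => (half r dl x)%:E).
  rewrite oppr_eq0 oner_neq0 normrN normr1 invr1 mul1e integral_half// => <- //.
  - by apply: eq_integral => x _; rewrite mulN1r addr0.
  - exact/measurable_EFinP.
  - by move=> x; rewrite lee_fin half_ge0.
have -> : (4 * (1 + ln (r / dl)))%:E =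
  (\int[mu]_x (2%:E * ((half r dl x)%:E + (half r dl (- x))%:E)))%E.
  rewrite ge0_integralZl//; last 2 first.
  - by apply: emeasurable_funD => //; exact/measurable_EFinP.
  - by move=> x _; rewrite adde_ge0// lee_fin half_ge0.
  rewrite ge0_integralD//; last 3 first.
  - by move=> x _; rewrite lee_fin half_ge0.
  - exact/measurable_EFinP.
  - by move=> x _; rewrite lee_fin half_ge0.
  by rewrite E integral_half// -EFinD -EFinM; congr EFin; ring.
have npsi : nneg_meas (fun p => (psi r dl p)%:E).
  by apply: nneg_meas_EFin => //; exact: measurable_psi.
rewrite /I2; apply: ge0_le_integral => //.
- by move=> x _; apply: integral_ge0 => y _; rewrite lee_fin.
- exact: (nneg_meas_inner npsi).
- by apply: measurable_funeM; apply: emeasurable_funD => //; exact/measurable_EFinP.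
move=> x _.
pose k := (if `|x| <= r then (`|x| * Num.max `|x| dl)^-1 else 0).
have k0 : 0 <= k by rewrite /k; case: ifP => // _; rewrite invr_ge0 mulr_ge0// le_max normr_ge0.
have -> : (\int[mu]_y (psi r dl (x, y))%:E = \int[mu]_y (k * \1_(`[- `|x|, `|x|]) y)%:E)%E.
  apply: eq_integral => y _; congr EFin; rewrite /psi /= indicE mem_setE.
  rewrite in_itv /= -ler_norml -/k.
  by case: ifP => _; rewrite ?mulr1 ?mulr0.
rewrite integral_indic_itv//; last by rewrite -subr_ge0 opprK addr_ge0.
rewrite -EFinD -EFinM lee_fin opprK /k.
have hh : 0 <= half r dl x + half r dl (- x) by rewrite addr_ge0 ?half_ge0.
case: ifP => [xr|_]; last by rewrite mul0r mulr_ge0.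
have [->|x0] := eqVneq x 0; first by rewrite normr0 mul0r invr0 mul0r oppr0 mulr_ge0// addr_ge0 ?half_ge0.
have x0' : 0 < `|x| by rewrite normr_gt0.
have -> : (`|x| * Num.max `|x| dl)^-1 * (`|x| + `|x|) = 2 * (Num.max `|x| dl)^-1.
  by field; rewrite !gt_eqF ?lt_max ?x0'.
rewrite ler_pM2l//.
have : (Num.max `|x| dl)^-1 <= half r dl `|x|.
  rewrite /half !indicE !mem_setE !in_itv /= normr_ge0 /=.
  have [xd|xd] := leP `|x| dl.
    by rewrite mul1r lerDl mulr_ge0// invr_ge0.
  by rewrite (ltW xd) xr mul0r add0r mul1r.
by have [x1|x1] := ltP x 0; [rewrite ltr0_norm//|rewrite ger0_norm//] => /le_trans; apply;
  rewrite ?lerDl ?lerDr half_ge0.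
Qed.

Let I2_phi r dl : 0 < dl -> dl <= r ->
  (I2 (fun p => (phi r dl p)%:E) <= (8 * (1 + ln (r / dl)))%:E)%E.
Proof.
move=> dl0 dr.
have npsi : nneg_meas (fun p => (psi r dl p)%:E).
  by apply: nneg_meas_EFin => //; exact: measurable_psi.
have npsi' : nneg_meas (fun p => (psi r dl (p.2, p.1))%:E) :=
  nneg_meas_comp npsi (@measurable_swap_pair R).
apply: (@le_trans _ _ (I2 (fun p => (psi r dl p)%:E + (psi r dl (p.2, p.1))%:E)%E)).
  apply: I2_le.
  - by apply: nneg_meas_EFin => //; exact: measurable_phi.
  - split; first by apply: emeasurable_funD; [exact: npsi.1|exact: npsi'.1].
    by move=> p; rewrite adde_ge0 ?lee_fin.
  - by move=> p; rewrite -EFinD lee_fin; exact: phi_le_psi.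
rewrite I2D//.
have -> : I2 (fun p => (psi r dl (p.2, p.1))%:E) = I2 (fun p => (psi r dl p)%:E).
  by rewrite (I2_swap npsi).
have -> : (8 * (1 + ln (r / dl)))%:E = ((4 * (1 + ln (r / dl)))%:E + (4 * (1 + ln (r / dl)))%:E)%E.
  by rewrite -EFinD; congr EFin; ring.
by apply: leeD; exact: I2_psi.
Qed.

(** The plane is split according to the nearer of the two poles. There the other
    factor is at most the inverse of the larger of the distance to the near pole
    and half the distance of the poles, and the remaining integral is
    logarithmic. It is bounded without polar coordinates by comparing the norm
    with the larger coordinate, on the two cones where the latter is the first or
    the second. *)
Lemma riesz_convolution r p q : 0 < pnorm (p - q) -> pnorm (p - q) <= 2 * r ->
  (I2 (fun y => (riesz r (y - p) * riesz r (y - q))%:E) <=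
   (16 * (1 + ln (2 * r / pnorm (p - q))))%:E)%E.
Proof.
move=> d0 dr; pose dl := pnorm (p - q) / 2.
have dl0 : 0 < dl by rewrite divr_gt0.
have dlr : dl <= r by rewrite ler_pdivrMr// mulrC.
have mphi := measurable_phi r dl.
have nphi : nneg_meas (fun y => (phi r dl y)%:E) by exact: nneg_meas_EFin.
have mB (s : R * R) : measurable_fun setT (fun y : R * R => y - s).
  by apply: measurable_fun_pB => //; exact: measurable_id.
have nphiB (s : R * R) : nneg_meas (fun y => (phi r dl (y - s))%:E) := nneg_meas_comp nphi (mB s).
have half_le (y a b : R * R) : pnorm (a - b) = pnorm (p - q) -> pnorm (y - a) <= pnorm (y - b) ->
    riesz r (y - a) * riesz r (y - b) <= phi r dl (y - a).
  move=> ab ya; rewrite /riesz /phi; case: ifPn => [yar|_]; last by rewrite mul0r.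
  have yb : dl <= pnorm (y - b).
    have := pnorm_triangle a b y; rewrite [pnorm (a - y)]pnormBC ab /dl; lra.
  have yb0 : 0 < pnorm (y - b) by apply: lt_le_trans yb.
  case: ifPn => _; last by rewrite mulr0 invr_ge0 mulr_ge0 ?pnorm_ge0// le_max pnorm_ge0.
  rewrite invfM ler_wpM2l ?invr_ge0 ?pnorm_ge0// lef_pV2 ?posrE ?lt_max ?dl0 ?orbT//.
  by rewrite ge_max ya yb.
have mr (s : R * R) : measurable_fun setT (fun y : R * R => riesz r (y - s)).
  exact: (measurableT_comp (measurable_riesz r) (mB s)).
apply: (@le_trans _ _ (I2 (fun y => (phi r dl (y - p))%:E + (phi r dl (y - q))%:E)%E)).
  apply: I2_le.
  - apply: nneg_meas_EFin; first exact: measurable_funM.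
    by move=> y; rewrite mulr_ge0 ?riesz_ge0.
  - split; first by apply: emeasurable_funD; [exact: (nphiB p).1|exact: (nphiB q).1].
    by move=> y; rewrite adde_ge0 ?lee_fin ?phi_ge0.
  - move=> y; rewrite -EFinD lee_fin.
    have [h|/ltW h] := leP (pnorm (y - p)) (pnorm (y - q)).
      by apply: (le_trans (half_le _ _ _ erefl h)); rewrite lerDl phi_ge0.
    rewrite mulrC; apply: (le_trans (half_le _ _ _ (pnormBC q p) h)); rewrite lerDr; exact: phi_ge0.
rewrite (I2D (nphiB p) (nphiB q)) (I2_translate p nphi) (I2_translate q nphi).
have -> : 2 * r / pnorm (p - q) = r / dl by rewrite /dl; field; rewrite gt_eqF.
have -> : (16 * (1 + ln (r / dl)))%:E = ((8 * (1 + ln (r / dl)))%:E + (8 * (1 + ln (r / dl)))%:E)%E.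
  by rewrite -EFinD; congr EFin; ring.
by apply: leeD; exact: I2_phi.
Qed.

End kernel_convolution.

(** * Tonelli theorem with a parameter *)

Section plane_parameter.
Variables (R : realType) (d : measure_display) (T : measurableType d).
Local Notation mu := (@lebesgue_measure R).
Variable nu : {sigma_finite_measure set T -> \bar R}.
Variable H : T * (R * R) -> \bar R.
Hypothesis mH : measurable_fun setT H.
Hypothesis H0 : forall x, (0 <= H x)%E.

Let K (tx : T * R) : \bar R := (\int[mu]_y H (tx.1, (tx.2, y)))%E.

Let K0 tx : (0 <= K tx)%E. Proof. exact: integral_ge0. Qed.

Let measurable_assoc : measurable_fun setT (fun z : (T * R) * R => (z.1.1, (z.1.2, z.2))).
Proof.
have m1 : measurable_fun setT (fun z : (T * R) * R => z.1) by exact: measurable_fst.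
apply: measurable_fun_pair; first exact: (measurableT_comp measurable_fst m1).
apply: measurable_fun_pair; last exact: measurable_snd.
exact: (measurableT_comp measurable_snd m1).
Qed.

Let mK : measurable_fun setT K.
Proof.
have m : measurable_fun setT (fun z : (T * R) * R => H (z.1.1, (z.1.2, z.2))).
  exact: (measurableT_comp mH measurable_assoc).
exact: (@measurable_fun_fubini_tonelli_F _ _ _ _ R mu _ m (fun z => H0 _)).
Qed.

Lemma measurable_I2_param : measurable_fun setT (fun t => I2 (fun z => H (t, z))).
Proof. exact: (@measurable_fun_fubini_tonelli_F _ _ _ _ R mu K mK K0). Qed.

Lemma nneg_meas_param_integral : nneg_meas (fun z => \int[nu]_t H (t, z))%E.
Proof.
split=> [|z]; last exact: integral_ge0.
exact: (@measurable_fun_fubini_tonelli_G _ _ _ _ R nu H mH H0).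
Qed.

Lemma I2_param_swap : (\int[nu]_t I2 (fun z => H (t, z)) = I2 (fun z => \int[nu]_t H (t, z)))%E.
Proof.
rewrite /I2; transitivity (\int[mu]_x \int[nu]_t K (t, x))%E.
  exact: (@fubini_tonelli _ _ _ _ R nu mu K mK K0).
apply: eq_integral => x _.
have m : measurable_fun setT (fun ty : T * R => H (ty.1, (x, ty.2))).
  apply: (measurableT_comp mH); apply: measurable_fun_pair; first exact: measurable_fst.
  by apply: measurable_fun_pair => //; exact: measurable_snd.
exact: (@fubini_tonelli _ _ _ _ R nu mu _ m (fun z => H0 _)).
Qed.

End plane_parameter.

(** * Average length of the segments from a point *)

Section segments.
Variable R : realType.
Local Notation mu := (@lebesgue_measure R).
Variable sg : R * R -> R.
Hypothesis msg : measurable_fun setT sg.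
Hypothesis sg0 : forall p, 0 <= sg p.
Implicit Types (P Q : R * R).

Definition lerp P Q (s : R) : R * R := ((1 - s) * P.1 + s * Q.1, (1 - s) * P.2 + s * Q.2).

(** Length of the segment from [P] to [Q] in the metric [sg]. The indicator form
    suits Tonelli; the end point [s = 0] is left out because changes of variables
    divide by [s]. *)
Definition Seg P Q : \bar R :=
  (\int[mu]_s (\1_(`]0%R, 1%R]) s * (pnorm (Q - P)%R * sg (lerp P Q s)))%:E)%E.

Lemma indic_ge0 (A : set R) x : 0 <= \1_A x :> R.
Proof. by rewrite indicE. Qed.

Lemma measurable_fun_itv_indic d (T : measurableType d) (i : interval R) (f : T -> R) :
  measurable_fun setT f -> measurable_fun setT (fun x => \1_([set` i]) (f x) : R).
Proof.
by move=> mf; apply: (measurableT_comp _ mf); apply: measurable_indic; exact: measurable_itv.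
Qed.

Lemma Seg_ge0 P Q : (0 <= Seg P Q)%E.
Proof.
by apply: integral_ge0 => s _; rewrite lee_fin mulr_ge0 ?indic_ge0// mulr_ge0 ?pnorm_ge0.
Qed.

Lemma measurable_fun_lerp d (T : measurableType d) (P Q : T -> R * R) (s : T -> R) :
  measurable_fun setT P -> measurable_fun setT Q -> measurable_fun setT s ->
  measurable_fun setT (fun x => lerp (P x) (Q x) (s x)).
Proof.
move=> mP mQ ms; have m1 : measurable_fun setT (fun x => 1 - s x) by exact: measurable_funB.
by apply: measurable_fun_pair; apply: measurable_funD; apply: measurable_funM => //;
  (exact: measurable_fun_coord1 || exact: measurable_fun_coord2).
Qed.

Lemma measurable_Seg_integrand d (T : measurableType d) (P Q : T -> R * R) (s : T -> R) :
  measurable_fun setT P -> measurable_fun setT Q -> measurable_fun setT s ->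
  measurable_fun setT (fun x => \1_(`]0%R, 1%R]) (s x) * (pnorm (Q x - P x)%R * sg (lerp (P x) (Q x) (s x)))).
Proof.
move=> mP mQ ms; apply: measurable_funM; first exact: measurable_fun_itv_indic.
apply: measurable_funM; first by apply: measurable_fun_pnorm; exact: measurable_fun_pB.
exact: (measurableT_comp msg (measurable_fun_lerp mP mQ ms)).
Qed.

Lemma measurable_Seg d (T : measurableType d) (P Q : T -> R * R) :
  measurable_fun setT P -> measurable_fun setT Q -> measurable_fun setT (fun x => Seg (P x) (Q x)).
Proof.
move=> mP mQ.
pose F (xs : T * R) : \bar R :=
  (\1_(`]0%R, 1%R]) xs.2 * (pnorm (Q xs.1 - P xs.1)%R * sg (lerp (P xs.1) (Q xs.1) xs.2)))%:E.
have mF : measurable_fun setT F.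
  apply/measurable_EFinP; apply: measurable_Seg_integrand; last exact: measurable_snd.
    exact: (measurableT_comp mP measurable_fst).
  exact: (measurableT_comp mQ measurable_fst).
apply: (@measurable_fun_fubini_tonelli_F _ _ _ _ R mu F mF) => -[x s].
by rewrite /F lee_fin mulr_ge0 ?indic_ge0// mulr_ge0 ?pnorm_ge0.
Qed.

Lemma lerpB P Q s : lerp P Q s - P = (s * (Q - P).1, s * (Q - P).2).
Proof. by rewrite /lerp; case: P Q => [a b] [c d] /=; congr pair => /=; ring. Qed.

Section average.
Variables (P : R * R) (R0 T : R).
Hypotheses (T0 : 0 < T) (PR0 : pnorm P <= R0).
Let r := R0 + 1 + T.

Let R00 : 0 <= R0. Proof. exact: le_trans (pnorm_ge0 P) PR0. Qed.
Let r0 : 0 < r. Proof. by rewrite /r ltr_wpDl// addr_ge0. Qed.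

Let G (s : R) (y : R * R) : R := if pnorm (y - P) <= s * r then pnorm (y - P) / s * sg y else 0.
Let h (s : R) (z : R * R) : R :=
  if pnorm (z - P) <= r then pnorm (z - P) * sg (lerp P z s) else 0.

Let mB : measurable_fun setT (fun y : R * R => y - P).
Proof. by apply: measurable_fun_pB => //; exact: measurable_id. Qed.

Let mnB : measurable_fun setT (fun y : R * R => pnorm (y - P)).
Proof. exact: measurable_fun_pnorm. Qed.

Let nG s : 0 < s -> nneg_meas (fun y => (G s y)%:E).
Proof.
move=> s0; apply: nneg_meas_EFin.
  apply: measurable_fun_ifT => //; first exact: measurable_fun_ler.
  by apply: measurable_funM => //; exact: measurable_funM.
by move=> p; rewrite /G; case: ifP => // _; rewrite mulr_ge0// divr_ge0 ?pnorm_ge0// ltW.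
Qed.

Let nh s : nneg_meas (fun y => (h s y)%:E).
Proof.
apply: nneg_meas_EFin.
  apply: measurable_fun_ifT => //; first exact: measurable_fun_ler.
  apply: measurable_funM => //; apply: (measurableT_comp msg).
  by apply: measurable_fun_lerp => //; exact: measurable_id.
by move=> p; rewrite /h; case: ifP => // _; rewrite mulr_ge0// pnorm_ge0.
Qed.

Let I2_h s : 0 < s -> (I2 (fun z => (h s z)%:E) = (s ^- 2)%:E * I2 (fun y => (G s y)%:E))%E.
Proof.
move=> s0; have sn0 : s != 0 by rewrite gt_eqF.
have E : `|s * s|^-1 = s ^- 2 by rewrite -expr2 ger0_norm// sqr_ge0.
rewrite -E -(I2_affine ((1 - s) * P.1) ((1 - s) * P.2) sn0 sn0 (nG s0)).
apply: (congr1 (@I2 R)); apply/funext => z.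
have -> : (s * z.1 + (1 - s) * P.1, s * z.2 + (1 - s) * P.2) = lerp P z s.
  by rewrite /lerp; congr pair; rewrite addrC.
congr EFin; rewrite /h /G lerpB pnormZ gtr0_norm// ler_pM2l//.
by case: ifP => // _; rewrite [s * _]mulrC mulfK.
Qed.

Let wt (z : R * R) : R := \1_(`[1/2, 1]) z.1 * \1_(`[- T, T]) z.2.
Let pt (z : R * R) : R * R := (z.1, z.1 * z.2).

Lemma measurable_weight : measurable_fun setT wt.
Proof.
apply: measurable_funM.
  by apply: measurable_fun_itv_indic; exact: measurable_fst.
by apply: measurable_fun_itv_indic; exact: measurable_snd.
Qed.

Lemma measurable_pt : measurable_fun setT pt.
Proof.
apply: measurable_fun_pair; first exact: measurable_fst.
by apply: measurable_funM; [exact: measurable_fst|exact: measurable_snd].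
Qed.

Let I2_wt s : (I2 (fun z => (wt z * (pnorm (pt z - P)%R * sg (lerp P (pt z) s)))%:E) <=
  2%:E * I2 (fun z => (h s z)%:E))%E.
Proof.
have mi := nneg_meas_inner (nh s).
have i0 x : (0 <= \int[mu]_y (h s (x, y))%:E)%E.
  by apply: integral_ge0 => y _; exact: (nh s).2.
have two0 : (0 <= 2%:E :> \bar R)%E by rewrite lee_fin.
have -> : (2%:E * I2 (fun z => (h s z)%:E) = \int[mu]_x (2%:E * \int[mu]_y (h s (x, y))%:E))%E.
  by rewrite (ge0_integralZl mu measurableT mi (fun x _ => i0 x) two0).
apply: ge0_le_integral => //.
- move=> x _; apply: integral_ge0 => y _; rewrite lee_fin mulr_ge0//.
    by rewrite mulr_ge0 ?indic_ge0.
  by rewrite mulr_ge0 ?pnorm_ge0.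
- have n : nneg_meas (fun z => (wt z * (pnorm (pt z - P)%R * sg (lerp P (pt z) s)))%:E).
    apply: nneg_meas_EFin.
      apply: measurable_funM; first exact: measurable_weight.
      apply: measurable_funM.
        by apply: measurable_fun_pnorm; apply: measurable_fun_pB => //; exact: measurable_pt.
      by apply: (measurableT_comp msg); apply: measurable_fun_lerp => //; exact: measurable_pt.
    by move=> z; rewrite mulr_ge0 ?mulr_ge0 ?indic_ge0 ?pnorm_ge0.
  exact: (nneg_meas_inner n).
- exact: measurable_funeM.
move=> x _; rewrite /wt /pt /=.
have [xin|xout] := boolP (1/2 <= x <= 1); last first.
  rewrite (_ : \int[mu]_y _ = 0)%E ?mule_ge0//.
  by apply: integral0_eq => y _; rewrite indicE mem_setE in_itv /= (negbTE xout) !mul0r.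
have /andP[x2 x1] := xin; have x0 : 0 < x by lra.
have xn0 : x != 0 by rewrite gt_eqF.
have mhx : measurable_fun setT (fun y => (h s (x, y))%:E).
  exact: (measurable_fun_pair2 x (nh s).1).
have h0x y : (0 <= (h s (x, y))%:E)%E by exact: (nh s).2.
apply: (@le_trans _ _ (\int[mu]_y (h s (x, x * y + 0))%:E)%E); last first.
  rewrite (integral_affine 0 xn0 mhx h0x) gtr0_norm//.
  rewrite lee_wpmul2r// lee_fin invf_ple ?posrE//; lra.
apply: ge0_le_integral => //.
- by move=> y _; rewrite lee_fin !mulr_ge0 ?indic_ge0 ?pnorm_ge0.
- apply/measurable_EFinP; apply: measurable_funM.
    by apply: measurable_funM => //; exact: measurable_indic.
  have mxy : measurable_fun setT (fun y : R => (x, x * y)).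
    by apply: measurable_fun_pair => //; exact: measurable_funM.
  apply: measurable_funM.
    by apply: measurable_fun_pnorm; exact: measurable_fun_pB.
  by apply: (measurableT_comp msg); exact: measurable_fun_lerp.
- by apply: (measurableT_comp mhx); exact: measurable_affine.
move=> y _; rewrite lee_fin addr0 !indicE !mem_setE !in_itv /= xin mul1r.
have [yin|_] := boolP (- T <= y <= T); last first.
  by rewrite mul0r /h; case: ifP => // _; rewrite mulr_ge0 ?pnorm_ge0.
rewrite mul1r /h ifT//.
have yT : `|y| <= T by rewrite ler_norml.
apply: (@le_trans _ _ (pnorm (x, x * y) + pnorm P)).
  by rewrite -[pnorm P]pnormN; exact: pnormD.
have : pnorm (x, x * y) <= `|x| + `|x * y| by exact: (pnorm_le_coord (x, x * y)).
rewrite normrM (gtr0_norm x0).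
have : x * `|y| <= 1 * T by apply: ler_pM => //; exact: ltW.
rewrite /r; have := PR0; lra.
Qed.

(** For fixed [s] the map sending the end point [Z] to [y = (1 - s) P + s Z] has
    Jacobian [s ^ 2], and [|y - P| = s |Z - P|]. The mass found at [y] comes from
    [s >= |y - P| / r] only, and the integral of [s ^- 3] over that range turns the
    factor [|y - P|] into the kernel [1 / |y - P|]. *)
Lemma Seg_average : (I2 (fun z => (wt z)%:E * Seg P (pt z)) <=
  I2 (fun y => (r ^+ 2 * (sg y * riesz r (y - P)))%:E))%E.
Proof.
pose H (zs : R * (R * R)) : \bar R :=
  (wt zs.2 * (\1_(`]0%R, 1%R]) zs.1 * (pnorm (pt zs.2 - P)%R * sg (lerp P (pt zs.2) zs.1))))%:E.
have mptf : measurable_fun setT (fun zs : R * (R * R) => pt zs.2).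
  exact: (measurableT_comp measurable_pt measurable_snd).
have mH : measurable_fun setT H.
  apply/measurable_EFinP; apply: measurable_funM.
    exact: (measurableT_comp measurable_weight measurable_snd).
  by apply: measurable_Seg_integrand => //; exact: measurable_fst.
have H0 zs : (0 <= H zs)%E.
  by rewrite lee_fin !mulr_ge0 ?indic_ge0 ?pnorm_ge0.
have -> : I2 (fun z => (wt z)%:E * Seg P (pt z))%E = (\int[mu]_s I2 (fun z => H (s, z)))%E.
  rewrite (I2_param_swap mu mH H0); apply: (congr1 (@I2 R)); apply/funext => z.
  rewrite /Seg -ge0_integralZl//.
  - apply/measurable_EFinP; apply: measurable_Seg_integrand => //; exact: measurable_id.
  - by move=> s _; rewrite lee_fin !mulr_ge0 ?indic_ge0 ?pnorm_ge0.
  - by rewrite lee_fin mulr_ge0 ?indic_ge0.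
pose K (sy : R * (R * R)) : R := \1_(`]0%R, 1%R]) sy.1 * (2 * (sy.1 ^- 2 * G sy.1 sy.2)).
have mK : measurable_fun setT (fun sy => (K sy)%:E).
  apply/measurable_EFinP; apply: measurable_funM.
    by apply: measurable_fun_itv_indic; exact: measurable_fst.
  apply: measurable_funM => //; apply: measurable_funM.
    by apply: measurable_funV; apply: measurable_funX; exact: measurable_fst.
  have mn2 : measurable_fun setT (fun sy : R * (R * R) => pnorm (sy.2 - P)).
    exact: (measurableT_comp mnB measurable_snd).
  apply: measurable_fun_ifT => //.
    by apply: measurable_fun_ler => //; apply: measurable_funM => //; exact: measurable_fst.
  apply: measurable_funM; last exact: (measurableT_comp msg measurable_snd).
  by apply: measurable_fun_div => //; exact: measurable_fst.
have K0 sy : (0 <= (K sy)%:E)%E.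
  rewrite lee_fin /K indicE mem_setE in_itv /=; case: ltP => s0 /=; last by rewrite mul0r.
  rewrite mulr_ge0// mulr_ge0// mulr_ge0// ?invr_ge0 ?sqr_ge0//.
  by have := (nG s0).2 sy.2; rewrite lee_fin.
apply: (@le_trans _ _ (\int[mu]_s I2 (fun y => (K (s, y))%:E))%E).
  apply: ge0_le_integral.
  - exact: measurableT.
  - move=> s _; apply: integral_ge0 => x _; exact: integral_ge0.
  - exact: measurable_I2_param mH H0.
  - exact: measurable_I2_param mK K0.
  move=> s _; have [sin|sout] := boolP (s \in `]0%R, 1%R]); last first.
    rewrite /I2 [X in (X <= _)%E](_ : _ = 0)%E.
      by apply: integral_ge0 => x _; apply: integral_ge0.
    apply: integral0_eq => x _; apply: integral0_eq => y _.
    by rewrite /H /= indicE mem_setE (negbTE sout) mul0r mulr0.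
  have s0 : 0 < s by move: sin; rewrite in_itv /= => /andP[].
  have -> : (fun z => H (s, z)) = fun z => (wt z * (pnorm (pt z - P)%R * sg (lerp P (pt z) s)))%:E.
    by apply/funext => z; rewrite /H /= indicE mem_setE sin mul1r.
  apply: (le_trans (I2_wt s)); rewrite I2_h//.
  rewrite -I2Zl; last 2 first.
  - by rewrite invr_ge0 sqr_ge0.
  - exact: nG.
  rewrite -I2Zl; last 2 first.
  - by [].
  - split; first by apply: measurable_funeM; exact: (nG s0).1.
    by move=> y; rewrite mule_ge0 ?lee_fin ?invr_ge0 ?sqr_ge0//; have := (nG s0).2 y; rewrite lee_fin.
  rewrite le_eqVlt; apply/orP; left; apply/eqP; apply: (congr1 (@I2 R)); apply/funext => y.
  by rewrite /K /= indicE mem_setE sin mul1r -!EFinM.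
rewrite (I2_param_swap mu mK K0); apply: I2_le.
- exact: (nneg_meas_param_integral mu mK K0).
- apply: nneg_meas_EFin; last by move=> y; rewrite mulr_ge0 ?sqr_ge0// mulr_ge0 ?riesz_ge0.
  apply: measurable_funM => //; apply: measurable_funM => //.
  exact: (measurableT_comp (measurable_riesz r) mB).
move=> y; set dl := pnorm (y - P).
have dl0 : 0 <= dl by exact: pnorm_ge0.
have [dlz|dln] := eqVneq dl 0.
  rewrite (_ : \int[mu]_s _ = 0)%E; first by rewrite lee_fin mulr_ge0 ?sqr_ge0// mulr_ge0 ?riesz_ge0.
  apply: integral0_eq => s _; rewrite /K /G /= -/dl dlz !mul0r.
  by case: ifP => _; rewrite !mulr0.
have dlp : 0 < dl by rewrite lt_neqAle eq_sym dln.
have [dr|dr] := leP dl r; last first.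
  rewrite (_ : \int[mu]_s _ = 0)%E; first by rewrite lee_fin mulr_ge0 ?sqr_ge0// mulr_ge0 ?riesz_ge0.
  apply: integral0_eq => s _; rewrite /K /G /= -/dl indicE mem_setE in_itv /=.
  case: (boolP (0 < s <= 1)) => [/andP[s0 s1]|_]; last by rewrite mul0r.
  rewrite ifF ?mulr0//; apply/negbTE; rewrite -ltNge; apply: le_lt_trans dr.
  by rewrite ler_piMl// ltW.
have c0 : 0 < dl / r by rewrite divr_gt0.
have c1 : dl / r <= 1 by rewrite ler_pdivrMr// mul1r.
have -> : (\int[mu]_s (K (s, y))%:E =
  \int[mu]_s ((2 * (dl * sg y))%:E * (\1_(`[dl / r, 1%R]) s * (s ^+ 3)^-1)%:E))%E.
  apply: eq_integral => s _; rewrite -EFinM; congr EFin.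
  rewrite /K /G /= -/dl !indicE !mem_setE !in_itv /= ler_pdivrMr//.
  have [s0|s0] := ltP 0 s; last first.
    rewrite /= mul0r; case: (boolP (dl <= s * r)) => [|_]; last by rewrite mul0r mulr0.
    move=> /(lt_le_trans dlp); rewrite pmulr_lgt0// ltNge s0//.
  have [s1|s1] := leP s 1; last by rewrite /= andbF !mul0r mulr0.
  rewrite /= andbT mul1r; case: ifP => _; last by rewrite !mulr0 mul0r mulr0.
  by rewrite mul1r; field; rewrite gt_eqF.
rewrite ge0_integralZl//; last 3 first.
- apply/measurable_EFinP; apply: measurable_funM; first exact: measurable_indic.
  by apply: measurable_funV; exact: measurable_funX.
- move=> s _; rewrite lee_fin indicE mem_setE in_itv /=.
  case: (boolP (dl / r <= s <= 1)) => [/andP[s0 _]|_]; last by rewrite mul0r.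
  by rewrite mul1r invr_ge0 exprn_ge0// (le_trans (ltW c0)).
- by rewrite lee_fin mulr_ge0// mulr_ge0.
rewrite integral_indicM integral_inv3// -EFinM lee_fin /riesz -/dl dr.
have -> : (dl / r) ^- 2 = r ^+ 2 / dl ^+ 2 by field; rewrite dln gt_eqF.
have -> : r ^+ 2 * (sg y / dl) = 2 * (dl * sg y) * ((r ^+ 2 / dl ^+ 2) / 2) by field.
rewrite ler_wpM2l//; first by rewrite mulr_ge0// mulr_ge0.
lra.
Qed.

End average.
End segments.

(** * Energy and the Cauchy-Schwarz bound *)

Section energy.
Variable R : realType.
Local Notation mu := (@lebesgue_measure R).

Lemma ereal_amgm (l a : R) (u : \bar R) : 0 < l -> (0 <= u)%E ->
  (a%:E * u <= (l / 2)%:E * (a ^+ 2)%:E + (1 / (2 * l))%:E * (u * u))%E.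
Proof.
move=> l0; case: u => [u| |]//; rewrite ?lee_fin => u0.
  rewrite -?EFinM -?EFinD ?lee_fin.
  have -> : l / 2 * a ^+ 2 + 1 / (2 * l) * (u * u) = a * u + (l * a - u) ^+ 2 / (2 * l).
    by field; rewrite gt_eqF.
  by rewrite lerDl divr_ge0 ?sqr_ge0// mulr_ge0// ltW.
have q : 0 < 1 / (2 * l) by rewrite divr_gt0// mulr_gt0.
have -> : ((1 / (2 * l))%:E * (+oo * +oo) = +oo :> \bar R)%E by rewrite mulyy gt0_muley ?lte_fin.
by rewrite -EFinM addey// leey.
Qed.

(** The optimal weight in the inequality between arithmetic and geometric
    means, which makes it a Cauchy-Schwarz inequality after integration. *)
Lemma sqrt_amgm (A e : R) : 0 < A -> 0 < e ->
  exists2 l, 0 < l & l / 2 * A + 1 / (2 * l) * e = Num.sqrt (A * e).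
Proof.
move=> A0 e0; exists (Num.sqrt (e / A)); first by rewrite sqrtr_gt0 divr_gt0.
have sA : 0 < Num.sqrt A by rewrite sqrtr_gt0.
have se : 0 < Num.sqrt e by rewrite sqrtr_gt0.
rewrite (sqrtrM _ (ltW e0)) (sqrtrM _ (ltW A0)) sqrtrV ?ltW//.
move: (sqr_sqrtr (ltW A0)) (sqr_sqrtr (ltW e0)) sA se.
move: (Num.sqrt A) (Num.sqrt e) => x y <- <- x0 y0.
by field; rewrite !gt_eqF.
Qed.

Variables (d : measure_display) (T : measurableType d).
Variable m : {sigma_finite_measure set T -> \bar R}.
Variables (sg : R * R -> R) (kap : T * (R * R) -> R).
Hypothesis msg : measurable_fun setT sg.
Hypothesis sg0 : forall p, 0 <= sg p.
Hypothesis mkap : measurable_fun setT kap.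
Hypothesis kap0 : forall p, 0 <= kap p.

Let mk (p : T) : measurable_fun setT (fun y => kap (p, y)).
Proof. exact: (measurable_fun_pair2 p mkap). Qed.

Let mkE : measurable_fun setT (EFin \o kap). Proof. exact/measurable_EFinP. Qed.

Let u (y : R * R) : \bar R := (\int[m]_p (kap (p, y))%:E)%E.

Let nu : nneg_meas u.
Proof. by apply: (nneg_meas_param_integral m mkE) => x; rewrite lee_fin. Qed.

Let mutual (p q : T) : \bar R := I2 (fun y => (kap (p, y) * kap (q, y))%:E).

Lemma measurable_mutual : measurable_fun setT (fun pq : T * T => mutual pq.1 pq.2).
Proof.
apply: (@measurable_I2_param R _ _ (fun x => (kap (x.1.1, x.2) * kap (x.1.2, x.2))%:E)); last first.
  by move=> x; rewrite lee_fin mulr_ge0.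
have mg (f : T * T -> T) : measurable_fun setT f ->
    measurable_fun setT (fun x : (T * T) * (R * R) => kap (f x.1, x.2)).
  move=> mf; apply: (measurableT_comp mkap); apply: measurable_fun_pair; last exact: measurable_snd.
  exact: (measurableT_comp mf measurable_fst).
apply/measurable_EFinP; apply: measurable_funM; apply: mg; [exact: measurable_fst|exact: measurable_snd].
Qed.

Let I2_usquare : (I2 (fun y => u y * u y) = \int[m]_p \int[m]_q mutual p q)%E.
Proof.
have mku : measurable_fun setT (fun x : T * (R * R) => (kap x)%:E * u x.2)%E.
  by apply: emeasurable_funM => //; exact: (measurableT_comp nu.1 measurable_snd).
have ku0 (x : T * (R * R)) : (0 <= (kap x)%:E * u x.2)%E.
  by rewrite mule_ge0 ?lee_fin//; exact: nu.2.
transitivity (I2 (fun y => \int[m]_p ((kap (p, y))%:E * u y))%E).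
  apply: (congr1 (@I2 R)); apply/funext => y; rewrite ge0_integralZr//.
  - exact: (measurable_fun_pair1 y mkE).
  - by move=> p _; rewrite lee_fin.
  - exact: nu.2.
rewrite -(I2_param_swap m mku ku0); apply: eq_integral => p _.
have mkk : measurable_fun setT (fun x : T * (R * R) => (kap (p, x.2) * kap x)%:E).
  by apply/measurable_EFinP; apply: measurable_funM => //; exact: (measurableT_comp (mk p) measurable_snd).
have kk0 (x : T * (R * R)) : (0 <= (kap (p, x.2) * kap x)%:E)%E by rewrite lee_fin mulr_ge0.
rewrite /mutual (I2_param_swap m mkk kk0); apply: (congr1 (@I2 R)); apply/funext => y.
rewrite /u /= -ge0_integralZl//.
- exact: (measurable_fun_pair1 y mkE).
- by move=> q _; rewrite lee_fin.
- by rewrite lee_fin.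
Qed.

(** With the potential [u y] defined as the integral of [kap (p, y)] over [p], the
    left-hand side is the integral of [sg * u], and the square of [u] integrates to
    the mutual energy by Tonelli. The inequality is then that of Cauchy and
    Schwarz, proved through the weighted inequality between arithmetic and
    geometric means so that [u] may take infinite values. *)
Lemma energy_bound (A e : R) : 0 < A -> 0 < e ->
  (I2 (fun y => (sg y ^+ 2)%:E) <= A%:E)%E ->
  (\int[m]_p \int[m]_q mutual p q <= e%:E)%E ->
  (\int[m]_p I2 (fun y => (sg y * kap (p, y))%:E) <= (Num.sqrt (A * e))%:E)%E.
Proof.
move=> A0 e0 hA he; have [l l0 <-] := sqrt_amgm A0 e0.
have msk : measurable_fun setT (fun x : T * (R * R) => (sg x.2 * kap x)%:E).
  by apply/measurable_EFinP; apply: measurable_funM => //; exact: (measurableT_comp msg measurable_snd).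
have sk0 (x : T * (R * R)) : (0 <= (sg x.2 * kap x)%:E)%E by rewrite lee_fin mulr_ge0.
rewrite (I2_param_swap m msk sk0).
have nsg2 : nneg_meas (fun y => (sg y ^+ 2)%:E).
  by apply: nneg_meas_EFin => [|p]; [exact: measurable_funX|exact: sqr_ge0].
have nuu : nneg_meas (fun y => u y * u y)%E.
  split; first by apply: emeasurable_funM; exact: nu.1.
  by move=> y; rewrite mule_ge0//; exact: nu.2.
have l2 : 0 <= l / 2 by rewrite divr_ge0// ltW.
have il : 0 <= 1 / (2 * l) by rewrite divr_ge0// mulr_ge0// ltW.
have nZ (k : R) F : 0 <= k -> nneg_meas F -> nneg_meas (fun y => k%:E * F y)%E.
  move=> k0 [mF F0]; split; first exact: measurable_funeM.
  by move=> y; rewrite mule_ge0// lee_fin.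
apply: (@le_trans _ _ (I2 (fun y => (l / 2)%:E * (sg y ^+ 2)%:E + (1 / (2 * l))%:E * (u y * u y)))%E).
  apply: I2_le.
  - exact: (nneg_meas_param_integral m msk sk0).
  - split; first by apply: emeasurable_funD; [exact: (nZ _ _ l2 nsg2).1|exact: (nZ _ _ il nuu).1].
    by move=> y; rewrite adde_ge0//; [exact: (nZ _ _ l2 nsg2).2|exact: (nZ _ _ il nuu).2].
  move=> y; rewrite [X in (X <= _)%E](_ : _ = ((sg y)%:E * u y)%E).
    by apply: ereal_amgm => //; exact: nu.2.
  rewrite /u -ge0_integralZl//.
  - exact: (measurable_fun_pair1 y mkE).
  - by move=> p _; rewrite lee_fin.
  - by rewrite lee_fin.
rewrite I2D; [|exact: nZ|exact: nZ].
rewrite (I2Zl l2 nsg2) (I2Zl il nuu) I2_usquare EFinD !EFinM.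
by apply: leeD; apply: lee_wpmul2l => //; rewrite lee_fin.
Qed.

End energy.

Lemma convex_between (R : realType) (s x y lo hi : R) : 0 <= s -> s <= 1 ->
  lo <= y -> y <= x -> x <= hi -> lo <= (1 - s) * x + s * y <= hi.
Proof. by move=> s0 s1 ly yx xh; apply/andP; split; nra. Qed.

Lemma uniform_weight (R : realType) (c : \bar R) : (0 <= c)%E ->
  measurable_fun setT (fun a : R => (2 * \1_(`[1/2, 1]) a)%:E * c)%E /\
  (\int[@lebesgue_measure R]_a ((2 * \1_(`[1/2, 1]) a)%:E * c) = c)%E.
Proof.
move=> c0; have m1 : measurable_fun setT (fun a : R => (2 * \1_(`[1/2, 1]) a : R)%:E).
  apply/measurable_EFinP; apply: measurable_funM; first exact: measurable_cst.
  by apply: measurable_fun_itv_indic; exact: measurable_id.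
split; first by apply: emeasurable_funM => //; exact: measurable_cst.
have i0 (a : R) : setT a -> (0 <= (2 * \1_(`[1/2, 1]) a : R)%:E)%E.
  by rewrite lee_fin mulr_ge0 ?indic_ge0.
rewrite (ge0_integralZr (@lebesgue_measure R) measurableT m1 i0 c0).
rewrite (@integral_indic_itv R (1/2) 1 2); [|exact: ler0n|lra].
by rewrite (_ : 2 * (1 - 1 / 2) = 1 :> R) ?mul1e//; field.
Qed.

(** * The pencil of rays through a corner *)

Section radial_segments.
Variable R : realType.
Local Notation mu := (@lebesgue_measure R).
Variables (sg : R * R -> R) (T r0 r1 A : R).
Hypothesis msg : measurable_fun setT sg.
Hypothesis sg0 : forall p, 0 <= sg p.
Hypothesis T0 : 0 < T.
Hypothesis r1_gt0 : 0 < r1.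
Hypothesis r10 : r1 <= r0.
Hypothesis A0 : 0 < A.
Hypothesis sgA : (I2 (fun y => (sg y ^+ 2)%:E) <= A%:E)%E.

(** Density of the slope of a ray whose angle is uniform in [- atan T, atan T]. *)
Definition angular_weight (t : R) : R := \1_(`[- T, T]) t * (1 + t ^+ 2)^-1 / (2 * atan T).
Local Notation w := angular_weight.

(** Joint law of an abscissa uniform on [1/2, 1] and an independent slope. Spreading
    the abscissa gives the end points of the rays a density in the plane, as
    is needed when they are joined to other points. *)
Definition pencil_weight (z : R * R) : R := 2 * \1_(`[1/2, 1]) z.1 * w z.2.

Definition pencil (r : R) (z : R * R) : R * R := (r * z.1, r * (z.1 * z.2)).

Lemma atan_gt0 : 0 < atan T.
Proof. by rewrite -[ltLHS](@atan0 R) lt_atan. Qed.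

Let D0 (t : R) : 0 < 1 + t ^+ 2. Proof. by rewrite ltr_pwDl// sqr_ge0. Qed.

Lemma angular_weight_ge0 t : 0 <= w t.
Proof.
rewrite /w divr_ge0//; last by rewrite mulr_ge0// ltW// atan_gt0.
by rewrite mulr_ge0 ?indic_ge0// invr_ge0 ltW.
Qed.

Lemma measurable_add1_sqr d' (X : measurableType d') (f : X -> R) : measurable_fun setT f ->
  measurable_fun setT (fun x => 1 + f x ^+ 2).
Proof. by move=> mf; apply: measurable_funD => //; exact: measurable_funX. Qed.

Lemma measurable_angular_weight d' (X : measurableType d') (f : X -> R) : measurable_fun setT f ->
  measurable_fun setT (fun x => w (f x)).
Proof.
move=> mf; apply: measurable_funM => //; apply: measurable_funM.
  exact: measurable_fun_itv_indic.
by apply: measurable_funV; exact: measurable_add1_sqr.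
Qed.

Lemma measurable_pencil r d' (X : measurableType d') (f : X -> R * R) : measurable_fun setT f ->
  measurable_fun setT (fun x => pencil r (f x)).
Proof.
move=> mf; have m1 := measurable_fun_coord1 mf; have m2 := measurable_fun_coord2 mf.
have mr : measurable_fun setT (fun _ : X => r) by exact: measurable_cst.
apply: measurable_fun_pair; first exact: measurable_funM.
by apply: measurable_funM; [exact: mr|exact: measurable_funM].
Qed.

Lemma measurable_pencil_weight d' (X : measurableType d') (f : X -> R * R) : measurable_fun setT f ->
  measurable_fun setT (fun x => pencil_weight (f x)).
Proof.
move=> mf; have m1 := measurable_fun_coord1 mf; have m2 := measurable_fun_coord2 mf.
apply: measurable_funM; last exact: measurable_angular_weight.
apply: measurable_funM; first exact: measurable_cst.
exact: measurable_fun_itv_indic.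
Qed.

Lemma pencil_weight_ge0 z : 0 <= pencil_weight z.
Proof. by rewrite mulr_ge0 ?angular_weight_ge0// mulr_ge0 ?indic_ge0. Qed.

Lemma measurable_pencil_Seg d' (X : measurableType d') (f : X -> R * R) : measurable_fun setT f ->
  measurable_fun setT (fun x => Seg sg (pencil r0 (f x)) (pencil r1 (f x))).
Proof.
by move=> mf; apply: measurable_Seg; [exact: msg|exact: sg0|exact: measurable_pencil|exact: measurable_pencil].
Qed.

Let J (z : R * R) : R :=
  \1_(`[r1 / 2, r0]) z.1 * (Num.sqrt (1 + z.2 ^+ 2) * sg (z.1, z.2 * z.1)).

Let J_ge0 z : 0 <= J z.
Proof. by rewrite /J mulr_ge0 ?indic_ge0// mulr_ge0// sqrtr_ge0. Qed.

Let mpt : measurable_fun setT (fun z : R * R => (z.1, z.2 * z.1)).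
Proof.
apply: measurable_fun_pair; first exact: measurable_fst.
by apply: measurable_funM; [exact: measurable_snd|exact: measurable_fst].
Qed.

Let mJ : measurable_fun setT J.
Proof.
apply: measurable_funM; first by apply: measurable_fun_itv_indic; exact: measurable_fst.
apply: measurable_funM; last exact: (measurableT_comp msg mpt).
by apply: measurable_fun_sqrt; apply: measurable_add1_sqr; exact: measurable_snd.
Qed.

Let Seg_le a t : 1 / 2 <= a <= 1 ->
  (Seg sg (pencil r0 (a, t)) (pencil r1 (a, t)) <= \int[mu]_x (J (x, t))%:E)%E.
Proof.
move=> /andP[a2 a1]; have a0 : 0 < a by lra.
have J0 : (0 <= \int[mu]_x (J (x, t))%:E)%E by apply: integral_ge0 => x _; rewrite lee_fin.
set P := pencil r0 _; set Q := pencil r1 _.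
pose k := (r1 - r0) * a.
have nPQ : pnorm (Q - P)%R = `|k| * Num.sqrt (1 + t ^+ 2).
  have -> : Q - P = (k * 1, k * t) by rewrite /k /Q /P /pencil; congr pair => /=; ring.
  by rewrite (pnormZ k (1, t)) pnormE /= expr1n.
have lPQ s : lerp P Q s = (k * s + r0 * a, t * (k * s + r0 * a)).
  by rewrite /lerp /k /P /Q /pencil; congr pair => /=; ring.
have [k0|kn0] := eqVneq k 0.
  rewrite /Seg (_ : integral _ _ _ = 0%E)//; apply: integral0_eq => s _.
  by rewrite nPQ k0 normr0 !mul0r mulr0.
have kp : 0 < `|k| by rewrite normr_gt0.
have mJt : measurable_fun setT (fun x => (J (x, t))%:E).
  by apply/measurable_EFinP; exact: (measurable_fun_pair1 t mJ).
have Jt0 x : (0 <= (J (x, t))%:E)%E by rewrite lee_fin.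
have mJk : measurable_fun setT (fun s : R => (J (k * s + r0 * a, t))%:E).
  exact: (measurableT_comp mJt (measurable_affine k (r0 * a))).
rewrite -[leRHS](_ : (`|k|%:E * \int[mu]_s (J (k * s + r0 * a, t))%:E)%E = _); last first.
  by rewrite (integral_affine (r0 * a) kn0 mJt Jt0) muleA -EFinM divff ?mul1e// gt_eqF.
have k0' : (0 <= `|k|%:E :> \bar R)%E by rewrite lee_fin.
rewrite -(ge0_integralZl mu measurableT mJk (fun s _ => Jt0 _) k0').
apply: ge0_le_integral.
- exact: measurableT.
- by move=> s _; rewrite lee_fin mulr_ge0 ?indic_ge0// mulr_ge0 ?pnorm_ge0.
- apply/measurable_EFinP; apply: measurable_Seg_integrand => //; exact: measurable_id.
- exact: measurable_funeM.
move=> s _; rewrite -EFinM lee_fin indicE mem_setE in_itv /=.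
case: (boolP (0 < s <= 1)) => [/andP[s0 s1]|_]; last by rewrite mul0r mulr_ge0.
rewrite mul1r nPQ lPQ /J /= -mulrA ler_wpM2l// indicE mem_setE in_itv /=.
have e : k * s + r0 * a = (1 - s) * (r0 * a) + s * (r1 * a) by rewrite /k; ring.
have -> : r1 / 2 <= k * s + r0 * a <= r0; last by rewrite mul1r.
have h1 : r1 * (1 / 2) <= r1 * a by rewrite ler_wpM2l// ltW.
have h2 : r1 * a <= r0 * a by rewrite ler_wpM2r// ltW.
have r0p : 0 <= r0 := ltW (lt_le_trans r1_gt0 r10).
have h3 : r0 * a <= r0 * 1 by rewrite ler_wpM2l.
rewrite e; apply: convex_between => //; [lra|by move: h1; rewrite div1r|by move: h3; rewrite mulr1].
Qed.

Let mwJ : measurable_fun setT (fun z : R * R => w z.2 * J z).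
Proof. by apply: measurable_funM => //; apply: measurable_angular_weight; exact: measurable_snd. Qed.

Let wJ0 (z : R * R) : 0 <= w z.2 * J z.
Proof. by rewrite mulr_ge0 ?angular_weight_ge0. Qed.

Let average_le : (I2 (fun z => (pencil_weight z)%:E * Seg sg (pencil r0 z) (pencil r1 z)) <=
  I2 (fun z => (w z.2 * J z)%:E))%E.
Proof.
set c := I2 (fun z => (w z.2 * J z)%:E).
have nwJ : nneg_meas (fun z => (w z.2 * J z)%:E) by apply: nneg_meas_EFin.
have c0 : (0 <= c)%E by apply: integral_ge0 => x _; apply: integral_ge0 => y _; exact: nwJ.2.
have cE : c = (\int[mu]_t \int[mu]_x (w t * J (x, t))%:E)%E by exact: I2_swap.
have n : nneg_meas (fun z => (pencil_weight z)%:E * Seg sg (pencil r0 z) (pencil r1 z))%E.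
  split; first by apply: emeasurable_funM; [apply/measurable_EFinP; apply: measurable_pencil_weight|apply: measurable_pencil_Seg];
    exact: measurable_id.
  move=> z; apply: mule_ge0; last exact: Seg_ge0.
  by rewrite lee_fin pencil_weight_ge0.
have [mi <-] := uniform_weight c0.
apply: ge0_le_integral.
- exact: measurableT.
- by move=> a _; apply: integral_ge0 => t _; exact: n.2.
- exact: (nneg_meas_inner n).
- exact: mi.
move=> a _; rewrite /pencil_weight /= indicE mem_setE in_itv /=.
have [ain|_] := boolP (1 / 2 <= a <= 1); last first.
  rewrite mulr0 mul0e (_ : integral _ _ _ = 0%E); [exact: lexx|].
  by apply: integral0_eq => t _; rewrite mul0r mul0e.
rewrite mulr1 cE.
have mJi : measurable_fun setT (fun t => \int[mu]_x (w t * J (x, t))%:E)%E.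
  exact: (nneg_meas_inner (nneg_meas_comp nwJ (@measurable_swap_pair R))).
have Ji0 t : (0 <= \int[mu]_x (w t * J (x, t))%:E)%E.
  by apply: integral_ge0 => x _; exact: (nwJ.2 (x, t)).
have two0 : (0 <= 2%:E :> \bar R)%E by rewrite lee_fin.
rewrite -(ge0_integralZl mu measurableT mJi (fun x _ => Ji0 x) two0).
have mat : measurable_fun setT (fun t : R => (a, t)) by exact: measurable_fun_pair.
apply: ge0_le_integral.
- exact: measurableT.
- move=> t _; apply: mule_ge0; last exact: Seg_ge0.
  by rewrite lee_fin; apply: mulr_ge0; [exact: ler0n|exact: angular_weight_ge0].
- apply: emeasurable_funM; last exact: measurable_pencil_Seg.
  apply/measurable_EFinP; apply: measurable_funM; first exact: measurable_cst.
  by apply: measurable_angular_weight; exact: measurable_id.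
- exact: measurable_funeM.
move=> t _; rewrite EFinM -muleA; apply: lee_wpmul2l; first exact: two0.
have w0 : (0 <= (w t)%:E)%E by rewrite lee_fin angular_weight_ge0.
have mJt : measurable_fun setT (fun x => (J (x, t))%:E).
  by apply/measurable_EFinP; exact: (measurable_fun_pair1 t mJ).
have Jt0 (x : R) : setT x -> (0 <= (J (x, t))%:E)%E by move=> _; rewrite lee_fin.
have -> : (\int[mu]_x (w t * J (x, t))%:E = (w t)%:E * \int[mu]_x (J (x, t))%:E)%E.
  by rewrite -(ge0_integralZl mu measurableT mJt Jt0 w0).
by apply: lee_wpmul2l; [exact: w0|exact: Seg_le].
Qed.

Let F1 (z : R * R) : R := \1_(`[r1 / 2, r0]) z.1 * (z.1 * sg (z.1, z.2 * z.1) ^+ 2).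
Let F2 (z : R * R) : R := \1_(`[r1 / 2, r0]) z.1 * z.1^-1 * (w z.2 ^+ 2 * (1 + z.2 ^+ 2)).

Let nF1 : nneg_meas (fun z => (F1 z)%:E).
Proof.
apply: nneg_meas_EFin.
  apply: measurable_funM; first by apply: measurable_fun_itv_indic; exact: measurable_fst.
  apply: measurable_funM; first exact: measurable_fst.
  by apply: measurable_funX; exact: (measurableT_comp msg mpt).
move=> z; rewrite /F1 indicE mem_setE in_itv /=; case: (boolP (_ <= _ <= _)) => [/andP[h _]|_].
  by rewrite mul1r mulr_ge0 ?sqr_ge0//; apply: le_trans h; rewrite divr_ge0// ltW.
by rewrite mul0r.
Qed.

Let nF2 : nneg_meas (fun z => (F2 z)%:E).
Proof.
apply: nneg_meas_EFin.
  apply: measurable_funM.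
    apply: measurable_funM; first by apply: measurable_fun_itv_indic; exact: measurable_fst.
    by apply: measurable_funV; exact: measurable_fst.
  apply: measurable_funM; last by apply: measurable_add1_sqr; exact: measurable_snd.
  by apply: measurable_funX; apply: measurable_angular_weight; exact: measurable_snd.
move=> z; rewrite /F2 mulr_ge0//; last by rewrite mulr_ge0 ?sqr_ge0// ltW.
rewrite indicE mem_setE in_itv /=; case: (boolP (_ <= _ <= _)) => [/andP[h _]|_].
  by rewrite mul1r invr_ge0; apply: le_trans h; rewrite divr_ge0// ltW.
by rewrite mul0r.
Qed.

Let I2_F1 : (I2 (fun z => (F1 z)%:E) <= A%:E)%E.
Proof.
have nsg2 : nneg_meas (fun y => (sg y ^+ 2)%:E).
  by apply: nneg_meas_EFin => [|p]; [exact: measurable_funX|exact: sqr_ge0].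
apply: le_trans sgA; apply: ge0_le_integral.
- exact: measurableT.
- by move=> x _; apply: integral_ge0 => t _; exact: nF1.2.
- exact: (nneg_meas_inner nF1).
- exact: (nneg_meas_inner nsg2).
move=> x _; rewrite /F1 /= indicE mem_setE in_itv /=.
case: (boolP (r1 / 2 <= x <= r0)) => [/andP[h _]|_]; last first.
  rewrite (_ : integral _ _ _ = 0%E); first by apply: integral_ge0 => y _; exact: nsg2.2.
  by apply: integral0_eq => y _; rewrite mul0r.
have x0 : 0 < x by apply: lt_le_trans h; rewrite divr_gt0.
have msx : measurable_fun setT (fun y => (sg (x, y) ^+ 2)%:E) by exact: (measurable_fun_pair2 x nsg2.1).
have sx0 y : (0 <= (sg (x, y) ^+ 2)%:E)%E by exact: (nsg2.2 (x, y)).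
have xn0 : x != 0 by rewrite gt_eqF.
have msx' : measurable_fun setT (fun t : R => (sg (x, x * t + 0) ^+ 2)%:E).
  exact: (measurableT_comp msx (measurable_affine x 0)).
have x0' : (0 <= x%:E)%E by rewrite lee_fin ltW.
have e := integral_affine 0 xn0 msx sx0.
rewrite (_ : (\int[mu]_y (1 * (x * sg (x, y * x) ^+ 2))%:E =
   x%:E * \int[mu]_t (sg (x, x * t + 0) ^+ 2)%:E)%E).
  by rewrite e gtr0_norm// muleA -EFinM divff// mul1e.
rewrite -(ge0_integralZl mu measurableT msx' (fun x _ => sx0 _) x0').
by apply: eq_integral => t _; rewrite mul1r addr0 mulrC EFinM muleC [t * x]mulrC.
Qed.

Let I2_F2 : (I2 (fun z => (F2 z)%:E) = (ln (2 * r0 / r1) / (2 * atan T))%:E)%E.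
Proof.
have aT := atan_gt0.
have iw : (\int[mu]_t (w t ^+ 2 * (1 + t ^+ 2))%:E = ((2 * atan T)^-1)%:E)%E.
  have E t : w t ^+ 2 * (1 + t ^+ 2) = (2 * atan T) ^- 2 * (\1_(`[- T, T]) t * (1 + t ^+ 2)^-1).
    have i2 : \1_(`[- T, T]) t ^+ 2 = \1_(`[- T, T]) t :> R.
      by rewrite indicE; case: (_ \in _); rewrite ?expr1n ?expr0n.
    rewrite /w exprMn [_ ^+ 2 * _]mulrC exprMn i2 exprVn.
    by field; rewrite !gt_eqF.
  under eq_integral do rewrite E EFinM.
  rewrite ge0_integralZl//; last 3 first.
  - apply/measurable_EFinP; apply: measurable_funM; first exact: measurable_indic.
    by apply: measurable_funV; apply: measurable_add1_sqr; exact: measurable_id.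
  - by move=> t _; rewrite lee_fin mulr_ge0 ?indic_ge0// invr_ge0 ltW.
  - by rewrite lee_fin invr_ge0 sqr_ge0.
  rewrite integral_indicM integral_atan// -EFinM; congr EFin.
  by field; rewrite gt_eqF.
have r12 : 0 < r1 / 2 by rewrite divr_gt0.
have r00 : 0 < r0 by exact: lt_le_trans r10.
have mw2 : measurable_fun setT (fun t : R => (w t ^+ 2 * (1 + t ^+ 2))%:E).
  apply/measurable_EFinP; apply: measurable_funM; last by apply: measurable_add1_sqr; exact: measurable_id.
  by apply: measurable_funX; apply: measurable_angular_weight; exact: measurable_id.
have w20 (t : R) : (0 <= (w t ^+ 2 * (1 + t ^+ 2))%:E)%E by rewrite lee_fin mulr_ge0 ?sqr_ge0// ltW.
have i0 (x : R) : 0 <= \1_(`[r1 / 2, r0]) x * x^-1.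
  rewrite indicE mem_setE in_itv /=; case: (boolP (_ <= _ <= _)) => [/andP[h _]|_]; last by rewrite mul0r.
  by rewrite mul1r invr_ge0; apply: le_trans h; exact: ltW.
transitivity (\int[mu]_x ((\1_(`[r1 / 2, r0]) x * x^-1)%:E * ((2 * atan T)^-1)%:E))%E.
  apply: eq_integral => x _; rewrite -iw.
  have i0' : (0 <= (\1_(`[r1 / 2, r0]) x * x^-1)%:E)%E by rewrite lee_fin.
  rewrite -(ge0_integralZl mu measurableT mw2 (fun t _ => w20 t) i0').
  by apply: eq_integral => t _; rewrite /F2 /= -EFinM.
rewrite ge0_integralZr//; last 3 first.
- by apply/measurable_EFinP; apply: measurable_funM; [exact: measurable_indic|exact: measurable_invr].
- by move=> x _; rewrite lee_fin.
- by rewrite lee_fin invr_ge0 mulr_ge0// ltW.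
rewrite integral_indicM integral_inv//; last first.
  by apply: le_trans r10; rewrite ler_pdivrMr// ler_pMr//; lra.
rewrite -EFinM; congr EFin; congr (_ * _).
by rewrite -ln_div ?posrE//; congr ln; field; rewrite gt_eqF.
Qed.

(** In the coordinates [(x, t)] of the points [(x, t * x)], where area is
    [x dx dt], the expected length is the integral of the metric against the
    weight [w t * sqrt (1 + t ^ 2)]. The Cauchy-Schwarz inequality leaves the
    integral of [dx / x], the logarithm of the ratio of the scales, times that of
    [w ^ 2 * (1 + t ^ 2)], which equals [1 / (2 * atan T)]: the opening angle of
    the sector, close to [pi] for large [T]. *)
Lemma pencil_average :
  (I2 (fun z => (pencil_weight z)%:E * Seg sg (pencil r0 z) (pencil r1 z)) <=
   (Num.sqrt (A * (ln (2 * r0 / r1) / (2 * atan T))))%:E)%E.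
Proof.
apply: (le_trans average_le).
have e0 : 0 < ln (2 * r0 / r1) / (2 * atan T).
  rewrite divr_gt0//; last by rewrite mulr_gt0// atan_gt0.
  by rewrite ln_gt0// ltr_pdivlMr// mul1r; have := r1_gt0; have := r10; lra.
have [l l0 <-] := sqrt_amgm A0 e0.
have l2 : 0 <= l / 2 by rewrite divr_ge0// ltW.
have il : 0 <= 1 / (2 * l) by rewrite divr_ge0// mulr_ge0// ltW.
have nZ (k : R) F : 0 <= k -> nneg_meas F -> nneg_meas (fun y => k%:E * F y)%E.
  move=> k0 [mF F0]; split; first exact: measurable_funeM.
  by move=> y; rewrite mule_ge0// lee_fin.
apply: (@le_trans _ _ (I2 (fun z => (l / 2)%:E * (F1 z)%:E + (1 / (2 * l))%:E * (F2 z)%:E))%E).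
  apply: I2_le.
  - exact: nneg_meas_EFin.
  - split; first by apply: emeasurable_funD; [exact: (nZ _ _ l2 nF1).1|exact: (nZ _ _ il nF2).1].
    by move=> y; rewrite adde_ge0//; [exact: (nZ _ _ l2 nF1).2|exact: (nZ _ _ il nF2).2].
  move=> [x t]; rewrite -!EFinM -EFinD lee_fin /J /F1 /F2 /= !indicE !mem_setE !in_itv /=.
  case: (boolP (r1 / 2 <= x <= r0)) => [/andP[h _]|_]; last by rewrite !mul0r !mulr0 addr0.
  have x0 : 0 < x by apply: lt_le_trans h; rewrite divr_gt0.
  rewrite !mul1r -{2}[1 + t ^+ 2]sqr_sqrtr; last by rewrite ltW.
  move: (sg _) (Num.sqrt _) (w t) => a b c.
  rewrite -subr_ge0.
  have -> : l / 2 * (x * a ^+ 2) + (2 * l)^-1 * (x^-1 * (c ^+ 2 * b ^+ 2)) - c * (b * a) =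
      (l * x * a - c * b) ^+ 2 / (2 * l * x) by field; rewrite !gt_eqF.
  by rewrite divr_ge0 ?sqr_ge0// !mulr_ge0// ltW.
rewrite I2D; [|exact: nZ|exact: nZ].
rewrite (I2Zl l2 nF1) (I2Zl il nF2) I2_F2 EFinD !EFinM leeD//.
by rewrite lee_wpmul2l ?lee_fin.
Qed.

End radial_segments.

(** * Segments from a set of finite energy to the pencil *)

Section end_segments.
Variable R : realType.
Local Notation mu := (@lebesgue_measure R).

Definition scale (r : R) (p : R * R) : R * R := (r * p.1, r * p.2).

Lemma measurable_scale r : measurable_fun setT (scale r).
Proof.
have mr : measurable_fun [set: R * R] (fun _ : R * R => r) by exact: measurable_cst.
by apply: measurable_fun_pair; exact: measurable_funM.
Qed.

(** The homothety of ratio [r] carries the metric [r * sg (r y)] to [sg],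
    preserving lengths and areas. Each end of the broken line can so be studied
    at unit scale. *)
Lemma Seg_scale (sg : R * R -> R) (r : R) P Q : 0 < r ->
  Seg sg (scale r P) (scale r Q) = Seg (fun y => r * sg (scale r y)) P Q.
Proof.
move=> r0; apply: eq_integral => s _; congr EFin; congr (_ * _).
have -> : scale r Q - scale r P = scale r (Q - P).
  by rewrite /scale; congr pair => /=; ring.
have -> : lerp (scale r P) (scale r Q) s = scale r (lerp P Q s).
  by rewrite /scale /lerp; congr pair => /=; ring.
by rewrite [X in X * _](pnormZ r) gtr0_norm// mulrCA mulrA.
Qed.

Lemma area_scale (sg : R * R -> R) (r : R) : 0 < r -> measurable_fun setT sg ->
  I2 (fun y => ((r * sg (scale r y)) ^+ 2)%:E) = I2 (fun y => (sg y ^+ 2)%:E).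
Proof.
move=> r0 msg; have nsg2 : nneg_meas (fun y => (sg y ^+ 2)%:E).
  by apply: nneg_meas_EFin => [|p]; [exact: measurable_funX|exact: sqr_ge0].
have rn0 : r != 0 by rewrite gt_eqF.
have nS : nneg_meas (fun y => (sg (scale r y) ^+ 2)%:E) := nneg_meas_comp nsg2 (measurable_scale r).
have e := I2_affine 0 0 rn0 rn0 nsg2.
transitivity ((r ^+ 2)%:E * I2 (fun y => (sg (scale r y) ^+ 2)%:E))%E.
  rewrite -(I2Zl (sqr_ge0 r) nS); apply: (congr1 (@I2 R)); apply/funext => y.
  by rewrite exprMn EFinM.
rewrite (_ : (fun y => (sg (scale r y) ^+ 2)%:E) =
  (fun p => (sg (r * p.1 + 0, r * p.2 + 0) ^+ 2)%:E)); last first.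
  by apply/funext => y; rewrite /scale !addr0.
by rewrite e muleA -EFinM -expr2 ger0_norm ?sqr_ge0// divff ?mul1e// expf_neq0.
Qed.

(** The logarithmic kernel normalised to be nonnegative on sets of diameter at
    most 2, and zero off the set, so that Tonelli applies. *)
Definition log_kernel (K0 : set (R * R)) (p q : R * R) : \bar R :=
  if (p \in K0) && (q \in K0) then ((ln 2)%:E - lne (pnorm (p - q)%R)%:E)%E else 0%E.

Lemma pencilE (r : R) z : pencil r z = scale r (z.1, z.1 * z.2).
Proof. by []. Qed.

Variables (m : probability (R * R)%type R) (K0 : set (R * R)) (P : R * R -> R * R).
Hypothesis mK0 : measurable K0.
Hypothesis mP : measurable_fun setT P.
Variables (sg : R * R -> R) (T r R0 A V kappa : R).
Hypothesis msg : measurable_fun setT sg.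
Hypothesis sg0 : forall p, 0 <= sg p.
Hypothesis T0 : 0 < T.
Hypothesis r0 : 0 < r.
Hypothesis R00 : 0 <= R0.
Hypothesis A0 : 0 < A.
Hypothesis sgA : (I2 (fun y => (sg y ^+ 2)%:E) <= A%:E)%E.
Hypothesis PR0 : forall p, K0 p -> pnorm (P p) <= R0.
Hypothesis kappa0 : 0 < kappa.
Hypothesis kappa1 : kappa <= 1.
Hypothesis kappaP : forall p q, K0 p -> K0 q -> kappa * pnorm (p - q) <= pnorm (P p - P q).
Hypothesis V0 : 0 <= V.
Hypothesis diamK0 : forall p q, K0 p -> K0 q -> pnorm (p - q) <= 2.
Hypothesis mlog : measurable_fun setT (fun pq : (R * R) * (R * R) => log_kernel K0 pq.1 pq.2).
Hypothesis VE : (\int[m]_p \int[m]_q log_kernel K0 p q <= V%:E)%E.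

(** Bounds the distance from a point of norm at most [R0] to the end points of
    the pencil at unit scale. *)
Definition spread_radius (R0 T : R) : R := R0 + 1 + T.
Local Notation rho := (spread_radius R0 T).
(** Factor by which the average over the pencil exceeds the Riesz kernel. *)
Definition spread_const (R0 T : R) : R := spread_radius R0 T ^+ 2 / atan T.
Local Notation B := (spread_const R0 T).
Local Notation e := (16 * B ^+ 2 * (1 + ln (rho / kappa) + V)).

Let rho1 : 1 <= rho. Proof. by rewrite /spread_radius; have := R00; have := T0; lra. Qed.
Let B0 : 0 < B. Proof. by rewrite divr_gt0 ?atan_gt0// exprn_gt0// (lt_le_trans _ rho1). Qed.

Let kap (x : (R * R) * (R * R)) : R := \1_K0 x.1 * (B * riesz rho (x.2 - P x.1)).

Let mkap : measurable_fun setT kap.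
Proof.
apply: measurable_funM; first exact: (measurableT_comp (measurable_indic mK0) measurable_fst).
apply: measurable_funM; first exact: measurable_cst.
apply: (measurableT_comp (measurable_riesz rho)); apply: measurable_fun_pB; first exact: measurable_snd.
exact: (measurableT_comp mP measurable_fst).
Qed.

Let kap0 x : 0 <= kap x.
Proof. by rewrite /kap mulr_ge0 ?indic_ge0// mulr_ge0 ?riesz_ge0// ltW. Qed.

Let c0 : 0 <= 1 + ln (rho / kappa).
Proof.
by rewrite addr_ge0// ln_ge0// ler_pdivlMr// mul1r (le_trans kappa1).
Qed.

Lemma log_kernel_ge0 p q : (0 <= log_kernel K0 p q)%E.
Proof.
rewrite /log_kernel; case: ifP => // /andP[/set_mem Kp /set_mem Kq].
have := pnorm_ge0 (p - q); rewrite le_eqVlt => /predU1P[<-|h].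
  by rewrite le0_lneNy// leey.
by rewrite lne_EFin// -EFinB lee_fin subr_ge0 ler_ln ?posrE// diamK0.
Qed.

Let mutual_le p q : (I2 (fun y => (kap (p, y) * kap (q, y))%:E) <=
  (16 * B ^+ 2)%:E * ((1 + ln (rho / kappa))%:E * (\1_K0 p * \1_K0 q)%:E + log_kernel K0 p q))%E.
Proof.
have C0 : 0 <= 16 * B ^+ 2 by rewrite mulr_ge0// sqr_ge0.
have [Kpq|Kpq] := boolP ((p \in K0) && (q \in K0)); last first.
  rewrite [X in (X <= _)%E](_ : _ = 0%E).
    rewrite mule_ge0 ?lee_fin// adde_ge0 ?log_kernel_ge0// -EFinM lee_fin.
    by rewrite mulr_ge0// mulr_ge0// indic_ge0.
  apply: integral0_eq => x _; apply: integral0_eq => y _; rewrite /kap /= !indicE.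
  by move: Kpq; rewrite negb_and => /orP[] /negbTE ->; rewrite !mul0r ?mulr0.
rewrite /log_kernel Kpq; move: Kpq => /andP[Kp Kq].
have := pnorm_ge0 (p - q); rewrite le_eqVlt => /predU1P[<-|h].
  rewrite le0_lneNy// !indicE Kp Kq /= addey// gt0_muley ?leey//.
  by rewrite lte_fin mulr_gt0// exprn_gt0.
have h' : 0 < pnorm (P p - P q).
  by apply: lt_le_trans (kappaP (set_mem Kp) (set_mem Kq)); rewrite mulr_gt0.
have h'' : pnorm (P p - P q) <= 2 * rho.
  have := pnormD (P p) (- P q); rewrite pnormN.
  have := PR0 (set_mem Kp); have := PR0 (set_mem Kq); have := T0; rewrite /spread_radius; lra.
have rr0 : 0 < rho by exact: lt_le_trans rho1.
have -> : (fun y => (kap (p, y) * kap (q, y))%:E) =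
    (fun y => (B ^+ 2)%:E * (riesz rho (y - P p) * riesz rho (y - P q))%:E)%E.
  by apply/funext => y; rewrite /kap /= !indicE Kp Kq /= !mul1r -EFinM; congr EFin; ring.
have nrr : nneg_meas (fun y => (riesz rho (y - P p) * riesz rho (y - P q))%:E).
  have mr (Q : R * R) : measurable_fun setT (fun y : R * R => riesz rho (y - Q)).
    apply: (measurableT_comp (measurable_riesz rho)); apply: measurable_fun_pB; first exact: measurable_id.
    exact: measurable_cst.
  by apply: nneg_meas_EFin => [|y]; [exact: measurable_funM|rewrite mulr_ge0 ?riesz_ge0].
rewrite (I2Zl (sqr_ge0 B) nrr).
apply: le_trans (lee_wpmul2l _ (riesz_convolution h' h'')) _; first by rewrite lee_fin sqr_ge0.
rewrite lne_EFin// !indicE Kp Kq /= mulr1 mule1 -EFinB -EFinD -!EFinM lee_fin.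
rewrite [B ^+ 2 * _]mulrA [B ^+ 2 * 16]mulrC ler_wpM2l//.
rewrite -addrA lerD2l -lnV ?posrE// -!lnM ?posrE ?invr_gt0 ?mulr_gt0 ?divr_gt0 ?invr_gt0//.
rewrite ler_ln ?posrE ?divr_gt0 ?mulr_gt0 ?divr_gt0 ?invr_gt0//.
rewrite ler_pdivrMr//.
have -> : rho / kappa * (2 / pnorm (p - q)) * pnorm (P p - P q) =
  2 * rho * (pnorm (P p - P q) / (kappa * pnorm (p - q))) by field; rewrite !gt_eqF.
rewrite ler_pMr ?mulr_gt0// ler_pdivlMr ?mulr_gt0// mul1r.
exact: kappaP (set_mem Kp) (set_mem Kq).
Qed.

Lemma spread_energy_gt0 : 0 < e.
Proof.
apply: mulr_gt0.
  by apply: mulr_gt0; [rewrite ltr0n|apply: exprn_gt0; exact: B0].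
have : 0 <= ln (rho / kappa) by rewrite ln_ge0// ler_pdivlMr// mul1r (le_trans kappa1).
have := V0; lra.
Qed.

Let mutual_energy : (\int[m]_p \int[m]_q I2 (fun y => (kap (p, y) * kap (q, y))%:E) <= e%:E)%E.
Proof.
have mm := measurable_mutual mkap kap0.
have mi : measurable_fun setT (fun q : R * R => \1_K0 q : R) := measurable_indic mK0.
pose W (pq : (R * R) * (R * R)) : \bar R :=
  ((1 + ln (rho / kappa))%:E * (\1_K0 pq.1 * \1_K0 pq.2)%:E + log_kernel K0 pq.1 pq.2)%E.
have mW1 : measurable_fun setT (fun pq : (R * R) * (R * R) => ((1 + ln (rho / kappa))%:E * (\1_K0 pq.1 * \1_K0 pq.2)%:E)%E).
  apply: measurable_funeM; apply/measurable_EFinP; apply: measurable_funM.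
    exact: (measurableT_comp mi measurable_fst).
  exact: (measurableT_comp mi measurable_snd).
have W10 pq : (0 <= ((1 + ln (rho / kappa))%:E * (\1_K0 pq.1 * \1_K0 pq.2)%:E)%E)%E.
  by rewrite -EFinM lee_fin mulr_ge0// mulr_ge0// indic_ge0.
have mW : measurable_fun setT W by exact: emeasurable_funD.
have W0 pq : (0 <= W pq)%E by rewrite adde_ge0 ?log_kernel_ge0.
have lin pq : (0 <= log_kernel K0 pq.1 pq.2)%E by exact: log_kernel_ge0.
have B20 : 0 <= 16 * B ^+ 2 by rewrite mulr_ge0// sqr_ge0.
have F2 (f : (R * R) * (R * R) -> \bar R) : measurable_fun setT f -> (forall x, 0 <= f x)%E ->
   (\int[m \x m]_x f x = \int[m]_p \int[m]_q f (p, q))%E.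
  by move=> mf f0; exact: (@fubini_tonelli1 _ _ _ _ R m m f mf f0).
rewrite -(F2 (fun x => I2 (fun y => (kap (x.1, y) * kap (x.2, y))%:E)))//; last first.
  by move=> x; apply: integral_ge0 => y _; apply: integral_ge0 => z _; rewrite lee_fin mulr_ge0.
apply: (@le_trans _ _ (\int[m \x m]_x ((16 * B ^+ 2)%:E * W x))%E).
  apply: ge0_le_integral.
  - exact: measurableT.
  - by move=> x _; apply: integral_ge0 => y _; apply: integral_ge0 => z _; rewrite lee_fin mulr_ge0.
  - exact: mm.
  - exact: measurable_funeM.
  by move=> x _; exact: mutual_le.
rewrite ge0_integralZl//.
rewrite [leRHS]EFinM lee_wpmul2l ?lee_fin//.
rewrite /W ge0_integralD// [leRHS]EFinD; apply: leeD; last first.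
  by rewrite (F2 (fun x => log_kernel K0 x.1 x.2)).
have mii : measurable_fun setT (fun pq : (R * R) * (R * R) => (\1_K0 pq.1 * \1_K0 pq.2 : R)%:E).
  apply/measurable_EFinP; apply: measurable_funM.
    exact: (measurableT_comp mi measurable_fst).
  exact: (measurableT_comp mi measurable_snd).
have ii0 (pq : (R * R) * (R * R)) : setT pq -> (0 <= (\1_K0 pq.1 * \1_K0 pq.2 : R)%:E)%E.
  by rewrite lee_fin mulr_ge0// indic_ge0.
have c0' : (0 <= (1 + ln (rho / kappa))%:E)%E by rewrite lee_fin.
rewrite (ge0_integralZl (m \x m)%E measurableT mii ii0 c0').
rewrite -[leRHS]mule1 lee_wpmul2l ?lee_fin//.
have -> : (1 = (m \x m) setT)%E.
  have m1 : (m setT = 1)%E := probability_setT m.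
  rewrite -setXTT; transitivity (m setT * m setT)%E; first by rewrite m1 mule1.
  by apply/esym; exact: product_measure1E.
rewrite -[leRHS]mul1e -(integral_cst (m \x m)%E measurableT 1).
apply: ge0_le_integral.
- exact: measurableT.
- exact: ii0.
- exact: mii.
- exact: measurable_cst.
by move=> x _; rewrite lee_fin !indicE; do 2 case: (_ \in _); rewrite ?mulr0 ?mulr1.
Qed.

Let sgr (y : R * R) : R := r * sg (scale r y).

Let msgr : measurable_fun setT sgr.
Proof.
apply: measurable_funM; first exact: measurable_cst.
exact: (measurableT_comp msg (measurable_scale r)).
Qed.

Let sgr0 y : 0 <= sgr y. Proof. by rewrite mulr_ge0// ltW. Qed.

Let average_le p : K0 p ->
  (I2 (fun z => (pencil_weight T z)%:E * Seg sg (scale r (P p)) (pencil r z)) <=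
   I2 (fun y => (sgr y * kap (p, y))%:E))%E.
Proof.
move=> Kp; have aT := atan_gt0 T0.
pose wt (z : R * R) : R := \1_(`[1/2, 1]) z.1 * \1_(`[- T, T]) z.2.
pose pt (z : R * R) := (z.1, z.1 * z.2).
have mS : measurable_fun setT (fun z => Seg sgr (P p) (pt z)).
  by apply: (measurable_Seg msgr sgr0); [exact: measurable_cst|exact: measurable_pt].
have nS : nneg_meas (fun z => (wt z)%:E * Seg sgr (P p) (pt z))%E.
  split; first by apply: emeasurable_funM => //; apply/measurable_EFinP; exact: measurable_weight.
  by move=> z; rewrite mule_ge0 ?Seg_ge0// lee_fin mulr_ge0 ?indic_ge0.
have iT : 0 <= (atan T)^-1 by rewrite invr_ge0 ltW.
apply: (@le_trans _ _ (I2 (fun z => (atan T)^-1%:E * ((wt z)%:E * Seg sgr (P p) (pt z))))%E).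
  apply: I2_le.
  - split=> [|z]; last by rewrite mule_ge0 ?Seg_ge0// lee_fin pencil_weight_ge0.
    apply: emeasurable_funM.
      by apply/measurable_EFinP; apply: measurable_pencil_weight; exact: measurable_id.
    apply: (measurable_Seg msg sg0); first exact: measurable_cst.
    by apply: measurable_pencil; exact: measurable_id.
  - split; first by apply: measurable_funeM; exact: nS.1.
    by move=> z; rewrite mule_ge0 ?lee_fin//; exact: nS.2.
  move=> z; rewrite pencilE Seg_scale// muleA -EFinM.
  apply: lee_wpmul2r; first exact: Seg_ge0.
  rewrite lee_fin /pencil_weight /angular_weight /wt.
  have h : (1 + z.2 ^+ 2)^-1 <= 1 by rewrite invf_le1 ?ltr_pwDl ?sqr_ge0// lerDl sqr_ge0.
  have -> : 2 * \1_(`[1/2, 1]) z.1 * (\1_(`[- T, T]) z.2 * (1 + z.2 ^+ 2)^-1 / (2 * atan T)) =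
    ((atan T)^-1 * (\1_(`[1/2, 1]) z.1 * \1_(`[- T, T]) z.2)) * (1 + z.2 ^+ 2)^-1.
    by field; rewrite !gt_eqF// ltr_pwDl ?sqr_ge0.
  by rewrite ler_piMr// mulr_ge0// mulr_ge0 ?indic_ge0.
rewrite (I2Zl iT nS).
apply: (@le_trans _ _ ((atan T)^-1%:E * I2 (fun y => (rho ^+ 2 * (sgr y * riesz rho (y - P p)))%:E))%E).
  by rewrite lee_wpmul2l ?lee_fin//; exact: (Seg_average msgr sgr0 T0 (PR0 Kp)).
rewrite -(I2Zl iT); last first.
  apply: nneg_meas_EFin => [|y]; last by rewrite mulr_ge0 ?sqr_ge0// mulr_ge0// riesz_ge0.
  apply: measurable_funM; first exact: measurable_cst.
  apply: measurable_funM => //; apply: (measurableT_comp (measurable_riesz rho)).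
  by apply: measurable_fun_pB; [exact: measurable_id|exact: measurable_cst].
rewrite le_eqVlt; apply/orP; left; apply/eqP; apply: (congr1 (@I2 R)); apply/funext => y.
rewrite -EFinM; congr EFin; rewrite /kap /= indicE mem_set// mul1r /spread_const.
by move: (sgr y) (riesz _ _) => a b; field; rewrite gt_eqF.
Qed.

(** Averaging over the end point in the pencil replaces each segment by a Riesz
    kernel at [P p]. The mutual energy of two such kernels is logarithmic in
    [|P p - P q|], hence in [|p - q|] up to [- ln kappa], and it is finite on average
    over [p] and [q] because the probability has finite energy. *)
Lemma end_segment_average :
  (\int[m]_p ((\1_K0 p)%:E * I2 (fun z => (pencil_weight T z)%:E * Seg sg (scale r (P p)) (pencil r z)))
   <= (Num.sqrt (A * e))%:E)%E.
Proof.
have hA : (I2 (fun y => (sgr y ^+ 2)%:E) <= A%:E)%E by rewrite area_scale.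
apply: le_trans (energy_bound msgr sgr0 mkap kap0 A0 spread_energy_gt0 hA mutual_energy).
have mF : measurable_fun setT (fun x : (R * R) * (R * R) =>
    (pencil_weight T x.2)%:E * Seg sg (scale r (P x.1)) (pencil r x.2))%E.
  apply: emeasurable_funM.
    by apply/measurable_EFinP; apply: measurable_pencil_weight; exact: measurable_snd.
  apply: (measurable_Seg msg sg0); last by apply: measurable_pencil; exact: measurable_snd.
  apply: (measurableT_comp (measurable_scale r)); exact: (measurableT_comp mP measurable_fst).
have F0 (x : (R * R) * (R * R)) : (0 <= (pencil_weight T x.2)%:E * Seg sg (scale r (P x.1)) (pencil r x.2))%E.
  by rewrite mule_ge0 ?Seg_ge0// lee_fin pencil_weight_ge0.
have I0 (p : R * R) : (0 <= I2 (fun z => (pencil_weight T z)%:E * Seg sg (scale r (P p)) (pencil r z)))%E.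
  by apply: integral_ge0 => x _; apply: integral_ge0 => y _; exact: (F0 (p, (x, y))).
apply: ge0_le_integral.
- exact: measurableT.
- by move=> p _; rewrite mule_ge0// lee_fin indic_ge0.
- apply: emeasurable_funM; first by apply/measurable_EFinP; exact: measurable_indic.
  exact: (measurable_I2_param mF F0).
- have ms : measurable_fun setT (fun x : (R * R) * (R * R) => (sgr x.2 * kap x)%:E).
    apply/measurable_EFinP; apply: measurable_funM => //.
    exact: (measurableT_comp msgr measurable_snd).
  apply: (measurable_I2_param ms) => x; by rewrite lee_fin mulr_ge0.
move=> p _; rewrite indicE; case: (boolP (p \in K0)) => [/set_mem Kp|_].
  by rewrite mul1e; exact: average_le.
rewrite mul0e; apply: integral_ge0 => x _; apply: integral_ge0 => y _.
by rewrite lee_fin mulr_ge0.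
Qed.

End end_segments.

(** * Arc length and integrals along curves *)

Section arc_length.
Variable R : realType.
Implicit Types (g : R -> cplane R) (s t : R).

Lemma cvariation_rcons g (a b b' : R) (l : seq R) :
  cvariation a b' g (rcons l b') = cvariation a b g l + modulus (g b' - g (last a l)).
Proof.
rewrite /cvariation /= size_rcons big_nat_recr//=; congr (_ + modulus (g _ - g _)).
- apply: eq_big_nat => i /andP[_ il]; congr (modulus (g _ - g _)).
    by rewrite /= nth_rcons il (set_nth_default b).
  by case: i il => //= i il; rewrite nth_rcons (ltnW il) (set_nth_default b)// ltnW.
- by rewrite nth_rcons ltnn eqxx.
- by case/lastP: l => //= l x; rewrite size_rcons last_rcons /= -cats1 -cats1 -catA nth_cat ltnn subnn.
Qed.

Lemma curve_length_step g (a t t' : R) : t < t' ->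
  (curve_length a t g + (modulus (g t' - g t))%:E <= curve_length a t' g)%E.
Proof.
move=> tt'; rewrite -leeBrDr//; apply: ge_ereal_sup => _ [l [pl /eqP lt] <-].
have e := cvariation_rcons g a t t' l; rewrite lt in e.
rewrite leeBrDr// -EFinD -e; apply: ereal_sup_ubound.
exists (rcons l t') => //; split; last by rewrite last_rcons.
by rewrite rcons_path pl lt.
Qed.

Lemma curve_length_refl g (a : R) : curve_length a a g = 0%E.
Proof.
rewrite /curve_length (_ : [set _ | _ in _] = [set 0%E]) ?ereal_sup1//.
apply/seteqP; split=> [_ [l /itv_partitionxx -> <-]|_ ->].
  by rewrite /cvariation big_geq.
by exists [::]; [split => /=|rewrite /cvariation big_geq].
Qed.

Lemma curve_length_ge g (a t : R) : a <= t -> ((modulus (g t - g a))%:E <= curve_length a t g)%E.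
Proof.
rewrite le_eqVlt => /predU1P[<-|at_]; first by rewrite curve_length_refl subrr modulus0.
by have := curve_length_step g a at_; rewrite curve_length_refl add0e.
Qed.

Lemma curve_length_ge0 g (a t : R) : a <= t -> (0 <= curve_length a t g)%E.
Proof. by move=> at_; apply: le_trans (curve_length_ge g at_); rewrite lee_fin modulus_ge0. Qed.

Lemma rectifiable_length g : rectifiable g ->
  exists2 L : R, 0 <= L & curve_length 0 1 g = L%:E.
Proof.
move=> [_ h]; have h0 := curve_length_ge0 g (@ler01 R).
exists (fine (curve_length 0 1 g)); first exact: fine_ge0.
by rewrite fineK// ge0_fin_numE.
Qed.

(** A chord is no longer than its arc, and at most the length [L - s] is left once
    the distance [s] is travelled. This holds at parameters where the distance
    travelled is at least [s], and at their infimum by continuity. *)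
Lemma arc_param_dist g (L s : R) : rectifiable g -> curve_length 0 1 g = L%:E ->
  0 <= s -> s <= L -> modulus (arc_param g s - g 1) <= L - s.
Proof.
move=> [gc _] gL s0 sL; rewrite /arc_param; set S := [set t | _].
have S1 : S 1 by split; [rewrite ler01 lexx|rewrite gL lee_fin].
have lbS : lbound S 0 by move=> t [/andP[]].
have hS : has_inf S by split; [exists 1|exists 0].
have t01 : 0 <= inf S <= 1.
  by apply/andP; split; [apply: lb_le_inf => //; exists 1|exact: (ge_inf hS.2)].
have dS t : S t -> modulus (g t - g 1) <= L - s.
  move=> [/andP[t0 t1] st]; move: t1; rewrite le_eqVlt => /predU1P[->|t1].
    by rewrite subrr modulus0 subr_ge0.
  have := curve_length_step g 0 t1; rewrite gL modulusBC => h.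
  have := le_trans (leeD2r _ st) h; rewrite -EFinD lee_fin; lra.
rewrite leNgt; apply/negP => hlt.
pose e := modulus (g (inf S) - g 1) - (L - s).
have e0 : 0 < e by rewrite subr_gt0.
have /subspace_continuousP/(_ (inf S)) := gc.
have t01' : `[0, 1]%classic (inf S) by rewrite /= in_itv.
move=> /(_ t01')/(_ [set z | modulus (z - g (inf S)) < e]) [].
  by apply/nbhs_modulusP; exists e.
move=> /= d d0 hd; have [t St tlt] := inf_adherent d0 hS.
have tS : inf S <= t by exact: (ge_inf hS.2).
have /= hh : modulus (g t - g (inf S)) < e.
  apply: hd; last by rewrite /= in_itv; case: St.
  by rewrite /ball /= ler0_norm ?subr_le0// opprB ltrBlDr addrC.
have := modulus_triangle (g (inf S)) (g 1) (g t).
have := dS _ St; rewrite /e modulusBC in hh *; lra.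
Qed.

Lemma arc_param0 g : arc_param g 0 = g 0.
Proof.
rewrite /arc_param (_ : [set t | _] = [set` `[0, 1]]); first by rewrite inf_itv// bnd_simp ler01.
apply/seteqP; split=> t /=; rewrite in_itv /=; first by case.
by move=> t01; split => //; apply: curve_length_ge0; case/andP: t01.
Qed.

End arc_length.

Section integral_monotone.
Context d (T : measurableType d) (R : realType).
Variable mu : {measure set T -> \bar R}.

(** Along an arbitrary curve the integrand is of unknown measurability. The
    integral of a nonnegative function is a supremum over simple functions, and
    is monotone in all cases. *)
Lemma le_integral_nomeas (D : set T) (f1 f2 : T -> \bar R) :
  (forall x, D x -> (0 <= f1 x)%E) -> (forall x, D x -> (f1 x <= f2 x)%E) ->
  (\int[mu]_(x in D) f1 x <= \int[mu]_(x in D) f2 x)%E.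
Proof.
move=> f0 f12; rewrite [leLHS]integral_mkcond [leRHS]integral_mkcond.
have h x : (0 <= (f1 \_ D) x)%E by rewrite patchE; case: ifPn => // /set_mem; exact: f0.
have h12 x : ((f1 \_ D) x <= (f2 \_ D) x)%E by rewrite !patchE; case: ifPn => // /set_mem; exact: f12.
rewrite !ge0_integralTE//; last by move=> x; exact: le_trans (h12 x).
apply: ereal_sup_le => _ [k hk <-]; exists k => //.
by move=> x; exact: le_trans (h12 x).
Qed.

End integral_monotone.

Section lower_curve.
Variable R : realType.
Local Notation mu := (@lebesgue_measure R).

Lemma integral_inv_affine (b L : R) : 0 < b -> 0 <= L ->
  (\int[mu]_(s in `[0%R, L]) ((b + (L - s))^-1)%:E = (ln ((b + L) / b))%:E)%E.
Proof.
move=> b0; rewrite le_eqVlt => /predU1P[<-|L0].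
  by rewrite set_itv1 integral_set1 addr0 divff ?gt_eqF// ln1.
have pos (x : R) : 0 <= x <= L -> 0 < b + (L - x) by lra.
have d1 (x : R) : is_derive x 1 (fun s : R => b + (L - s)) (0 + (0 - 1)).
  by apply: is_deriveD; apply: is_deriveB.
have c1 (x : R) : 0 <= x <= L -> {for x, continuous (fun s : R => (b + (L - s))^-1)}.
  move=> xL; apply: continuousV; first by rewrite gt_eqF// pos.
  by apply/differentiable_continuous/derivable1_diffP; case: (d1 x).
have c2 (x : R) : 0 <= x <= L -> is_derive x 1 (fun s : R => - ln (b + (L - s))) (b + (L - x))^-1.
  move=> xL; have px := pos x xL.
  have d2 : is_derive (b + (L - x)) 1 (@ln R) (b + (L - x))^-1 by exact: is_derive1_ln.
  have d3 := @is_derive1_comp R (@ln R) (fun s : R => b + (L - s)) x _ _ d2 (d1 x).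
  have := is_deriveN d3; rewrite /= => d4; apply: (is_derive_eq d4).
  by rewrite /GRing.scale /=; ring.
rewrite (integral_antiderivative L0 c1 c2) subrr subr0 addr0 opprK; congr EFin.
by rewrite addrC ln_div ?posrE// addr_gt0.
Qed.

(** The point at arc length [s] is within [L - s] of the end point, hence within
    [|g 1 - zeta| + (L - s)] of [zeta]; integrating the metric over [s] yields a
    logarithm, and [L] is at least the distance of the end points. *)
Lemma curve_integral_ge (zeta : cplane R) (h : R) (g : R -> cplane R) : 0 < h -> rectifiable g ->
  ((ln ((modulus (g 0%R - zeta) + h) / (modulus (g 1%R - zeta) + h)))%:E <=
   curve_integral (fun x : cplane R => (modulus (x - zeta) + h)^-1)%R g)%E.
Proof.
move=> h0 rg; have [L L0 gL] := rectifiable_length rg.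
rewrite /curve_integral gL /=; set b := modulus (g 1 - zeta) + h.
have b0 : 0 < b by rewrite ltr_wpDl// modulus_ge0.
have d01 : modulus (g 0 - zeta) + h <= b + L.
  have := arc_param_dist rg gL (lexx 0) L0; rewrite arc_param0 subr0 => h1.
  by have := modulus_triangle (g 0) zeta (g 1); rewrite /b; lra.
apply: (@le_trans _ _ (ln ((b + L) / b))%:E).
  have g00 : 0 < modulus (g 0 - zeta) + h by rewrite ltr_wpDl// modulus_ge0.
  have bL : 0 < b + L by rewrite ltr_pwDl.
  rewrite lee_fin ler_ln ?posrE; [|exact: divr_gt0|exact: divr_gt0].
  by rewrite ler_pM2r ?invr_gt0.
rewrite -integral_inv_affine//; apply: le_integral_nomeas => s /=; rewrite in_itv /= => /andP[s0 sL].
  by rewrite lee_fin invr_ge0 addr_ge0 ?(ltW b0)// subr_ge0.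
have bs : 0 < b + (L - s) by rewrite ltr_pwDl// subr_ge0.
have m0 : 0 < modulus (arc_param g s - zeta) + h by rewrite ltr_wpDl// modulus_ge0.
rewrite lee_fin ler_pV2 ?inE ?unitfE ?gt_eqF//.
have := arc_param_dist rg gL s0 sL.
have := modulus_triangle (arc_param g s) zeta (g 1); rewrite /b; lra.
Qed.

End lower_curve.

Lemma convex_lt1 (R : realType) (p q c : R) : p < 1 -> q < 1 -> 0 <= c -> c <= 1 ->
  (1 - c) * p + c * q < 1.
Proof.
move=> p1 q1 c0 c1; have [c2|c2] := ltP c (1 / 2).
  have h : 0 < (1 - c) * (1 - p) by apply: mulr_gt0; lra.
  have h' : 0 <= c * (1 - q) by apply: mulr_ge0; lra.
  lra.
have h : 0 <= (1 - c) * (1 - p) by apply: mulr_ge0; lra.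
have h' : 0 < c * (1 - q) by apply: mulr_gt0; lra.
lra.
Qed.

(** * Broken lines *)

Section polygon.
Variable R : realType.
Local Notation mu := (@lebesgue_measure R).
Implicit Types (P Q : R * R) (s b e : R).

Definition clamp e (x : R) : R := Num.max 0 (Num.min e x).

Lemma clamp_lt0 e x : 0 <= e -> x <= 0 -> clamp e x = 0.
Proof.
move=> e0 x0; rewrite /clamp; apply/max_idPl.
by apply: le_trans x0; rewrite ge_min lexx orbT.
Qed.

Lemma clamp_in e x : 0 <= x -> x <= e -> clamp e x = x.
Proof. by move=> x0 xe; rewrite /clamp (min_idPr xe); apply/max_idPr. Qed.

Lemma clamp_gt e x : 0 <= e -> e <= x -> clamp e x = e.
Proof. by move=> e0 xe; rewrite /clamp (min_idPl xe); apply/max_idPr. Qed.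

Lemma clamp_homo e x y : x <= y -> clamp e x <= clamp e y.
Proof.
move=> xy; rewrite /clamp ge_max le_max lexx /= le_max; apply/orP; right.
by rewrite le_min !ge_min lexx xy orbT.
Qed.

Lemma clampD e e' x : 0 <= e -> 0 <= e' -> clamp e x + clamp e' (x - e) = clamp (e + e') x.
Proof.
move=> e0 e'0; have [x0|x0] := leP x 0.
  by rewrite !clamp_lt0 ?addr0//; [exact: addr_ge0|lra].
have [xe|xe] := leP x e.
  by rewrite (clamp_in (ltW x0) xe) (@clamp_lt0 e')// ?subr_le0// addr0 clamp_in//; lra.
rewrite (clamp_gt e0 (ltW xe)); have [xe'|xe'] := leP x (e + e').
  by rewrite !clamp_in//; lra.
by rewrite !clamp_gt//; lra.
Qed.

Lemma clamp_contract e x y : 0 <= e -> x <= y -> clamp e y - clamp e x <= y - x.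
Proof.
move=> e0 xy; rewrite /clamp /Num.max /Num.min.
case: (ltP e y) => h1; case: (ltP e x) => h2; case: (ltP 0 e) => h3;
  rewrite ?h3; try (case: (ltP 0 x) => h4); try (case: (ltP 0 y) => h5); lra.
Qed.

(** The part of the way from [P] to [Q] covered at time [s], for a point leaving
    [P] at time [b] with unit speed. *)
Definition stretch P Q b s : R * R := scale (clamp (pnorm (Q - P)) (s - b) / pnorm (Q - P)) (Q - P).

Lemma pnorm_eq0 P : pnorm P = 0 -> P = 0.
Proof.
move=> h; have := coord1_le_pnorm P; have := coord2_le_pnorm P; rewrite h !normr_le0.
by case: P {h} => a b /= /eqP -> /eqP ->.
Qed.

Lemma stretch_lt P Q b s : s <= b -> stretch P Q b s = 0.
Proof.
move=> sb; rewrite /stretch clamp_lt0 ?pnorm_ge0 ?subr_le0// mul0r /scale !mul0r.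
by [].
Qed.

Lemma stretch_gt P Q b s : b + pnorm (Q - P) <= s -> stretch P Q b s = Q - P.
Proof.
move=> sb; have e0 := pnorm_ge0 (Q - P); rewrite /stretch clamp_gt//; last lra.
have [e|en] := eqVneq (pnorm (Q - P)) 0.
  by rewrite (pnorm_eq0 e) /scale !mulr0.
by rewrite divff// /scale !mul1r; case: (Q - P).
Qed.

Lemma stretch_in P Q b s : b <= s -> s <= b + pnorm (Q - P) ->
  stretch P Q b s = scale ((s - b) / pnorm (Q - P)) (Q - P).
Proof. by move=> sb se; rewrite /stretch clamp_in//; lra. Qed.

Lemma pnorm_stretchB P Q b s s' : s <= s' ->
  pnorm (stretch P Q b s' - stretch P Q b s) <=
  clamp (pnorm (Q - P)) (s' - b) - clamp (pnorm (Q - P)) (s - b).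
Proof.
move=> ss'; set e := pnorm (Q - P); set c' := clamp e (s' - b); set c := clamp e (s - b).
have -> : stretch P Q b s' - stretch P Q b s = scale ((c' - c) / e) (Q - P).
  by rewrite /stretch -/e -/c -/c' /scale; congr pair => /=; ring.
rewrite [leLHS](pnormZ _ (Q - P)) -/e.
have cc' : 0 <= c' - c by rewrite subr_ge0 clamp_homo// lerD2r.
have e0 : 0 <= e := pnorm_ge0 _.
have [->|en] := eqVneq e 0; first by rewrite mulr0.
have ep : 0 < e by rewrite lt_neqAle eq_sym en.
by rewrite ger0_norm ?divr_ge0// divfK.
Qed.

Variables v0 v1 v2 v3 : R * R.
Let e1 := pnorm (v1 - v0).
Let e2 := pnorm (v2 - v1).
Let e3 := pnorm (v3 - v2).

Let e1_0 : 0 <= e1. Proof. exact: pnorm_ge0. Qed.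
Let e2_0 : 0 <= e2. Proof. exact: pnorm_ge0. Qed.
Let e3_0 : 0 <= e3. Proof. exact: pnorm_ge0. Qed.

(** A sum of increments, each of them constant outside its own interval of
    time: the unit speed bound follows by adding three bounds of which one at
    most is growing. *)
Definition broken_line s : R * R :=
  v0 + (stretch v0 v1 0 s + (stretch v1 v2 e1 s + stretch v2 v3 (e1 + e2) s)).
Local Notation G := broken_line.

Definition broken_length : R := e1 + e2 + e3.
Local Notation L := broken_length.

Let L0 : 0 <= L. Proof. by rewrite /L !addr_ge0. Qed.

Lemma broken_line_lipschitz s s' : s <= s' -> pnorm (G s' - G s) <= s' - s.
Proof.
move=> ss'.
have -> : G s' - G s = (stretch v0 v1 0 s' - stretch v0 v1 0 s) +
   ((stretch v1 v2 e1 s' - stretch v1 v2 e1 s) + (stretch v2 v3 (e1 + e2) s' - stretch v2 v3 (e1 + e2) s)).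
  rewrite /G; move: (stretch v0 v1 0 s') (stretch v0 v1 0 s) (stretch v1 v2 _ _) (stretch v1 v2 _ _)
    (stretch v2 v3 _ _) (stretch v2 v3 _ _) => [a1 a2] [b1 b2] [c1 c2] [d1 d2] [f1 f2] [g1 g2].
  by case: v0 => [x y]; congr pair => /=; ring.
apply: le_trans (pnormD _ _) _; apply: le_trans (lerD (lexx _) (pnormD _ _)) _.
apply: le_trans (lerD (pnorm_stretchB _ _ _ ss') (lerD (pnorm_stretchB _ _ _ ss') (pnorm_stretchB _ _ _ ss'))) _.
rewrite -/e1 -/e2 -/e3 !subr0 !opprD !addrA.
have h x : clamp e1 x + clamp e2 (x - e1) + clamp e3 (x - e1 - e2) = clamp L x.
  by rewrite clampD// -[x - e1 - e2]addrA -opprD clampD// addr_ge0.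
have := clamp_contract L0 ss'; rewrite -!h; lra.
Qed.

Lemma lerpE P Q c : P + scale c (Q - P) = lerp P Q c.
Proof. by rewrite /scale /lerp; congr pair => /=; ring. Qed.

Lemma broken_line1 s : 0 <= s -> s <= e1 -> G s = lerp v0 v1 ((s - 0) / e1).
Proof.
move=> s0 s1; rewrite /G stretch_in ?add0r// (@stretch_lt v1)// stretch_lt; last first.
  by apply: le_trans s1 _; rewrite lerDl.
by rewrite !addr0 lerpE.
Qed.

Lemma broken_line2 s : e1 <= s -> s <= e1 + e2 -> G s = lerp v1 v2 ((s - e1) / e2).
Proof.
move=> s0 s1; rewrite /G stretch_gt ?add0r// stretch_in// stretch_lt//.
by rewrite addr0 addrA [v0 + _]addrC subrK lerpE.
Qed.

Lemma broken_line3 s : e1 + e2 <= s -> s <= L -> G s = lerp v2 v3 ((s - (e1 + e2)) / e3).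
Proof.
move=> s0 s1; rewrite /G stretch_gt ?add0r; last by apply: le_trans s0; rewrite lerDl.
rewrite (@stretch_gt v1)// stretch_in//.
by rewrite addrA [v0 + (v1 - v0)]addrC subrK addrA [v1 + (v2 - v1)]addrC subrK lerpE.
Qed.

Lemma pnorm_lerpB P Q b s s' : b <= s -> s <= s' -> s' <= b + pnorm (Q - P) ->
  pnorm (lerp P Q ((s' - b) / pnorm (Q - P)) - lerp P Q ((s - b) / pnorm (Q - P))) = s' - s.
Proof.
set e := pnorm _ => bs ss' se.
have -> : lerp P Q ((s' - b) / e) - lerp P Q ((s - b) / e) = scale ((s' - s) / e) (Q - P).
  by rewrite /lerp /scale; congr pair => /=; ring.
rewrite [LHS](pnormZ _ (Q - P)) -/e; have [e0|en] := eqVneq e 0.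
  by rewrite e0 mulr0; move: se; rewrite e0; lra.
have ep : 0 < e by rewrite lt_neqAle eq_sym en pnorm_ge0.
by rewrite normrM normfV (gtr0_norm ep) divfK// ger0_norm// subr_ge0.
Qed.

Definition broken_curve (t : R) : cplane R := toC (G (L * t)).
Local Notation g := broken_curve.

Lemma broken_curve_lipschitz t t' : t <= t' -> modulus (g t' - g t) <= L * (t' - t).
Proof.
move=> tt'; rewrite -pnormB mulrBr; apply: broken_line_lipschitz.
by rewrite ler_wpM2l.
Qed.

Lemma curve_length_lipschitz (f : R -> cplane R) (k a b : R) :
  (forall t t', t <= t' -> modulus (f t' - f t) <= k * (t' - t)) ->
  (curve_length a b f <= (k * (b - a))%:E)%E.
Proof.
move=> fk; apply: ge_ereal_sup => _ [l [pl /eqP <-] <-]; rewrite lee_fin.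
elim/last_ind: l pl => [|l x ih]; first by rewrite /cvariation big_geq//= subrr mulr0.
rewrite rcons_path => /andP[pl lx]; rewrite last_rcons.
have := cvariation_rcons f a (last a l) x l; rewrite /= => ->.
have -> : k * (x - a) = k * (last a l - a) + k * (x - last a l) by ring.
by rewrite lerD ?ih// fk// ltW.
Qed.

Lemma curve_length_step_le (f : R -> cplane R) (a t t' : R) : t <= t' ->
  (curve_length a t f + (modulus (f t' - f t))%:E <= curve_length a t' f)%E.
Proof.
rewrite le_eqVlt => /predU1P[<-|]; last exact: curve_length_step.
by rewrite subrr modulus0 adde0.
Qed.

Let step (b c s s' : R) : 0 < L -> b <= s -> s <= s' -> s' <= b + c ->
  (forall u u', b <= u -> u <= u' -> u' <= b + c -> pnorm (G u' - G u) = u' - u) ->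
  (s%:E <= curve_length 0 (s / L) g)%E -> (s'%:E <= curve_length 0 (s' / L) g)%E.
Proof.
move=> Lp bs ss' sc iso h.
have ts : s / L <= s' / L by rewrite ler_pM2r ?invr_gt0.
apply: le_trans (curve_length_step_le g 0 ts).
have -> : modulus (g (s' / L) - g (s / L)) = s' - s.
  rewrite /g -pnormB [L * (s' / L)]mulrC divfK ?gt_eqF// [L * (s / L)]mulrC divfK ?gt_eqF//.
  exact: iso.
have -> : s'%:E = (s%:E + (s' - s)%:E)%E by rewrite -EFinD; congr EFin; ring.
by rewrite leeD2r.
Qed.

(** The Lipschitz bound gives one inequality; for the other, the line moves
    isometrically on each of its three pieces, so that the lengths add up. *)
Lemma broken_curve_length t : 0 <= t -> t <= 1 -> curve_length 0 t g = (L * t)%:E.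
Proof.
move=> t0 t1; apply/eqP; rewrite eq_le; apply/andP; split.
  by rewrite -{2}[t]subr0; apply: curve_length_lipschitz => u u'; exact: broken_curve_lipschitz.
have [Lz|Ln] := eqVneq L 0; first by rewrite Lz mul0r; exact: curve_length_ge0.
have Lp : 0 < L by rewrite lt_neqAle eq_sym Ln L0.
have iso1 u u' : 0 <= u -> u <= u' -> u' <= 0 + e1 -> pnorm (G u' - G u) = u' - u.
  move=> h1 h2 h3; rewrite !broken_line1; try lra.
  by apply: pnorm_lerpB.
have iso2 u u' : e1 <= u -> u <= u' -> u' <= e1 + e2 -> pnorm (G u' - G u) = u' - u.
  move=> h1 h2 h3; rewrite !broken_line2; try lra.
  by apply: pnorm_lerpB.
have iso3 u u' : e1 + e2 <= u -> u <= u' -> u' <= e1 + e2 + e3 -> pnorm (G u' - G u) = u' - u.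
  move=> h1 h2 h3; rewrite !broken_line3; rewrite /L; try lra.
  by apply: pnorm_lerpB.
have z0 : (0%:E <= curve_length 0 (0 / L) g)%E by rewrite mul0r curve_length_refl.
have {2}-> : t = (L * t) / L by rewrite mulrC mulrA mulVf ?mul1r.
have Lt0 : 0 <= L * t by exact: mulr_ge0.
have LtL : L * t <= e1 + e2 + e3 by rewrite -/L ler_piMr.
have [h1|h1] := leP (L * t) e1.
  by apply: (step (b := 0) (c := e1) Lp _ _ _ iso1 z0) => //; rewrite add0r.
have z1 : (e1%:E <= curve_length 0 (e1 / L) g)%E.
  by apply: (step (b := 0) (c := e1) Lp _ _ _ iso1 z0) => //; rewrite add0r.
have [h2|h2] := leP (L * t) (e1 + e2).
  by apply: (step (b := e1) (c := e2) Lp _ _ _ iso2 z1) => //; exact: ltW.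
have z2 : ((e1 + e2)%:E <= curve_length 0 ((e1 + e2) / L) g)%E.
  by apply: (step (b := e1) (c := e2) Lp _ _ _ iso2 z1) => //; rewrite lerDl.
by apply: (step (b := e1 + e2) (c := e3) Lp _ _ _ iso3 z2) => //; exact: ltW.
Qed.

Lemma broken_curve_rectifiable : rectifiable g.
Proof.
split; last by rewrite broken_curve_length// ?ler01// ltry.
apply: continuous_subspaceT => t; apply/cvg_modulusP => e e0.
have h : 0 < e / (L + 1) by rewrite divr_gt0// ltr_wpDl.
exists (e / (L + 1)); first exact: h.
move=> t' tt'; change (modulus (g t' - g t) < e); have {}tt' : `|t - t'| < e / (L + 1) := tt'.
have d : modulus (g t' - g t) <= L * `|t - t'|.
  have [le|lt] := leP t t'.
    by rewrite distrC ger0_norm ?subr_ge0//; exact: broken_curve_lipschitz.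
  by rewrite modulusBC gtr0_norm ?subr_gt0//; apply: broken_curve_lipschitz; exact: ltW.
apply: le_lt_trans d _; apply: (@le_lt_trans _ _ ((L + 1) * `|t - t'|)).
  by rewrite ler_wpM2r// lerDl.
by rewrite mulrC -ltr_pdivlMr// ltr_wpDl.
Qed.

Lemma broken_curve_ends : g 0 = toC v0 /\ g 1 = toC v3.
Proof.
split; rewrite /g.
  by rewrite mulr0 broken_line1// subrr mul0r /lerp subr0 !mul1r !mul0r !addr0; case: v0.
rewrite mulr1 broken_line3//; last by rewrite /L lerDl.
have -> : L - (e1 + e2) = e3 by rewrite /L; ring.
have [z|n] := eqVneq e3 0.
  rewrite z mul0r /lerp subr0 !mul1r !mul0r !addr0.
  by have /eqP := pnorm_eq0 z; rewrite subr_eq0 => /eqP ->; case: v2.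
by rewrite divff// /lerp subrr !mul0r !mul1r !add0r; case: v3.
Qed.

(** The line has unit speed, so it is its own arc-length parametrization. *)
Lemma broken_arc_param s : 0 < L -> 0 <= s -> s <= L -> arc_param g s = toC (G s).
Proof.
move=> Lp s0 sL; rewrite /arc_param (_ : [set t | _] = [set` `[s / L, 1]]).
  by rewrite inf_itv ?bnd_simp ?ler_pdivrMr ?mul1r// /g mulrC divfK ?gt_eqF.
apply/seteqP; split=> t /=; rewrite in_itv /=.
  by move=> [/andP[t0 t1]]; rewrite broken_curve_length// lee_fin t1 andbT ler_pdivrMr// mulrC.
move=> /andP[st t1]; have t0 : 0 <= t by apply: le_trans st; rewrite divr_ge0.
by rewrite t0 t1 broken_curve_length// lee_fin mulrC -ler_pdivrMr.
Qed.

Lemma pnorm_lerp_lt1 P Q c : pnorm P < 1 -> pnorm Q < 1 -> 0 <= c -> c <= 1 -> pnorm (lerp P Q c) < 1.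
Proof.
move=> P1 Q1 c0 c1; have -> : lerp P Q c = scale (1 - c) P + scale c Q by [].
apply: le_lt_trans (pnormD _ _) _; rewrite [pnorm (scale _ P)]pnormZ [pnorm (scale _ Q)]pnormZ.
by rewrite !ger0_norm ?subr_ge0//; exact: convex_lt1.
Qed.

Lemma ratio_itv s b e : 0 <= e -> b <= s -> s <= b + e -> 0 <= (s - b) / e <= 1.
Proof.
move=> e0 bs se; have [->|en] := eqVneq e 0; first by rewrite invr0 mulr0 lexx ler01.
have ep : 0 < e by rewrite lt_neqAle eq_sym en.
by rewrite divr_ge0 ?subr_ge0//= ler_pdivrMr// mul1r; lra.
Qed.

Lemma broken_line_disk s : pnorm v0 < 1 -> pnorm v1 < 1 -> pnorm v2 < 1 -> pnorm v3 < 1 ->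
  0 <= s -> s <= L -> pnorm (G s) < 1.
Proof.
move=> h0 h1 h2 h3 s0 sL; have [s1|/ltW s1] := leP s e1.
  have s1' : s <= 0 + e1 by rewrite add0r.
  have /andP[c0 c1] := ratio_itv e1_0 s0 s1'.
  by rewrite broken_line1//; exact: pnorm_lerp_lt1.
have [s2|/ltW s2] := leP s (e1 + e2).
  have /andP[c0 c1] := ratio_itv e2_0 s1 s2.
  by rewrite broken_line2//; exact: pnorm_lerp_lt1.
have /andP[c0 c1] := ratio_itv e3_0 s2 sL.
by rewrite broken_line3//; exact: pnorm_lerp_lt1.
Qed.

Variables (sg : R * R -> R) (rho : cplane R -> R).
Hypothesis msg : measurable_fun setT sg.
Hypothesis sg0 : forall p, 0 <= sg p.
Hypothesis rho_sg : forall p, pnorm p < 1 -> rho (toC p) = sg p.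

Let piece P Q b s : R :=
  \1_(`]0%R, 1%R]) ((s - b) / pnorm (Q - P)) * sg (lerp P Q ((s - b) / pnorm (Q - P))).

Let piece_ge0 P Q b s : 0 <= piece P Q b s.
Proof. by rewrite mulr_ge0 ?indic_ge0. Qed.

Let mpiece P Q b : measurable_fun setT (piece P Q b).
Proof.
have m1 : measurable_fun setT (fun s : R => (s - b) / pnorm (Q - P)).
  by apply: measurable_funM; [apply: measurable_funB|]; (exact: measurable_id || exact: measurable_cst).
apply: measurable_funM; first exact: measurable_fun_itv_indic.
apply: (measurableT_comp msg); apply: measurable_fun_lerp => //; exact: measurable_cst.
Qed.

Let integral_piece P Q b : (\int[mu]_s (piece P Q b s)%:E = Seg sg P Q)%E.
Proof.
set e := pnorm (Q - P); have [e0|en] := eqVneq e 0.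
  rewrite /Seg /piece -/e e0 [LHS]integral0_eq ?[RHS]integral0_eq// => s _.
    by rewrite mul0r mulr0.
  by rewrite invr0 mulr0 indicE mem_setE in_itv /= ltxx mul0r.
have ep : 0 < e by rewrite lt_neqAle eq_sym en pnorm_ge0.
pose F (s : R) : \bar R := (\1_(`]0%R, 1%R]) s * sg (lerp P Q s))%:E.
have mF : measurable_fun setT F.
  apply/measurable_EFinP; apply: measurable_funM; first exact: measurable_indic.
  apply: (measurableT_comp msg); apply: measurable_fun_lerp;
    (exact: measurable_id || exact: measurable_cst).
have F0 s : (0 <= F s)%E by rewrite lee_fin mulr_ge0 ?indic_ge0.
have ie0 : e^-1 != 0 by rewrite invr_neq0.
transitivity (\int[mu]_s F (e^-1 * s + (- b / e))%R)%E.
  apply: eq_integral => s _; rewrite /F /piece -/e.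
  by have -> : e^-1 * s + - b / e = (s - b) / e by ring.
rewrite (integral_affine (- b / e) ie0 mF F0) gtr0_norm ?invr_gt0// invrK.
have e0' : (0 <= e%:E)%E by rewrite lee_fin ltW.
rewrite -(ge0_integralZl mu measurableT mF (fun s _ => F0 s) e0').
by apply: eq_integral => s _; rewrite /F -EFinM -/e mulrCA.
Qed.

Let mG : measurable_fun setT G.
Proof.
have mst P Q b : measurable_fun setT (stretch P Q b).
  have mc : measurable_fun setT (fun s : R => clamp (pnorm (Q - P)) (s - b) / pnorm (Q - P)).
    apply: measurable_funM; last exact: measurable_cst.
    apply: measurable_maxr; first exact: measurable_cst.
    apply: measurable_minr; first exact: measurable_cst.
    by apply: measurable_funB; [exact: measurable_id|exact: measurable_cst].
  by apply: measurable_fun_pair; apply: measurable_funM => //; exact: measurable_cst.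
apply: measurable_fun_pD; first exact: measurable_cst.
by apply: measurable_fun_pD => //; exact: measurable_fun_pD.
Qed.

Lemma piece_value P Q b s : b < s -> s <= b + pnorm (Q - P) ->
  sg (lerp P Q ((s - b) / pnorm (Q - P))) <= piece P Q b s.
Proof.
move=> bs se; have ep : 0 < pnorm (Q - P) by lra.
rewrite /piece indicE mem_setE in_itv /= divr_gt0 ?subr_gt0//= ler_pdivrMr// mul1r.
by rewrite lerBlDl se mul1r.
Qed.

Lemma curve_integral_broken : pnorm v0 < 1 -> pnorm v1 < 1 -> pnorm v2 < 1 -> pnorm v3 < 1 ->
  (curve_integral rho g <= Seg sg v0 v1 + (Seg sg v1 v2 + Seg sg v2 v3))%E.
Proof.
move=> h0 h1 h2 h3; have S0 P Q := Seg_ge0 sg0 P Q.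
rewrite /curve_integral broken_curve_length ?ler01// mulr1 /=.
have [Lz|Ln] := eqVneq L 0.
  by rewrite Lz set_itv1 integral_set1 adde_ge0// adde_ge0.
have Lp : 0 < L by rewrite lt_neqAle eq_sym Ln L0.
have msG : measurable_fun setT (fun s => (sg (G s))%:E).
  by apply/measurable_EFinP; exact: (measurableT_comp msg mG).
rewrite [leLHS](_ : _ = \int[mu]_(s in `]0%R, L]) (sg (G s))%:E)%E; last first.
  rewrite integral_itv_obnd_cbnd; last exact: measurable_funTS.
  apply: eq_integral => s; rewrite inE /= in_itv /= => /andP[s0 sL].
  by rewrite broken_arc_param// rho_sg//; exact: broken_line_disk.
have mp P Q b : measurable_fun setT (fun s => (piece P Q b s)%:E) by apply/measurable_EFinP.
have p0 P Q b s : setT s -> (0 <= (piece P Q b s)%:E)%E by rewrite lee_fin.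
have -> : (Seg sg v0 v1 + (Seg sg v1 v2 + Seg sg v2 v3) =
  \int[mu]_s ((piece v0 v1 0 s)%:E + ((piece v1 v2 e1 s)%:E + (piece v2 v3 (e1 + e2) s)%:E)))%E.
  rewrite -(integral_piece v0 v1 0) -(integral_piece v1 v2 e1) -(integral_piece v2 v3 (e1 + e2)).
  have m12 := emeasurable_funD (mp v1 v2 e1) (mp v2 v3 (e1 + e2)).
  have p12 s : setT s -> (0 <= (piece v1 v2 e1 s)%:E + (piece v2 v3 (e1 + e2) s)%:E)%E.
    by move=> _; rewrite adde_ge0// p0.
  rewrite (ge0_integralD mu measurableT (p0 v0 v1 0) (mp v0 v1 0) p12 m12).
  by rewrite (ge0_integralD mu measurableT (p0 v1 v2 e1) (mp v1 v2 e1) (p0 v2 v3 (e1 + e2)) (mp v2 v3 (e1 + e2))).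
rewrite integral_mkcond; apply: le_integral_nomeas => s _; rewrite patchE.
  by case: ifP => // _; rewrite lee_fin.
case: ifPn => [|_]; last by rewrite !adde_ge0 ?lee_fin.
rewrite inE /= in_itv /= => /andP[s0 sL]; rewrite -!EFinD lee_fin.
have q0 := piece_ge0 v0 v1 0 s; have q1 := piece_ge0 v1 v2 e1 s; have q2 := piece_ge0 v2 v3 (e1 + e2) s.
have [s1|s1] := leP s e1.
  have := @piece_value v0 v1 0 s s0; rewrite add0r -/e1 => /(_ s1) hp.
  by rewrite (broken_line1 (ltW s0) s1); apply: le_trans hp _; rewrite lerDl addr_ge0.
have [s2|s2] := leP s (e1 + e2).
  have hp := @piece_value v1 v2 e1 s s1 s2; rewrite (broken_line2 (ltW s1) s2).
  by apply: le_trans hp _; rewrite addrCA lerDl addr_ge0.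
have hp := @piece_value v2 v3 (e1 + e2) s s2 sL; rewrite (broken_line3 (ltW s2) sL).
by apply: le_trans hp _; rewrite addrA lerDr addr_ge0.
Qed.

End polygon.

(** * Borel sets of the plane *)

Section borel_plane.
Variable R : realType.

(** Second countability: an open set is the union of the disks contained in it
    whose centre is rational and whose radius is the inverse of an integer. *)
Lemma open_plane_measurable (U : set (R * R)) :
  (forall p, U p -> exists2 e : R, 0 < e & forall q, pnorm (q - p) < e -> U q) -> measurable U.
Proof.
move=> oU; pose c (x : rat * rat * nat) : R * R := (ratr x.1.1, ratr x.1.2).
pose B (x : rat * rat * nat) : set (R * R) := [set q | pnorm (q - c x) < x.2.+1%:R^-1].
pose F x : set (R * R) := if pselect (B x `<=` U) then B x else set0.
have -> : U = \bigcup_x F x.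
  apply/seteqP; split=> [p Up|p [x _]]; last by rewrite /F; case: pselect => // BU /BU.
  have [e e0 eU] := oU p Up.
  have [n ne] : exists n : nat, n.+1%:R^-1 < e / 2.
    have e2 : 0 < e / 2 by rewrite divr_gt0.
    exists (Num.truncn (e / 2)^-1); rewrite invf_plt ?posrE//.
    exact: truncnS_gt.
  have n0 : 0 < n.+1%:R^-1 / 2 :> R by rewrite divr_gt0.
  have lt1 : p.1 < p.1 + n.+1%:R^-1 / 2 by rewrite ltrDl.
  have lt2 : p.2 < p.2 + n.+1%:R^-1 / 2 by rewrite ltrDl.
  have [a] := rat_in_itvoo lt1; have [b] := rat_in_itvoo lt2.
  rewrite !in_itv /= => /andP[b1 b2] /andP[a1 a2].
  have pB : pnorm (p - c (a, b, n)) < n.+1%:R^-1.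
    apply: le_lt_trans (pnorm_le_coord _) _; rewrite /c /=.
    have -> : `|p.1 - ratr a| = ratr a - p.1 by rewrite distrC gtr0_norm// subr_gt0.
    have -> : `|p.2 - ratr b| = ratr b - p.2 by rewrite distrC gtr0_norm// subr_gt0.
    move: (ratr a : R) (ratr b : R) (n.+1%:R^-1 : R) a1 a2 b1 b2 => x y i *; lra.
  have BU : B (a, b, n) `<=` U.
    move=> q qB; apply: eU; have {}qB : pnorm (q - c (a, b, n)) < n.+1%:R^-1 by [].
    have := pnorm_triangle q p (c (a, b, n)); rewrite [pnorm (c _ - p)]pnormBC.
    move: (n.+1%:R^-1 : R) (pnorm (q - c (a, b, n))) qB (pnorm (p - c (a, b, n))) pB ne => i x xi y yi *; lra.
  by exists (a, b, n) => //; rewrite /F; case: pselect => // BU'; exact: pB.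
apply: countable_bigcupT_measurable => [|x]; first exact: countableP.
have mf : measurable_fun setT (fun q : R * R => pnorm (q - c x)).
  apply: measurable_fun_pnorm; apply: measurable_fun_pB; first exact: measurable_id.
  exact: measurable_cst.
have mB : measurable (B x).
  have := mf measurableT _ (measurable_itv `]-oo, (x.2.+1%:R^-1 : R)[).
  by rewrite setTI; congr measurable; apply/seteqP; split=> q /=; rewrite in_itv.
by rewrite /F; case: pselect => BU; [exact: mB|exact: measurable0].
Qed.

Lemma compact_plane_measurable (K : set (cplane R)) : compact K -> measurable (@toC R @^-1` K).
Proof.
move=> cK; have clK : closed K by apply: compact_closed => //; exact: norm_hausdorff.
rewrite -[X in measurable X]setCK; apply: measurableC; apply: open_plane_measurable => p Kp.
have : nbhs (toC p) (~` K).
  by apply: open_nbhs_nbhs; split => //; exact: closed_openC.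
move=> /nbhs_modulusP[e e0 h]; exists e => // q qp; apply: h.
by rewrite -pnormB.
Qed.

Lemma disk_plane_measurable : measurable (@toC R @^-1` (@unit_disk R)).
Proof.
apply: open_plane_measurable => p; rewrite /preimage /= unit_diskE => p1.
exists (1 - modulus (toC p)); first by rewrite subr_gt0.
move=> q; rewrite pnormB => qp; suff : modulus (toC q) < 1 by rewrite -unit_diskE.
by have := modulusB_ge (toC q) (toC p); lra.
Qed.

(** Only the values in the disk are under control, and there the preimages of
    open sets are open. *)
Lemma measurable_extend (f : cplane R -> cplane R) :
  (forall z, unit_disk z -> {for z, continuous f}) ->
  measurable_fun setT (fun p : R * R =>
    if p \in @toC R @^-1` (@unit_disk R) then (complex.Re (f (toC p)), complex.Im (f (toC p))) else (0, 0)).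
Proof.
move=> fc; set D := @toC R @^-1` _; have mD : measurable D := disk_plane_measurable.
have part (h : cplane R -> R) : (forall z w, `|h z - h w| <= modulus (z - w)) ->
    measurable_fun setT ((fun p : R * R => h (f (toC p))) \_ D).
  move=> hl; apply/(measurable_restrictT _ mD).
  apply: (measurability _ (RGenOpens.measurableE R)) => _ [_ [a [b ->] <-]].
  apply: open_plane_measurable => p [Dp] /=; rewrite in_itv /= => /andP[ha hb].
  have fp : {for toC p, continuous f} by exact: fc.
  pose e := Num.min (h (f (toC p)) - a) (b - h (f (toC p))).
  have e0 : 0 < e by rewrite lt_min !subr_gt0 ha.
  have [d d0 hd] : exists2 d : R, 0 < d & forall w, modulus (w - toC p) < d -> modulus (f w - f (toC p)) < e.
    by apply/nbhs_modulusP; move/cvg_modulusP : fp => /(_ e e0).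
  have Dp' : modulus (toC p) < 1 by rewrite -unit_diskE.
  exists (Num.min d (1 - modulus (toC p))); first by rewrite lt_min d0 subr_gt0.
  move=> q; rewrite lt_min pnormB => /andP[qd q1]; split.
    suff : modulus (toC q) < 1 by rewrite -unit_diskE.
    by have := modulusB_ge (toC q) (toC p); lra.
  have := hl (f (toC q)) (f (toC p)); have := hd _ qd; rewrite /e lt_min => /andP[h1 h2] h3.
  have := le_lt_trans h3 h1; have := le_lt_trans h3 h2; rewrite !ltr_norml /= in_itv /= => *; lra.
rewrite (_ : (fun p => _) = (fun p => (((fun q : R * R => complex.Re (f (toC q))) \_ D) p,
    ((fun q : R * R => complex.Im (f (toC q))) \_ D) p))).
  apply: measurable_fun_pair; apply: part => z w.
    by rewrite -raddfB /=; exact: (Re_le_modulus (z - w)).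
  by rewrite -raddfB /=; exact: (Im_le_modulus (z - w)).
by apply/funext => p; rewrite !patchE; case: ifP.
Qed.

End borel_plane.

(** * Probabilities of finite logarithmic energy *)

Section capacity.
Variable R : realType.

Lemma measurable_lne_dist :
  measurable_fun setT (fun pq : (R * R) * (R * R) => lne (pnorm (pq.1 - pq.2)%R)%:E).
Proof.
have mn : measurable_fun setT (fun pq : (R * R) * (R * R) => pnorm (pq.1 - pq.2)).
  by apply: measurable_fun_pnorm; apply: measurable_fun_pB; [exact: measurable_fst|exact: measurable_snd].
have -> : (fun pq : (R * R) * (R * R) => lne (pnorm (pq.1 - pq.2)%R)%:E) =
    (fun pq => if pnorm (pq.1 - pq.2) <= 0 then -oo%E else (ln (pnorm (pq.1 - pq.2)))%:E).
  apply/funext => pq; case: leP => h; first by rewrite le0_lneNy// lee_fin.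
  exact: lne_EFin.
apply: measurable_fun_ifT.
- by apply: measurable_fun_ler; [exact: mn|exact: measurable_cst].
- exact: measurable_cst.
- by apply/measurable_EFinP; exact: (measurableT_comp (@measurable_ln R) mn).
Qed.

Lemma measurable_log_kernel (K0 : set (R * R)) : measurable K0 ->
  measurable_fun setT (fun pq : (R * R) * (R * R) => log_kernel K0 pq.1 pq.2).
Proof.
move=> mK; have mi (f : (R * R) * (R * R) -> R * R) : measurable_fun setT f ->
    measurable_fun setT (fun x => f x \in K0).
  move=> mf; have mi : measurable_fun setT (fun x => \1_K0 (f x) : R).
    exact: (measurableT_comp (measurable_indic mK) mf).
  have -> : (fun x => f x \in K0) = (fun x => 0 < (\1_K0 (f x) : R)).
    by apply/funext => x; rewrite indicE; case: (_ \in _); rewrite ?ltr01 ?ltxx.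
  by apply: measurable_fun_ltr => //; exact: measurable_cst.
apply: measurable_fun_ifT; last exact: measurable_cst.
  by apply: measurable_and; apply: mi; [exact: measurable_fst|exact: measurable_snd].
apply: emeasurable_funB; first exact: measurable_cst.
exact: measurable_lne_dist.
Qed.

Variables (m : probability (R * R)%type R) (K0 : set (R * R)).
Hypothesis mK0 : measurable K0.
Hypothesis m1 : (m K0 = 1)%E.
Hypothesis K0d : forall p, K0 p -> pnorm p < 1.

Let f (p q : R * R) : \bar R := lne (pnorm (p - q)%R)%:E.

Let mf : measurable_fun setT (fun pq : (R * R) * (R * R) => f pq.1 pq.2).
Proof. exact: measurable_lne_dist. Qed.

Let mfp p : measurable_fun setT (f p).
Proof. exact: (measurable_fun_pair2 p mf). Qed.

Let ln2_ge0 : 0 <= ln 2 :> R.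
Proof. by rewrite ln_ge0// ler1n. Qed.

Lemma diam_lt2 p q : K0 p -> K0 q -> pnorm (p - q) <= 2.
Proof.
move=> /K0d hp /K0d hq; have := pnormD p (- q); rewrite pnormN; lra.
Qed.

Let f_le p q : K0 p -> K0 q -> (f p q <= (ln 2)%:E)%E.
Proof.
move=> Kp Kq; rewrite /f; have := pnorm_ge0 (p - q); rewrite le_eqVlt => /predU1P[<-|h].
  by rewrite le0_lneNy// leNye.
by rewrite lne_EFin// lee_fin ler_ln ?posrE// diam_lt2.
Qed.

Let integral_pos p : K0 p -> (\int[m]_q (f p)^\+ q <= (ln 2)%:E)%E.
Proof.
move=> Kp; have mN : measurable (~` K0) by exact: measurableC.
have N0 : (m (~` K0) = 0)%E by rewrite probability_setC// m1 subee.
rewrite (ge0_negligible_integral mN measurableT _ _ N0) //; last exact: measurable_funepos.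
rewrite setTD setCK; apply: (@le_trans _ _ (\int[m]_(q in K0) (ln 2)%:E)%E).
  by apply: le_integral_nomeas => // q Kq; rewrite funeposE ge_max f_le// lee_fin ln2_ge0.
by rewrite (integral_cst m mK0 (ln 2)%:E) [X in (_ * X)%E](_ : _ = 1%E) ?mule1//; exact: m1.
Qed.

Let g (p : R * R) : \bar R := (\int[m]_q f p q)%E.

Let kernel_le p : (\int[m]_q log_kernel K0 p q <= (2 * ln 2)%:E + g^\- p)%E.
Proof.
have gn0 : (0 <= g^\- p)%E by [].
have [Kp|Kp] := pselect (K0 p); last first.
  rewrite [X in (X <= _)%E](_ : _ = 0%E); first by rewrite adde_ge0// lee_fin mulr_ge0.
  by apply: integral0_eq => q _; rewrite /log_kernel memNset.
have fp0 q : (0 <= (f p)^\- q)%E by [].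
have mneg : measurable_fun setT (f p)^\-%E by exact: measurable_funeneg.
have h1 : (\int[m]_q log_kernel K0 p q <= (ln 2)%:E + \int[m]_q (f p)^\- q)%E.
  apply: (@le_trans _ _ (\int[m]_q ((ln 2)%:E + (f p)^\- q))%E).
    apply: le_integral_nomeas => q _; first exact: (log_kernel_ge0 diam_lt2).
    rewrite /log_kernel; case: ifP => _; last by rewrite adde_ge0// lee_fin.
    by rewrite leeD2l// funenegE le_max lexx.
  have c0 (q : R * R) : setT q -> (0 <= (ln 2)%:E :> \bar R)%E by rewrite lee_fin.
  rewrite (ge0_integralD m measurableT c0 (measurable_cst _) (fun q _ => fp0 q) mneg).
  by rewrite (integral_cst m measurableT (ln 2)%:E) [X in (_ * X)%E](_ : _ = 1%E) ?mule1//; exact: (probability_setT m).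
apply: (le_trans h1); have := integral_pos Kp.
have pos0 : (0 <= \int[m]_q (f p)^\+ q)%E by apply: integral_ge0.
have neg0 : (0 <= \int[m]_q (f p)^\- q)%E by apply: integral_ge0.
have gE : g p = (\int[m]_q (f p)^\+ q - \int[m]_q (f p)^\- q)%E by rewrite /g integralE.
rewrite funenegE gE; move: pos0 neg0.
case: (\int[m]_q (f p)^\+ q)%E => [x| |]//; case: (\int[m]_q (f p)^\- q)%E => [y| |]//.
  rewrite !lee_fin => x0 y0 xl; rewrite -EFinB -EFinN -EFin_max -!EFinD lee_fin.
  have : - (x - y) <= Num.max (- (x - y)) 0 by rewrite le_max lexx.
  lra.
Qed.

(** On a set of diameter at most 2 the kernel [ln |p - q|] is bounded above by
    [ln 2], so that an energy above [-oo] bounds the integral of its negative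
    part. *)
Lemma finite_energy : (-oo < \int[m]_p \int[m]_q lne (pnorm (p - q)%R)%:E)%E ->
  exists2 V : R, 0 <= V & (\int[m]_p \int[m]_q log_kernel K0 p q <= V%:E)%E.
Proof.
move=> h.
pose F (pq : (R * R) * (R * R)) := f pq.1 pq.2.
have mg : measurable_fun setT g.
  have -> : g = (fun p => \int[m]_q F^\+%E (p, q) - \int[m]_q F^\-%E (p, q))%E.
    apply/funext => p; rewrite /g integralE; congr (_ - _)%E; apply: eq_integral => q _.
      by rewrite !funeposE.
    by rewrite !funenegE.
  have p0 x : (0 <= F^\+%E x)%E by [].
  have n0 x : (0 <= F^\-%E x)%E by [].
  apply: emeasurable_funB.
    exact: (@measurable_fun_fubini_tonelli_F _ _ _ _ R m _ (measurable_funepos mf) p0).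
  exact: (@measurable_fun_fubini_tonelli_F _ _ _ _ R m _ (measurable_funeneg mf) n0).
have gn0 (p : R * R) : (0 <= g^\- p)%E by [].
have gN : (\int[m]_p g^\- p < +oo)%E.
  rewrite ltey; apply/eqP => e; move: h.
  by rewrite [X in (_ < X)%E]integralE -/g e addeNy ltxx.
have I0 : (0 <= \int[m]_p g^\- p)%E by apply: integral_ge0.
exists (2 * ln 2 + fine (\int[m]_p g^\- p)%E).
  by rewrite addr_ge0 ?mulr_ge0// fine_ge0.
rewrite EFinD fineK ?ge0_fin_numE//.
apply: (@le_trans _ _ (\int[m]_p ((2 * ln 2)%:E + g^\- p))%E).
  apply: le_integral_nomeas => p _; last exact: kernel_le.
  by apply: integral_ge0 => q _; exact: (log_kernel_ge0 diam_lt2).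
have c0 (q : R * R) : setT q -> (0 <= (2 * ln 2)%:E :> \bar R)%E by rewrite lee_fin mulr_ge0.
rewrite (ge0_integralD m measurableT c0 (measurable_cst _) (fun q _ => gn0 q) (measurable_funeneg mg)).
by rewrite (integral_cst m measurableT (2 * ln 2)%:E) [X in (_ * X)%E](_ : _ = 1%E) ?mule1//; exact: (probability_setT m).
Qed.

End capacity.

Section non_polar_sets.
Variable R : realType.

(** A positive capacity means that the supremum of the energies is above [-oo],
    hence that some probability carried by the set has finite energy. *)
Lemma non_polar_measure (K : set (cplane R)) : compact K -> K `<=` @unit_disk R -> non_polar K ->
  exists m : probability (R * R)%type R, (m (@toC R @^-1` K) = 1)%E /\
    exists2 V : R, 0 <= V & (\int[m]_p \int[m]_q log_kernel (@toC R @^-1` K) p q <= V%:E)%E.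
Proof.
move=> cK Kd; rewrite /non_polar /log_capacity => h.
have : (-oo < ereal_sup [set log_energy mu | mu in
    [set mu : probability (R * R)%type R | mu (@toC R @^-1` K) = 1%E]])%E.
  rewrite ltNye; apply/eqP => e; move: h; rewrite e /= ltxx.
  by [].
move=> /ereal_sup_gt[_ [m /= m1 <-]] hm; exists m; split => //.
apply: finite_energy => //.
- exact: compact_plane_measurable.
- by move=> p /Kd; rewrite unit_diskE.
Qed.

End non_polar_sets.

(** * Area integrals over the disk *)

Section area.
Variable R : realType.
Local Notation mu := (@lebesgue_measure R).
Local Notation D0 := (@toC R @^-1` (@unit_disk R)).

Lemma disk_pointE (p : R * R) : D0 p = (pnorm p < 1) :> Prop.
Proof. by rewrite -unit_diskE. Qed.

(** A metric is given on the disk only; extended by zero it lives on the plane,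
    where the invariance of area under affine maps is available. *)
Definition zero_ext (h : cplane R -> R) : R * R -> R := (h \o @toC R) \_ D0.

Lemma measurable_zero_ext (h : cplane R -> R) : measurable_fun D0 (h \o @toC R) ->
  measurable_fun setT (zero_ext h).
Proof. by move=> mh; apply/(measurable_restrictT _ (@disk_plane_measurable R)). Qed.

Lemma zero_ext_ge0 (h : cplane R -> R) p : (forall z, unit_disk z -> 0 <= h z) -> 0 <= zero_ext h p.
Proof. by move=> h0; rewrite /zero_ext patchE; case: ifPn => // /set_mem Dp; exact: h0. Qed.

Lemma zero_extE (h : cplane R -> R) p : pnorm p < 1 -> h (toC p) = zero_ext h p.
Proof. by move=> p1; rewrite /zero_ext patchE mem_set// disk_pointE. Qed.

Lemma area_integral_I2 (h : cplane R -> R) : (forall z, unit_disk z -> 0 <= h z) ->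
  measurable_fun D0 (h \o @toC R) ->
  area_integral (@unit_disk R) h = I2 (fun p => (zero_ext h p)%:E).
Proof.
move=> h0 mh; rewrite -I2_prod; last first.
  by apply: nneg_meas_EFin => [|p]; [exact: measurable_zero_ext|exact: zero_ext_ge0].
rewrite /area_integral integral_mkcond; apply: eq_integral => p _.
by rewrite /zero_ext !patchE; case: ifP.
Qed.

End area.

(** * Lower bound for extremal distances: a metric with a pole *)

Section lower_bound.
Variable R : realType.
Local Notation mu := (@lebesgue_measure R).
Local Notation D0 := (@toC R @^-1` (@unit_disk R)).
Variables (zeta : cplane R) (h : R).
Hypothesis zeta1 : modulus zeta = 1.
Hypothesis h0 : 0 < h.
Hypothesis h1 : h <= 1.

(** Nearly extremal for the curves from a fixed compact set to a set of size [h]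
    at distance [h] from the boundary point [zeta]: away from the scale [h] it is
    the logarithmic metric [1 / |x - zeta|]. *)
Definition pole_metric (x : cplane R) : R := (modulus (x - zeta) + h)^-1.
Local Notation rho := pole_metric.

Let pos x : 0 < modulus (x - zeta) + h. Proof. by rewrite ltr_wpDl// modulus_ge0. Qed.

Let W (y : R * R) : R := \1_(`[0, 2]) y.1 * (\1_(`[-1, 1]) y.2 * ((y.1 + h) ^+ 2 + y.2 ^+ 2)^-1).

Let nW : nneg_meas (fun y => (W y)%:E).
Proof.
apply: nneg_meas_EFin => [|y]; last first.
  by rewrite /W !mulr_ge0 ?indic_ge0// invr_ge0 addr_ge0 ?sqr_ge0.
apply: measurable_funM; first by apply: measurable_fun_itv_indic; exact: measurable_fst.
apply: measurable_funM; first by apply: measurable_fun_itv_indic; exact: measurable_snd.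
apply: measurable_funV; apply: measurable_funD; apply: measurable_funX; last exact: measurable_snd.
by apply: measurable_funD; [exact: measurable_fst|exact: measurable_cst].
Qed.

Lemma integral_cauchy_kernel (b : R) : 0 < b ->
  (\int[mu]_y (\1_(`[-1, 1]) y * (b ^+ 2 + y ^+ 2)^-1)%:E <= (pi / b)%:E)%E.
Proof.
move=> b0; have bn0 : b != 0 by rewrite gt_eqF.
pose G (y : R) : \bar R := (\1_(`[-1, 1]) y * (b ^+ 2 + y ^+ 2)^-1)%:E.
have mG : measurable_fun setT G.
  apply/measurable_EFinP; apply: measurable_funM; first exact: measurable_indic.
  apply: measurable_funV; apply: measurable_funD; first exact: measurable_cst.
  by apply: measurable_funX; exact: measurable_id.
have G0 y : (0 <= G y)%E by rewrite lee_fin mulr_ge0 ?indic_ge0// invr_ge0 addr_ge0 ?sqr_ge0.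
have e := integral_affine 0 bn0 mG G0.
have b0' : (0 <= b%:E)%E by rewrite lee_fin ltW.
rewrite [leLHS](_ : _ = (b%:E * \int[mu]_y G (b * y + 0)%R)%E); last first.
  by rewrite e gtr0_norm// muleA -EFinM divff// mul1e.
have -> : (\int[mu]_y G (b * y + 0)%R = \int[mu]_y ((b ^- 2)%:E * (\1_(`[- b^-1, b^-1]) y * (1 + y ^+ 2)^-1)%:E))%E.
  apply: eq_integral => y _; rewrite /G addr0 -EFinM; congr EFin.
  have -> : \1_(`[-1, 1]) (b * y) = \1_(`[- b^-1, b^-1]) y :> R.
    rewrite !indicE !mem_setE !in_itv /= -[b^-1]mul1r -mulNr ler_pdivrMr// ler_pdivlMr//.
    by rewrite [y * b]mulrC.
  rewrite mulrCA; congr (_ * _); rewrite -invfM; congr (_^-1); ring.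
have ib : 0 < b^-1 by rewrite invr_gt0.
rewrite ge0_integralZl//; last 3 first.
- apply/measurable_EFinP; apply: measurable_funM; first exact: measurable_indic.
  by apply: measurable_funV; apply: measurable_add1_sqr; exact: measurable_id.
- by move=> y _; rewrite lee_fin mulr_ge0 ?indic_ge0// invr_ge0 addr_ge0// sqr_ge0.
- by rewrite lee_fin invr_ge0 sqr_ge0.
rewrite integral_indicM (integral_atan ib) -!EFinM lee_fin.
have -> : b * (b ^- 2 * (2 * atan b^-1)) = (2 * atan b^-1) / b by field.
by rewrite ler_pM2r// mulrC -ler_pdivlMr// ltW// atan_ltpi2.
Qed.

Let I2_W : (I2 (fun y => (W y)%:E) <= (pi * ln (3 / h))%:E)%E.
Proof.
have pi0 : 0 <= pi :> R by exact: pi_ge0.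
have mV (k : R) : measurable_fun setT (fun x : R => (\1_(`[k, k + 2]) x * (x + (h - k))^-1)%:E).
  apply/measurable_EFinP; apply: measurable_funM; first exact: measurable_indic.
  apply: measurable_funV; apply: measurable_funD; first exact: measurable_id.
  exact: measurable_cst.
have V0 (k : R) : 0 <= k -> forall x : R, (0 <= (\1_(`[k, k + 2]) x * (x + (h - k))^-1)%:E)%E.
  move=> k0 x; rewrite lee_fin indicE mem_setE in_itv /=.
  case: (boolP (_ <= _ <= _)) => [/andP[kx _]|_]; last by rewrite mul0r.
  by rewrite mul1r invr_ge0 addrCA addr_ge0// ?subr_ge0// ltW.
have Vx (x : R) : setT x -> (0 <= (\1_(`[0, 2]) x * (x + h)^-1)%:E)%E.
  by move=> _; have := V0 0 (lexx 0) x; rewrite add0r subr0.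
have mV0 : measurable_fun setT (fun x : R => (\1_(`[0, 2]) x * (x + h)^-1)%:E).
  by have := mV 0; rewrite add0r subr0.
apply: (@le_trans _ _ (\int[mu]_x (pi%:E * (\1_(`[0, 2]) x * (x + h)^-1)%:E))%E).
  apply: ge0_le_integral.
  - exact: measurableT.
  - by move=> x _; apply: integral_ge0 => y _; exact: nW.2.
  - exact: (nneg_meas_inner nW).
  - exact: measurable_funeM.
  move=> x _; rewrite /W /= indicE mem_setE in_itv /=.
  case: (boolP (_ <= _ <= _)) => [/andP[x0 _]|_]; last first.
    rewrite mul0r mule0 (_ : integral _ _ _ = 0%E) ?lexx//.
    by apply: integral0_eq => y _; rewrite mul0r.
  have b0 : 0 < x + h by rewrite ltr_wpDl.
  rewrite mul1r -EFinM; apply: le_trans (integral_cauchy_kernel b0).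
  by rewrite le_eqVlt; apply/orP; left; apply/eqP; apply: eq_integral => y _; rewrite mul1r.
have pi0' : (0 <= (pi : R)%:E)%E by rewrite lee_fin.
rewrite (ge0_integralZl mu measurableT mV0 Vx pi0') EFinM; apply: lee_wpmul2l => //.
have -> : (\int[mu]_x (\1_(`[0, 2]) x * (x + h)^-1)%:E = \int[mu]_x (\1_(`[h, h + 2]) x * x^-1)%:E)%E.
  have e := integral_affine h (oner_neq0 R) (f := fun x : R => (\1_(`[h, h + 2]) x * x^-1)%:E).
  rewrite normr1 invr1 mul1e in e; rewrite -e.
  - apply: eq_integral => x _; rewrite mul1r !indicE !mem_setE !in_itv /=.
    by rewrite lerDr addrC lerD2l.
  - by have := mV h; rewrite subrr; under eq_fun do rewrite addr0.
  - by move=> x; have := V0 h (ltW h0) x; rewrite subrr addr0.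
rewrite integral_indicM integral_inv//; last by rewrite lerDl.
rewrite lee_fin -ln_div ?posrE ?addr_gt0// ler_ln ?posrE ?divr_gt0 ?addr_gt0//.
by rewrite ler_pM2r ?invr_gt0//; have := h1; lra.
Qed.

Let mrho : measurable_fun D0 (rho \o @toC R).
Proof.
apply: measurable_funTS; apply: measurable_funV; apply: measurable_funD; last exact: measurable_cst.
rewrite (_ : (fun p => _) = (fun p : R * R => pnorm (p - ofC zeta))).
  by apply: measurable_fun_pnorm; apply: measurable_fun_pB; [exact: measurable_id|exact: measurable_cst].
by apply/funext => p; rewrite pnormB toCK.
Qed.

Let rho2 (z : cplane R) : R := rho z ^+ 2.

Let rho2_ge0 z : unit_disk z -> 0 <= rho2 z. Proof. by move=> _; exact: sqr_ge0. Qed.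

Let mrho2 : measurable_fun D0 (rho2 \o @toC R).
Proof. exact: (measurable_funX 2 mrho). Qed.

Let n2 : nneg_meas (fun p => (zero_ext rho2 p)%:E).
Proof. by apply: nneg_meas_EFin => [|p]; [exact: measurable_zero_ext|exact: zero_ext_ge0]. Qed.

Lemma boundary_chartB r y : modulus (boundary_chart zeta r y - zeta) = `|r| * pnorm y.
Proof.
rewrite /boundary_chart mulrBr mulr1 addrAC subrr add0r modulusN modulusM zeta1 mul1r.
exact: (pnormZ r y).
Qed.

(** In the coordinates at [zeta] the disk lies in the half plane [y1 >= 0], where
    [(|y| + h) ^ 2] is at least [(y1 + h) ^ 2 + y2 ^ 2]. The integral of the inverse
    in [y2] is at most [pi / (y1 + h)], and that in [y1] gives the logarithm. *)
Lemma pole_area_le : (area_integral (@unit_disk R) rho2 <= (pi * ln (3 / h))%:E)%E.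
Proof.
rewrite (area_integral_I2 rho2_ge0 mrho2).
have n0 : (1 : R) != 0 by exact: oner_neq0.
have := I2_boundary_chart zeta1 n0 n2; rewrite expr1n invr1 mul1e => <-.
apply: le_trans I2_W; apply: I2_le => //.
  exact: (nneg_meas_comp n2 (measurable_ofC_boundary_chart zeta 1)).
move=> y; rewrite lee_fin /zero_ext patchE; case: ifPn => [/set_mem|_]; last first.
  by have := nW.2 y; rewrite lee_fin.
rewrite /preimage /= toCK unit_diskE.
have -> : modulus (boundary_chart zeta 1 y) = pnorm (1 - y.1, - y.2).
  rewrite /boundary_chart modulusM zeta1 !mul1r /pnorm; congr modulus.
  by rewrite /toC /=; apply/eqP; rewrite eq_complex /= sub0r !eqxx.
rewrite pnormE /= sqrrN => y1.
have {}y1 : (1 - y.1) ^+ 2 + y.2 ^+ 2 < 1.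
  by move: y1; rewrite -[X in _ < X -> _]sqrtr1 ltr_sqrt.
have s1 := sqr_ge0 (1 - y.1); have s2 := sqr_ge0 y.2.
have a1 : 0 <= y.1 <= 2 by apply/andP; split; nra.
have a2 : -1 <= y.2 <= 1 by apply/andP; split; nra.
rewrite /W !indicE !mem_setE !in_itv /= a1 a2 !mul1r.
have hp : 0 < (y.1 + h) ^+ 2 + y.2 ^+ 2.
  by rewrite ltr_pwDl ?sqr_ge0// exprn_gt0// ltr_wpDl//; case/andP: a1.
rewrite /rho2 /rho boundary_chartB normr1 mul1r exprVn.
have hp' : 0 < (pnorm y + h) ^+ 2 by rewrite exprn_gt0// ltr_wpDl// pnorm_ge0.
rewrite ler_pV2 ?inE ?unitfE ?gt_eqF//.
have e2 : pnorm y ^+ 2 = y.1 ^+ 2 + y.2 ^+ 2.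
  by rewrite pnormE sqr_sqrtr// addr_ge0 ?sqr_ge0.
have := coord1_le_pnorm y; rewrite ger0_norm; last by case/andP: a1.
have := h0; move: e2; rewrite !expr2; nra.
Qed.

(** The metric is at least [1 / 3] on the disk, in particular on the square of side
    [1 / 2] at the origin. *)
Lemma pole_area_gt0 : (0 < area_integral (@unit_disk R) rho2)%E.
Proof.
rewrite (area_integral_I2 rho2_ge0 mrho2).
pose B (p : R * R) : R := 9^-1 * \1_(`[0, 1 / 2]) p.1 * \1_(`[0, 1 / 2]) p.2.
have nB : nneg_meas (fun p => (B p)%:E).
  apply: nneg_meas_EFin => [|p]; last by rewrite /B !mulr_ge0 ?indic_ge0// invr_ge0.
  apply: measurable_funM; last by apply: measurable_fun_itv_indic; exact: measurable_snd.
  apply: measurable_funM; first exact: measurable_cst.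
  by apply: measurable_fun_itv_indic; exact: measurable_fst.
apply: (@lt_le_trans _ _ (I2 (fun p => (B p)%:E))).
  have i9 : 0 <= 9^-1 :> R by rewrite invr_ge0.
  have h2 : (0 : R) <= 1 / 2 by lra.
  have -> : I2 (fun p => (B p)%:E) = (\int[mu]_x ((9^-1 * (1 / 2 - 0)) * \1_(`[0, 1 / 2]) x)%:E)%E.
    apply: eq_integral => x _; rewrite /B /= mulrAC.
    have := integral_indic_itv (k := 9^-1 * \1_(`[0, 1 / 2]) x) _ h2; rewrite -/mu => -> //.
  rewrite integral_indic_itv//.
apply: I2_le => // p; rewrite lee_fin /B !indicE !mem_setE !in_itv /=.
have [p1|_] := boolP (0 <= p.1 <= 1 / 2); last by rewrite mulr0 mul0r; exact: zero_ext_ge0.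
have [p2|_] := boolP (0 <= p.2 <= 1 / 2); last by rewrite mulr0; exact: zero_ext_ge0.
rewrite !mulr1.
have pn : pnorm p < 1.
  rewrite -[X in _ < X]sqrtr1 pnormE ltr_sqrt//.
  by move: p1 p2 => /andP[? ?] /andP[? ?]; nra.
rewrite -zero_extE// /rho2 /rho exprVn ler_pV2 ?inE ?unitfE ?gt_eqF ?exprn_gt0//.
have hp := pos (toC p); have : modulus (toC p - zeta) <= pnorm p + 1.
  by apply: le_trans (modulusB _ _) _; rewrite zeta1.
have -> : 9 = 3 ^+ 2 :> R by rewrite -natrX.
by move=> hm; rewrite ler_sqr ?nnegrE// ?(ltW hp)//; have := h1; lra.
by rewrite /= ltr0n.
Qed.

Lemma metric_on_pole : metric_on (@unit_disk R) rho.
Proof.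
split.
- by move=> z _; rewrite /rho invr_ge0 ltW.
- exact: mrho.
- by rewrite pole_area_gt0/=; apply: le_lt_trans pole_area_le _; exact: ltry.
Qed.

Lemma extremal_distance_pole_ge (E F : set (cplane R)) (l0 : R) : 0 <= l0 ->
  (forall x y, E x -> F y -> l0 <= ln ((modulus (x - zeta) + h) / (modulus (y - zeta) + h))) ->
  ((l0 ^+ 2 / (pi * ln (3 / h)))%:E <= extremal_distance (@unit_disk R) E F)%E.
Proof.
move=> l00 hl; rewrite /extremal_distance /extremal_length.
set I := ereal_inf [set curve_integral rho g | g in joining_curves (@unit_disk R) E F].
have lI : (l0%:E <= I)%E.
  apply: le_ereal_inf_tmp => _ [g [rg _ Eg Fg] <-].
  by apply: le_trans (curve_integral_ge zeta h0 rg); rewrite lee_fin hl.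
set A := area_integral (@unit_disk R) rho2.
have A0 : (0 < A)%E := pole_area_gt0.
have Afin : A \is a fin_num.
  by rewrite gt0_fin_numE//; apply: le_lt_trans pole_area_le _; exact: ltry.
apply: (@le_trans _ _ (I ^+ 2 / A)%E); last by apply: ereal_sup_ubound; exists rho => //; exact: metric_on_pole.
have a0 : 0 < fine A by rewrite -lte_fin fineK.
have aA : fine A <= pi * ln (3 / h) by rewrite -lee_fin fineK//; exact: pole_area_le.
apply: (@le_trans _ _ ((l0 ^+ 2)%:E / A)%E).
  rewrite -(fineK Afin) inver gt_eqF// -EFinM lee_fin.
  by rewrite ler_wpM2l ?sqr_ge0// lef_pV2 ?posrE// (lt_le_trans a0).
apply: lee_wpmul2r; first by rewrite inve_ge0 ltW.
by rewrite expr2 EFinM expe2 lee_pmul ?lee_fin.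
Qed.

End lower_bound.

(** * Coordinates at a boundary point *)

Section corner_coordinates.
Variable R : realType.
Implicit Types (P Q p q x y : R * R).

Lemma lerp_sym P Q (s : R) : lerp P Q (1 - s) = lerp Q P s.
Proof. by rewrite /lerp; congr pair; ring. Qed.

Lemma Seg_sym (sg : R * R -> R) P Q : measurable_fun setT sg -> (forall p, 0 <= sg p) ->
  Seg sg P Q = Seg sg Q P.
Proof.
move=> msg sg0; pose f (s : R) : \bar R := (pnorm (Q - P)%R * sg (lerp P Q s))%:E.
have mf : measurable_fun setT f.
  apply/measurable_EFinP; apply: measurable_funM; first exact: measurable_cst.
  apply: (measurableT_comp msg); apply: measurable_fun_lerp;
    (exact: measurable_id || exact: measurable_cst).
have f0 s : (0 <= f s)%E by rewrite lee_fin mulr_ge0// pnorm_ge0.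
have segE A B : Seg sg A B = (\int[@lebesgue_measure R]_(s in `[0%R, 1%R]) (pnorm (B - A)%R * sg (lerp A B s))%:E)%E.
  rewrite /Seg integral_indicM integral_itv_obnd_cbnd//; apply: measurable_funTS.
  apply/measurable_EFinP; apply: measurable_funM; first exact: measurable_cst.
  apply: (measurableT_comp msg); apply: measurable_fun_lerp;
    (exact: measurable_id || exact: measurable_cst).
rewrite !segE; pose F s : \bar R := (\1_(`[0, 1]) s * (pnorm (Q - P)%R * sg (lerp P Q s)))%:E.
have mF : measurable_fun setT F.
  apply/measurable_EFinP; apply: measurable_funM; first exact: measurable_indic.
  exact/measurable_EFinP.
have F0 s : (0 <= F s)%E.
  by rewrite lee_fin mulr_ge0 ?indic_ge0// mulr_ge0 ?pnorm_ge0.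
have n1 : (-1 : R) != 0 by rewrite oppr_eq0 oner_neq0.
have e := integral_affine 1 n1 mF F0; rewrite normrN1 invr1 mul1e in e.
rewrite -integral_indicM -[RHS]integral_indicM -/F -e; apply: eq_integral => s _.
rewrite /F; congr EFin; rewrite mulN1r addrC lerp_sym pnormBC; congr (_ * _).
by rewrite !indicE !mem_setE !in_itv /= subr_ge0 lerBlDr lerDl andbC.
Qed.

Variable zeta : cplane R.
Hypothesis zeta1 : modulus zeta = 1.

Definition chart y : R * R := ofC (boundary_chart zeta 1 y).

(** Multiplication by [conjc zeta] turns the outer normal at [zeta] into the first
    axis. *)
Definition cochart x : R * R := ofC (1 - conjc zeta * toC x).

Lemma zeta_conj : zeta * conjc zeta = 1.
Proof.
have : cRe zeta ^+ 2 + cIm zeta ^+ 2 = 1.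
  by rewrite -(expr1n _ 2) -zeta1 modulusE sqr_sqrtr// addr_ge0 ?sqr_ge0.
case: zeta => c s /= e; apply/eqP; rewrite eq_complex /=; apply/andP; split; apply/eqP; last ring.
rewrite -e; ring.
Qed.

Lemma chartK x : chart (cochart x) = x.
Proof.
rewrite -[RHS](@ofCK R); congr ofC; rewrite /boundary_chart.
have -> : Complex (1 * (cochart x).1) (1 * (cochart x).2) = 1 - conjc zeta * toC x.
  by rewrite !mul1r; exact: (@toCK R).
by rewrite opprB addrC subrK mulrA zeta_conj mul1r.
Qed.

Lemma chartB x y : pnorm (chart x - chart y) = pnorm (x - y).
Proof.
rewrite pnormB /chart !toCK /boundary_chart -mulrBr modulusM zeta1 mul1r pnormBC pnormB.
by congr modulus; rewrite !mul1r opprB addrC addrA subrK.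
Qed.

Lemma cochartB x y : pnorm (cochart x - cochart y) = pnorm (x - y).
Proof. by rewrite -chartB !chartK. Qed.

Lemma pnorm_cochart x : pnorm (cochart x) = modulus (toC x - zeta).
Proof.
rewrite /pnorm /cochart toCK modulusBC.
have -> : zeta - toC x = zeta * (1 - conjc zeta * toC x).
  by rewrite mulrBr mulr1 mulrA zeta_conj mul1r.
by rewrite modulusM zeta1 mul1r.
Qed.

Lemma lerp_chart P Q (s : R) : lerp (chart P) (chart Q) s = chart (lerp P Q s).
Proof.
rewrite /chart !ofC_boundary_chart /lerp /=.
by case: P Q => [a b] [c d] /=; congr pair; ring.
Qed.

Lemma Seg_chart (sg : R * R -> R) P Q : Seg sg (chart P) (chart Q) = Seg (sg \o chart) P Q.
Proof. by apply: eq_integral => s _; rewrite chartB lerp_chart. Qed.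

Lemma measurable_chart : measurable_fun setT chart.
Proof. exact: measurable_ofC_boundary_chart. Qed.

Lemma measurable_cochart (f : R * R -> R * R) : measurable_fun setT f ->
  measurable_fun setT (fun x => cochart (f x)).
Proof.
move=> mf; have m1 := measurable_fun_coord1 mf; have m2 := measurable_fun_coord2 mf.
have -> : (fun x => cochart (f x)) = (fun x =>
   (1 - (cRe zeta * (f x).1 + cIm zeta * (f x).2), cIm zeta * (f x).1 - cRe zeta * (f x).2)).
  apply/funext => x; rewrite /cochart; case: zeta (f x) => [c s] [a b]; rewrite /ofC /=.
  by congr pair; ring.
have mk (k : R) (g : R * R -> R) : measurable_fun setT g -> measurable_fun setT (fun x => k * g x).
  by move=> mg; apply: measurable_funM => //; exact: measurable_cst.
apply: measurable_fun_pair; last by apply: measurable_funB; exact: mk.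
apply: measurable_funB; first exact: measurable_cst.
by apply: measurable_funD; exact: mk.
Qed.

(** The ray of slope [t] leaves the disk at the abscissa [2 / (1 + t ^ 2)]. *)
Lemma chart_pencil_disk (T r : R) z : 0 < r -> r * (1 + T ^+ 2) <= 1 ->
  1 / 2 <= z.1 <= 1 -> - T <= z.2 <= T -> pnorm (chart (pencil r z)) < 1.
Proof.
move=> r0 rT /andP[a2 a1] /andP[t1 t2].
have -> : pnorm (chart (pencil r z)) = pnorm (1 - r * z.1, - (r * (z.1 * z.2))).
  rewrite /chart /pnorm toCK /boundary_chart modulusM zeta1 mul1r; congr modulus.
  by apply/eqP; rewrite eq_complex /= !mul1r sub0r !eqxx.
rewrite pnormE /= sqrrN -[X in _ < X]sqrtr1 ltr_sqrt//.
have tT : z.2 ^+ 2 <= T ^+ 2.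
  have h : 0 <= (T - z.2) * (z.2 + T) by apply: mulr_ge0; lra.
  by rewrite -subr_ge0 (_ : _ - _ = (T - z.2) * (z.2 + T))//; ring.
set a := z.1; set t := z.2; have a0 : 0 < a by rewrite /a; lra.
have ra : 0 < r * a by rewrite mulr_gt0.
have h1 : r * (1 + t ^+ 2) <= 1 by apply: le_trans rT; rewrite ler_pM2l// lerD2l.
have h2 : a * (r * (1 + t ^+ 2)) <= 1.
  by rewrite -[X in _ <= X]mul1r; apply: ler_pM => //; [exact: ltW|rewrite mulr_ge0 ?ltW// ltr_pwDl// sqr_ge0].
have -> : (1 - r * a) ^+ 2 + (r * (a * t)) ^+ 2 = 1 - (r * a) * (2 - a * (r * (1 + t ^+ 2))) by ring.
by rewrite ltrBlDr ltrDl mulr_gt0//; lra.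
Qed.

End corner_coordinates.

Section pencil_mass.
Variable R : realType.
Local Notation mu := (@lebesgue_measure R).

Lemma pencil_mass (T : R) (c : \bar R) : 0 < T -> (0 <= c)%E ->
  I2 (fun z => (pencil_weight T z)%:E * c)%E = c.
Proof.
move=> T0 c0; have aT := atan_gt0 T0.
have mw : measurable_fun setT (fun t : R => (angular_weight T t)%:E).
  by apply/measurable_EFinP; apply: measurable_angular_weight; exact: measurable_id.
have w0 (t : R) : setT t -> (0 <= (angular_weight T t)%:E)%E.
  by move=> _; rewrite lee_fin angular_weight_ge0.
have iw : (\int[mu]_t (angular_weight T t)%:E = 1)%E.
  have iT : 0 <= (2 * atan T)^-1 by rewrite invr_ge0 mulr_ge0// ltW.
  transitivity (\int[mu]_t (((2 * atan T)^-1)%:E * (\1_(`[- T, T]) t * (1 + t ^+ 2)^-1)%:E))%E.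
    by apply: eq_integral => t _; rewrite -EFinM; congr EFin; rewrite /angular_weight mulrC.
  rewrite ge0_integralZl//; last 2 first.
  - apply/measurable_EFinP; apply: measurable_funM; first exact: measurable_indic.
    by apply: measurable_funV; apply: measurable_add1_sqr; exact: measurable_id.
  - by move=> t _; rewrite lee_fin mulr_ge0 ?indic_ge0// invr_ge0 addr_ge0// sqr_ge0.
  by rewrite integral_indicM integral_atan// -EFinM mulVf// gt_eqF// mulr_gt0.
rewrite -[RHS](uniform_weight c0).2; apply: eq_integral => a _; rewrite /pencil_weight /=.
have i0 : (0 <= (2 * \1_(`[1/2, 1]) a : R)%:E)%E by rewrite lee_fin mulr_ge0 ?indic_ge0.
transitivity (\int[mu]_t (((2 * \1_(`[1/2, 1]) a : R)%:E * c) * (angular_weight T t)%:E))%E.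
  by apply: eq_integral => t _; rewrite EFinM muleAC.
have ic0 : (0 <= (2 * \1_(`[1/2, 1]) a : R)%:E * c)%E by rewrite mule_ge0.
by rewrite (ge0_integralZl mu measurableT mw w0 ic0) iw mule1.
Qed.

Lemma pencil_weight_neq0 (T : R) (z : R * R) : pencil_weight T z != 0 ->
  1 / 2 <= z.1 <= 1 /\ - T <= z.2 <= T.
Proof.
rewrite /pencil_weight /angular_weight !indicE !mem_setE !in_itv /=.
case: (boolP (1 / 2 <= z.1 <= 1)) => _ /=; last by rewrite mulr0 mul0r eqxx.
by case: (boolP (- T <= z.2 <= T)) => _ //=; rewrite !mul0r mulr0 eqxx.
Qed.

End pencil_mass.

Lemma arc_param_in (R : realType) (g : R -> cplane R) (s : R) :
  (s%:E <= curve_length 0 1 g)%E -> exists2 t, 0 <= t <= 1 & arc_param g s = g t.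
Proof.
move=> sL; rewrite /arc_param; set S := [set t | _].
have S1 : S 1 by split; [rewrite ler01 lexx|].
have lbS : lbound S 0 by move=> t [/andP[]].
have hS : has_inf S by split; [exists 1|exists 0].
exists (inf S) => //; apply/andP.
by split; [apply: lb_le_inf => //; exists 1|exact: (ge_inf hS.2)].
Qed.

Lemma nneg_measD (R : realType) (F G : R * R -> \bar R) : nneg_meas F -> nneg_meas G ->
  nneg_meas (fun z => F z + G z)%E.
Proof.
by move=> [mF F0] [mG G0]; split; [exact: emeasurable_funD|move=> z; exact: adde_ge0].
Qed.

Lemma I2_sum3 (R : realType) (F G H : R * R -> \bar R) : nneg_meas F -> nneg_meas G -> nneg_meas H ->
  nneg_meas (fun z => F z + (G z + H z))%E /\
  (I2 (fun z => F z + (G z + H z)) = I2 F + (I2 G + I2 H))%E.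
Proof.
move=> nF nG nH; have nGH := nneg_measD nG nH; split; first exact: nneg_measD.
by rewrite (I2D nF nGH) (I2D nG nH).
Qed.

Lemma mul0_sum3 (R : realType) (a b c d : \bar R) :
  (0%:E * a <= 0%:E * b + (0%:E * c + 0%:E * d))%E.
Proof. by rewrite !mul0e !adde0. Qed.

Lemma mul1_sum3 (R : realType) (a b c d : \bar R) :
  (1%:E * a <= 1%:E * b + (1%:E * c + 1%:E * d))%E = (a <= b + (c + d))%E.
Proof. by rewrite !mul1e. Qed.

Lemma weighted_sum3 (R : realType) (w a b c d : \bar R) : (0 <= w)%E ->
  (0 <= b)%E -> (0 <= c)%E -> (0 <= d)%E -> (a <= b + (c + d))%E ->
  (w * a <= w * b + (w * c + w * d))%E.
Proof.
move=> w0 b0 c0 d0 abcd.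
rewrite -(ge0_muleDr w c0 d0) -(ge0_muleDr w b0 (adde_ge0 c0 d0)).
exact: lee_wpmul2l.
Qed.

(** * Upper bound for extremal distances: random broken lines *)

Section upper_bound.
Variable R : realType.
Local Notation mu := (@lebesgue_measure R).
Local Notation D := (@unit_disk R).
Local Notation D0 := (@toC R @^-1` (@unit_disk R)).

(** The energy bound for an end of the random broken line, as a function of its
    size [R0] and of the contraction [kappa] of the starting measure. *)
Definition end_energy (T V R0 kappa : R) : R :=
  16 * spread_const R0 T ^+ 2 * (1 + ln (spread_radius R0 T / kappa) + V).

Variables (K : set (cplane R)) (f : cplane R -> cplane R).
Local Notation K0 := (@toC R @^-1` K).
Hypothesis mK0 : measurable K0.
Hypothesis Kd : K `<=` D.
Hypothesis fD : forall z, unit_disk z -> unit_disk (f z).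
Hypothesis fc : forall z, unit_disk z -> {for z, continuous f}.
Variable m : probability (R * R)%type R.
Hypothesis m1 : (m K0 = 1)%E.
Variable V : R.
Hypothesis V0 : 0 <= V.
Hypothesis mV : (\int[m]_p \int[m]_q log_kernel K0 p q <= V%:E)%E.
Variables (zeta : cplane R) (h T C kappa : R).
Hypothesis zeta1 : modulus zeta = 1.
Hypothesis h0 : 0 < h.
Hypothesis h1 : h <= 1.
Hypothesis T0 : 0 < T.
Hypothesis C0 : 0 <= C.
Hypothesis fC : forall z, K z -> modulus (f z - zeta) <= C * h.
Hypothesis kappa0 : 0 < kappa.
Hypothesis kappa1 : kappa <= 1.
Hypothesis fkappa : forall z w, K z -> K w -> kappa * h * modulus (z - w) <= modulus (f z - f w).

Let r0 : R := (1 + T ^+ 2)^-1.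
Let r1 : R := r0 * h.

Let T2 : 0 < 1 + T ^+ 2. Proof. by rewrite ltr_pwDl// sqr_ge0. Qed.
Let r0_gt0 : 0 < r0. Proof. by rewrite invr_gt0. Qed.
Let r1_gt0 : 0 < r1. Proof. by rewrite mulr_gt0. Qed.
Let r10 : r1 <= r0. Proof. by rewrite /r1 ler_piMr// ltW. Qed.
Let r0T : r0 * (1 + T ^+ 2) <= 1. Proof. by rewrite mulVf// gt_eqF. Qed.
Let r1T : r1 * (1 + T ^+ 2) <= 1.
Proof. by apply: le_trans r0T; rewrite ler_wpM2r// ltW. Qed.
Let r0_le1 : r0 <= 1. Proof. by rewrite invf_le1// lerDl sqr_ge0. Qed.

Let q0 (p : R * R) : R * R :=
  if p \in D0 then (complex.Re (f (toC p)), complex.Im (f (toC p))) else (0, 0).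

Let q0E p : K0 p -> toC (q0 p) = f (toC p).
Proof. by move=> /Kd Kp; rewrite /q0 mem_set//; case: (f _). Qed.

(** Ends of the broken line in the coordinates at [zeta], rescaled to unit size:
    the first by the scale [r0] of the beginning of the rays, the last by the scale
    [r1 = r0 * h] of their end. *)
Let start p : R * R := scale r0^-1 (cochart zeta p).
Let finish p : R * R := scale r1^-1 (cochart zeta (q0 p)).

Let scaleVK (r : R) (p : R * R) : 0 < r -> scale r (scale r^-1 p) = p.
Proof. by move=> r0'; rewrite /scale /= !mulrA divff ?gt_eqF// !mul1r; case: p. Qed.

Let pnorm_scale (r : R) p : 0 < r -> pnorm (scale r p) = r * pnorm p.
Proof. by move=> r0'; rewrite [LHS](pnormZ r) gtr0_norm. Qed.

Let scaleB (r : R) p q : scale r p - scale r q = scale r (p - q).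
Proof. by rewrite /scale; congr pair => /=; ring. Qed.

Let mstart : measurable_fun setT start.
Proof.
apply: (measurableT_comp (measurable_scale r0^-1)).
by apply: measurable_cochart; exact: measurable_id.
Qed.

Let mfinish : measurable_fun setT finish.
Proof.
apply: (measurableT_comp (measurable_scale r1^-1)).
by apply: measurable_cochart; exact: measurable_extend.
Qed.

Let K0lt p : K0 p -> pnorm p < 1. Proof. by move=> /Kd; rewrite unit_diskE. Qed.

Let start_le p : K0 p -> pnorm (start p) <= 2 * r0^-1.
Proof.
move=> /K0lt p1; rewrite pnorm_scale ?invr_gt0// mulrC ler_pM2r ?invr_gt0// pnorm_cochart//.
by apply: le_trans (modulusB _ _) _; rewrite zeta1; apply: lerD => //; exact: ltW.
Qed.

Let start_dist p q : K0 p -> K0 q -> 1 * pnorm (p - q) <= pnorm (start p - start q).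
Proof.
move=> _ _; rewrite scaleB pnorm_scale ?invr_gt0// cochartB// ler_wpM2r ?pnorm_ge0//.
by rewrite invf_ge1.
Qed.

Let finish_le p : K0 p -> pnorm (finish p) <= C * r0^-1.
Proof.
move=> Kp; rewrite pnorm_scale ?invr_gt0// pnorm_cochart// q0E//.
rewrite ler_pdivrMl// /r1; apply: le_trans (fC Kp) _.
by rewrite [r0 * h]mulrC -mulrA [r0 * _]mulrCA divff ?gt_eqF// mulr1 mulrC.
Qed.

Let finish_dist p q : K0 p -> K0 q -> kappa * pnorm (p - q) <= pnorm (finish p - finish q).
Proof.
move=> Kp Kq; rewrite scaleB pnorm_scale ?invr_gt0// cochartB//.
rewrite [leLHS](_ : _ = kappa * modulus (toC p - toC q)); last by rewrite pnormB.
rewrite [pnorm (q0 p - _)]pnormB !q0E// ler_pdivlMl//.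
apply: le_trans (fkappa Kp Kq); rewrite mulrA ler_wpM2r ?modulus_ge0//.
by rewrite [r1 * _]mulrC ler_wpM2l ?(ltW kappa0)// /r1 ler_piMl// ltW.
Qed.

Let e1 := end_energy T V (2 * r0^-1) 1.
Let e2 := ln (2 / h) / (2 * atan T).
Let e3 := end_energy T V (C * r0^-1) kappa.

Section one_metric.
Variable rho : cplane R -> R.
Hypothesis mrho : metric_on D rho.

Let rho0 z : unit_disk z -> 0 <= rho z. Proof. by case: mrho => h' _ _; exact: h'. Qed.
Let mr : measurable_fun D0 (rho \o @toC R). Proof. by case: mrho. Qed.

Let srho : R * R -> R := zero_ext rho.
Let sg : R * R -> R := srho \o chart zeta.

Let msrho : measurable_fun setT srho. Proof. exact: measurable_zero_ext. Qed.
Let srho0 p : 0 <= srho p. Proof. exact: zero_ext_ge0. Qed.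
Let msg : measurable_fun setT sg.
Proof. exact: (measurableT_comp msrho (measurable_chart zeta)). Qed.
Let sg0 p : 0 <= sg p. Proof. exact: srho0. Qed.

Let area : \bar R := area_integral D (fun z => rho z ^+ 2)%R.

Let area_sg : area = I2 (fun y => (sg y ^+ 2)%:E).
Proof.
have n2 : nneg_meas (fun p => (srho p ^+ 2)%:E).
  by apply: nneg_meas_EFin => [|p]; [exact: measurable_funX|exact: sqr_ge0].
rewrite /area area_integral_I2.
- transitivity (I2 (fun p => (srho p ^+ 2)%:E)).
    apply: (congr1 (@I2 R)); apply/funext => p; rewrite /srho /zero_ext !patchE.
    by case: ifP => // _; rewrite /point /= expr0n.
  have := I2_boundary_chart zeta1 (oner_neq0 R) n2; rewrite expr1n invr1 mul1e => <-.
  by [].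
- by move=> z _; exact: sqr_ge0.
- exact: (measurable_funX 2 mr).
Qed.

Let curve_inf : \bar R := ereal_inf [set curve_integral rho g | g in joining_curves D K (f @` K)].

Let S1 p z : \bar R := Seg sg (scale r0 (start p)) (pencil r0 z).
Let S2 z : \bar R := Seg sg (pencil r0 z) (pencil r1 z).
Let S3 p z : \bar R := Seg sg (scale r1 (finish p)) (pencil r1 z).

(** The four points lie in the disk, which is convex: the broken line is one of
    the curves considered. *)
Let one_curve p z : K0 p -> 1 / 2 <= z.1 <= 1 -> - T <= z.2 <= T ->
  (curve_inf <= S1 p z + (S2 z + S3 p z))%E.
Proof.
move=> Kp z1 z2; pose q := q0 p.
have qE : toC q = f (toC p) by exact: q0E.
have p1 := K0lt Kp.
have q1 : pnorm q < 1 by rewrite /pnorm qE -unit_diskE; apply: fD; exact: Kd.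
have d0 := chart_pencil_disk zeta1 r0_gt0 r0T z1 z2.
have d1 := chart_pencil_disk zeta1 r1_gt0 r1T z1 z2.
set v1 := chart zeta (pencil r0 z) in d0 *; set v2 := chart zeta (pencil r1 z) in d1 *.
apply: (@le_trans _ _ (Seg srho p v1 + (Seg srho v1 v2 + Seg srho v2 q))%E).
  apply: (@le_trans _ _ (curve_integral rho (broken_curve p v1 v2 q))).
    apply: ge_ereal_inf; exists (curve_integral rho (broken_curve p v1 v2 q)) => //.
    exists (broken_curve p v1 v2 q) => //; have [g0 g1] := broken_curve_ends p v1 v2 q.
    split; [exact: broken_curve_rectifiable| |by rewrite g0|by rewrite g1 qE; exists (toC p)].
    have L0 : 0 <= broken_length p v1 v2 q by rewrite /broken_length !addr_ge0 ?pnorm_ge0.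
    move=> t /andP[t0 t1]; rewrite unit_diskE; apply: (broken_line_disk p1 d0 d1 q1).
      exact: mulr_ge0 L0 (ltW t0).
    by rewrite ler_piMr// ltW.
  by apply: curve_integral_broken => // x x1; exact: zero_extE.
have eq0 : chart zeta (scale r0 (start p)) = p by rewrite scaleVK// chartK.
have eq1 : chart zeta (scale r1 (finish p)) = q by rewrite scaleVK// chartK.
rewrite /S1 /S2 /S3 /sg -!(Seg_chart zeta1) eq0 eq1 -/v1 -/v2.
by rewrite (Seg_sym v2 q msrho srho0).
Qed.

Let mS (r : R) (P : R * R -> R * R) : measurable_fun setT P ->
  measurable_fun setT (fun x : (R * R) * (R * R) =>
    ((pencil_weight T x.2)%:E * Seg sg (scale r (P x.1)) (pencil r x.2))%E).
Proof.
move=> mP; apply: emeasurable_funM.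
  by apply/measurable_EFinP; apply: measurable_pencil_weight; exact: measurable_snd.
apply: (measurable_Seg msg sg0); last by apply: measurable_pencil; exact: measurable_snd.
by apply: (measurableT_comp (measurable_scale r)); exact: (measurableT_comp mP measurable_fst).
Qed.

Let S_ge0 (r : R) (P : R * R -> R * R) (x : (R * R) * (R * R)) :
  (0 <= (pencil_weight T x.2)%:E * Seg sg (scale r (P x.1)) (pencil r x.2))%E.
Proof. by rewrite mule_ge0 ?Seg_ge0// lee_fin pencil_weight_ge0. Qed.

Let nS2 : nneg_meas (fun z => (pencil_weight T z)%:E * S2 z)%E.
Proof.
split=> [|z]; last by rewrite mule_ge0 ?Seg_ge0// lee_fin pencil_weight_ge0.
apply: emeasurable_funM.
  by apply/measurable_EFinP; apply: measurable_pencil_weight; exact: measurable_id.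
exact: (measurable_pencil_Seg r0 r1 msg sg0 (@measurable_id _ _ setT)).
Qed.

Lemma curve_inf_ge0 : (0 <= curve_inf)%E.
Proof.
apply: le_ereal_inf_tmp => _ [g [rg gD Eg [z Kz Fz]] <-]; have [L L0 gL] := rectifiable_length rg.
rewrite /curve_integral gL /=; apply: integral_ge0 => s /=; rewrite in_itv /= => /andP[s0 sL].
rewrite lee_fin; apply: rho0; have [|t /andP[t0 t1] ->] := @arc_param_in R g s; first by rewrite gL lee_fin.
move: t0; rewrite le_eqVlt => /predU1P[<-|t0]; first exact: Kd.
move: t1; rewrite le_eqVlt => /predU1P[->|t1]; first by rewrite -Fz; apply: fD; exact: Kd.
by apply: gD; rewrite t0.
Qed.

(** The infimum is at most the expected length of the broken line from a point [p]
    of law [m] through the two scales of a common random ray to [f p]. The three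
    pieces are bounded separately. *)
Lemma curve_inf_le (A : R) : area = A%:E -> 0 < A ->
  (curve_inf <= (Num.sqrt (A * e1) + (Num.sqrt (A * e2) + Num.sqrt (A * e3)))%:E)%E.
Proof.
move=> aA A0.
have sgA : (I2 (fun y => (sg y ^+ 2)%:E) <= A%:E)%E by rewrite -area_sg aA.
have mlog := measurable_log_kernel mK0.
have diam : forall p q, K0 p -> K0 q -> pnorm (p - q) <= 2 by exact: diam_lt2.
have R1 : 0 <= 2 * r0^-1 by rewrite mulr_ge0// invr_ge0 ltW.
have R3 : 0 <= C * r0^-1 by rewrite mulr_ge0// invr_ge0 ltW.
have b1 := end_segment_average mK0 mstart msg sg0 T0 r0_gt0 R1 A0 sgA start_le ltr01 (lexx 1)
  start_dist V0 diam mlog mV.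
have b3 := end_segment_average mK0 mfinish msg sg0 T0 r1_gt0 R3 A0 sgA finish_le kappa0 kappa1
  finish_dist V0 diam mlog mV.
have b2 := pencil_average msg sg0 T0 r1_gt0 r10 A0 sgA.
have er : 2 * r0 / r1 = 2 / h by rewrite /r1; field; rewrite !gt_eqF.
rewrite er -/e2 in b2.
pose F1 p := I2 (fun z => (pencil_weight T z)%:E * S1 p z)%E.
pose F2 := I2 (fun z => (pencil_weight T z)%:E * S2 z)%E.
pose F3 p := I2 (fun z => (pencil_weight T z)%:E * S3 p z)%E.
have F20 : (0 <= F2)%E by apply: integral_ge0 => x _; apply: integral_ge0 => y _; exact: nS2.2.
have F10 p : (0 <= F1 p)%E.
  by apply: integral_ge0 => x _; apply: integral_ge0 => y _; exact: (S_ge0 r0 start (p, (x, y))).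
have F30 p : (0 <= F3 p)%E.
  by apply: integral_ge0 => x _; apply: integral_ge0 => y _; exact: (S_ge0 r1 finish (p, (x, y))).
have mi : measurable_fun setT (fun p : R * R => (\1_K0 p : R)%:E).
  by apply/measurable_EFinP; exact: measurable_indic.
have i0 (p : R * R) : (0 <= (\1_K0 p : R)%:E)%E by rewrite lee_fin indicE ler0n.
have mF1 : measurable_fun setT (fun p => (\1_K0 p)%:E * F1 p)%E.
  by apply: emeasurable_funM => //; exact: (measurable_I2_param (mS r0 mstart) (S_ge0 r0 start)).
have mF3 : measurable_fun setT (fun p => (\1_K0 p)%:E * F3 p)%E.
  by apply: emeasurable_funM => //; exact: (measurable_I2_param (mS r1 mfinish) (S_ge0 r1 finish)).
have mF2 : measurable_fun setT (fun p => (\1_K0 p)%:E * F2)%E.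
  by apply: emeasurable_funM => //; exact: measurable_cst.
have F1' p : setT p -> (0 <= (\1_K0 p)%:E * F1 p)%E := fun _ => mule_ge0 (i0 p) (F10 p).
have F2' p : setT p -> (0 <= (\1_K0 p)%:E * F2)%E := fun _ => mule_ge0 (i0 p) (F20).
have F3' p : setT p -> (0 <= (\1_K0 p)%:E * F3 p)%E := fun _ => mule_ge0 (i0 p) (F30 p).
have im : (\int[m]_p (\1_K0 p)%:E = 1)%E by rewrite integral_indic// setIT; exact: m1.
have cst_int (c : \bar R) : (0 <= c)%E -> (\int[m]_p ((\1_K0 p)%:E * c) = c)%E.
  by move=> c0; rewrite (ge0_integralZr m measurableT mi (fun p _ => i0 p) c0) im mul1e.
apply: (@le_trans _ _ (\int[m]_p ((\1_K0 p)%:E * F1 p + ((\1_K0 p)%:E * F2 + (\1_K0 p)%:E * F3 p)))%E).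
  rewrite -(cst_int _ curve_inf_ge0); apply: le_integral_nomeas => p _; first exact: mule_ge0 (i0 p) curve_inf_ge0.
  have [Kp|Kp] := pselect (K0 p); last first.
    have -> : \1_K0 p = 0 :> R by rewrite indicE memNset.
    exact: mul0_sum3.
  have -> : \1_K0 p = 1 :> R by rewrite indicE mem_set.
  rewrite mul1_sum3 -[leLHS](pencil_mass T0 curve_inf_ge0).
  have n1 : nneg_meas (fun z => (pencil_weight T z)%:E * S1 p z)%E.
    by split=> [|z]; [exact: (measurable_fun_pair2 p (mS r0 mstart))|exact: (S_ge0 r0 start (p, z))].
  have n3 : nneg_meas (fun z => (pencil_weight T z)%:E * S3 p z)%E.
    by split=> [|z]; [exact: (measurable_fun_pair2 p (mS r1 mfinish))|exact: (S_ge0 r1 finish (p, z))].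
  have [n123 e123] := I2_sum3 n1 nS2 n3.
  have -> : (F1 p + (F2 + F3 p))%E = I2 (fun z => (pencil_weight T z)%:E * S1 p z +
    ((pencil_weight T z)%:E * S2 z + (pencil_weight T z)%:E * S3 p z))%E := esym e123.
  apply: I2_le; [|exact: n123|].
    split=> [|z]; last by apply: mule_ge0; [rewrite lee_fin pencil_weight_ge0|exact: curve_inf_ge0].
    apply: emeasurable_funM; last exact: measurable_cst.
    by apply/measurable_EFinP; apply: measurable_pencil_weight; exact: measurable_id.
  move=> z; have [->|/pencil_weight_neq0 [z1 z2]] := eqVneq (pencil_weight T z) 0.
    exact: mul0_sum3.
  apply: weighted_sum3; [by rewrite lee_fin pencil_weight_ge0|exact: Seg_ge0|exact: Seg_ge0|exact: Seg_ge0|].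
  exact: one_curve.
have m23 := emeasurable_funD mF2 mF3.
have F23 p : setT p -> (0 <= (\1_K0 p)%:E * F2 + (\1_K0 p)%:E * F3 p)%E.
  by move=> _; exact: adde_ge0 (F2' p I) (F3' p I).
rewrite (ge0_integralD m measurableT F1' mF1 F23 m23) (ge0_integralD m measurableT F2' mF2 F3' mF3).
have b2' : (\int[m]_p ((\1_K0 p)%:E * F2) <= (Num.sqrt (A * e2))%:E)%E.
  by apply: le_trans b2; have -> := cst_int F2 F20; exact: lexx.
rewrite [leRHS]EFinD [X in (_ <= _ + X)%E]EFinD.
exact: leeD b1 (leeD b2' b3).
Qed.

End one_metric.

(** The bound on lengths is homogeneous in the metric, so that the area cancels
    in the quotient. *)
Lemma extremal_distance_le : (extremal_distance D K (f @` K) <=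
  ((Num.sqrt e1 + (Num.sqrt e2 + Num.sqrt e3)) ^+ 2)%:E)%E.
Proof.
apply: ge_ereal_sup => _ [rho mrho <-].
have [_ _ /andP[A0 Aoo]] := mrho.
move AE : (area_integral D (fun z => rho z ^+ 2)%R) => A; rewrite AE in A0 Aoo.
case: A AE A0 Aoo => [A| |]// AE; rewrite lte_fin => A0 _.
have := curve_inf_le mrho AE A0; set I := ereal_inf _.
have I0 : (0 <= I)%E by exact: (curve_inf_ge0 mrho).
have -> : Num.sqrt (A * e1) + (Num.sqrt (A * e2) + Num.sqrt (A * e3)) =
    Num.sqrt A * (Num.sqrt e1 + (Num.sqrt e2 + Num.sqrt e3)).
  by rewrite !(sqrtrM _ (ltW A0)) !mulrDr.
set E := Num.sqrt e1 + _; set B := _ * E => hI.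
have B0 : 0 <= B by rewrite mulr_ge0 ?addr_ge0 ?sqrtr_ge0.
apply: (@le_trans _ _ ((B ^+ 2)%:E / A%:E)%E).
  apply: lee_wpmul2r; first by rewrite inve_ge0 lee_fin ltW.
  by rewrite EFin_expe lee_sqr// lee_fin.
rewrite inver gt_eqF// -EFinM lee_fin /B exprMn (sqr_sqrtr (ltW A0)).
by rewrite mulrAC divff ?gt_eqF// mul1r.
Qed.

End upper_bound.

Lemma spread_radius_ge1 (R : realType) (R0 T : R) : 0 <= R0 -> 0 <= T -> 1 <= spread_radius R0 T.
Proof. by rewrite /spread_radius; lra. Qed.

Lemma ln_ratio_ge0 (R : realType) (x kappa : R) : 1 <= x -> 0 < kappa -> kappa <= 1 -> 0 <= ln (x / kappa).
Proof. by move=> x1 k0 k1; rewrite ln_ge0// ler_pdivlMr// mul1r (le_trans k1). Qed.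

Lemma end_energy_ge0 (R : realType) (T V R0 kappa : R) : 0 <= T -> 0 <= V -> 0 <= R0 ->
  0 < kappa -> kappa <= 1 -> 0 <= end_energy T V R0 kappa.
Proof.
move=> T0 V0 R00 k0 k1; have l0 := ln_ratio_ge0 (spread_radius_ge1 R00 T0) k0 k1.
apply: mulr_ge0; first by apply: mulr_ge0; [exact: ler0n|exact: sqr_ge0].
exact: addr_ge0 (addr_ge0 ler01 l0) V0.
Qed.

(** * Extremal distance from a compact set to its images *)

Section semigroup_estimates.
Variables (R : realType) (phi : R -> cplane R -> cplane R) (K : set (cplane R)) (z : cplane R).
Hypothesis sgphi : holomorphic_semigroup phi.
Hypothesis nephi : non_elliptic phi.
Hypothesis cK : compact K.
Hypothesis Kd : K `<=` @unit_disk R.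
Hypothesis Kz : K z.
Local Notation D := (@unit_disk R).
Local Notation lam u := (extremal_distance D K (phi u @` K)).
Local Notation disp u := (displacement phi z u).

Let Klt p : K p -> modulus p < 1. Proof. by move=> /Kd; rewrite unit_diskE. Qed.
Let z1 : modulus z < 1 := Klt Kz.

(** All boundary points are nearest to 0; the choice of 1 is arbitrary. *)
Definition nearest_boundary_point (w : cplane R) : cplane R :=
  if w == 0 then 1 else w / Complex (modulus w) 0.

Lemma modulus_boundary_point w : modulus (nearest_boundary_point w) = 1.
Proof.
rewrite /nearest_boundary_point; case: eqVneq => [_|w0]; first exact: modulus1.
rewrite modulusf_div modulus_real ger0_norm ?modulus_ge0// divff//.
by rewrite gt_eqF// modulus_gt0.
Qed.

Lemma dist_boundary_point w : modulus w < 1 -> modulus (w - nearest_boundary_point w) = 1 - modulus w.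
Proof.
move=> w1; rewrite /nearest_boundary_point; case: eqVneq => [->|w0].
  by rewrite sub0r modulusN modulus1 modulus0 subr0.
have m0 : 0 < modulus w by rewrite modulus_gt0.
have mc0 : Complex (modulus w) 0 != 0 :> cplane R.
  by rewrite eq_complex /= negb_and gt_eqF.
have -> : w - w / Complex (modulus w) 0 = w * Complex (modulus w - 1) 0 / Complex (modulus w) 0.
  have -> : Complex (modulus w - 1) 0 = Complex (modulus w) 0 - 1 :> cplane R.
    by apply/eqP; rewrite eq_complex /= subr0 !eqxx.
  by rewrite mulrBr mulr1 mulrBl mulfK.
rewrite modulusf_div modulusM !modulus_real (ger0_norm (ltW m0)) mulrAC divff ?gt_eqF// mul1r.
by rewrite distrC ger0_norm// subr_ge0 ltW.
Qed.

Lemma compact_radius : exists2 r : R, 0 <= r < 1 & forall p, K p -> modulus p <= r.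
Proof.
have [|c cin H] := @compact_EVT_max _ R (@modulus R) K (ex_intro _ z Kz) cK.
  by apply: continuous_subspaceT => p; exact: modulus_continuous.
exists (modulus c); first by rewrite modulus_ge0/=; apply: Klt; exact: set_mem.
by move=> p Kp; apply: H; exact: mem_set.
Qed.

(** Compactness enters as a bound on the hyperbolic radius, which the
    semigroup preserves by Schwarz-Pick. *)
Lemma compact_phd_radius : exists2 k : R, 0 <= k < 1 & forall p, K p -> phd z p <= k.
Proof.
have [r /andP[r0 r1] H] := compact_radius.
have p0 (p : cplane R) : phd 0 p = modulus p.
  by rewrite phdE sub0r modulusN -[0]/(0 : cplane R) conjc0 mul0r subr0 modulus1 divr1.
have z0 := modulus_ge0 z.
exists ((modulus z + r) / (1 + modulus z * r)).
  by rewrite radius_lt1// andbT divr_ge0 ?addr_ge0// mulr_ge0.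
move=> p Kp; apply: (@phd_triangle_radius R z 0 p) => //.
- by rewrite modulus0.
- exact: Klt.
- by rewrite phdC p0.
- by rewrite p0; exact: H.
Qed.

Let gap u : R := 1 - modulus (phi u z).

Let gap_gt0 u : 0 <= u -> 0 < gap u.
Proof. by move=> u0; rewrite subr_gt0; exact: semigroup_lt1. Qed.

Let gap_le1 u : gap u <= 1.
Proof. by rewrite /gap lerBlDr lerDl modulus_ge0. Qed.

(** The whole image of [K] stays at distance comparable to [gap u] from the
    boundary point nearest to [phi u z]. *)
Let orbit_spread k u p : 0 <= u -> k < 1 -> K p -> phd z p <= k ->
  modulus (phi u p - nearest_boundary_point (phi u z)) <= (2 * k / (1 - k) + 1) * gap u.
Proof.
move=> u0 k1 Kp pk; have w1 : modulus (phi u z) < 1 by exact: semigroup_lt1.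
have q1 : modulus (phi u p) < 1 by apply: semigroup_lt1 => //; exact: Klt.
have le : phd (phi u z) (phi u p) <= k.
  by apply: le_trans pk; apply: schwarz_pick; [exact: semigroup_self_map|exact: z1|exact: Klt].
have := phd_dist_le w1 q1 le k1; rewrite modulusBC => h1.
have := modulus_triangle (phi u p) (nearest_boundary_point (phi u z)) (phi u z).
rewrite dist_boundary_point// mulrDl mul1r => h2; apply: (le_trans h2).
by rewrite lerD2r.
Qed.

Let disp_le u : 0 <= u -> disp u <= hyp_dist z 0 + hyp_dist 0 (phi u z).
Proof.
move=> u0; apply: hyp_dist_triangle => //; first by rewrite modulus0.
exact: semigroup_lt1.
Qed.

Let hyp0_le u : 0 <= u -> hyp_dist 0 (phi u z) <= hyp_dist 0 z + disp u.
Proof.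
move=> u0; apply: hyp_dist_triangle => //; first by rewrite modulus0.
exact: semigroup_lt1.
Qed.

Lemma square_quotient_ge (X a b : R) : 0 < X + b -> X - 2 * a - b <= (X - a) ^+ 2 / (X + b).
Proof.
move=> Xb; rewrite ler_pdivlMr//.
have -> : (X - a) ^+ 2 = (X - 2 * a - b) * (X + b) + (a + b) ^+ 2 by ring.
by rewrite lerDl sqr_ge0.
Qed.

(** With the pole at the boundary point nearest to [phi u z] and [h = gap u], the
    set [K] is at distance bounded below and its image at distance [O(h)] from the
    pole. Lengths are at least [X - a] and the area is at most [pi * (X + ln 3)],
    where [X = - ln h] is twice the displacement up to a constant. *)
Lemma extremal_distance_lower : exists C U : R, 0 <= U /\ forall u, U <= u ->
  (((disp u - C) * (2 / pi))%:E <= lam u)%E.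
Proof.
have [r /andP[r0 r1] Kr] := compact_radius.
have [k /andP[k0 k1] Kk] := compact_phd_radius.
pose C1 := 2 * k / (1 - k) + 1.
have C11 : 1 <= C1 by rewrite lerDr divr_ge0 ?subr_ge0 ?(ltW k1)// mulr_ge0.
have C10 : 0 < C1 + 1 by apply: addr_gt0 => //; exact: lt_le_trans C11.
pose b0 := (1 - r) / (C1 + 1).
have b00 : 0 < b0 by rewrite divr_gt0// subr_gt0.
have b01 : b0 < 1 by rewrite ltr_pdivrMr// mul1r; lra.
have b02 : 1 - b0 < 1 by rewrite gtrDl oppr_lt0.
have [U U0 HU] := orbit_modulus nephi z1 b02.
pose a := - ln b0.
exists (hyp_dist z 0 + ln 2 / 2 + a + ln 3 / 2), U; split=> // u uU.
have u0 : 0 <= u := le_trans U0 uU.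
have g0 := gap_gt0 u0; have g1 := gap_le1 u.
have gb : gap u <= b0 by rewrite /gap lerBlDr addrC -lerBlDr; exact: HU.
pose X := - ln (gap u).
have Xa : 0 <= X - a by rewrite /X /a opprK addrC subr_ge0 ler_ln ?posrE.
have l3 : 0 < ln 3 :> R by rewrite ln_gt0// ltr1n.
have X0 : 0 <= X by rewrite oppr_ge0 ln_le0.
have hl p q : K p -> (phi u @` K) q -> X - a <=
  ln ((modulus (p - nearest_boundary_point (phi u z)) + gap u) / (modulus (q - nearest_boundary_point (phi u z)) + gap u)).
  move=> Kp [p' Kp' <-].
  have -> : X - a = ln (b0 / gap u) by rewrite ln_div ?posrE// /X /a opprK addrC.
  have h1 := orbit_spread u0 k1 Kp' (Kk _ Kp'); rewrite -/C1 in h1.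
  have h2 : 1 - r <= modulus (p - nearest_boundary_point (phi u z)).
    rewrite modulusBC; apply: le_trans (modulusB_ge _ _); rewrite modulus_boundary_point.
    by rewrite lerD2l lerN2; exact: Kr.
  have d0 : 0 < modulus (phi u p' - nearest_boundary_point (phi u z)) + gap u by rewrite ltr_wpDl// modulus_ge0.
  have n0 : 0 < modulus (p - nearest_boundary_point (phi u z)) + gap u by rewrite ltr_wpDl// modulus_ge0.
  rewrite ler_ln ?posrE; [|exact: divr_gt0|exact: divr_gt0].
  rewrite ler_pdivlMr//; apply: (@le_trans _ _ (b0 / gap u * ((C1 + 1) * gap u))).
    by rewrite (ler_pM2l (divr_gt0 b00 g0)) mulrDl mul1r lerD2r.
  have -> : b0 / gap u * ((C1 + 1) * gap u) = 1 - r by rewrite /b0; field; rewrite !gt_eqF.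
  by apply: le_trans h2 _; rewrite lerDl ltW.
apply: le_trans (extremal_distance_pole_ge (modulus_boundary_point _) g0 g1 Xa hl).
rewrite lee_fin ln_div ?posrE// -/X.
have Xl : 0 < X + ln 3 by rewrite ltr_wpDl.
have := square_quotient_ge a Xl; have := disp_le u0.
have := ln_bdist_le (semigroup_lt1 sgphi u0 z1) => /andP[_]; rewrite -/(gap u) -/X.
have p0 : 0 < pi :> R by exact: pi_gt0.
have -> : (X - a) ^+ 2 / (pi * (ln 3 + X)) = ((X - a) ^+ 2 / (X + ln 3)) / 2 * (2 / pi).
  rewrite [ln 3 + X]addrC; move: (X + ln 3) Xl ((X - a) ^+ 2) (pi : R) p0 => Y Yl B c c0'.
  by field; rewrite !gt_eqF.
move=> h1 h2 h3; rewrite ler_pM2r ?divr_gt0//; lra.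
Qed.

(** The middle term is the large one and keeps a factor close to 1. *)
Lemma sqr_sum3_le (x y w t : R) : 0 < t ->
  (x + (y + w)) ^+ 2 <= (1 + t) * y ^+ 2 + 2 * (1 + t^-1) * (x ^+ 2 + w ^+ 2).
Proof.
move=> t0; rewrite -subr_ge0.
have -> : (1 + t) * y ^+ 2 + 2 * (1 + t^-1) * (x ^+ 2 + w ^+ 2) - (x + (y + w)) ^+ 2 =
  (t * y - (x + w)) ^+ 2 / t + (1 + t^-1) * (x - w) ^+ 2 by field; rewrite gt_eqF.
have it0 : 0 <= t^-1 by rewrite invr_ge0 ltW.
apply: addr_ge0; first exact: mulr_ge0 (sqr_ge0 _) it0.
exact: mulr_ge0 (addr_ge0 ler01 it0) (sqr_ge0 _).
Qed.

Variable m : probability (R * R)%type R.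
Variable V : R.
Hypothesis m1 : (m (@toC R @^-1` K) = 1)%E.
Hypothesis V0 : 0 <= V.
Hypothesis mV : (\int[m]_p \int[m]_q log_kernel (@toC R @^-1` K) p q <= V%:E)%E.

(** The opening of the pencil is chosen first, with [atan T = pi / 2 / (1 + t)], so
    that its energy is [2 / pi * (1 + t)] times the displacement up to a constant.
    The image of [K] has size [gap u] and is contracted, relative to that size, by
    no more than [expR (- eta * u)], which adds [eta * u] to the energy of the last
    piece; the first piece does not depend on [u]. *)
Lemma extremal_distance_upper (t : R) : 0 < t -> exists2 E : R, 0 <= E & forall eta : R, 0 < eta ->
  exists C : R, forall u, 0 <= u ->
  (lam u <= (2 / pi * ((1 + t) ^+ 2 * disp u + E * eta * u + C))%:E)%E.
Proof.
move=> t0; have p0 : 0 < pi :> R by exact: pi_gt0.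
pose th : R := pi / 2 / (1 + t).
have t1 : 0 < 1 + t by rewrite addr_gt0.
have th0 : 0 < th by rewrite !divr_gt0.
pose T := tan th.
have aT : atan T = th.
  apply: tanK; rewrite in_itv /=; apply/andP; split.
    by apply: lt_trans th0; rewrite oppr_lt0 divr_gt0.
  by rewrite /th ltr_pdivrMr// ltr_pMr ?divr_gt0// ltrDl.
have T0 : 0 < T.
  rewrite ltNge; apply/negP => /(@le_atan R); rewrite aT atan0 leNgt th0.
  by [].
have [k /andP[k0 k1] Kk] := compact_phd_radius.
pose C1 := 2 * k / (1 - k) + 1.
have C11 : 1 <= C1 by rewrite lerDr divr_ge0 ?subr_ge0 ?(ltW k1)// mulr_ge0.
have C10 : 0 <= C1 by exact: le_trans C11.
pose rr : R := (1 + T ^+ 2)^-1.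
have T2 : 0 < 1 + T ^+ 2 by rewrite ltr_pwDl// sqr_ge0.
have rr0 : 0 < rr by rewrite invr_gt0.
pose B3 := 16 * spread_const (C1 / rr) T ^+ 2.
have B30 : 0 <= B3 by rewrite mulr_ge0// sqr_ge0.
have it0 : 0 < t^-1 by rewrite invr_gt0.
pose Q := pi * (1 + t^-1).
have Q0 : 0 <= Q by rewrite mulr_ge0 ?ltW// addr_gt0.
exists (Q * B3); first exact: mulr_ge0.
move=> eta eta0; have [c c0 Hc] := subexponential_contraction sgphi nephi z1 k1 eta0.
have k21 : 0 < 1 - k ^+ 2 by rewrite subr_gt0 exprn_ilt1.
pose c' := Num.min 1 (c * (1 - k ^+ 2) / 8).
have c'0 : 0 < c' by rewrite lt_min ltr01 !divr_gt0// mulr_gt0.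
have c'1 : c' <= 1 by rewrite ge_min lexx.
pose e1 := end_energy T V (2 / rr) 1.
pose rho := spread_radius (C1 / rr) T.
have R3 : 0 <= C1 / rr by rewrite divr_ge0// ltW.
have R1 : 0 <= 2 / rr by rewrite divr_ge0// ltW.
have rho1 : 1 <= rho := spread_radius_ge1 R3 (ltW T0).
have e10 : 0 <= e1 := end_energy_ge0 (ltW T0) V0 R1 ltr01 (lexx 1).
pose H := hyp_dist 0 z.
exists ((1 + t) ^+ 2 * (ln 2 / 2 + H) + Q * (e1 + B3 * (1 + ln (rho / c') + V))) => u u0.
have g0 := gap_gt0 u0; have g1 := gap_le1 u.
pose kappa := c' * expR (- eta * u).
have ex1 : expR (- eta * u) <= 1 by rewrite expR_le1 mulNr oppr_le0 mulr_ge0// ltW.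
have kappa0 : 0 < kappa by rewrite mulr_gt0// expR_gt0.
have kappa1 : kappa <= 1 by rewrite /kappa mulr_ile1// ?expR_ge0// ltW.
have fkappa p q : K p -> K q -> kappa * gap u * modulus (p - q) <= modulus (phi u p - phi u q).
  move=> Kp Kq; have p1 := Klt Kp; have q1 := Klt Kq.
  have fp1 := semigroup_lt1 sgphi u0 p1; have fq1 := semigroup_lt1 sgphi u0 q1.
  have fz1 := semigroup_lt1 sgphi u0 z1.
  have := Hc u p q u0 p1 q1 (Kk _ Kp) (Kk _ Kq) => h1.
  have h2 := phd_ge_dist p1 q1; have h3 := phd_le_dist fp1 fq1.
  have le : phd (phi u z) (phi u p) <= k.
    by apply: le_trans (Kk _ Kp); apply: schwarz_pick => //; exact: semigroup_self_map.
  have h4 := phd_modulus_le fz1 fp1 le k1; rewrite -/(gap u) in h4.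
  apply: le_trans h3.
  have h5 : (1 - k ^+ 2) / 4 * gap u <= 1 - modulus (phi u p).
    apply: (@le_trans _ _ ((1 - k ^+ 2) / 4 * (4 / (1 - k ^+ 2) * (1 - modulus (phi u p))))).
      by rewrite ler_pM2l ?divr_gt0.
    by rewrite mulrA (_ : (1 - k ^+ 2) / 4 * (4 / (1 - k ^+ 2)) = 1) ?mul1r//; field; rewrite gt_eqF.
  have h6 : c * expR (- eta * u) * (modulus (p - q) / 2) <= phd (phi u p) (phi u q).
    by apply: le_trans h1; rewrite ler_wpM2l// mulr_ge0 ?expR_ge0// ltW.
  have x0 : 0 <= c * expR (- eta * u) * (modulus (p - q) / 2).
    by rewrite mulr_ge0 ?divr_ge0 ?modulus_ge0// mulr_ge0 ?expR_ge0// ltW.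
  have y0 : 0 <= (1 - k ^+ 2) / 4 * gap u by rewrite mulr_ge0 ?divr_ge0// ltW.
  apply: le_trans (ler_pM x0 y0 h6 h5).
  have -> : c * expR (- eta * u) * (modulus (p - q) / 2) * ((1 - k ^+ 2) / 4 * gap u) =
     (c * (1 - k ^+ 2) / 8) * (expR (- eta * u) * gap u * modulus (p - q)) by field.
  have -> : kappa * gap u * modulus (p - q) = c' * (expR (- eta * u) * gap u * modulus (p - q)).
    by rewrite /kappa; ring.
  rewrite ler_wpM2r// ?ge_min ?lexx ?orbT//.
  by rewrite mulr_ge0 ?modulus_ge0// mulr_ge0 ?expR_ge0// ltW.
have fD w : D w -> D (phi u w) by rewrite !unit_diskE; exact: semigroup_lt1.
have fc w : D w -> {for w, continuous (phi u)}.
  by rewrite unit_diskE => w1; apply: self_map_continuous => //; exact: semigroup_self_map.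
have fC p : K p -> modulus (phi u p - nearest_boundary_point (phi u z)) <= C1 * gap u.
  by move=> Kp; exact: orbit_spread u0 k1 Kp (Kk _ Kp).
apply: le_trans (extremal_distance_le (compact_plane_measurable cK) Kd fD fc m1 V0 mV
  (modulus_boundary_point _) g0 g1 T0 C10 fC kappa0 kappa1 fkappa) _.
rewrite lee_fin -/rr -/e1 aT.
set e2 := ln (2 / gap u) / (2 * th); set e3 := end_energy _ _ _ kappa.
have e3E : e3 = B3 * (1 + ln (rho / c') + V) + B3 * (eta * u).
  rewrite /e3 /end_energy -/B3 -/rho /kappa.
  have -> : rho / (c' * expR (- eta * u)) = rho / c' * expR (eta * u).
    by rewrite invfM -expRN mulNr opprK mulrA.
  rewrite lnM ?posrE ?expR_gt0 ?divr_gt0 ?(lt_le_trans ltr01 rho1)// expRK; ring.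
have e30 : 0 <= e3 := end_energy_ge0 (ltW T0) V0 R3 kappa0 kappa1.
have e20 : 0 <= e2.
  apply: divr_ge0; last by apply: mulr_ge0; [exact: ler0n|exact: ltW].
  by apply: ln_ratio_ge0 => //; rewrite ler1n.
apply: le_trans (sqr_sum3_le _ _ _ t0) _; rewrite (sqr_sqrtr e10) (sqr_sqrtr e20) (sqr_sqrtr e30).
have hX : ln (2 / gap u) <= 2 * (ln 2 / 2 + H + disp u).
  rewrite ln_div ?posrE//; have := ln_bdist_le (semigroup_lt1 sgphi u0 z1) => /andP[+ _].
  by have := hyp0_le u0; rewrite -/(gap u) -/H; lra.
have he2 : (1 + t) * e2 <= 2 / pi * ((1 + t) ^+ 2 * (ln 2 / 2 + H + disp u)).
  have -> : (1 + t) * e2 = (1 + t) ^+ 2 / pi * ln (2 / gap u).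
    by rewrite /e2 /th; move: (pi : R) p0 => pp pp0; field; rewrite !gt_eqF.
  have -> : 2 / pi * ((1 + t) ^+ 2 * (ln 2 / 2 + H + disp u)) =
     (1 + t) ^+ 2 / pi * (2 * (ln 2 / 2 + H + disp u)) by ring.
  by rewrite ler_wpM2l// divr_ge0 ?sqr_ge0// ltW.
apply: le_trans (lerD he2 (lexx _)) _; rewrite e3E le_eqVlt; apply/orP; left; apply/eqP.
by rewrite /Q; move: (pi : R) p0 => pp pp0; field; rewrite !gt_eqF.
Qed.

Lemma main_estimate (e : R) : 0 < e -> exists2 U : R, 1 <= U & forall u, U <= u ->
  exists2 l : R, lam u = l%:E & `|hyp_step phi u z - pi / 2 * l| <= e * u.
Proof.
move=> e0; have p0 : 0 < pi :> R by exact: pi_gt0.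
have e3 : 0 < e / 4 by rewrite divr_gt0.
have [Us Us1 Hs] := hyp_step_displacement sgphi z1 e3.
have [M M0 HM] := displacement_linear sgphi z1.
have [Cl [Ul [Ul0 Hl]]] := extremal_distance_lower.
(* the excess [(1 + t) ^ 2 - 1] is at most [3 * t], and the displacement at most [M * u] *)
pose t := Num.min 1 (e / 4 / (3 * M)).
have t0 : 0 < t by rewrite lt_min ltr01 divr_gt0// mulr_gt0.
have t1 : t <= 1 by rewrite ge_min lexx.
have tM : 3 * t * M <= e / 4.
  have : t <= e / 4 / (3 * M) by rewrite ge_min lexx orbT.
  rewrite ler_pdivlMr ?mulr_gt0// => h; apply: le_trans h.
  by rewrite le_eqVlt; apply/orP; left; apply/eqP; ring.
have [E E0 HE] := extremal_distance_upper t0.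
have E1 : 0 < E + 1 by rewrite ltr_wpDl.
have [Cu HCu] := HE (e / 4 / (E + 1)) (divr_gt0 e3 E1).
have Eeta : E * (e / 4 / (E + 1)) <= e / 4.
  by rewrite mulrCA ger_pMr// ler_pdivrMr// mul1r lerDl.
pose U := Us + Ul + 4 / e * (`|Cl| + `|Cu|).
have C0 : 0 <= 4 / e * (`|Cl| + `|Cu|) by rewrite mulr_ge0 ?addr_ge0// divr_ge0// ltW.
exists U; first by rewrite /U; lra.
move=> u uU; have uUs : Us <= u by apply: le_trans uU; rewrite /U; lra.
have uUl : Ul <= u by apply: le_trans uU; rewrite /U; lra.
have u1 : 1 <= u by lra.
have u0 : 0 <= u by lra.
have Cb : `|Cl| + `|Cu| <= e / 4 * u.
  apply: (@le_trans _ _ (e / 4 * (4 / e * (`|Cl| + `|Cu|)))).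
    by rewrite mulrA (_ : e / 4 * (4 / e) = 1) ?mul1r//; field; rewrite gt_eqF.
  by rewrite ler_pM2l//; apply: le_trans uU; rewrite /U; lra.
have lo := Hl u uUl; have up := HCu u u0.
have fin : lam u \is a fin_num.
  rewrite fin_numElt; apply/andP; split.
    by apply: lt_le_trans lo; rewrite ltNyr.
  by apply: le_lt_trans up _; rewrite ltry.
exists (fine (lam u)); first by rewrite fineK.
rewrite -(fineK fin) !lee_fin in lo up.
have := Hs u uUs; have := HM u u1; have := displacement_ge0 sgphi z1 u0.
move: (disp u) (hyp_step phi u z) (fine _) lo up => d s l lo up d0 dM hs.
have {}lo : d - Cl <= pi / 2 * l.
  have := lo; rewrite -(ler_pM2l (divr_gt0 p0 (ltr0n _ 2))) => h; apply: le_trans h.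
  by rewrite le_eqVlt; apply/orP; left; apply/eqP; move: (pi : R) p0 => c c0; field; rewrite gt_eqF.
have {}up : pi / 2 * l <= (1 + t) ^+ 2 * d + E * (e / 4 / (E + 1)) * u + Cu.
  have := up; rewrite -(ler_pM2l (divr_gt0 p0 (ltr0n _ 2))) => h; apply: (le_trans h).
  by rewrite le_eqVlt; apply/orP; left; apply/eqP; move: (pi : R) p0 => c c0; field; rewrite !gt_eqF.
have h1 : (1 + t) ^+ 2 * d <= d + e / 4 * u.
  have -> : (1 + t) ^+ 2 * d = d + (2 + t) * t * d by ring.
  rewrite lerD2l; apply: (@le_trans _ _ (3 * t * (M * u))).
    apply: ler_pM => //; first by rewrite !mulr_ge0// ?addr_ge0// ltW.
    by rewrite ler_pM2r//; lra.
  by rewrite mulrA ler_wpM2r.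
have h2 : E * (e / 4 / (E + 1)) * u <= e / 4 * u by rewrite ler_wpM2r.
have n1 := ler_norm Cl; have n2 := ler_norm Cu; have n3 := normr_ge0 Cl; have n4 := normr_ge0 Cu.
move: hs; rewrite !ler_norml => /andP[hs1 hs2].
move: (`|Cl|) (`|Cu|) n1 n2 n3 n4 Cb => cl cu n1 n2 n3 n4 Cb.
move: (pi / 2 * l) lo up => pl lo up.
have -> : e * u = 4 * (e / 4 * u) by field.
move: (e / 4 * u) (E * (e / 4 / (E + 1)) * u) ((1 + t) ^+ 2 * d) h1 h2 hs1 hs2 Cb up => x y w h1 h2 hs1 hs2 Cb up.
by apply/andP; split; lra.
Qed.

End semigroup_estimates.

Theorem proposition1p1 (R : realType) (phi : R -> cplane R -> cplane R)
    (K : set (cplane R)) :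
  holomorphic_semigroup phi ->
  non_elliptic phi ->
  compact K ->
  K `<=` @unit_disk R ->
  non_polar K ->
  forall z : cplane R, K z ->
    (((hyp_step phi u z)%:E
       - (pi / 2)%:E * extremal_distance (@unit_disk R) K (phi u @` K))
      / u%:E)%E @[u --> +oo] --> 0%E.
Proof.
move=> sgphi nephi cK Kd npK z Kz.
have [m [m1 [V V0 mV]]] := non_polar_measure cK Kd npK.
have est := main_estimate sgphi nephi cK Kd Kz m1 V0 mV.
have val (u l : R) : 1 <= u -> extremal_distance (@unit_disk R) K (phi u @` K) = l%:E ->
  (((hyp_step phi u z)%:E - (pi / 2)%:E * extremal_distance (@unit_disk R) K (phi u @` K))
      / u%:E)%E = ((hyp_step phi u z - pi / 2 * l) / u)%:E.
  by move=> u1 ->; rewrite inver gt_eqF// (lt_le_trans ltr01).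
apply/fine_cvgP; split.
  have [U U1 HU] := est 1 ltr01.
  near=> u; have uU : U <= u by near: u; apply: nbhs_pinfty_ge; exact: num_real.
  by have [l le _] := HU u uU; rewrite (val u l)//; exact: le_trans uU.
apply/cvgrPdist_le => e e0; have [U U1 HU] := est e e0.
near=> u; have uU : U <= u by near: u; apply: nbhs_pinfty_ge; exact: num_real.
have u1 : 1 <= u by exact: le_trans uU.
have [l le hl] := HU u uU.
rewrite sub0r normrN /= (val u l)//= normrM normfV [`|u|]ger0_norm ?(le_trans ler01)//.
by rewrite ler_pdivrMr// (lt_le_trans ltr01).
Unshelve. all: by end_near.
Qed.
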